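(* The family of generalized eigenvectors $\Phi=\{\phi_{1,n}\mid n\in\mathbb{N}^*\}\cup\{\phi_{2,m}\mid m\in\mathbb{Z}\}$ of $\mathcal{A}$ is a Riesz basis of $\mathcal{H}^0$. Hence $\mathcal{A}$ is a Riesz-spectral operator that generates a $C_0$-semigroup.
   Context: Notation: $\mathbb{N}^*=\{1,2,\dots\}$. Fix $L>0$, $c\in\mathbb{R}$, $\beta\in L^\infty(0,L)$ real-valued, and $\alpha>1$ such that $c\neq\frac{1}{2L}\log\big(\frac{\alpha-1}{\alpha+1}\big)+\frac{n^2\pi^2}{L^2}$ for all integers $n\geq0$. Let $H^1_{(0)}(0,L)=\{g\in H^1(0,L): g(0)=0\}$ and let $\mathcal{H}^0=L^2(0,L)\times H^1_{(0)}(0,L)\times L^2(0,L)$ (complex-valued functions) with inner product $\langle(f_1,g_1,h_1),(f_2,g_2,h_2)\rangle=\int_0^L(f_1\overline{f_2}+g_1'\overline{g_2'}+h_1\overline{h_2})$. The operator $\mathcal{A}:D(\mathcal{A})\subset\mathcal{H}^0\to\mathcal{H}^0$ is $\mathcal{A}(f,g,h)=(f''+cf+\beta g,\;h,\;g'')$ with domain $D(\mathcal{A})=\{(f,g,h)\in H^2(0,L)\times H^2(0,L)\times H^1(0,L): f(0)=f(L)=g(0)=h(0)=0,\ g'(L)+\alpha h(L)=0\}$. Its eigenvalues are $\lambda_{1,n}=c-\frac{n^2\pi^2}{L^2}$ ($n\in\mathbb{N}^*$) and $\lambda_{2,m}=\frac{1}{2L}\log\big(\frac{\alpha-1}{\alpha+1}\big)+i\frac{m\pi}{L}$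 ($m\in\mathbb{Z}$), with associated eigenvectors $\phi_{1,n}=\big(\sqrt{\frac2L}\sin(\frac{n\pi}{L}x),0,0\big)$ and $\phi_{2,m}=(\phi^1_{2,m},\phi^2_{2,m},\phi^3_{2,m})$, where, with $\mu=-\frac{1}{2L}\log\big(\frac{\alpha-1}{\alpha+1}\big)>0$, $A_m=\frac{\sqrt{(\mu^2L^2+m^2\pi^2)\sinh(2\mu L)}}{L\sqrt{2\mu}}$ and $r_m$ a square root of $\lambda_{2,m}-c$ with $\operatorname{Re}r_m\geq0$, $\phi^1_{2,m}(x)=\frac{1}{A_mr_m}\int_x^L\beta(s)\sinh(\lambda_{2,m}s)\sinh(r_m(x-s))\,ds+\frac{\sinh(r_m(L-x))}{A_mr_m\sinh(r_mL)}\int_0^L\beta(s)\sinh(\lambda_{2,m}s)\sinh(r_ms)\,ds$, $\phi^2_{2,m}(x)=\frac{1}{A_m}\sinh(\lambda_{2,m}x)$, $\phi^3_{2,m}(x)=\frac{\lambda_{2,m}}{A_m}\sinh(\lambda_{2,m}x)$. A Riesz-spectral operator is a closed operator on a Hilbert space whose eigenvalues are simple, whose associated eigenvectors form a Riesz basis, and such that the closure of the set of eigenvalues is totally disconnected. *)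

(* Defs.v *)
From HB Require Import structures.
From mathcomp Require Import all_boot all_order all_algebra.
From mathcomp Require Import complex ring lra.
From mathcomp Require Import all_classical all_reals all_analysis.
From mathcomp Require Import measurable_realfun.

Set Implicit Arguments.
Unset Strict Implicit.
Unset Printing Implicit Defensive.

Import Order.TTheory GRing.Theory Num.Theory.
Import numFieldNormedType.Exports.

Local Open Scope classical_set_scope.
Local Open Scope complex_scope.
Local Open Scope ring_scope.
Local Open Scope quotient_scope.

Section ComplexFunctions.
Variable R : realType.

Definition Cexp (z : R[i]) : R[i] :=
  (expR (complex.Re z))%:C * (cos (complex.Im z) +i* sin (complex.Im z)).

Definition Csinh (z : R[i]) : R[i] := (Cexp z - Cexp (- z)) / 2%:R.

(* The squared modulus, as a real number. *)
Definition sqmod (z : R[i]) : R := complex.Re z ^+ 2 + complex.Im z ^+ 2.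

Definition Cint (D : set R) (f : R -> R[i]) : R[i] :=
  (\int[lebesgue_measure]_(x in D) complex.Re (f x)) +i*
  (\int[lebesgue_measure]_(x in D) complex.Im (f x)).

End ComplexFunctions.

Section L2.
Variables (R : realType) (L : R).
Local Notation mu := (@lebesgue_measure R).
Local Notation I := (`]0, L[%classic : set R).

(* Complex-valued functions are only looked at on (0, L); their values elsewhere
   are arbitrary. *)
Definition square_integrable (f : R -> R[i]) : Prop :=
  [/\ measurable_fun I (fun x => complex.Re (f x)),
      measurable_fun I (fun x => complex.Im (f x)) &
      mu.-integrable I (fun x => (sqmod (f x))%:E)].

Definition sqint : {pred (R -> R[i])} := fun f => `[< square_integrable f >].

Let mI : measurable I. Proof. exact: measurable_itv. Qed.

Lemma sqint_submod_closed : submod_closed sqint.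
Proof.
split=> [|a f g].
  apply/asboolP; split; [exact: measurable_cst|exact: measurable_cst|].
  rewrite (_ : (fun _ => _) = cst 0%E); first exact: integrable0.
  by apply/funext => x; rewrite /sqmod/= expr0n addr0.
case: a => a b /asboolP[f1 f2 fi] /asboolP[g1 g2 gi].
have m1 : measurable_fun I (fun x => complex.Re ((Complex a b *: f + g) x)).
  rewrite (_ : (fun x => _) = fun x =>
     a * complex.Re (f x) - b * complex.Im (f x) + complex.Re (g x)).
    by apply: measurable_funD => //; apply: measurable_funB;
      exact: measurable_funM.
  apply/funext => x; rewrite -[(_ + g) x]/(Complex a b * f x + g x).
  by case: (f x) (g x) => [? ?] [? ?].
have m2 : measurable_fun I (fun x => complex.Im ((Complex a b *: f + g) x)).
  rewrite (_ : (fun x => _) = fun x =>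
     a * complex.Im (f x) + b * complex.Re (f x) + complex.Im (g x)).
    by apply: measurable_funD => //; apply: measurable_funD;
      exact: measurable_funM.
  apply/funext => x; rewrite -[(_ + g) x]/(Complex a b * f x + g x).
  by case: (f x) (g x) => [? ?] [? ?].
apply/asboolP; split => //.
pose G := fun x => ((2 * sqmod (Complex a b))%:E * (sqmod (f x))%:E
   + 2%:E * (sqmod (g x))%:E)%E.
have iG : mu.-integrable I G.
  by apply: integrableD => //; exact: integrableZl.
refine (@le_integrable _ _ _ mu I mI _ G _ _ iG).
  apply/measurable_EFinP; rewrite /sqmod.
  by apply: measurable_funD; exact: measurable_funX.
move=> x _; rewrite (_ : G x =
  (2 * sqmod (Complex a b) * sqmod (f x) + 2 * sqmod (g x))%:E)//.
rewrite lee_fin.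
rewrite -[(_ + g) x]/(Complex a b * f x + g x).
have sq_ge0 (z : R[i]) : 0 <= sqmod z by rewrite addr_ge0 ?sqr_ge0.
rewrite ger0_norm// ger0_norm; last by rewrite addr_ge0// mulr_ge0// mulr_ge0.
rewrite /sqmod; case: (f x) (g x) => [u v] [w z] /=.
rewrite -subr_ge0.
rewrite (_ : _ - _ = (a * u - b * v - w) ^+ 2 + (a * v + b * u - z) ^+ 2).
  by rewrite addr_ge0 ?sqr_ge0.
by ring.
Qed.

HB.instance Definition _ :=
  GRing.isSubmodClosed.Build _ _ sqint sqint_submod_closed.

Record L2fun := MkL2fun { L2fun_val :> R -> R[i]; _ : L2fun_val \in sqint }.
HB.instance Definition _ := [isSub for L2fun_val].
HB.instance Definition _ := [Choice of L2fun by <:].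
HB.instance Definition _ := [SubChoice_isSubLmodule of L2fun by <:].

Definition L2eq (f g : L2fun) : bool := `[< f = g %[ae mu in I] >].

Let aeF : Filter (almost_everywhere mu).
Proof. exact: (ae_filter_ringOfSetsType mu). Qed.

Lemma L2eq_refl : reflexive L2eq.
Proof. by move=> f; apply/asboolP; exact: aeW. Qed.

Lemma L2eq_sym : symmetric L2eq.
Proof.
suff H f g : L2eq f g -> L2eq g f by move=> f g; apply/idP/idP; exact: H.
move=> /asboolP fg; apply/asboolP.
apply: filterS fg; first exact: aeF; move=> x + Ix.
by move=> /(_ Ix) ->.
Qed.

Lemma L2eq_trans : transitive L2eq.
Proof.
move=> g f h /asboolP fg /asboolP gh; apply/asboolP.
apply: filterS2 fg gh; first exact: aeF.
by move=> x fg gh Ix; rewrite fg// gh.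
Qed.

Canonical L2eq_equiv := EquivRel L2eq L2eq_refl L2eq_sym L2eq_trans.

Definition L2 : Type := {eq_quot L2eq}.
HB.instance Definition _ := Choice.on L2.
HB.instance Definition _ := EqQuotient.on L2.

Definition L2_fun (u : L2) : R -> R[i] := repr u : L2fun.
Coercion L2_fun : L2 >-> Funclass.

Lemma L2P (f g : L2fun) : f = g %[ae mu in I] -> \pi_L2 f = \pi_L2 g.
Proof. by move=> fg; apply/eqmodP/asboolP. Qed.

Lemma L2_repr (f : L2fun) : (repr (\pi_L2 f) : L2fun) = f %[ae mu in I].
Proof. by apply/asboolP; rewrite -/(L2eq _ _) -eqmodE reprK. Qed.

Definition L2_opp (u : L2) : L2 := \pi_L2 (- repr u).
Definition L2_add (u v : L2) : L2 := \pi_L2 (repr u + repr v).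
Definition L2_scale (a : R[i]) (u : L2) : L2 := \pi_L2 (a *: repr u).

Lemma pi_L2_opp f : L2_opp (\pi f) = \pi_L2 (- f).
Proof.
apply/esym/L2P; apply: filterS (L2_repr f); first exact: aeF.
move=> x + Ix.
by move=> /(_ Ix) /esym; exact: congr1.
Qed.

Lemma pi_L2_add f g : L2_add (\pi f) (\pi g) = \pi_L2 (f + g).
Proof.
apply/esym/L2P; apply: filterS2 (L2_repr f) (L2_repr g); first exact: aeF.
move=> x + + Ix.
by move=> /(_ Ix) ff /(_ Ix) gg; exact: (congr2 _ (esym ff) (esym gg)).
Qed.

Lemma pi_L2_scale a f : L2_scale a (\pi f) = \pi_L2 (a *: f).
Proof.
apply/esym/L2P; apply: filterS (L2_repr f); first exact: aeF.
move=> x + Ix.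
by move=> /(_ Ix) /esym; exact: (congr1 ( *%R a)).
Qed.

Lemma L2_addA : associative L2_add.
Proof.
move=> u v w; rewrite -[u]reprK -[v]reprK -[w]reprK.
by rewrite !pi_L2_add addrA.
Qed.

Lemma L2_addC : commutative L2_add.
Proof. by move=> u v; rewrite -[u]reprK -[v]reprK !pi_L2_add addrC. Qed.

Lemma L2_add0 : left_id (\pi_L2 0) L2_add.
Proof. by move=> u; rewrite -[u]reprK pi_L2_add add0r. Qed.

Lemma L2_addN : left_inverse (\pi_L2 0) L2_opp L2_add.
Proof. by move=> u; rewrite -[u]reprK pi_L2_opp pi_L2_add addNr. Qed.

HB.instance Definition _ :=
  GRing.isZmodule.Build L2 L2_addA L2_addC L2_add0 L2_addN.

Lemma L2_scaleA a b (u : L2) : L2_scale a (L2_scale b u) = L2_scale (a * b) u.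
Proof. by rewrite -[u]reprK !pi_L2_scale scalerA. Qed.

Lemma L2_scale1 : left_id 1 L2_scale.
Proof. by move=> u; rewrite -[u]reprK pi_L2_scale scale1r. Qed.

Lemma L2_scaleDr : right_distributive L2_scale +%R.
Proof.
move=> a u v; rewrite -[u]reprK -[v]reprK -[X in L2_scale a X]/(L2_add _ _).
by rewrite pi_L2_add !pi_L2_scale -[RHS]/(L2_add _ _) pi_L2_add scalerDr.
Qed.

Lemma L2_scaleDl (u : L2) : {morph L2_scale^~ u : a b / a + b}.
Proof.
move=> a b; rewrite -[u]reprK.
by rewrite !pi_L2_scale -[RHS]/(L2_add _ _) pi_L2_add scalerDl.
Qed.

HB.instance Definition _ := GRing.Zmodule_isLmodule.Build R[i] L2
  L2_scaleA L2_scale1 L2_scaleDr L2_scaleDl.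

(* Junk value 0 when f is not square integrable. *)
Definition L2class (f : R -> R[i]) : L2 := \pi_L2 (insubd 0 f).

End L2.

Section Sobolev.
Variables (R : realType) (L : R).
Local Notation mu := (@lebesgue_measure R).
Local Notation I := (`]0, L[%classic : set R).
Local Notation L2 := (L2 L).

(* Weak derivatives are tested against C^1_c(0, L), as is usual in dimension
   one; this gives the same weak derivatives as C^oo_c(0, L). *)
Definition test_function (p : R -> R) : Prop :=
  [/\ forall x, derivable p x 1,
      continuous p^`()%classic &
      exists a b, [/\ 0 < a, b < L & forall x, x \notin `[a, b] -> p x = 0]].

Definition weak_deriv (u v : L2) : Prop := forall p, test_function p ->
  Cint I (fun x => u x * (p^`()%classic x)%:C) = - Cint I (fun x => v x * (p x)%:C).

Definition H1 : set L2 := [set u | exists v, weak_deriv u v].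

(* Junk value 0 outside H1. *)
Definition wderiv (u : L2) : L2 := xget 0 [set v | weak_deriv u v].

Definition H2 : set L2 := [set u | H1 u /\ H1 (wderiv u)].

(* y is the value at a of a continuous representative of u on [0, L]. *)
Definition is_trace (u : L2) (a : R) (y : R[i]) : Prop :=
  exists f : R -> R[i]^o,
    [/\ {within `[0, L], continuous f}, u = f %[ae mu in I] & f a = y].

(* Membership in H^1_(0)(0, L). *)
Definition H10_pred : {pred L2} := fun u => `[< H1 u /\ is_trace u 0 0 >].

Let mI : measurable I. Proof. exact: measurable_itv. Qed.

Let aeF : Filter (almost_everywhere mu).
Proof. exact: (ae_filter_ringOfSetsType mu). Qed.

Lemma L2_linE (a : R[i]) (u v : L2) :
  (a *: u + v : L2) = (fun x => a * u x + v x) %[ae mu in I].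
Proof.
have h1 := L2_repr (repr (L2_scale a u) + repr v).
have h2 := L2_repr (a *: repr u).
apply: filterS2 h1 h2; first exact: aeF.
move=> x + + Ix; move=> /(_ Ix) h1 /(_ Ix) h2.
rewrite -[LHS]/((repr (\pi_L2 (repr (L2_scale a u) + repr v)) : L2fun L) x) h1.
by rewrite -[LHS]/((repr (\pi_L2 (a *: repr u)) : L2fun L) x + v x) h2.
Qed.

Lemma L2_measurable (u : L2) : measurable_fun I (fun x => complex.Re (u x)) /\
  measurable_fun I (fun x => complex.Im (u x)).
Proof. by rewrite /L2_fun; case: (repr u) => f /= /asboolP[]. Qed.

Lemma L2_integrable (u : L2) : mu.-integrable I (fun x => (sqmod (u x))%:E).
Proof. by rewrite /L2_fun; case: (repr u) => f /= /asboolP[]. Qed.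

Lemma L2_test_integrable (u : L2) (p : R -> R) : continuous p ->
  mu.-integrable I (fun x => (complex.Re (u x) * p x)%:E) /\
  mu.-integrable I (fun x => (complex.Im (u x) * p x)%:E).
Proof.
move=> cp; have [mr mi] := L2_measurable u.
have mp : measurable_fun I p.
  by apply: measurable_funTS; exact: continuous_measurable_fun.
have ip : mu.-integrable I (fun x => (p x ^+ 2)%:E).
  refine (@integrableS _ _ _ mu `[0, L] I _ _ _ _ _) => //.
    exact: subset_itv_oo_cc.
  apply: (@continuous_compact_integrable R (fun x => p x ^+ 2)).
    exact: segment_compact.
  apply: continuous_subspaceT => x.
  by rewrite /continuous_at expr2; under eq_fun do rewrite expr2;
    apply: cvgM; exact: cp.
have iG : mu.-integrable I (fun x => (sqmod (u x))%:E + (p x ^+ 2)%:E)%E.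
  by apply: integrableD => //; exact: L2_integrable.
have le (a b c : R) : `|a * c| <= `|a ^+ 2 + b ^+ 2 + c ^+ 2|.
  rewrite [leRHS]ger0_norm; last by rewrite !addr_ge0 ?sqr_ge0.
  rewrite ler_norml.
  by apply/andP; split; nra.
split; refine (@le_integrable _ _ _ mu I mI _ _ _ _ iG).
- by apply/measurable_EFinP; exact: measurable_funM.
- by move=> x _; rewrite lee_fin; exact: le.
- by apply/measurable_EFinP; exact: measurable_funM.
- move=> x _; rewrite lee_fin /sqmod [_ ^+ 2 + complex.Im _ ^+ 2]addrC.
  exact: le.
Qed.

Lemma Cint_lin (a : R[i]) (u v : L2) (p : R -> R) : continuous p ->
  Cint I (fun x => (a *: u + v : L2) x * (p x)%:C) =
  a * Cint I (fun x => u x * (p x)%:C) + Cint I (fun x => v x * (p x)%:C).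
Proof.
move=> cp.
have [ur ui] := L2_test_integrable u cp.
have [vr vi] := L2_test_integrable v cp.
have [wr wi] := L2_test_integrable (a *: u + v) cp.
have ReM (z : R[i]) (t : R) : complex.Re (z * t%:C) = complex.Re z * t.
  by case: z => x y /=; rewrite mulr0 subr0.
have ImM (z : R[i]) (t : R) : complex.Im (z * t%:C) = complex.Im z * t.
  by case: z => x y /=; rewrite mulr0 add0r.
have mI' : measurable (I : set (measurableTypeR R)) by exact: mI.
have iZ k (f : R -> R) : mu.-integrable I (EFin \o f) ->
    mu.-integrable I (EFin \o (fun x => k * f x)).
  by move=> fi; exact: (integrableZl mI' k fi).
have iD (f g : R -> R) : mu.-integrable I (EFin \o f) ->
    mu.-integrable I (EFin \o g) ->
    mu.-integrable I (EFin \o (fun x => f x + g x)).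
  by move=> fi gi; exact: (integrableD mI' fi gi).
have iB (f g : R -> R) : mu.-integrable I (EFin \o f) ->
    mu.-integrable I (EFin \o g) ->
    mu.-integrable I (EFin \o (fun x => f x - g x)).
  by move=> fi gi; exact: (integrableB mI' fi gi).
rewrite /Cint.
under eq_Rintegral do rewrite ReM.
under [X in _ +i* X]eq_Rintegral do rewrite ImM.
under [X in a * (X +i* _)]eq_Rintegral do rewrite ReM.
under [X in a * (_ +i* X)]eq_Rintegral do rewrite ImM.
under [X in _ + (X +i* _)]eq_Rintegral do rewrite ReM.
under [X in _ + (_ +i* X)]eq_Rintegral do rewrite ImM.
case: a wr wi => a b wr wi.
rewrite -[RHS]/(Complex (a * _ - b * _ + _) (a * _ + b * _ + _)).
congr Complex.
- rewrite -!RintegralZl// -RintegralB//; do 1?exact: iZ.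
  rewrite -RintegralD//; last exact: iB (iZ _ _ ur) (iZ _ _ ui).
  congr fine; apply: ae_eq_integral => //.
  + exact: measurable_int wr.
  + exact: (measurable_int mu (iD _ _ (iB _ _ (iZ _ _ ur) (iZ _ _ ui)) vr)).
  + apply: filterS (L2_linE (Complex a b) u v); first exact: aeF.
    move=> x /[apply] ->; congr EFin.
    by case: (u x) (v x) => [? ?] [? ?] /=; ring.
- rewrite -!RintegralZl// -RintegralD//; do 1?exact: iZ.
  rewrite -RintegralD//; last exact: iD (iZ _ _ ui) (iZ _ _ ur).
  congr fine; apply: ae_eq_integral => //.
  + exact: measurable_int wi.
  + exact: (measurable_int mu (iD _ _ (iD _ _ (iZ _ _ ui) (iZ _ _ ur)) vi)).
  + apply: filterS (L2_linE (Complex a b) u v); first exact: aeF.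
    move=> x /[apply] ->; congr EFin.
    by case: (u x) (v x) => [? ?] [? ?] /=; ring.
Qed.

Lemma weak_deriv_lin (a : R[i]) (u v u' v' : L2) :
  weak_deriv u u' -> weak_deriv v v' ->
  weak_deriv (a *: u + v) (a *: u' + v').
Proof.
move=> uu vv p tp; have [dp cp _] := tp.
rewrite !Cint_lin//; first by rewrite uu// vv// mulrN opprD.
by move=> x; apply: differentiable_continuous; exact/derivable1_diffP.
Qed.

Lemma is_trace_lin (a : R[i]) (u v : L2) (t : R) (y z : R[i]) :
  is_trace u t y -> is_trace v t z -> is_trace (a *: u + v) t (a * y + z).
Proof.
move=> [f [cf uf fy]] [g [cg vg gz]].
exists (fun x => a *: f x + g x); split; last by rewrite fy gz.
- move=> x; apply: cvgD; last exact: cg.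
  by apply: cvgZr; exact: cf.
- apply: filterS3 (L2_linE a u v) uf vg; first exact: aeF.
  by move=> x h1 h2 h3 Ix; rewrite h1// h2// h3.
Qed.

Lemma H10_submod_closed : submod_closed H10_pred.
Proof.
have z0 : (0 : L2) = (fun=> 0) %[ae mu in I].
  apply: filterS (L2_repr (0 : L2fun L)); first exact: aeF.
  by move=> x + Ix; move=> /(_ Ix).
split=> [|a u v /asboolP[[u' uu] tu] /asboolP[[v' vv] tv]]; apply/asboolP.
  split; last first.
    by exists (fun=> 0); split => // x; exact: cvg_cst.
  exists 0 => p tp; have [dp cp _] := tp.
  have E (q : R -> R) : continuous q -> Cint I (fun x => (0 : L2) x * (q x)%:C) = 0.
    move=> cq; have := @Cint_lin (-1) 0 0 q cq.
    by rewrite scaler0 addr0 mulN1r addNr.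
  rewrite !E ?oppr0//.
  by move=> x; apply: differentiable_continuous; exact/derivable1_diffP.
split; first by exists (a *: u' + v'); exact: weak_deriv_lin.
by have := is_trace_lin a tu tv; rewrite mulr0 addr0.
Qed.

HB.instance Definition _ :=
  GRing.isSubmodClosed.Build _ _ H10_pred H10_submod_closed.

Record H10 := MkH10 { H10_val :> L2; _ : H10_val \in H10_pred }.
HB.instance Definition _ := [isSub for H10_val].
HB.instance Definition _ := [Choice of H10 by <:].
HB.instance Definition _ := [SubChoice_isSubLmodule of H10 by <:].

End Sobolev.

Section HilbertOperators.
Variables (R : realType) (H : lmodType R[i]) (ip : H -> H -> R[i]).

Definition hnorm (u : H) : R := Num.sqrt (complex.Re (ip u u)).

Definition hcvg (u_ : nat -> H) (u : H) : Prop :=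
  hnorm (u_ n - u) @[n --> \oo] --> (0 : R).

Definition hcauchy (u_ : nat -> H) : Prop := forall e : R, 0 < e ->
  exists N : nat, forall n p : nat,
    (N <= n)%N -> (N <= p)%N -> hnorm (u_ n - u_ p) < e.

Definition inner_product : Prop :=
  [/\ forall a u v w, ip (a *: u + v) w = a * ip u w + ip v w,
      forall u v, ip v u = conjc (ip u v) &
      forall u, u != 0 -> 0 < ip u u].

Definition hilbert_space : Prop :=
  inner_product /\ forall u_, hcauchy u_ -> exists u, hcvg u_ u.

(* The family (phi j), j in D, is a Riesz basis when its finite linear
   combinations are dense and the two-sided l^2 estimate holds for them. *)
Definition riesz_basis (J : eqType) (D : set J) (phi : J -> H) : Prop :=
  (forall (u : H) (e : R), 0 < e -> exists (s : seq J) (a : J -> R[i]),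
     (forall j, j \in s -> D j) /\
     hnorm (u - \sum_(j <- s) a j *: phi j) < e) /\
  (exists m M : R, [/\ 0 < m, 0 < M &
     forall (s : seq J) (a : J -> R[i]), uniq s -> (forall j, j \in s -> D j) ->
       m * (\sum_(j <- s) sqmod (a j))
         <= hnorm (\sum_(j <- s) a j *: phi j) ^+ 2
         <= M * (\sum_(j <- s) sqmod (a j))]).

(* app is only meaningful on dom. *)
Record operator := Operator { dom : set H; app : H -> H }.
Implicit Type A : operator.

Definition linear_operator A : Prop :=
  dom A 0 /\ forall a u v, dom A u -> dom A v ->
    dom A (a *: u + v) /\ app A (a *: u + v) = a *: app A u + app A v.

Definition closed_operator A : Prop :=
  linear_operator A /\
  forall (u_ : nat -> H) u v, (forall n, dom A (u_ n)) ->
    hcvg u_ u -> hcvg (fun n => app A (u_ n)) v -> dom A u /\ app A u = v.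

Definition eigenvector A (l : R[i]) (u : H) : Prop :=
  [/\ u != 0, dom A u & app A u = l *: u].

Definition is_eigenvalue A (l : R[i]) : Prop := exists u, eigenvector A l u.

(* u is in the domain and in the kernel of (A - l)^k. *)
Fixpoint root_vector A (l : R[i]) (k : nat) (u : H) : Prop :=
  if k is k'.+1 then dom A u /\ root_vector A l k' (app A u - l *: u)
  else u = 0.

(* Algebraic multiplicity one: all root vectors for l lie on one line. *)
Definition simple_eigenvalue A (l : R[i]) : Prop :=
  exists u, eigenvector A l u /\
    forall k v, root_vector A l k v -> exists a : R[i], v = a *: u.

(* The Riesz basis of eigenvectors is indexed by the eigenvalues themselves, one
   eigenvector for each since they are simple. *)
Definition riesz_spectral A : Prop :=
  [/\ hilbert_space,
      closed_operator A,
      forall l, is_eigenvalue A l -> simple_eigenvalue A l,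
      exists phi : R[i] -> H,
        (forall l, is_eigenvalue A l -> eigenvector A l (phi l)) /\
        riesz_basis [set l | is_eigenvalue A l] phi &
      totally_disconnected (closure [set l : R[i]^o | is_eigenvalue A l])].

Definition bounded_linear (S : H -> H) : Prop :=
  (forall a u v, S (a *: u + v) = a *: S u + S v) /\
  exists M : R, forall u, hnorm (S u) <= M * hnorm u.

Definition C0_semigroup (T : R -> H -> H) : Prop :=
  [/\ forall t, 0 <= t -> bounded_linear (T t),
      forall u, T 0 u = u,
      forall s t u, 0 <= s -> 0 <= t -> T (s + t) u = T s (T t u) &
      forall u, hnorm (T t u - u) @[t --> 0^'+] --> (0 : R)].

Definition generator_of (T : R -> H -> H) A : Prop :=
  forall u v, (dom A u /\ app A u = v) <->
    hnorm ((t^-1)%:C *: (T t u - u) - v) @[t --> 0^'+] --> (0 : R).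

Definition generates_C0_semigroup A : Prop :=
  exists T, C0_semigroup T /\ generator_of T A.

End HilbertOperators.

Section HeatWave.
Variables (R : realType) (L c : R) (beta : R -> R) (alpha : R).
Local Notation mu := (@lebesgue_measure R).
Local Notation I := (`]0, L[%classic : set R).
Local Notation L2 := (L2 L).
Local Notation H10 := (H10 L).

Definition Linfty (b : R -> R) : Prop :=
  measurable_fun I b /\
  exists M : R, \forall x \ae mu, I x -> `|b x| <= M.

(* The space H^0. *)
Definition state : Type := (L2 * H10 * L2)%type.
HB.instance Definition _ := GRing.Lmodule.on state.

Definition ipL2 (u v : L2) : R[i] := Cint I (fun x => u x * conjc (v x)).

Definition ip0 (z w : state) : R[i] :=
  ipL2 z.1.1 w.1.1 + ipL2 (wderiv z.1.2) (wderiv w.1.2) + ipL2 z.2 w.2.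

(* Junk value 0 outside H^1_(0). *)
Definition toH10 (u : L2) : H10 := insubd 0 u.

Definition mkstate (f g h : R -> R[i]) : state :=
  (L2class L f, toH10 (L2class L g), L2class L h).

Definition domA : set state := [set z |
  let f := z.1.1 in let g := H10_val z.1.2 in let h := z.2 in
  [/\ H2 f, H2 g & H1 h] /\
  [/\ is_trace f 0 0, is_trace f L 0, is_trace g 0 0, is_trace h 0 0 &
      exists y z : R[i], [/\ is_trace (wderiv g) L y, is_trace h L z &
                             y + alpha%:C * z = 0]]].

Definition appA (z : state) : state :=
  let f := z.1.1 in let g := H10_val z.1.2 in let h := z.2 in
  (wderiv (wderiv f) + c%:C *: f + L2class L (fun x => (beta x)%:C * g x),
   toH10 h,
   wderiv (wderiv g)).

Definition opA : operator state := Operator domA appA.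

(* The common real part of the lambda_{2,m}; it is -mu. *)
Definition sigma : R := (2 * L)^-1 * ln ((alpha - 1) / (alpha + 1)).

Definition lambda1 (n : nat) : R[i] := (c - n%:R ^+ 2 * pi ^+ 2 / L ^+ 2)%:C.

Definition lambda2 (m : int) : R[i] := sigma +i* (m%:~R * pi / L).

Definition phi1 (n : nat) : state :=
  mkstate (fun x => (Num.sqrt (2 / L) * sin (n%:R * pi / L * x))%:C)
          (fun=> 0) (fun=> 0).

(* A_m. *)
Definition Anorm (m : int) : R :=
  let mu := - sigma in
  Num.sqrt ((mu ^+ 2 * L ^+ 2 + m%:~R ^+ 2 * pi ^+ 2) *
            ((expR (2 * mu * L) - expR (- (2 * mu * L))) / 2))
  / (L * Num.sqrt (2 * mu)).

(* r is a square root of lambda2 m - c. *)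
Definition phi2_1 (m : int) (r : R[i]) (x : R) : R[i] :=
  let l := lambda2 m in
  ((Anorm m)%:C * r)^-1 *
    Cint `]x, L[ (fun s => (beta s)%:C * Csinh (l * s%:C) *
                           Csinh (r * (x - s)%:C)) +
  Csinh (r * (L - x)%:C) / ((Anorm m)%:C * r * Csinh (r * L%:C)) *
    Cint `]0, L[ (fun s => (beta s)%:C * Csinh (l * s%:C) *
                           Csinh (r * s%:C)).

Definition phi2_2 (m : int) (x : R) : R[i] :=
  ((Anorm m)%:C)^-1 * Csinh (lambda2 m * x%:C).

Definition phi2_3 (m : int) (x : R) : R[i] :=
  lambda2 m / (Anorm m)%:C * Csinh (lambda2 m * x%:C).

Definition phi2 (m : int) (r : R[i]) : state :=
  mkstate (phi2_1 m r) (phi2_2 m) (phi2_3 m).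

(* inl n stands for phi_{1,n+1} (so that n + 1 >= 1), inr m for phi_{2,m}. *)
Definition eigval (j : nat + int) : R[i] :=
  match j with inl n => lambda1 n.+1 | inr m => lambda2 m end.

Definition Phi (r : int -> R[i]) (j : nat + int) : state :=
  match j with inl n => phi1 n.+1 | inr m => phi2 m (r m) end.

End HeatWave.

(* Main.v *)
(* A computation gives the eigenvectors. For the Riesz property, the variables
   (f, g' + h, g' - h) and the multiplication by e^{+-sigma x} turn phi_{2,m} into
   (phi^1_{2,m}, k_m e^{i m pi x / L}, k_m e^{-i m pi x / L}) with |k_m| independent of m, and
   these isomorphisms leave phi_{1,n} unchanged. The pairs (e^{i m pi x / L}, e^{-i m pi x / L})
   form an orthogonal basis of L^2 x L^2, and the imaginary part of the energy identity for
   f'' + (c - lambda) f = - beta g gives ||phi^1_{2,m}|| <= C / |m|, so the family is a triangular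
   perturbation of an orthogonal basis by a square-summable sequence.
   Conversely, let A be closed with a Riesz basis of eigenvectors, and let A - l0 be injective
   for some l0 away from the eigenvalues. Then D(A) consists of the sums of
   a_i phi_i with (a_i) and (lambda_i a_i) in l^2; hence the lambda_i are all the eigenvalues,
   distinct lambda_i are simple, and exp(t lambda_i) defines the semigroup when Re lambda_i is
   bounded above. Here l0 is any real number larger than c and 0, by the energy identity again. *)

Require Import Defs.
From mathcomp Require Import all_boot all_order all_algebra.
From mathcomp Require Import complex ring lra.
From mathcomp Require Import all_classical all_reals all_analysis.
From mathcomp Require Import measurable_realfun.

Set Implicit Arguments.
Unset Strict Implicit.
Unset Printing Implicit Defensive.

Import Order.TTheory GRing.Theory Num.Theory.
Import numFieldNormedType.Exports.

Local Open Scope classical_set_scope.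
Local Open Scope complex_scope.
Local Open Scope ring_scope.

(** Everything is computed in the coordinates (f, g', h): [wd] and [mk10] are inverse isometries
    between H^1_(0) and L^2, so the state space is L^2 cubed and [mk3] builds a state from its
    coordinates. Functions in H^1 are handled as pairs (F, f) with F a primitive of f ([ac]). The
    product rule for such pairs is bilinear and bounded, so density of the cosines reduces it to
    smooth functions. The triangular structure replaces any smallness of the perturbation: the last
    two components determine the sum of |a_m|^2 over the wave indices exactly, Cauchy-Schwarz then
    bounds what the phi^1_{2,m} add to the first component, and the sine coefficients are recovered
    from the remainder. The energy estimate is void at m = 0, which only affects a constant. The
    condition on c acts twice: it makes sinh (r_m L) non-zero, and it separates lambda_{2,0} from
    the lambda_{1,n}. That the vectors of the family are non-zero is read off the lower Riesz bound,
    so the eigenvector property is completed only after the Riesz property. *)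

Local Notation Re := (@complex.Re (Real.sort _)).
Local Notation Im := (@complex.Im (Real.sort _)).

(** * Real and imaginary parts, squared moduli *)

Section ComplexParts.
Variable R : realType.
Implicit Types (z w : R[i]) (x y : R).

Lemma complexP z w : Re z = Re w -> Im z = Im w -> z = w.
Proof. by case: z w => [? ?] [? ?] /= -> ->. Qed.

Lemma cReD z w : Re (z + w) = Re z + Re w. Proof. by case: z w => [? ?] [? ?]. Qed.
Lemma cImD z w : Im (z + w) = Im z + Im w. Proof. by case: z w => [? ?] [? ?]. Qed.
Lemma cReN z : Re (- z) = - Re z. Proof. by case: z. Qed.
Lemma cImN z : Im (- z) = - Im z. Proof. by case: z. Qed.
Lemma cReM z w : Re (z * w) = Re z * Re w - Im z * Im w.
Proof. by case: z w => [? ?] [? ?]. Qed.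
Lemma cImM z w : Im (z * w) = Re z * Im w + Im z * Re w.
Proof. by case: z w => [? ?] [? ?]. Qed.
Lemma cRe_conj z : Re (conjc z) = Re z. Proof. by case: z. Qed.
Lemma cIm_conj z : Im (conjc z) = - Im z. Proof. by case: z. Qed.
Lemma cRe_real x : Re x%:C = x. Proof. by []. Qed.
Lemma cIm_real x : Im x%:C = 0. Proof. by []. Qed.
Lemma cReB z w : Re (z - w) = Re z - Re w. Proof. by rewrite cReD cReN. Qed.
Lemma cImB z w : Im (z - w) = Im z - Im w. Proof. by rewrite cImD cImN. Qed.
Definition ReImE :=
  (cReB, cImB, cReD, cImD, cReN, cImN, cReM, cImM, cRe_conj, cIm_conj, cRe_real, cIm_real).

Lemma sqmod_ge0 z : 0 <= sqmod z. Proof. by rewrite addr_ge0 ?sqr_ge0. Qed.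
Lemma sqmodM z w : sqmod (z * w) = sqmod z * sqmod w.
Proof. by rewrite /sqmod !ReImE; ring. Qed.
Lemma sqmodN z : sqmod (- z) = sqmod z.
Proof. by rewrite /sqmod !ReImE !sqrrN. Qed.
Lemma sqmodB z w : sqmod (z - w) = sqmod (w - z).
Proof. by rewrite -opprB sqmodN. Qed.
Lemma sqmod_real x : sqmod x%:C = x ^+ 2.
Proof. by rewrite /sqmod/= expr0n addr0. Qed.
Lemma sqmod_conj z : sqmod (conjc z) = sqmod z.
Proof. by rewrite /sqmod !ReImE sqrrN. Qed.
Lemma sqmod0 : sqmod (0 : R[i]) = 0. Proof. by rewrite sqmod_real expr0n. Qed.
Lemma sqmod1 : sqmod (1 : R[i]) = 1. Proof. by rewrite sqmod_real expr1n. Qed.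
Lemma sqmod_eq0 z : (sqmod z == 0) = (z == 0).
Proof.
rewrite paddr_eq0 ?sqr_ge0// !sqrf_eq0 -[RHS]/(z == Complex 0 0).
by rewrite eq_complex.
Qed.
Lemma sqmod_gt0 z : (0 < sqmod z) = (z != 0).
Proof. by rewrite lt0r sqmod_eq0 sqmod_ge0 andbT. Qed.
Lemma sqmodV z : sqmod z^-1 = (sqmod z)^-1.
Proof.
have [->|z0] := eqVneq z 0; first by rewrite invr0 sqmod0 invr0.
have : sqmod (z * z^-1) = 1 by rewrite divff// sqmod1.
rewrite sqmodM => h.
by rewrite -[LHS]mul1r -[in LHS](@mulVf _ (sqmod z)) ?sqmod_eq0// -mulrA h mulr1.
Qed.
Lemma sqmodD_le z w : sqmod (z + w) <= 2 * (sqmod z + sqmod w).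
Proof.
rewrite /sqmod !ReImE -subr_ge0.
rewrite (_ : _ - _ = (Re z - Re w) ^+ 2 + (Im z - Im w) ^+ 2); last by ring.
by rewrite addr_ge0 ?sqr_ge0.
Qed.
Lemma mulcJ z : z * conjc z = (sqmod z)%:C.
Proof. by apply: complexP; rewrite /sqmod !ReImE; ring. Qed.
Lemma sqr_Re_le z : Re z ^+ 2 <= sqmod z.
Proof. by rewrite lerDl sqr_ge0. Qed.
Lemma sqr_Im_le z : Im z ^+ 2 <= sqmod z.
Proof. by rewrite lerDr sqr_ge0. Qed.

Lemma le_of_sqr x y : 0 <= y -> x ^+ 2 <= y ^+ 2 -> x <= y.
Proof.
move=> y0 h; have [x0|x0] := leP 0 x; first by rewrite -ler_sqr.
exact: le_trans (ltW x0) y0.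
Qed.

End ComplexParts.

(** * Complex inner product spaces *)

Section InnerProduct.
Variables (R : realType) (H : lmodType R[i]) (ip : H -> H -> R[i]).
Hypothesis ipP : inner_product ip.
Implicit Types (u v w : H) (a b : R[i]).
Local Notation nrm := (hnorm ip).

Lemma ip_lin a u v w : ip (a *: u + v) w = a * ip u w + ip v w.
Proof. by case: ipP. Qed.
Lemma ipC u v : ip v u = conjc (ip u v). Proof. by case: ipP. Qed.
Lemma ip0l w : ip 0 w = 0.
Proof. by have := ip_lin (-1) 0 0 w; rewrite scaler0 addr0 mulN1r addNr. Qed.
Lemma ipDl u v w : ip (u + v) w = ip u w + ip v w.
Proof. by have := ip_lin 1 u v w; rewrite scale1r mul1r. Qed.
Lemma ipZl a u w : ip (a *: u) w = a * ip u w.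
Proof. by have := ip_lin a u 0 w; rewrite addr0 ip0l addr0. Qed.
Lemma ipNl u w : ip (- u) w = - ip u w.
Proof. by rewrite -scaleN1r ipZl mulN1r. Qed.
Lemma ipBl u v w : ip (u - v) w = ip u w - ip v w.
Proof. by rewrite ipDl ipNl. Qed.
Lemma ip0r w : ip w 0 = 0. Proof. by rewrite ipC ip0l conjc0. Qed.
Lemma ipDr u v w : ip w (u + v) = ip w u + ip w v.
Proof. by rewrite ipC ipDl rmorphD /= -!ipC. Qed.
Lemma ipZr a u w : ip w (a *: u) = conjc a * ip w u.
Proof. by rewrite ipC ipZl rmorphM /= -ipC. Qed.
Lemma ipNr u w : ip w (- u) = - ip w u.
Proof. by rewrite ipC ipNl rmorphN /= -ipC. Qed.
Lemma ipBr u v w : ip w (u - v) = ip w u - ip w v.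
Proof. by rewrite ipDr ipNr. Qed.
Lemma ip_sumr (J : Type) (s : seq J) (F : J -> H) w :
  ip w (\sum_(j <- s) F j) = \sum_(j <- s) ip w (F j).
Proof. by elim/big_ind2 : _ => [|? ? ? ? <- <-|//]; rewrite ?ip0r// ipDr. Qed.

Lemma ip_self_ge0 u : 0 <= ip u u.
Proof.
have [->|u0] := eqVneq u 0; first by rewrite ip0l.
by apply/ltW; case: ipP => _ _; exact.
Qed.

Lemma hnorm_ge0 u : 0 <= nrm u. Proof. exact: sqrtr_ge0. Qed.

Lemma hnorm_sq u : nrm u ^+ 2 = Re (ip u u).
Proof. by rewrite sqr_sqrtr//; have := ip_self_ge0 u; rewrite lecE => /andP[]. Qed.

Lemma ip_self u : ip u u = (nrm u ^+ 2)%:C.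
Proof.
apply: complexP; first by rewrite hnorm_sq.
by have := ip_self_ge0 u; rewrite lecE => /andP[/eqP].
Qed.

Lemma hnorm0 : nrm 0 = 0. Proof. by rewrite /hnorm ip0l sqrtr0. Qed.

Lemma hnorm_eq0 u : (nrm u == 0) = (u == 0).
Proof.
apply/eqP/eqP => [u0|->]; last exact: hnorm0.
apply/eqP; apply: contraT => un; have [_ _ /(_ u un)] := ipP.
by rewrite ip_self u0 expr0n ltxx.
Qed.

Lemma hnorm_sqZ a u : nrm (a *: u) ^+ 2 = sqmod a * nrm u ^+ 2.
Proof.
by rewrite [LHS]hnorm_sq ipZl ipZr mulrA mulcJ ip_self -rmorphM.
Qed.

Lemma hnormZ a u : nrm (a *: u) = Num.sqrt (sqmod a) * nrm u.
Proof.
rewrite -[LHS]ger0_norm ?hnorm_ge0// -sqrtr_sqr hnorm_sqZ.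
by rewrite sqrtrM ?sqmod_ge0// sqrtr_sqr ger0_norm// hnorm_ge0.
Qed.

Lemma hnorm_opp u : nrm (- u) = nrm u.
Proof. by rewrite /hnorm ipNl ipNr opprK. Qed.

Lemma hnormBC u v : nrm (u - v) = nrm (v - u).
Proof. by rewrite -opprB hnorm_opp. Qed.

Lemma hnormD_sq u v :
  nrm (u + v) ^+ 2 = nrm u ^+ 2 + nrm v ^+ 2 + 2 * Re (ip u v).
Proof.
rewrite [LHS]hnorm_sq ipDl !ipDr !ip_self (ipC u v) !ReImE.
by ring.
Qed.

Lemma cauchy_schwarz u v : sqmod (ip u v) <= nrm u ^+ 2 * nrm v ^+ 2.
Proof.
have [->|v0] := eqVneq v 0; first by rewrite ip0r sqmod0 hnorm0 expr0n mulr0.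
have nv : 0 < nrm v ^+ 2 by rewrite exprn_gt0// lt0r hnorm_eq0 v0 hnorm_ge0.
(* This vector is |v|^2 times the component of u orthogonal to v. *)
have : 0 <= nrm ((nrm v ^+ 2)%:C *: u - ip u v *: v) ^+ 2 by rewrite sqr_ge0.
rewrite hnormD_sq hnorm_opp !hnorm_sqZ ipNr ipZl ipZr sqmod_real !ReImE.
have -> : Re (ip u v) * Re (ip u v) - - Im (ip u v) * Im (ip u v) =
  sqmod (ip u v) by rewrite /sqmod; ring.
set N := nrm v ^+ 2 in nv *; set S := sqmod _ => h.
have : 0 <= N * (nrm u ^+ 2 * N - S) by nra.
by rewrite pmulr_rge0// subr_ge0.
Qed.

Lemma Re_ip_le u v : Re (ip u v) <= nrm u * nrm v.
Proof.
apply: le_of_sqr; first by rewrite mulr_ge0// hnorm_ge0.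
rewrite exprMn; apply: le_trans (cauchy_schwarz u v); exact: sqr_Re_le.
Qed.

Lemma hnormD_le u v : nrm (u + v) <= nrm u + nrm v.
Proof.
apply: le_of_sqr; first by rewrite addr_ge0// hnorm_ge0.
have := Re_ip_le u v; rewrite hnormD_sq; set a := nrm u; set b := nrm v.
move: (Re _) => c h; nra.
Qed.

Lemma hnorm_dist u v w : nrm (u - w) <= nrm (u - v) + nrm (v - w).
Proof. by rewrite -[u - w](subrKA v); exact: hnormD_le. Qed.

Lemma hnormD_sq_le u v : nrm (u + v) ^+ 2 <= 2 * (nrm u ^+ 2 + nrm v ^+ 2).
Proof.
have := hnormD_le u v; have := hnorm_ge0 (u + v).
move: (nrm (u + v)) (nrm u) (nrm v) => a b c a0 h.
have : 0 <= (b - c) ^+ 2 by rewrite sqr_ge0.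
nra.
Qed.

Lemma pythagoras (J : eqType) (s : seq J) (x : J -> H) (a : J -> R[i]) :
  uniq s -> (forall i j, i \in s -> j \in s -> i != j -> ip (x i) (x j) = 0) ->
  nrm (\sum_(j <- s) a j *: x j) ^+ 2 =
  \sum_(j <- s) sqmod (a j) * nrm (x j) ^+ 2.
Proof.
elim: s => [|i s IH]; first by rewrite !big_nil hnorm0 expr0n.
move=> /= /andP[iNs us] h; rewrite !big_cons hnormD_sq hnorm_sqZ IH//; last first.
  by move=> k l ks ls; apply: h; rewrite in_cons ?ks ?ls orbT.
rewrite ip_sumr [X in Re X]big1_seq ?mulr0 ?addr0// => j /andP[_ js].
rewrite ipZl ipZr h ?mulr0// ?in_cons ?eqxx ?js ?orbT//.
by apply: contraNneq iNs => ->.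
Qed.

Lemma hcvgP (u_ : nat -> H) u : hcvg ip u_ u <->
  forall e : R, 0 < e -> exists N, forall n, (N <= n)%N -> nrm (u_ n - u) < e.
Proof.
split=> [/cvgrPdist_lt h e e0|h].
  have [N _ hN] := h e e0; exists N => n Nn.
  by have := hN n Nn; rewrite /= sub0r normrN ger0_norm// hnorm_ge0.
apply/cvgrPdist_lt => e e0; have [N hN] := h e e0; exists N => // n /= Nn.
by rewrite sub0r normrN ger0_norm ?hnorm_ge0//; exact: hN.
Qed.

Lemma hnorm_small u : (forall e : R, 0 < e -> nrm u <= e) -> u = 0.
Proof.
move=> h; apply/eqP; rewrite -hnorm_eq0 eq_le hnorm_ge0 andbT.
by apply/ler_addgt0Pl => e e0; rewrite addr0; exact: h.
Qed.

Lemma hcvg_uniq (u_ : nat -> H) u v : hcvg ip u_ u -> hcvg ip u_ v -> u = v.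
Proof.
move=> /hcvgP hu /hcvgP hv; apply/eqP; rewrite -subr_eq0; apply/eqP.
apply: hnorm_small => e e0; have e2 : 0 < e / 2 by rewrite divr_gt0.
have [N hN] := hu _ e2; have [M hM] := hv _ e2.
apply: le_trans (hnorm_dist _ (u_ (maxn N M)) _) _.
rewrite (splitr e) hnormBC lerD// ltW//; [apply: hN|apply: hM].
  exact: leq_maxl.
exact: leq_maxr.
Qed.

Lemma hcvg_lin a (u_ v_ : nat -> H) u v : hcvg ip u_ u -> hcvg ip v_ v ->
  hcvg ip (fun n => a *: u_ n + v_ n) (a *: u + v).
Proof.
move=> hu hv.
apply: (@squeeze_cvgr _ _ _ _ (fun=> 0)
  (fun n => Num.sqrt (sqmod a) * nrm (u_ n - u) + nrm (v_ n - v))).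
- near=> n; rewrite hnorm_ge0 /=.
  by rewrite -hnormZ opprD addrACA -scalerBr hnormD_le.
- exact: cvg_cst.
- rewrite -[X in _ --> X]addr0 -[X in _ --> X + _](mulr0 (Num.sqrt (sqmod a))).
  by apply: cvgD => //; apply: cvgM => //; exact: cvg_cst.
Unshelve. all: by end_near. Qed.

Lemma hcvgD (u_ v_ : nat -> H) u v : hcvg ip u_ u -> hcvg ip v_ v ->
  hcvg ip (fun n => u_ n + v_ n) (u + v).
Proof.
move=> hu hv; have := hcvg_lin 1 hu hv.
by under eq_fun do rewrite scale1r; rewrite scale1r.
Qed.

End InnerProduct.

Section BoundedMaps.
Variables (R : realType) (H K : lmodType R[i]).
Variables (ip : H -> H -> R[i]) (ip' : K -> K -> R[i]).
Hypotheses (ipP : inner_product ip) (ipP' : inner_product ip').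

Lemma hcvg_bounded (T : H -> K) (C : R) (u_ : nat -> H) u :
  (forall u v, T (u - v) = T u - T v) ->
  (forall u, hnorm ip' (T u) ^+ 2 <= C * hnorm ip u ^+ 2) ->
  hcvg ip u_ u -> hcvg ip' (fun n => T (u_ n)) (T u).
Proof.
(* The bound does not force C to be non-negative when all norms vanish, and the square root below
   needs a sign. *)
move=> TB TC hu; pose C1 := Num.max 0 C.
have C1ge : 0 <= C1 by rewrite le_max lexx.
apply: (@squeeze_cvgr _ _ _ _ (fun=> 0)
  (fun n => Num.sqrt C1 * hnorm ip (u_ n - u))).
- near=> n; rewrite hnorm_ge0 /= -TB; apply: le_of_sqr.
    by rewrite mulr_ge0 ?sqrtr_ge0// hnorm_ge0.
  rewrite exprMn (sqr_sqrtr C1ge); apply: (le_trans (TC _)).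
  by rewrite ler_wpM2r ?sqr_ge0// le_max lexx orbT.
- exact: cvg_cst.
- rewrite -[X in _ --> X](mulr0 (Num.sqrt C1)).
  by apply: cvgM => //; exact: cvg_cst.
Unshelve. all: by end_near. Qed.

End BoundedMaps.

(** * Derivatives of real functions *)

Section RealDerivatives.
Variable R : realType.
Implicit Types (f g : R -> R) (a b x z : R).

Lemma is_derive_funM f g x a b : is_derive x 1 f a -> is_derive x 1 g b ->
  is_derive x 1 (fun t => f t * g t) (a * g x + f x * b).
Proof.
move=> fa gb; apply: (@is_derive_eq _ _ _ (f * g)).
by rewrite addrC; congr (_ + _); exact: mulrC.
Qed.

Lemma is_derive_funD f g x a b : is_derive x 1 f a -> is_derive x 1 g b ->
  is_derive x 1 (fun t => f t + g t) (a + b).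
Proof. by move=> fa gb; exact: (@is_derive_eq _ _ _ (f + g)). Qed.

Lemma is_derive_funN f x a : is_derive x 1 f a ->
  is_derive x 1 (fun t => - f t) (- a).
Proof. by move=> fa; exact: (@is_derive_eq _ _ _ (- f)). Qed.

Lemma is_derive_mulr x z : is_derive x 1 (fun t => t * z) z.
Proof.
have := @is_derive_funM id (cst z) x 1 0 _ _.
by rewrite mul1r mulr0 addr0; apply.
Qed.

Lemma is_derive_scale (f : R -> R) z x a : is_derive (x * z) 1 f a ->
  is_derive x 1 (fun t => f (t * z)) (z * a).
Proof.
move=> fa; have := is_derive_mulr x z => gz.
by rewrite mulrC; exact: (@is_derive1_comp _ f (fun t => t * z)).
Qed.

End RealDerivatives.

(** * The complex exponential near zero *)

Section ComplexExp.
Variable R : realType.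
Implicit Types (z w l : R[i]) (x y t : R).

Lemma CexpD z w : Cexp (z + w) = Cexp z * Cexp w.
Proof.
rewrite /Cexp; apply: complexP; rewrite !ReImE /= expRD ?cosD ?sinD; ring.
Qed.

Lemma Cexp0 : Cexp (0 : R[i]) = 1.
Proof. by apply: complexP; rewrite !ReImE /= expR0 cos0 sin0; ring. Qed.

Lemma sqmod_Cexp z : sqmod (Cexp z) = expR (2 * Re z).
Proof.
rewrite /Cexp sqmodM sqmod_real /sqmod /= cos2Dsin2 mulr1.
by rewrite mulr_natl mulr2n expRD expr2.
Qed.

(** Squared form of |e^x - 1| <= |x| e^X. Both signs of x follow from 1 + y <= e^y, taken at y = x
    and y = -x. *)
Lemma sqr_expRB1_le x X : 0 <= X -> x <= X ->
  (expR x - 1) ^+ 2 <= x ^+ 2 * expR (2 * X).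
Proof.
move=> X0 xX; rewrite [2 * X]mulr_natl mulr2n expRD -expr2 -exprMn.
have e1 := expR_ge1Dx x; have e2 := expR_ge1Dx (- x).
have e3 : expR x <= expR X by rewrite ler_expR.
have e4 : 1 <= expR X by rewrite -expR0 ler_expR.
have e5 : expR x * expR (- x) = 1 by rewrite -expRD subrr expR0.
have e6 := expR_gt0 x.
rewrite -[leLHS]real_normK ?num_real// -[leRHS]real_normK ?num_real//.
rewrite ler_sqr ?nnegrE// normrM (ger0_norm (expR_ge0 X)).
have [x0|x0] := leP 0 x.
  rewrite !ger0_norm ?subr_ge0 -?expR0 ?ler_expR//; rewrite expR0; nra.
rewrite (ltr0_norm x0) ler0_norm; nra.
Qed.

Lemma sin_abs_le x : `|sin x| <= `|x|.
Proof.
wlog x0 : x / 0 < x => [h|].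
  have [x0|x0|<-] := ltgtP 0 x; [exact: h| |by rewrite sin0].
  by rewrite -normrN -sinN -[in leRHS]normrN h// oppr_gt0.
have [c _] := @MVT R sin cos 0 x x0 (fun y _ => is_derive_sin y)
  (continuous_subspaceT (@continuous_sin R)).
rewrite sin0 !subr0 => ->; rewrite normrM.
by rewrite ler_piMl// ler_norml cos_geN1 cos_le1.
Qed.

(** The half-angle formula 1 - cos x = 2 sin^2 (x / 2) reduces this to |sin y| <= |y|. *)
Lemma cos_ge_quadratic x : 1 - cos x <= x ^+ 2 / 2.
Proof.
have -> : cos x = 1 - 2 * sin (x / 2) ^+ 2.
  have h := cos2Dsin2 (x / 2).
  rewrite (_ : cos x = cos (x / 2) ^+ 2 - sin (x / 2) ^+ 2); first by lra.
  by rewrite [in LHS](splitr x) cosD !expr2.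
have := sin_abs_le (x / 2).
rewrite -ler_sqr ?nnegrE// !real_normK ?num_real// => h; lra.
Qed.

(** With l = x + iy, |e^{tl} - 1|^2 = (e^{tx} - 1)^2 + 2 e^{tx} (1 - cos ty), so the two parts are
    estimated separately. The bound depends on l only through |l| and the common [om]: it is the
    majorant behind the computation of the generator. *)
Lemma sqmod_CexpB1_le l t om : 0 <= om -> Re l <= om -> 0 <= t <= 1 ->
  sqmod (Cexp (t%:C * l) - 1) <= expR (2 * om) * t ^+ 2 * sqmod l.
Proof.
move=> w0 lw /andP[t0 t1].
rewrite /sqmod /Cexp !ReImE /= !mul0r !subr0 !addr0.
set x := Re l in lw *; set y := Im l.
have h1 : (expR (t * x) - 1) ^+ 2 <= (t * x) ^+ 2 * expR (2 * om).
  by apply: sqr_expRB1_le => //; nra.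
have h2 := cos_ge_quadratic (t * y).
have h3 : expR (t * x) <= expR (2 * om) by rewrite ler_expR; nra.
have h4 := expR_gt0 (t * x); have h5 := cos2Dsin2 (t * y).
have h6 : 0 <= 1 - cos (t * y) by rewrite subr_ge0 cos_le1.
move: (expR (t * x)) (expR (2 * om)) (cos (t * y)) (sin (t * y)) h1 h2 h3 h4 h5 h6.
move=> e E c s h1 h2 h3 h4 h5 h6.
have -> : (e * c - 1) ^+ 2 + (e * s) ^+ 2 = (e - 1) ^+ 2 + 2 * (e * (1 - c)).
  rewrite (_ : _ + _ = e ^+ 2 * (c ^+ 2 + s ^+ 2) - 2 * e * c + 1); last by ring.
  by rewrite h5; ring.
have h7 : e * (1 - c) <= E * ((t * y) ^+ 2 / 2).
  by apply: ler_pM => //; exact: ltW.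
nra.
Qed.

Lemma sqmod_CexpB1_cvg0 l : sqmod (Cexp (t%:C * l) - 1) @[t --> 0^'+] --> (0 : R).
Proof.
pose om := Num.max 0 (Re l).
apply: (@squeeze_cvgr _ _ _ _ (fun=> 0) (fun t => expR (2 * om) * t ^+ 2 * sqmod l)).
- near=> t; rewrite sqmod_ge0 /=; apply: sqmod_CexpB1_le.
  + by rewrite le_max lexx.
  + by rewrite le_max lexx orbT.
  + apply/andP; split; first by near: t; exact: nbhs_right_ge.
    by near: t; exact: nbhs_right_le.
- exact: cvg_cst.
- apply: cvg_at_right_filter.
  rewrite -[X in _ --> X](_ : expR (2 * om) * 0 ^+ 2 * sqmod l = 0); last first.
    by rewrite expr0n mulr0 mul0r.
  apply: cvgM; last exact: cvg_cst.
  by apply: cvgM; [exact: cvg_cst|exact: exprn_continuous].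
Unshelve. all: by end_near. Qed.

Lemma right_derive_cvg (f : R -> R) (d : R) : is_derive (0 : R) 1 f d ->
  (t^-1 * (f t - f 0)) @[t --> 0^'+] --> d.
Proof.
move=> [/cvg_ex[e he] <-]; rewrite /derive (cvg_lim _ he)//.
rewrite (_ : (fun t => _) = fun h => h^-1 *: ((f \o shift 0) (h *: 1) - f 0)).
  exact: cvg_dnbhs_at_right.
by apply/funext => t /=; rewrite [t%:A]mulr1 addr0.
Qed.

Lemma sqmod_Cexp_derive_cvg0 l :
  sqmod ((t^-1)%:C * (Cexp (t%:C * l) - 1) - l) @[t --> 0^'+] --> (0 : R).
Proof.
case: l => x y.
have dr : is_derive (0 : R) 1 (fun t => expR (t * x) * cos (t * y)) x.
  have := is_derive_funM (is_derive_scale (is_derive_expR (0 * x)))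
    (is_derive_scale (is_derive_cos (0 * y))).
  by rewrite !mul0r expR0 sin0 cos0 oppr0 !mulr0 addr0 !mulr1.
have di : is_derive (0 : R) 1 (fun t => expR (t * x) * sin (t * y)) y.
  have := is_derive_funM (is_derive_scale (is_derive_expR (0 * x)))
    (is_derive_scale (is_derive_sin (0 * y))).
  by rewrite !mul0r expR0 sin0 cos0 !mulr0 add0r mul1r mulr1.
have /right_derive_cvg cr := dr; have /right_derive_cvg ci := di.
rewrite !mul0r expR0 ?cos0 ?sin0 ?mulr1 ?mulr0 in cr ci.
rewrite (_ : (fun t => _) = fun t =>
  (t^-1 * (expR (t * x) * cos (t * y) - 1) - x) ^+ 2 +
  (t^-1 * (expR (t * x) * sin (t * y) - 0) - y) ^+ 2); last first.
  apply/funext => t; rewrite /sqmod /Cexp !ReImE /= !mul0r !addr0 !subr0.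
  by congr (_ ^+ 2 + _ ^+ 2); ring.
rewrite -[X in _ --> X](_ : (x - x) ^+ 2 + (y - y) ^+ 2 = 0); last first.
  by rewrite !subrr expr0n addr0.
have sq (g : R -> R) (z : R) : g t @[t --> 0^'+] --> z ->
    (g t - z) ^+ 2 @[t --> 0^'+] --> (z - z) ^+ 2.
  move=> gz; rewrite expr2; under eq_fun do rewrite expr2.
  by apply: cvgM; apply: cvgB => //; exact: cvg_cst.
by apply: cvgD; apply: sq.
Qed.

End ComplexExp.

(** * Square-summable sequences *)

Section SquareSummable.
Variable R : realType.
Implicit Types (a b : nat -> R[i]) (C e : R).

(** Summability and a bound on the squared norm at once, through partial sums, so that no series has
    to be manipulated. *)
Definition ell2 a C := forall N, \sum_(0 <= i < N) sqmod (a i) <= C.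

Lemma ell2_ge0 a C : ell2 a C -> 0 <= C.
Proof. by move=> /(_ 0%N); rewrite big_geq. Qed.

Lemma ell2_le a b C k : 0 <= k -> (forall i, sqmod (b i) <= k * sqmod (a i)) ->
  ell2 a C -> ell2 b (k * C).
Proof.
move=> k0 ba aC N; apply: (@le_trans _ _ (\sum_(0 <= i < N) k * sqmod (a i))).
  exact: ler_sum.
by rewrite -mulr_sumr ler_wpM2l.
Qed.

Lemma ell2_term a C i : ell2 a C -> sqmod (a i) <= C.
Proof.
move=> /(_ i.+1); apply: le_trans; rewrite big_nat_recr//= lerDr.
by apply: sumr_ge0 => j _; exact: sqmod_ge0.
Qed.

(** Beyond a partial sum that is within e of the supremum, the rest cannot exceed e. *)
Lemma ell2_tail a C : ell2 a C -> forall e, 0 < e ->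
  exists N, forall n, \sum_(N <= i < n) sqmod (a i) < e.
Proof.
move=> aC e e0; pose S := [set \sum_(0 <= i < n) sqmod (a i) | n in [set: nat]].
have hS : has_sup S.
  split; first by exists (\sum_(0 <= i < 0) sqmod (a i)); exists 0%N.
  by exists C => _ [n _ <-]; exact: aC.
have [_ [N _ <-] hN] := sup_adherent e0 hS; exists N => n.
have [Nn|nN] := leqP N n; last by rewrite big_geq// ltnW.
have : \sum_(0 <= i < n) sqmod (a i) <= sup S.
  by apply: ub_le_sup; [case: hS|exists n].
rewrite (@big_cat_nat _ _ _ N)//= => h.
by rewrite -(ltrD2l (sup S - e)) subrK; apply: lt_le_trans h; rewrite ltrD2r.
Qed.

(** Dominated convergence for series: a finite head tends to 0 term by term, and the tail is
    controlled by the majorant. The tail threshold e / (2 (k + 1)) has k + 1 because k may be 0. *)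
Lemma ell2_dominated (F : set_system R) (FF : Filter F) (b : R -> nat -> R[i]) a C k :
  ell2 a C -> 0 <= k ->
  (\forall t \near F, forall i, sqmod (b t i) <= k * sqmod (a i)) ->
  (forall i, sqmod (b t i) @[t --> F] --> (0 : R)) ->
  forall e, 0 < e -> \forall t \near F, ell2 (b t) e.
Proof.
move=> aC k0 bd b0 e e0.
have k1 : 0 < 2 * (k + 1) by lra.
have [N hN] := ell2_tail aC (divr_gt0 e0 k1).
have head : \forall t \near F, \sum_(0 <= i < N) sqmod (b t i) <= e / 2.
  have : \sum_(0 <= i < N) sqmod (b t i) @[t --> F] --> (0 : R).
    elim: N {hN} => [|N IH].
      by under eq_fun do rewrite big_geq//; exact: cvg_cst.
    under eq_fun do rewrite big_nat_recr//=.
    by rewrite -[X in nbhs X]addr0; exact: cvgD.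
  move=> /cvgrPdist_le /(_ (e / 2)); rewrite divr_gt0// => /(_ isT).
  apply: filterS => t; rewrite sub0r normrN ger0_norm//.
  by apply: sumr_ge0 => j _; exact: sqmod_ge0.
apply: filterS2 bd head => t bdt ht n.
have [Nn|nN] := leqP N n; last first.
  apply: le_trans (_ : e / 2 <= e); last by lra.
  apply: le_trans ht; rewrite (@big_cat_nat _ _ _ n 0 N)//=; last exact: ltnW.
  by rewrite lerDl; apply: sumr_ge0 => j _; exact: sqmod_ge0.
rewrite (@big_cat_nat _ _ _ N)//= (splitr e) lerD//.
apply: (@le_trans _ _ (\sum_(N <= i < n) k * sqmod (a i))).
  by apply: ler_sum => i _; exact: bdt.
rewrite -mulr_sumr; apply: (@le_trans _ _ (k * (e / (2 * (k + 1))))).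
  by rewrite ler_wpM2l// ltW.
rewrite invfM mulrA [k * _]mulrC -!mulrA ler_wpM2l//; first exact: ltW.
rewrite mulrCA ler_piMr ?invr_ge0//.
by rewrite ler_pdivrMr ?mul1r; lra.
Qed.

End SquareSummable.

(** * Operators with a Riesz basis of eigenvectors *)

Section RieszExpansion.
Variables (R : realType) (H : lmodType R[i]) (ip : H -> H -> R[i]).
Hypothesis hH : hilbert_space ip.
Let ipP : inner_product ip := hH.1.
Variables (phi : nat -> H) (m M : R).
Hypotheses (m0 : 0 < m) (M0 : 0 < M).
Hypothesis bnd : forall (s : seq nat) (a : nat -> R[i]), uniq s ->
  m * (\sum_(j <- s) sqmod (a j)) <= hnorm ip (\sum_(j <- s) a j *: phi j) ^+ 2
    <= M * (\sum_(j <- s) sqmod (a j)).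
Hypothesis dense : forall (u : H) (e : R), 0 < e -> exists (s : seq nat) (a : nat -> R[i]),
  hnorm ip (u - \sum_(j <- s) a j *: phi j) < e.
Implicit Types (a b : nat -> R[i]) (u v : H).
Local Notation nrm := (hnorm ip).

Definition psum a n := \sum_(0 <= i < n) a i *: phi i.
Definition expands a u := hcvg ip (psum a) u.

Lemma psum_lin x a b n :
  psum (fun i => x * a i + b i) n = x *: psum a n + psum b n.
Proof.
rewrite /psum scaler_sumr -big_split; apply: eq_bigr => i _.
by rewrite scalerDl scalerA.
Qed.

Lemma psum_dist a n p : (p <= n)%N ->
  psum a n - psum a p = \sum_(p <= i < n) a i *: phi i.
Proof. by move=> pn; rewrite /psum [X in X - _](@big_cat_nat _ _ _ p 0 n)//= addrAC subrr add0r. Qed.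

Lemma expands_lin x a b u v : expands a u -> expands b v ->
  expands (fun i => x * a i + b i) (x *: u + v).
Proof.
move=> au bv; rewrite /expands.
rewrite (_ : psum _ = fun n => x *: psum a n + psum b n).
  exact: hcvg_lin.
by apply/funext => n; exact: psum_lin.
Qed.

(** The upper Riesz bound makes the partial sums Cauchy; completeness gives the limit. *)
Lemma ell2_expands a C : ell2 a C -> exists u, expands a u.
Proof.
move=> aC; apply: hH.2 => e e0.
have e1 : 0 < e ^+ 2 / M by rewrite divr_gt0// exprn_gt0.
have [N hN] := ell2_tail aC e1; exists N.
suff P n p : (N <= p)%N -> (p <= n)%N -> nrm (psum a n - psum a p) < e.
  move=> n p Nn Np; have [pn|np] := leqP p n; first exact: P.
  by rewrite hnormBC//; apply: P => //; exact: ltnW.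
move=> Np pn; rewrite -ltr_sqr ?nnegrE ?hnorm_ge0 ?(ltW e0)// psum_dist//.
have /andP[_ h] := bnd a (iota_uniq p (n - p)); apply: le_lt_trans h _.
rewrite -ltr_pdivlMl// mulrC; apply: le_lt_trans (hN n).
rewrite [leRHS](@big_cat_nat _ _ _ p)//= lerDr.
by apply: sumr_ge0 => j _; exact: sqmod_ge0.
Qed.

(** The lower Riesz bound for finite sums, passed to the limit. *)
Lemma expands_ge a u : expands a u -> ell2 a (nrm u ^+ 2 / m).
Proof.
move=> /hcvgP au N; rewrite ler_pdivlMr// mulrC.
rewrite -[leLHS]sqr_sqrtr; last first.
  by rewrite mulr_ge0 ?(ltW m0)//; apply: sumr_ge0 => j _; exact: sqmod_ge0.
rewrite ler_sqr ?nnegrE ?sqrtr_ge0 ?hnorm_ge0//.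
apply/ler_addgt0Pr => e e0; have [K hK] := au e e0.
have {hK} := hK (maxn K N) (leq_maxl _ _).
set n := maxn K N; have Nn : (N <= n)%N by exact: leq_maxr.
move=> h; apply: (@le_trans _ _ (nrm (psum a n))); last first.
  rewrite -[psum a n](subrK u) addrC.
  by apply: (le_trans (hnormD_le _ _ _)) => //; rewrite lerD2l ltW.
apply: le_of_sqr; first exact: hnorm_ge0.
rewrite sqr_sqrtr; last first.
  by rewrite mulr_ge0 ?(ltW m0)//; apply: sumr_ge0 => j _; exact: sqmod_ge0.
have /andP[h1 _] := bnd a (iota_uniq 0 (n - 0)); apply: le_trans h1.
rewrite ler_wpM2l ?(ltW m0)//.
rewrite -[X in _ <= X]/(\sum_(0 <= j < n) sqmod (a j)).
rewrite [leRHS](@big_cat_nat _ _ _ N)//= lerDl.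
by apply: sumr_ge0 => j _; exact: sqmod_ge0.
Qed.

Lemma expands_le a u C : expands a u -> ell2 a C -> nrm u ^+ 2 <= M * C.
Proof.
move=> /hcvgP au aC; have C0 := ell2_ge0 aC.
have MC0 : 0 <= M * C by rewrite mulr_ge0// ltW.
rewrite -[leRHS]sqr_sqrtr// ler_sqr ?nnegrE ?sqrtr_ge0 ?hnorm_ge0//.
apply/ler_addgt0Pr => e e0; have [n /(_ n (leqnn n)) hn] := au e e0.
rewrite -[u](subrK (psum a n)) addrC.
apply: (le_trans (hnormD_le ipP _ _)); rewrite lerD//; last first.
  by rewrite hnormBC// ltW.
apply: le_of_sqr; rewrite ?sqrtr_ge0// (sqr_sqrtr MC0).
have /andP[_ h1] := bnd a (iota_uniq 0 (n - 0)); apply: (le_trans h1).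
by rewrite ler_wpM2l ?(ltW M0)//; exact: aC.
Qed.

Lemma expands_uniq a b u : expands a u -> expands b u -> a =1 b.
Proof.
move=> au bu i; have := expands_lin (-1) au bu.
rewrite scaleN1r addNr => /expands_ge /ell2_term => /(_ i).
rewrite hnorm0// expr0n mul0r mulN1r => h.
apply/esym/eqP; rewrite -subr_eq0 addrC -sqmod_eq0 eq_le h.
exact: sqmod_ge0.
Qed.

Lemma expands_finite a u n : (forall i, (n <= i)%N -> a i = 0) ->
  u = psum a n -> expands a u.
Proof.
move=> a0 ->; apply/hcvgP => e e0; exists n => p np.
by rewrite psum_dist// big_nat big1 ?hnorm0// => i /andP[/a0 -> _]; rewrite scale0r.
Qed.

(** The lists in the density hypothesis may be unordered and repeat indices; the coefficient [b i]
    adds up all occurrences of i. *)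
Lemma psum_of_seq (s : seq nat) a : exists n b,
  (forall i, (n <= i)%N -> b i = 0) /\ \sum_(j <- s) a j *: phi j = psum b n.
Proof.
pose n := (\max_(j <- s) j).+1; pose b i := \sum_(j <- s | j == i) a j.
have ltn j : j \in s -> (j < n)%N by move=> js; rewrite ltnS leq_bigmax_seq.
exists n, b; split.
  move=> i ni; rewrite /b big_seq_cond big1// => j /andP[/ltn jn /eqP ji].
  by move: ni; rewrite -ji leqNgt jn.
rewrite /psum /b; under [RHS]eq_bigr do rewrite scaler_suml.
rewrite (exchange_big_dep xpredT)//= [RHS]big_seq [LHS]big_seq.
apply: eq_bigr => j /ltn jn; rewrite (eq_bigl (fun i => i == j)); last first.
  by move=> i; rewrite eq_sym.
by rewrite big_nat1_eq jn.
Qed.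

Lemma expansion_of_dense (u : H) (e : R) : 0 < e -> exists c v,
  expands c v /\ nrm (u - v) < e.
Proof.
move=> e0; have [s [a]] := dense u e0.
have [n [b [b0 ->]]] := psum_of_seq s a.
by exists b, (psum b n); split => //; exact: (@expands_finite _ _ n).
Qed.

Lemma cvg_of_cauchy (x : nat -> R) :
  (forall e : R, 0 < e -> exists N, forall n p, (N <= n)%N -> (N <= p)%N ->
    `|x n - x p| <= e) -> exists l : R, x n @[n --> \oo] --> l.
Proof.
move=> h; apply/cvg_ex/cauchy_cvgP/cauchy_exP => e e0.
have [N hN] := h _ (divr_gt0 e0 (@ltr0n R 2)).
exists (x N); exists N => // n /= Nn; rewrite /ball /=.
by apply: le_lt_trans (hN _ _ _ Nn) _ => //; lra.
Qed.

(** Finite combinations v_k converging to u have coefficients that are Cauchy in l^2, by the lower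
    Riesz bound. Their limit a defines a vector x through the upper bound, and x is also the limit
    of the v_k. *)
Lemma expandsP u : exists a, expands a u.
Proof.
have /choice[w hw] : forall k : nat, exists cv : (nat -> R[i]) * H,
    expands cv.1 cv.2 /\ nrm (u - cv.2) < k.+1%:R^-1.
  move=> k; have k0 : 0 < k.+1%:R^-1 :> R by rewrite invr_gt0.
  by have [c [v h]] := expansion_of_dense u k0; exists (c, v).
pose c k := (w k).1; pose v k := (w k).2.
have cv k : expands (c k) (v k) by have [] := hw k.
have uv k : nrm (u - v k) < k.+1%:R^-1 by have [] := hw k.
have dist k l : (k <= l)%N -> nrm (v l - v k) <= 2 / k.+1%:R.
  move=> kl; apply: (le_trans (hnorm_dist ipP _ u _)).
  rewrite mulr_natl mulr2n lerD//; last exact: ltW.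
  rewrite hnormBC//; apply: le_trans (ltW (uv l)) _.
  by rewrite lef_pV2 ?posrE// ler_nat.
(* The square of 2 / (k + 1), which bounds the distance from v_l to v_k for l >= k, divided by the
   lower Riesz constant. *)
pose D k : R := (2 / k.+1%:R) ^+ 2 / m.
have D0 k : 0 <= D k by rewrite divr_ge0 ?sqr_ge0// ltW.
have cdist k l : (k <= l)%N -> ell2 (fun i => -1 * c k i + c l i) (D k).
  move=> kl N; apply: le_trans (expands_ge (expands_lin (-1) (cv k) (cv l)) N) _.
  rewrite ler_wpM2r ?invr_ge0 ?(ltW m0)// scaleN1r addrC.
  by rewrite ler_sqr ?nnegrE ?hnorm_ge0 ?divr_ge0//; exact: dist.
have Dlim (e : R) : 0 < e -> exists k, D k <= e.
  move=> e0; exists (Num.truncn (4 / (m * e))).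
  set k := Num.truncn _; have : 4 / (m * e) < k.+1%:R.
    by rewrite /k truncnS_gt.
  rewrite ltr_pdivrMr ?mulr_gt0// => hk.
  rewrite /D expr_div_n ler_pdivrMr// ler_pdivrMr ?exprn_gt0//.
  have k1 : 1 <= k.+1%:R :> R by rewrite ler1n.
  by have : 0 < e * m by [rewrite mulr_gt0]; nra.
have /choice[a ha] : forall i, exists z : R[i],
    (Re (c k i) @[k --> \oo] --> Re z) /\ (Im (c k i) @[k --> \oo] --> Im z).
  move=> i.
  have key (f : R[i] -> R) : (forall z w, f (z - w) = f z - f w) ->
      (forall z, f z ^+ 2 <= sqmod z) -> exists l : R, f (c k i) @[k --> \oo] --> l.
    move=> fB fle; apply: cvg_of_cauchy => e e0.
    have [k hk] := Dlim _ (exprn_gt0 2 (divr_gt0 e0 (@ltr0n R 2))).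
    have near_k n : (k <= n)%N -> `|f (c n i) - f (c k i)| <= e / 2.
      move=> kn; apply: le_of_sqr; first by rewrite divr_ge0// ltW.
      rewrite real_normK ?num_real// -fB; apply: le_trans (fle _) _.
      apply: le_trans hk; have := ell2_term i (cdist _ _ kn).
      by rewrite mulN1r addrC.
    exists k => n p kn kp; rewrite (splitr e).
    rewrite -[f (c n i)](subrK (f (c k i))) -addrA.
    apply: le_trans (ler_normD _ _) _; apply: lerD; first exact: near_k.
    by rewrite distrC; exact: near_k.
  have [x hx] := key Re (@cReB _) (@sqr_Re_le _).
  have [y hy] := key Im (@cImB _) (@sqr_Im_le _).
  by exists (x +i* y).
(* Each partial sum involves finitely many coefficients, so the bound [D k] survives the limit in
   l. *)
have adist k : ell2 (fun i => -1 * c k i + a i) (D k).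
  move=> N; have : \sum_(0 <= i < N) sqmod (-1 * c k i + c l i) @[l --> \oo] -->
      \sum_(0 <= i < N) sqmod (-1 * c k i + a i).
    elim: N => [|N IH].
      by rewrite big_geq//; under eq_fun do rewrite big_geq//; exact: cvg_cst.
    under eq_fun do rewrite big_nat_recr//=; rewrite big_nat_recr//=.
    apply: cvgD => //; have [hr hi] := ha N.
    rewrite /sqmod; under eq_fun do rewrite cReD cImD !expr2; rewrite cReD cImD !expr2.
    by apply: cvgD; apply: cvgM; apply: cvgD => //; exact: cvg_cst.
  move=> h; rewrite -(cvg_lim _ h)//; apply: limr_le; first by apply/cvg_ex; eexists; exact: h.
  by exists k => // l /= kl; exact: cdist.
have [z hz] := ell2_expands (adist 0%N).
pose x := v 0%N + z.
have ax : expands a x.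
  have := expands_lin 1 (cv 0%N) hz; rewrite scale1r.
  by congr expands; apply/funext => i; rewrite mul1r mulN1r addrA subrr add0r.
exists a; rewrite (_ : u = x)//; apply/eqP; rewrite -subr_eq0; apply/eqP.
apply: (hnorm_small ipP) => e e0.
have xv k : nrm (x - v k) ^+ 2 <= M * D k.
  have := expands_lin (-1) (cv k) ax; rewrite scaleN1r addrC.
  by move=> /expands_le; apply; exact: adist.
(* From |u - v_k|^2 <= m D_k / 4 and |x - v_k|^2 <= M D_k, the squared distance from u to x is at
   most 2 (m / 4 + M) D_k, hence at most e^2 once (4m + 4M) D_k <= e^2. *)
have [k hk] := Dlim _ (divr_gt0 (exprn_gt0 2 e0) (addr_gt0 (mulr_gt0 m0 (@ltr0n R 4)) (mulr_gt0 M0 (@ltr0n R 4)))).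
apply: le_of_sqr; first exact: ltW.
rewrite -[u - x](subrKA (v k)); apply: (le_trans (hnormD_sq_le ipP _ _)).
rewrite [X in _ + X ^+ 2]hnormBC//.
have h1 : nrm (u - v k) ^+ 2 <= m * D k / 4.
  rewrite (_ : m * D k / 4 = (k.+1%:R^-1) ^+ 2); last first.
    rewrite /D expr_div_n exprVn.
    have k0 : k.+1%:R != 0 :> R by [].
    by move: k0; move: (k.+1%:R) => K k0; field; rewrite k0 gt_eqF.
  by rewrite ler_sqr ?nnegrE ?hnorm_ge0 ?invr_ge0// ltW.
have h2 := xv k; move: hk; rewrite ler_pdivlMr; last by rewrite addr_gt0// mulr_gt0.
have := mulr_ge0 (ltW m0) (D0 k); have := mulr_ge0 (ltW M0) (D0 k).
move: (D k) h1 h2 => d; nra.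
Qed.

(** [l0] takes the place of a resolvent point. Distance at least 1 makes division by [lam i - l0]
    non-expanding on square-summable sequences. *)
Variables (A : operator H) (lam : nat -> R[i]) (l0 : R[i]).
Hypotheses (clA : closed_operator ip A)
  (eigA : forall i, dom A (phi i) /\ app A (phi i) = lam i *: phi i)
  (l0_far : forall i, 1 <= sqmod (lam i - l0))
  (l0_ker : forall u, dom A u -> app A u = l0 *: u -> u = 0).

Let linA : forall x u v, dom A u -> dom A v ->
  dom A (x *: u + v) /\ app A (x *: u + v) = x *: app A u + app A v.
Proof. by case: clA => -[]. Qed.

Let dom0 : dom A 0. Proof. by case: clA => -[]. Qed.

Let app0 : app A 0 = 0.
Proof.
by have [_] := linA (-1) dom0 dom0; rewrite scaler0 addr0 scaleN1r addNr.
Qed.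

Lemma psum_dom a n : dom A (psum a n) /\
  app A (psum a n) = psum (fun i => lam i * a i) n.
Proof.
elim: n => [|n [dn an]]; first by rewrite /psum !big_geq.
rewrite /psum !big_nat_recr//= ![_ + _ *: phi n]addrC.
have [dp ap] := eigA n.
by have [d e] := linA (a n) dp dn; split=> //; rewrite e ap an scalerA mulrC.
Qed.

(** Closedness of A, applied to the partial sums. *)
Lemma expands_dom a u v : expands a u -> expands (fun i => lam i * a i) v ->
  dom A u /\ app A u = v.
Proof.
move=> au av; apply: clA.2 au _ => [n|]; first exact: (psum_dom a n).1.
by under eq_fun do rewrite (psum_dom a _).2.
Qed.

(* The element w with coefficients (b_i - l0 a_i) / (lam_i - l0) satisfies
   (A - l0) w = (A - l0) u, so w = u by injectivity. *)
Lemma dom_expands a u : dom A u -> expands a u ->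
  expands (fun i => lam i * a i) (app A u).
Proof.
move=> du au; have [b bv] := expandsP (app A u).
pose d i := (b i - l0 * a i) / (lam i - l0).
have l0n i : lam i - l0 != 0.
  by rewrite -sqmod_eq0 gt_eqF// (lt_le_trans _ (l0_far i)).
have dE i : lam i * d i = l0 * d i + (b i - l0 * a i).
  by rewrite -[X in _ + X](divfK (l0n i)) -/(d i); ring.
have bl : expands (fun i => b i - l0 * a i) (app A u - l0 *: u).
  have := expands_lin (- l0) au bv; rewrite scaleNr addrC.
  by congr expands; apply/funext => i; rewrite mulNr addrC.
have dl : ell2 d (1 * (nrm (app A u - l0 *: u) ^+ 2 / m)).
  apply: ell2_le (expands_ge bl) => // i.
  rewrite /d sqmodM sqmodV mul1r ler_piMr ?sqmod_ge0//.
  by rewrite invf_le1 ?(lt_le_trans _ (l0_far i)).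
have [w dw] := ell2_expands dl.
have ldw : expands (fun i => lam i * d i) (l0 *: w + (app A u - l0 *: u)).
  have := expands_lin l0 dw bl.
  by congr expands; apply/funext => i; rewrite dE.
have [domw appw] := expands_dom dw ldw.
have [du' au'] := linA (-1) du domw.
have wu : w = u.
  apply/eqP; rewrite -subr_eq0; apply/eqP; rewrite addrC -scaleN1r.
  apply: l0_ker => //; rewrite au' appw !scaleN1r scalerDr scalerN.
  by rewrite [X in - _ + X]addrCA addKr addrC.
rewrite (_ : (fun i => _) = b) //; apply/funext => i.
rewrite wu in dw; have -> := expands_uniq au dw i.
by rewrite dE (expands_uniq au dw i); ring.
Qed.

(** Uniqueness of coefficients in A u = l u gives lam_i a_i = l a_i for all i, and some a_i is
    non-zero because u is. *)
Lemma is_eigenvalueP l : is_eigenvalue A l -> exists i, l = lam i.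
Proof.
move=> [u [u0 du au]]; have [a ua] := expandsP u.
have [|h] := pselect (exists i, a i != 0).
  move=> [i ai]; exists i; have := dom_expands du ua; rewrite au => h.
  have := expands_lin l ua (expands_finite (n := 0) (fun i _ => erefl) erefl).
  rewrite /psum big_geq// addr0 => h'.
  have := expands_uniq h h' i; rewrite /= addr0.
  by move/(mulIf ai).
have a0 : ell2 a 0.
  move=> N; rewrite big1// => i _; apply/eqP; rewrite sqmod_eq0.
  by apply: contra_notT h => ai; exists i.
have := expands_le ua a0; rewrite mulr0 => nu.
suff : u == 0 by rewrite (negbTE u0).
by rewrite -(hnorm_eq0 ipP) -sqrf_eq0 eq_le nu sqr_ge0.
Qed.

(** A - l multiplies the i-th coefficient by lam_i - l, so k applications multiply it by the k-th
    power. *)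
Lemma root_vector_expands l k u a : root_vector A l k u -> expands a u ->
  forall i, (lam i - l) ^+ k * a i = 0.
Proof.
elim: k u a => [|k IH] u a /=.
  move=> -> au i; rewrite mul1r.
  have z0 := expands_finite (n := 0) (a := fun=> 0) (fun i _ => erefl) erefl.
  by rewrite /psum big_geq// in z0; exact: (expands_uniq au z0).
move=> [du ru] au i; have h := expands_lin (- l) au (dom_expands du au).
rewrite scaleNr addrC in h.
by have := IH _ _ ru h i; rewrite exprSr -mulrA => <-; congr (_ * _); ring.
Qed.

Lemma simple_of_injective l : injective lam -> (forall i, phi i != 0) ->
  is_eigenvalue A l -> simple_eigenvalue A l.
Proof.
move=> linj phi0 /is_eigenvalueP[i ->]; exists (phi i); split.
  by have [] := eigA i.
move=> k v rv; have [a av] := expandsP v; exists (a i).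
have aj j : j != i -> a j = 0.
  move=> ji; have /eqP := root_vector_expands rv av j.
  rewrite mulf_eq0 => /orP[|/eqP//]; rewrite expf_eq0 subr_eq0 => /andP[_ /eqP/linj e].
  by rewrite e eqxx in ji.
apply: (hcvg_uniq ipP av); apply: (@expands_finite _ _ i.+1).
  by move=> j ij; rewrite aj// gtn_eqF.
rewrite /psum big_nat_recr//= big_nat big1 ?add0r// => j ji.
by rewrite aj ?scale0r// ltn_eqF.
Qed.

Variable om : R.
Hypotheses (om0 : 0 <= om) (lam_le : forall i, Re (lam i) <= om).

(** For t >= 0 the vector with coefficients e^{t lam_i} a_i exists and is unique. The default 0 can
    be reached only for negative t, where nothing is required of a semigroup. *)
Definition semigroup (t : R) (u : H) : H :=
  xget 0 [set v | exists a, expands a u /\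
                  expands (fun i => Cexp (t%:C * lam i) * a i) v].

Let sqmod_exp_le t i : 0 <= t -> sqmod (Cexp (t%:C * lam i)) <= expR (2 * (t * om)).
Proof.
move=> t0; rewrite sqmod_Cexp ler_expR cReM cRe_real cIm_real mul0r subr0.
by rewrite ler_wpM2l// ler_wpM2l.
Qed.

Lemma semigroup_expands t a u : 0 <= t -> expands a u ->
  expands (fun i => Cexp (t%:C * lam i) * a i) (semigroup t u).
Proof.
move=> t0 au.
have : ell2 (fun i => Cexp (t%:C * lam i) * a i)
    (expR (2 * (t * om)) * (nrm u ^+ 2 / m)).
  apply: ell2_le (expands_ge au); first exact: expR_ge0.
  by move=> i; rewrite sqmodM ler_wpM2r ?sqmod_ge0 ?sqmod_exp_le.
move=> /ell2_expands[v hv]; rewrite /semigroup; case: xgetP => [w _ [b [bu]]|].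
  by rewrite (_ : b = a)//; apply/funext; exact: expands_uniq bu au.
by move=> /(_ v) []; exists a.
Qed.

(** [ell2_dominated] for the coefficients, turned into convergence in H by the upper Riesz bound. *)
Let cvg_expands (F : set_system R) (FF : Filter F) (b : R -> nat -> R[i]) (w : R -> H) a C k :
  ell2 a C -> 0 <= k ->
  (\forall t \near F, forall i, sqmod (b t i) <= k * sqmod (a i)) ->
  (forall i, sqmod (b t i) @[t --> F] --> (0 : R)) ->
  (\forall t \near F, expands (b t) (w t)) ->
  hnorm ip (w t) @[t --> F] --> (0 : R).
Proof.
move=> aC k0 h1 h2 h3; apply/cvgrPdist_le => e e0.
have e1 : 0 < e ^+ 2 / M by rewrite divr_gt0// exprn_gt0.
apply: filterS2 (ell2_dominated FF aC k0 h1 h2 e1) h3 => t bt ht.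
rewrite sub0r normrN ger0_norm ?hnorm_ge0//.
apply: le_of_sqr; first exact: ltW.
by have := expands_le ht bt; rewrite mulrC divfK ?gt_eqF.
Qed.

Lemma semigroup_C0 : C0_semigroup ip semigroup.
Proof.
split.
- move=> t t0; split.
    move=> x u v; have [a au] := expandsP u; have [b bv] := expandsP v.
    have h1 := semigroup_expands t0 (expands_lin x au bv).
    have h2 := expands_lin x (semigroup_expands t0 au) (semigroup_expands t0 bv).
    apply: (hcvg_uniq ipP h1); move: h2; rewrite /expands; congr hcvg.
    by congr psum; apply/funext => i; ring.
  exists (Num.sqrt (M * (expR (2 * (t * om)) / m))) => u.
  have [a au] := expandsP u.
  have C0 : 0 <= M * (expR (2 * (t * om)) / m).
    by rewrite mulr_ge0 ?divr_ge0 ?expR_ge0 ?(ltW m0) ?(ltW M0).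
  apply: le_of_sqr; first by rewrite mulr_ge0 ?sqrtr_ge0 ?hnorm_ge0.
  rewrite exprMn (sqr_sqrtr C0).
  rewrite -!mulrA [m^-1 * _]mulrC; apply: expands_le (semigroup_expands t0 au) _.
  apply: ell2_le (expands_ge au); first exact: expR_ge0.
  by move=> i; rewrite sqmodM ler_wpM2r ?sqmod_ge0 ?sqmod_exp_le.
- move=> u; have [a au] := expandsP u.
  apply: (hcvg_uniq ipP (semigroup_expands (lexx 0) au)).
  move: au; rewrite /expands; congr hcvg; congr psum; apply/funext => i.
  by rewrite mul0r Cexp0 mul1r.
- move=> s t u s0 t0; have [a au] := expandsP u.
  apply: (hcvg_uniq ipP (semigroup_expands (addr_ge0 s0 t0) au)).
  have := semigroup_expands s0 (semigroup_expands t0 au).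
  rewrite /expands; congr hcvg; congr psum; apply/funext => i.
  by rewrite mulrA -CexpD rmorphD /= mulrDl.
- move=> u; have [a au] := expandsP u.
  (* For t <= 1 one has |e^{t lam} - 1|^2 <= 2 (e^{2 om} + 1), uniformly in the index. *)
  apply: (@cvg_expands _ _ (fun t i => (Cexp (t%:C * lam i) - 1) * a i)
            (fun t => semigroup t u - u) a _ (2 * (expR (2 * om) + 1)) (expands_ge au)).
  + by rewrite mulr_ge0// addr_ge0// expR_ge0.
  + near=> t => i; rewrite sqmodM ler_wpM2r ?sqmod_ge0//.
    apply: (le_trans (sqmodD_le _ _)); rewrite ler_wpM2l// sqmodN sqmod1 lerD2r.
    apply: (le_trans (sqmod_exp_le _ _)); first by near: t; exact: nbhs_right_ge.
    rewrite ler_expR ler_wpM2l// ler_piMl//.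
    by near: t; exact: nbhs_right_le.
  + move=> i; under eq_fun do rewrite sqmodM.
    rewrite -[X in nbhs X](mul0r (sqmod (a i))).
    by apply: cvgM; [exact: sqmod_CexpB1_cvg0|exact: cvg_cst].
  + near=> t; have t0 : 0 <= t by near: t; exact: nbhs_right_ge.
    have := expands_lin (-1) au (semigroup_expands t0 au).
    rewrite scaleN1r addrC; congr expands; apply/funext => i.
    by ring.
Unshelve. all: by end_near. Qed.

(** On D(A) the coefficients of the difference quotient are dominated by those of A u, which are
    square summable by [dom_expands]. Conversely, convergence of the quotient to v forces each
    coefficient of v to be lam_i a_i, and closedness puts u in D(A). *)
Lemma semigroup_generator : generator_of ip semigroup A.
Proof.
have quot t u v a b : 0 <= t -> expands a u -> expands b v ->
    expands (fun i => (t^-1)%:C * (Cexp (t%:C * lam i) - 1) * a i - b i)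
            ((t^-1)%:C *: (semigroup t u - u) - v).
  move=> t0 au bv.
  have h1 := expands_lin (-1) au (semigroup_expands t0 au).
  have z0 := expands_finite (n := 0) (a := fun=> 0) (fun i _ => erefl) erefl.
  rewrite /psum big_geq// in z0.
  have h2 := expands_lin (-1) bv (expands_lin (t^-1)%:C h1 z0).
  move: h2; rewrite !scaleN1r addr0 ![- _ + _]addrC; congr expands.
  by apply/funext => i; ring.
move=> u v; split.
  move=> [du <-]; have [a au] := expandsP u; have lau := dom_expands du au.
  apply: (@cvg_expands _ _ (fun t i =>
      (t^-1)%:C * (Cexp (t%:C * lam i) - 1) * a i - lam i * a i) _
      (fun i => lam i * a i) _ (2 * (expR (2 * om) + 1)) (expands_ge lau)).
  - by rewrite mulr_ge0// addr_ge0// expR_ge0.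
  - near=> t => i; have t0 : 0 < t by near: t; exact: nbhs_right_gt.
    rewrite -mulrBl !sqmodM mulrA ler_wpM2r ?sqmod_ge0//.
    apply: (le_trans (sqmodD_le _ _)); rewrite sqmodN -mulrA ler_wpM2l//.
    rewrite mulrDl mul1r lerD2r sqmodM sqmod_real.
    (* The factor t^2 of [sqmod_CexpB1_le] cancels the t^-2 of the quotient and leaves |lam_i|^2. *)
    apply: (@le_trans _ _ (t^-1 ^+ 2 * (expR (2 * om) * t ^+ 2 * sqmod (lam i)))).
      rewrite ler_wpM2l ?sqr_ge0// sqmod_CexpB1_le// ltW//=.
      by near: t; exact: nbhs_right_le.
    by rewrite exprVn -mulrA mulrCA mulKf// expf_neq0// gt_eqF.
  - move=> i; under eq_fun do rewrite -mulrBl sqmodM.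
    rewrite -[X in nbhs X](mul0r (sqmod (a i))).
    by apply: cvgM; [exact: sqmod_Cexp_derive_cvg0|exact: cvg_cst].
  - by near=> t; apply: quot => //; near: t; exact: nbhs_right_ge.
move=> huv; have [a au] := expandsP u; have [b bv] := expandsP v.
suff lb i : lam i * a i = b i.
  by apply: expands_dom au _; under eq_fun do rewrite lb.
have c1 : sqmod ((t^-1)%:C * (Cexp (t%:C * lam i) - 1) * a i - b i)
    @[t --> 0^'+] --> (0 : R).
  apply: (@squeeze_cvgr _ _ _ _ (fun=> 0)
    (fun t => hnorm ip ((t^-1)%:C *: (semigroup t u - u) - v) ^+ 2 / m)).
  - near=> t; rewrite sqmod_ge0 /=.
    have t0 : 0 <= t by near: t; exact: nbhs_right_ge.
    exact: (ell2_term i (expands_ge (quot _ _ _ _ _ t0 au bv))).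
  - exact: cvg_cst.
  - have -> : nbhs (0 : R) = nbhs (0 * 0 / m : R) by rewrite !mul0r.
    under eq_fun do rewrite expr2.
    by apply: cvgM; [exact: cvgM|exact: cvg_cst].
have c2 : sqmod ((t^-1)%:C * (Cexp (t%:C * lam i) - 1) * a i - lam i * a i)
    @[t --> 0^'+] --> (0 : R).
  under eq_fun do rewrite -mulrBl sqmodM.
  rewrite -[X in nbhs X](mul0r (sqmod (a i))).
  by apply: cvgM; [exact: sqmod_Cexp_derive_cvg0|exact: cvg_cst].
apply/eqP; rewrite -subr_eq0 -sqmod_eq0 eq_le sqmod_ge0 andbT.
apply/ler_addgt0Pl => e e0; rewrite addr0.
(* Two errors of e / 4 enter through |z + w|^2 <= 2 (|z|^2 + |w|^2). *)
have e4 : 0 < e / 4 by rewrite divr_gt0.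
move/cvgrPdist_le : c1 => /(_ _ e4) c1; move/cvgrPdist_le : c2 => /(_ _ e4) c2.
near (0 : R)^'+ => t.
have : `|0 - sqmod ((t^-1)%:C * (Cexp (t%:C * lam i) - 1) * a i - b i)| <= e / 4.
  by near: t.
have : `|0 - sqmod ((t^-1)%:C * (Cexp (t%:C * lam i) - 1) * a i - lam i * a i)| <= e / 4.
  by near: t.
rewrite !sub0r !normrN !ger0_norm ?sqmod_ge0// => h1 h2.
set q := _ * _ * a i in h1 h2.
rewrite -[_ - b i](subrKA q) addrC; apply: (le_trans (sqmodD_le _ _)).
by rewrite [X in _ + X]sqmodB; lra.
Unshelve. all: by end_near. Qed.

End RieszExpansion.

(** * The space L^2(0, L) *)

Section ComplexIntegral.
Variable R : realType.
Local Notation mu := (@lebesgue_measure R).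
Implicit Types (D E : set R) (f g : R -> R[i]).

Definition cintegrable D f := mu.-integrable D (fun x => (Re (f x))%:E) /\
  mu.-integrable D (fun x => (Im (f x))%:E).

Definition cmeasurable D f := measurable_fun D (fun x => Re (f x)) /\
  measurable_fun D (fun x => Im (f x)).

Lemma cmeasurable_real D (F : R -> R) : measurable_fun D F ->
  cmeasurable D (fun x => (F x)%:C).
Proof. by move=> mF; split => //; exact: measurable_cst. Qed.

Lemma rintegrableZ D (k : R) (f : R -> R) : measurable D ->
  mu.-integrable D (fun x => (f x)%:E) ->
  mu.-integrable D (fun x => (k * f x)%:E).
Proof.
by move=> mD fi; exact: (@integrableZl _ _ _ mu D mD k _ fi).
Qed.

Lemma rintegrableD D (f g : R -> R) : measurable D ->
  mu.-integrable D (fun x => (f x)%:E) -> mu.-integrable D (fun x => (g x)%:E) ->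
  mu.-integrable D (fun x => (f x + g x)%:E).
Proof.
by move=> mD fi gi; exact: (@integrableD _ _ _ mu D mD _ _ fi gi).
Qed.

Lemma cintegrable_meas D f : cintegrable D f -> cmeasurable D f.
Proof.
by move=> [h1 h2]; split; apply/measurable_EFinP; exact: (measurable_int mu).
Qed.

Lemma cintegrableS D E f : measurable D -> measurable E -> D `<=` E ->
  cintegrable E f -> cintegrable D f.
Proof. by move=> mD mE DE [h1 h2]; split; [exact: integrableS h1|exact: integrableS h2]. Qed.

Lemma cintegrable_lin D a f g : measurable D -> cintegrable D f -> cintegrable D g ->
  cintegrable D (fun x => a * f x + g x).
Proof.
move=> mD [f1 f2] [g1 g2]; split.
  rewrite (_ : (fun x => _) = fun x =>
    (Re a * Re (f x) + ((- Im a) * Im (f x) + Re (g x)))%:E).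
    by do 2! (apply: rintegrableD; rewrite //; first exact: rintegrableZ).
  by apply/funext => x; rewrite !ReImE; congr EFin; ring.
rewrite (_ : (fun x => _) = fun x =>
    (Re a * Im (f x) + (Im a * Re (f x) + Im (g x)))%:E).
  by do 2! (apply: rintegrableD; rewrite //; first exact: rintegrableZ).
by apply/funext => x; rewrite !ReImE; congr EFin; ring.
Qed.

Lemma CintE D f g : {in D, f =1 g} -> Cint D f = Cint D g.
Proof. by move=> fg; rewrite /Cint; congr Complex; apply: eq_Rintegral => x /fg ->. Qed.

Lemma RintegralE D (f : R -> R) : measurable D ->
  mu.-integrable D (fun x => (f x)%:E) ->
  (\int[mu]_(x in D) (f x)%:E)%E = (\int[mu]_(x in D) f x)%:E.
Proof.
by move=> mD fi; rewrite fineK//; exact: (@integrable_fin_num _ _ _ mu D mD _ fi).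
Qed.

Lemma cRe_Cint D f : Re (Cint D f) = \int[mu]_(x in D) Re (f x). Proof. by []. Qed.
Lemma cIm_Cint D f : Im (Cint D f) = \int[mu]_(x in D) Im (f x). Proof. by []. Qed.

Lemma Cint_linear D a f g : measurable D -> cintegrable D f -> cintegrable D g ->
  Cint D (fun x => a * f x + g x) = a * Cint D f + Cint D g.
Proof.
move=> mD [f1 f2] [g1 g2]; apply: complexP.
  rewrite cReD cReM !cRe_Cint cIm_Cint.
  under eq_Rintegral do rewrite !ReImE.
  rewrite RintegralD// ?RintegralB// ?RintegralZl//; try exact: rintegrableZ.
  rewrite (_ : _ \o _ = fun x =>
    (Re a * Re (f x) + (- Im a) * Im (f x))%:E).
    by apply: rintegrableD => //; exact: rintegrableZ.
  by apply/funext => x /=; rewrite mulNr.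
rewrite cImD cImM !cIm_Cint cRe_Cint.
under eq_Rintegral do rewrite !ReImE.
rewrite RintegralD// ?RintegralD// ?RintegralZl//; try exact: rintegrableZ.
by apply: rintegrableD => //; exact: rintegrableZ.
Qed.

Lemma cintegrable0 D : cintegrable D (fun=> 0).
Proof. by split; exact: integrable0. Qed.

Lemma Cint0 D : Cint D (fun=> 0) = 0.
Proof. by rewrite /Cint /= /Rintegral integral0. Qed.

Lemma cintegrableZ D a f : measurable D -> cintegrable D f ->
  cintegrable D (fun x => a * f x).
Proof.
move=> mD fi; have := cintegrable_lin a mD fi (cintegrable0 D).
by under eq_fun do rewrite addr0.
Qed.

Lemma CintD D f g : measurable D -> cintegrable D f -> cintegrable D g ->
  Cint D (fun x => f x + g x) = Cint D f + Cint D g.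
Proof.
move=> mD fi gi; have := Cint_linear 1 mD fi gi.
by under eq_fun do rewrite mul1r; rewrite mul1r.
Qed.

Lemma CintZ D a f : measurable D -> cintegrable D f ->
  Cint D (fun x => a * f x) = a * Cint D f.
Proof.
move=> mD fi; have := Cint_linear a mD fi (cintegrable0 D).
by under eq_fun do rewrite addr0; rewrite Cint0 addr0.
Qed.

Lemma Cint_ae D f g : measurable D -> cmeasurable D f -> cmeasurable D g ->
  {ae mu, forall x, D x -> f x = g x} -> Cint D f = Cint D g.
Proof.
move=> mD [f1 f2] [g1 g2] fg; rewrite /Cint /Rintegral.
have aeF := ae_filter_ringOfSetsType mu.
congr Complex; congr fine; apply: ae_eq_integral => //;
  try (exact/measurable_EFinP); by apply: filterS fg => x h /h ->.
Qed.

Lemma Cint_conj D f : measurable D -> cintegrable D f ->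
  Cint D (fun x => conjc (f x)) = conjc (Cint D f).
Proof.
move=> mD [f1 f2]; apply: complexP.
  rewrite cRe_conj !cRe_Cint.
  by under eq_Rintegral do rewrite !ReImE.
rewrite cIm_conj !cIm_Cint.
under eq_Rintegral do rewrite !ReImE -mulN1r.
by rewrite RintegralZl// mulN1r.
Qed.

Lemma Cint_setU D E f : measurable D -> measurable E -> D `&` E = set0 ->
  cintegrable (D `|` E) f -> Cint (D `|` E) f = Cint D f + Cint E f.
Proof.
move=> mD mE DE [f1 f2]; have dis : [disjoint D & E] by apply/disj_setPS; rewrite DE.
by apply: complexP; rewrite ?cReD ?cImD ?cRe_Cint ?cIm_Cint Rintegral_setU.
Qed.

End ComplexIntegral.

(** * Square integrable functions and their classes *)

Section L2Space.
Variables (R : realType) (L : R).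
Local Notation mu := (@lebesgue_measure R).
Local Notation I := (`]0, L[%classic : set R).
Local Notation sq := (@square_integrable R L).
Local Notation cl := (@L2class R L).
Local Notation ipL := (@ipL2 R L).
Implicit Types (f g : R -> R[i]) (u v w : L2 L).

Lemma measurable_I0L : measurable I. Proof. exact: measurable_itv. Qed.
Local Notation mI := measurable_I0L.

Lemma aeF : Filter (almost_everywhere mu).
Proof. exact: (ae_filter_ringOfSetsType mu). Qed.

Lemma sq_meas f : sq f -> cmeasurable I f. Proof. by case. Qed.

Lemma sq_lin a f g : sq f -> sq g -> sq (fun x => a * f x + g x).
Proof.
move=> /asboolP fs /asboolP gs; apply/asboolP.
have [_ h] := @sqint_submod_closed R L.
exact: (h a f g fs gs).
Qed.

Lemma sq0 : sq (fun=> 0).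
Proof. by apply/asboolP; have [] := @sqint_submod_closed R L. Qed.

Lemma sqZ a f : sq f -> sq (fun x => a * f x).
Proof. by move=> /(@sq_lin a)/(_ sq0); under eq_fun do rewrite addr0. Qed.

Lemma sqD f g : sq f -> sq g -> sq (fun x => f x + g x).
Proof. by move=> /(@sq_lin 1) h /h; under eq_fun do rewrite mul1r. Qed.

Lemma sqB f g : sq f -> sq g -> sq (fun x => f x - g x).
Proof.
move=> fs gs; have := sqD fs (sqZ (-1) gs).
by under eq_fun do rewrite mulN1r.
Qed.

Lemma sq_conj f : sq f -> sq (fun x => conjc (f x)).
Proof.
move=> [m1 m2 fi]; split.
- by under [X in measurable_fun _ X]eq_fun do rewrite cRe_conj.
- under [X in measurable_fun _ X]eq_fun do rewrite cIm_conj.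
  exact: measurable_funN.
- by under [X in integrable _ _ X]eq_fun do rewrite sqmod_conj.
Qed.

Lemma measurable_sqmod D f : measurable D -> cmeasurable D f ->
  measurable_fun D (fun x => sqmod (f x)).
Proof. by move=> mD [m1 m2]; apply: measurable_funD; exact: measurable_funX. Qed.

Lemma cmeasurableM D f g : cmeasurable D f -> cmeasurable D g ->
  cmeasurable D (fun x => f x * g x).
Proof.
move=> [f1 f2] [g1 g2]; split.
  under [X in measurable_fun _ X]eq_fun do rewrite cReM.
  by apply: measurable_funB; exact: measurable_funM.
under [X in measurable_fun _ X]eq_fun do rewrite cImM.
by apply: measurable_funD; exact: measurable_funM.
Qed.

Lemma sq_mul f g : sq f -> sq g -> cintegrable I (fun x => f x * g x).
Proof.
move=> [f1 f2 fi] [g1 g2 gi].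
have [m1 m2] := cmeasurableM (conj f1 f2) (conj g1 g2).
have iG := rintegrableD mI fi gi.
have key (z w : R[i]) (F : R[i] -> R) : (forall z, F z ^+ 2 <= sqmod z) ->
    `|F (z * w)| <= `|sqmod z + sqmod w|.
  move=> hF; rewrite [leRHS]ger0_norm; last by apply: addr_ge0; exact: sqmod_ge0.
  apply: le_of_sqr; first by apply: addr_ge0; exact: sqmod_ge0.
  rewrite real_normK ?num_real//; apply: (le_trans (hF _)); rewrite sqmodM.
  by have := sqmod_ge0 z; have := sqmod_ge0 w; nra.
split; refine (@le_integrable _ _ _ mu I mI _ _ _ _ iG).
- exact/measurable_EFinP.
- by move=> x _; rewrite lee_fin; apply: (key _ _ Re); exact: sqr_Re_le.
- exact/measurable_EFinP.
- by move=> x _; rewrite lee_fin; apply: (key _ _ Im); exact: sqr_Im_le.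
Qed.

Lemma sq_bounded f (C : R) : cmeasurable I f -> (forall x, I x -> sqmod (f x) <= C) -> sq f.
Proof.
move=> [m1 m2] fC; split => //.
have iC : mu.-integrable I (fun=> C%:E).
  apply: (@integrableS _ _ _ mu `[0, L]) => //; first exact: subset_itv_oo_cc.
  apply: (@continuous_compact_integrable R (fun=> C)); first exact: segment_compact.
  by apply: continuous_subspaceT => x; exact: cvg_cst.
refine (@le_integrable _ _ _ mu I mI _ _ _ _ iC).
  by apply/measurable_EFinP; exact: measurable_sqmod.
move=> x Ix; rewrite lee_fin ger0_norm ?sqmod_ge0//.
by apply: (le_trans (fC _ Ix)); rewrite ler_norm.
Qed.

Lemma sq_mulb b f (C : R) : cmeasurable I b -> (forall x, I x -> sqmod (b x) <= C) ->
  sq f -> sq (fun x => b x * f x).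
Proof.
move=> mb bC [f1 f2 fi]; have [m1 m2] := cmeasurableM mb (conj f1 f2).
split => //; refine (@le_integrable _ _ _ mu I mI _ _ _ _ (rintegrableZ C mI fi)).
  by apply/measurable_EFinP; exact: measurable_sqmod.
move=> x Ix; rewrite lee_fin ger0_norm ?sqmod_ge0// sqmodM.
by apply: (le_trans _ (ler_norm _)); rewrite ler_wpM2r ?sqmod_ge0 ?bC.
Qed.

Lemma sq_ae f g : cmeasurable I f -> {ae mu, forall x, I x -> f x = g x} -> sq g -> sq f.
Proof.
move=> mf fg [g1 g2 gi]; split; [by case: mf|by case: mf|].
apply/integrableP; split; first by apply/measurable_EFinP; exact: measurable_sqmod.
have /integrableP[_] := gi; congr (_ < _)%E.
apply: ge0_ae_eq_integral => //.
- apply/measurableT_comp => //; apply/measurable_EFinP; exact: measurable_sqmod.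
- apply/measurableT_comp => //; apply/measurable_EFinP; exact: measurable_sqmod.
- by apply: filterS fg => [|x fg /fg ->]; first exact: aeF.
Qed.

Lemma L2_sq u : sq u.
Proof. by rewrite /L2_fun; case: (repr u) => f /= /asboolP. Qed.

Lemma L2_ext u v : {ae mu, forall x, I x -> u x = v x} -> u = v.
Proof.
by move=> uv; rewrite -[u]reprK -[v]reprK; apply: L2P.
Qed.

Lemma L2classE f : sq f -> {ae mu, forall x, I x -> cl f x = f x}.
Proof.
move=> fs; have fm : f \in @sqint R L by apply/asboolP.
have := @L2_repr R L (insubd 0 f); rewrite /L2_fun /L2class.
by rewrite -[X in _ = X %[ae _ in _]]/(val (insubd 0 f : L2fun L)) insubdK.
Qed.

Lemma L2class_ae f g : sq f -> sq g -> {ae mu, forall x, I x -> f x = g x} -> cl f = cl g.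
Proof.
move=> fs gs fg; apply: L2_ext.
apply: filterS3 fg (L2classE fs) (L2classE gs); first exact: aeF.
by move=> x h1 h2 h3 Ix; rewrite h2// h3// h1.
Qed.

Lemma L2class_eq f g : sq f -> (forall x, I x -> f x = g x) -> cl f = cl g.
Proof.
move=> fs fg; have fs' := fs; apply: L2class_ae => //; last first.
  by apply: (filterE aeF) => x /fg.
apply: sq_ae fs.
  move: fs' => [f1 f2 _].
  by split; [apply: eq_measurable_fun f1|apply: eq_measurable_fun f2] => x /set_mem /fg ->.
by apply: (filterE aeF) => x /fg.
Qed.

Lemma L2class_fun u : cl u = u.
Proof. by apply: L2_ext; apply: L2classE; exact: L2_sq. Qed.

Lemma L2_linE_cl a f g : sq f -> sq g ->
  cl (fun x => a * f x + g x) = a *: cl f + cl g.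
Proof.
move=> fs gs; apply: L2_ext; have h := L2_linE a (cl f) (cl g).
have hl := L2classE (sq_lin a fs gs).
have h2 : {ae mu, forall x, I x -> cl f x = f x /\ cl g x = g x}.
  apply: filterS2 (L2classE fs) (L2classE gs); first exact: aeF.
  by move=> x h1 h2 Ix; split; [exact: h1|exact: h2].
apply: filterS3 h hl h2; first exact: aeF.
move=> x h1 h2 h Ix; have [h3 h4] := h Ix.
by rewrite h1// h2// h3// h4.
Qed.

Lemma L2classD f g : sq f -> sq g -> cl (fun x => f x + g x) = cl f + cl g.
Proof.
move=> fs gs; have := L2_linE_cl 1 fs gs; rewrite scale1r => <-.
by congr L2class; apply/funext => x; rewrite mul1r.
Qed.

Lemma L2class0 : cl (fun=> 0) = 0.
Proof.
have := L2_linE_cl (-1) sq0 sq0; rewrite scaleN1r addNr => <-.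
by congr L2class; apply/funext => x; rewrite mulr0 addr0.
Qed.

Lemma L2classZ a f : sq f -> cl (fun x => a * f x) = a *: cl f.
Proof.
move=> fs; have := L2_linE_cl a fs sq0; rewrite L2class0 addr0 => <-.
by congr L2class; apply/funext => x; rewrite addr0.
Qed.

Lemma L2classB f g : sq f -> sq g -> cl (fun x => f x - g x) = cl f - cl g.
Proof.
move=> fs gs; rewrite -scaleN1r -L2classZ// -L2classD//; last exact: sqZ.
by congr L2class; apply/funext => x; rewrite mulN1r.
Qed.

Lemma ipL2_cl f g : sq f -> sq g ->
  ipL (cl f) (cl g) = Cint I (fun x => f x * conjc (g x)).
Proof.
move=> fs gs; apply: Cint_ae; first exact: mI.
- by apply: cintegrable_meas; apply: sq_mul; [|apply: sq_conj]; exact: L2_sq.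
- by apply: cintegrable_meas; apply: sq_mul; [|exact: sq_conj].
- apply: filterS2 (L2classE fs) (L2classE gs); first exact: aeF.
  by move=> x h1 h2 Ix; rewrite h1// h2.
Qed.

Lemma ipL2_inner : inner_product ipL.
Proof.
split.
- move=> a u v w.
  rewrite -[u]L2class_fun -[v]L2class_fun -[w]L2class_fun.
  have us := L2_sq u; have vs := L2_sq v; have ws := L2_sq w.
  rewrite -L2_linE_cl// !ipL2_cl//; last exact: sq_lin.
  rewrite -Cint_linear//; try by [exact: mI|apply: sq_mul => //; exact: sq_conj].
  by apply: CintE => x _; ring.
- move=> u v; rewrite /ipL2 -Cint_conj; [|exact: mI|].
    by apply: CintE => x _; rewrite rmorphM /= conjcK mulrC.
  by apply: sq_mul; [|apply: sq_conj]; exact: L2_sq.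
- suff h (u : L2 L) : u != 0 -> 0 < ipL u u by move=> u; exact: h.
  move=> u0; have [m1 m2 ui] := L2_sq u.
  have E : ipL u u = (\int[mu]_(x in I) sqmod (u x))%:C.
    apply: complexP.
      by rewrite cRe_Cint cRe_real; apply: eq_Rintegral => x _; rewrite mulcJ.
    rewrite cIm_Cint cIm_real; under eq_Rintegral do rewrite mulcJ cIm_real.
    by rewrite /Rintegral integral0.
  have ge0 : 0 <= \int[mu]_(x in I) sqmod (u x).
    by apply: Rintegral_ge0 => x _; exact: sqmod_ge0.
  rewrite E ltcR lt0r ge0 andbT; apply: contraNneq u0 => int0.
  have ms : measurable_fun I (fun x => (sqmod (u x))%:E).
    by apply/measurable_EFinP; exact: measurable_sqmod.
  have : ae_eq mu I (fun x => (sqmod (u x))%:E) (cst 0%E).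
    apply/(ae_eq_integral_abs mu mI ms).
    under eq_integral do rewrite gee0_abs ?lee_fin ?sqmod_ge0//.
    by rewrite RintegralE ?int0.
  move=> h; apply/eqP; rewrite -L2class0 -[u]L2class_fun.
  apply: L2class_ae; [exact: L2_sq|exact: sq0|].
  have {}h : {ae mu, forall x, I x -> (sqmod (u x))%:E = 0%E} := h.
  apply: filterS h; first exact: aeF.
  by move=> x h Ix; have [/eqP] := h Ix; rewrite sqmod_eq0 => /eqP.
Qed.

Lemma hnorm_cl f : sq f ->
  hnorm ipL (cl f) ^+ 2 = \int[mu]_(x in I) sqmod (f x).
Proof.
move=> fs; rewrite (hnorm_sq ipL2_inner) ipL2_cl// cRe_Cint.
by apply: eq_Rintegral => x _; rewrite mulcJ.
Qed.

Lemma hnorm_mulb b f (C : R) : cmeasurable I b -> (forall x, I x -> sqmod (b x) <= C) ->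
  sq f -> hnorm ipL (cl (fun x => b x * f x)) ^+ 2 <= C * hnorm ipL (cl f) ^+ 2.
Proof.
move=> mb bC fs; have bfs := sq_mulb mb bC fs; rewrite !hnorm_cl//.
have [[_ _ i1] [_ _ i2]] := (bfs, fs).
rewrite -RintegralZl//; apply: le_Rintegral => //.
  exact: (rintegrableZ C mI i2).
by move=> x Ix; rewrite sqmodM ler_wpM2r ?sqmod_ge0 ?bC.
Qed.

End L2Space.

(** * Completeness of L^2 *)

Section L2Complete.
Variables (R : realType) (L : R).
Local Notation mu := (@lebesgue_measure R).
Local Notation I := (`]0, L[%classic : set R).
Local Notation sq := (@square_integrable R L).
Local Notation cl := (@L2class R L).
Local Notation ipL := (@ipL2 R L).
Local Notation nrm := (hnorm ipL).
Let mI : measurable I := @measurable_I0L R L.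
Implicit Types (f g : R -> R[i]) (u v w : L2 L).

Lemma geometric_sum_le (n : nat) : \sum_(0 <= k < n) (2^-1 : R) ^+ k <= 2.
Proof.
suff -> : \sum_(0 <= k < n) (2^-1 : R) ^+ k = 2 - 2 * 2^-1 ^+ n.
  by rewrite gerBl mulr_ge0// exprn_ge0// invr_ge0.
elim: n => [|n IH]; first by rewrite big_geq// expr0; ring.
by rewrite big_nat_recr//= IH exprS; field.
Qed.

Lemma cvg_of_geometric (x : nat -> R) (K : R) :
  (forall k, `|x k.+1 - x k| <= K * 2^-1 ^+ k) -> exists l : R, x n @[n --> \oo] --> l.
Proof.
move=> h.
have K0 : 0 <= K by have := h 0%N; rewrite expr0 mulr1; apply: le_trans.
have tel p k : `|x (k + p)%N - x k| <= 2 * K * 2^-1 ^+ k.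
  apply: (@le_trans _ _ (\sum_(0 <= i < p) K * 2^-1 ^+ k * 2^-1 ^+ i)).
    elim: p => [|p IH]; first by rewrite addn0 subrr normr0 big_geq.
    rewrite big_nat_recr//= addnS -[_ - x k](subrKA (x (k + p)%N)) addrC.
    apply: (le_trans (ler_normD _ _)); apply: lerD => //.
    by apply: (le_trans (h _)); rewrite exprD mulrA.
  rewrite -mulr_sumr [leRHS](_ : _ = K * 2^-1 ^+ k * 2); last by ring.
  by rewrite ler_wpM2l ?geometric_sum_le// mulr_ge0// exprn_ge0// invr_ge0.
apply: cvg_of_cauchy => e e0.
have [k hk] : exists k : nat, 2 * K * 2^-1 ^+ k <= e / 2.
  have : (2 * K * 2^-1 ^+ n) @[n --> \oo] --> 2 * K * (0 : R).
    by apply: cvgM; [exact: cvg_cst|apply: cvg_expr; rewrite ger0_norm ?invr_ge0// invf_lt1// ltr1n].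
  rewrite mulr0 => /cvgrPdist_le /(_ (e / 2)); rewrite divr_gt0// => /(_ isT)[k _ hk].
  exists k; have := hk k (leqnn k); rewrite sub0r normrN; apply: le_trans.
  exact: ler_norm.
exists k => n p kn kp; rewrite -(subnKC kn) -(subnKC kp) (splitr e).
rewrite -[x _ - x _](subrKA (x k)); apply: (le_trans (ler_normD _ _)).
apply: lerD; first exact: le_trans (tel _ _) hk.
by rewrite distrC; apply: le_trans (tel _ _) hk.
Qed.

(* Riesz-Fischer: a fast Cauchy subsequence converges pointwise where
   G = sum_k 4^k |f_(k+1) - f_k|^2 is finite; Fatou gives convergence in norm. *)
Lemma L2_fast_limit (f : nat -> R -> R[i]) : (forall k, sq (f k)) ->
  (forall k p, (k <= p)%N ->
     \int[mu]_(x in I) sqmod (f p x - f k x) <= (2^-1 : R) ^+ (3 * k)) ->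
  exists g, sq g /\ forall k,
    \int[mu]_(x in I) sqmod (g x - f k x) <= (2^-1 : R) ^+ (3 * k).
Proof.
move=> fs fC.
(* The weight 4^k serves twice: against the integral bound 8^-k the sum of the integrals stays
   finite, and finiteness of G at x gives |f_{k+1} - f_k| <= sqrt G 2^-k there. *)
pose D k x := 4 ^+ k * sqmod (f k.+1 x - f k x).
have mD k : measurable_fun I (fun x => (D k x)%:E).
  apply/measurable_EFinP; apply: measurable_funM => //.
  by apply: measurable_sqmod => //; apply: sq_meas; apply: sqB.
have D0 k x : (0 <= (D k x)%:E)%E.
  by rewrite lee_fin mulr_ge0 ?exprn_ge0 ?sqmod_ge0.
pose G x := (\sum_(0 <= k <oo) (D k x)%:E)%E.
have mG : measurable_fun I G by apply: ge0_emeasurable_sum.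
have G0 x : (0 <= G x)%E by apply: nneseries_ge0 => k _ _; exact: D0.
have iG : mu.-integrable I G.
  apply/integrableP; split => //.
  under eq_integral do rewrite gee0_abs//.
  rewrite integral_nneseries//.
  apply: (@le_lt_trans _ _ 2%:E); last exact: ltry.
  apply: lime_le; first by apply: is_cvg_nneseries => k _ _; apply: integral_ge0.
  near=> n; apply: (@le_trans _ _ (\sum_(0 <= k < n) ((2^-1 : R) ^+ k)%:E)%E).
    apply: lee_sum => k _.
    have [_ _ i1] := sqB (fs k.+1) (fs k).
    have i2 := rintegrableZ (4 ^+ k) mI i1.
    rewrite (RintegralE mI i2) lee_fin RintegralZl//; apply: (@le_trans _ _ (4 ^+ k * 2^-1 ^+ (3 * k))).
      by rewrite ler_wpM2l ?exprn_ge0 ?fC.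
    have -> // : (4 : R) ^+ k * 2^-1 ^+ (3 * k) = 2^-1 ^+ k.
    by rewrite exprM -exprMn; congr (_ ^+ _); field.
  by rewrite sumEFin lee_fin geometric_sum_le.
(* Cutting the functions off outside E changes them on a null set only and makes the sequence
   converge at every point, so the limit is measurable. *)
pose E := I `&` [set x | G x \is a fin_num].
have mE : measurable E by exact: emeasurable_fin_num.
pose b x : R[i] := (\1_E x)%:C.
have mb : cmeasurable I b.
  by apply: cmeasurable_real; exact: measurable_indic.
have b1 x : I x -> sqmod (b x) <= 1.
  move=> _; rewrite sqmod_real indicE; case: (_ \in _) => /=; rewrite ?expr1n ?expr0n//.
pose h k x := b x * f k x.
have hs k : sq (h k) by exact: sq_mulb mb b1 (fs k).
have bE : {ae mu, forall x, I x -> b x = 1}.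
  have fin : {ae mu, forall x, I x -> G x \is a fin_num} := @integrable_ae _ _ _ mu I mI _ iG.
  apply: filterS fin; first exact: aeF.
  by move=> x hx Ix; rewrite /b indicE mem_set//; split => //; exact: hx.
have hf k : {ae mu, forall x, I x -> h k x = f k x}.
  apply: filterS bE; first exact: aeF.
  by move=> x hx Ix; rewrite /h hx// mul1r.
have hC k p : (k <= p)%N ->
    \int[mu]_(x in I) sqmod (h p x - h k x) <= (2^-1 : R) ^+ (3 * k).
  move=> kp; apply: le_trans (fC _ _ kp); rewrite -!hnorm_cl; try exact: sqB.
  rewrite le_eqVlt; apply/orP; left; apply/eqP; congr (hnorm _ _ ^+ 2).
  apply: L2class_ae; try exact: sqB.
  apply: filterS2 (hf k) (hf p); first exact: aeF.
  by move=> x h1 h2 Ix; rewrite h1// h2.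
have cvgpart (F : R[i] -> R) x : (forall z w : R[i], F (z - w) = F z - F w) ->
    (forall z : R[i], F z ^+ 2 <= sqmod z) -> exists l : R, F (h k x) @[k --> \oo] --> l.
  move=> FB Fle; have F0 : F 0 = 0 by rewrite -(subrr 0) FB subrr.
  have [xE|xE] := pselect (E x); last first.
    exists 0; rewrite /h /b indicE memNset//.
    by under eq_fun do rewrite mul0r F0; exact: cvg_cst.
  have [Ix Gx] := xE; pose K := fine (G x).
  have K0 : 0 <= K by rewrite fine_ge0.
  apply: (@cvg_of_geometric _ (Num.sqrt K)) => k.
  rewrite /h /b indicE mem_set// !mul1r -FB.
  apply: le_of_sqr; first by rewrite mulr_ge0 ?sqrtr_ge0 ?exprn_ge0 ?invr_ge0.
  rewrite real_normK ?num_real// exprMn sqr_sqrtr//; apply: (le_trans (Fle _)).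
  rewrite -exprM mulnC exprM exprVn.
  have -> : (2 ^+ 2 : R) = 4 by ring.
  rewrite exprVn ler_pdivlMr ?exprn_gt0// mulrC -lee_fin fineK//.
  apply: le_trans (_ : (\sum_(0 <= i < k.+1) (D i x)%:E <= _)%E); last first.
    by apply: nneseries_lim_ge => i _ _; exact: D0.
  rewrite big_nat_recr//=; apply: leeDr; apply: sume_ge0 => i _; exact: D0.
have /choice[g hg] : forall x, exists z : R[i],
    (Re (h k x) @[k --> \oo] --> Re z) /\ (Im (h k x) @[k --> \oo] --> Im z).
  move=> x; have [r hr] := cvgpart Re x (@cReB _) (@sqr_Re_le _).
  by have [s hi] := cvgpart Im x (@cImB _) (@sqr_Im_le _); exists (r +i* s).
have mg : cmeasurable I g.
  split.
    apply: (@measurable_fun_cvg _ _ _ _ (fun k x => Re (h k x))) => [k|x _].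
      by have [] := hs k.
    by have [] := hg x.
  apply: (@measurable_fun_cvg _ _ _ _ (fun k x => Im (h k x))) => [k|x _].
    by have [] := hs k.
  by have [] := hg x.
have mgh k : measurable_fun I (fun x => sqmod (g x - h k x)).
  apply: measurable_sqmod => //; have [h1 h2 _] := hs k; have [g1 g2] := mg.
  split.
    by under [X in measurable_fun _ X]eq_fun do rewrite cReB; exact: measurable_funB.
  by under [X in measurable_fun _ X]eq_fun do rewrite cImB; exact: measurable_funB.
(* Fatou is applied to the sequence shifted by k, all of whose terms obey [hC]. *)
have fat k : (\int[mu]_(x in I) (sqmod (g x - h k x))%:E <=
    ((2^-1 : R) ^+ (3 * k))%:E)%E.
  have lim_x x : (sqmod (h (p + k)%N x - h k x))%:E @[p --> \oo] -->
      (sqmod (g x - h k x))%:E.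
    apply: cvg_EFin; first by near=> p.
    have [hr hi] := hg x.
    rewrite /sqmod /= !cReB !cImB; under eq_fun do rewrite /= cReB cImB !expr2.
    rewrite !expr2.
    have c1 : Re (h (p + k)%N x) @[p --> \oo] --> Re (g x).
      by rewrite (cvg_shiftn k (fun p => Re (h p x))).
    have c2 : Im (h (p + k)%N x) @[p --> \oo] --> Im (g x).
      by rewrite (cvg_shiftn k (fun p => Im (h p x))).
    by apply: cvgD; apply: cvgM; apply: cvgB => //; exact: cvg_cst.
  under eq_integral => x _ do rewrite -(cvg_limn_einf_sup (lim_x x)).1.
  apply: (le_trans (@fatou _ _ _ mu I mI _ _ _)).
  - move=> p; apply/measurable_EFinP; apply: measurable_sqmod => //.
    by apply: sq_meas; apply: sqB.
  - by move=> p x _; rewrite lee_fin sqmod_ge0.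
  rewrite limn_einf_lim; apply: lime_le; first exact: is_cvg_einfs.
  near=> n; apply: (@le_trans _ _ (\int[mu]_(x in I) (sqmod (h (n + k)%N x - h k x))%:E)%E).
    by apply: ereal_inf_lbound; exists n; rewrite //= leqnn.
  have [_ _ i1] := sqB (hs (n + k)%N) (hs k).
  by rewrite (RintegralE mI i1) lee_fin; apply: hC; rewrite leq_addl.
have sgh k : sq (fun x => g x - h k x).
  have [h1 h2 _] := hs k; have [g1 g2] := mg.
  split.
  - by under [X in measurable_fun _ X]eq_fun do rewrite cReB; exact: measurable_funB.
  - by under [X in measurable_fun _ X]eq_fun do rewrite cImB; exact: measurable_funB.
  - apply/integrableP; split; first by apply/measurable_EFinP; exact: mgh.
    under eq_integral do rewrite gee0_abs ?lee_fin ?sqmod_ge0//.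
    by apply: (le_lt_trans (fat k)); exact: ltry.
have gs : sq g.
  have := sqD (sgh 0%N) (hs 0%N).
  by congr square_integrable; apply/funext => x; rewrite subrK.
exists g; split => // k.
apply: (@le_trans _ _ (\int[mu]_(x in I) sqmod (g x - h k x))).
  rewrite -!hnorm_cl; try exact: sqB.
  rewrite le_eqVlt; apply/orP; left; apply/eqP; congr (hnorm _ _ ^+ 2).
  apply: L2class_ae; try exact: sqB.
  apply: filterS (hf k); first exact: aeF.
  by move=> x h1 Ix; rewrite h1.
have [_ _ i1] := sgh k.
by rewrite -lee_fin -(RintegralE mI i1); exact: fat.
Unshelve. all: by end_near. Qed.

Lemma L2_complete (u_ : nat -> L2 L) : hcauchy ipL u_ -> exists u, hcvg ipL u_ u.
Proof.
move=> cu; have ipP := @ipL2_inner R L.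
have /choice[N hN] : forall k : nat, exists N : nat, forall n p : nat,
    (N <= n)%N -> (N <= p)%N -> nrm (u_ n - u_ p) ^+ 2 <= (2^-1 : R) ^+ (3 * k).
  move=> k; have e0 : 0 < Num.sqrt ((2^-1 : R) ^+ (3 * k)).
    by rewrite sqrtr_gt0 exprn_gt0// invr_gt0.
  have [N hN] := cu _ e0; exists N => n p Nn Np.
  have := ltW (hN n p Nn Np); rewrite -ler_sqr ?nnegrE ?hnorm_ge0 ?sqrtr_ge0//.
  by rewrite [X in _ <= X]sqr_sqrtr// exprn_ge0// invr_ge0.
(* Taking maxima makes the chosen indices nondecreasing, so every later one is still beyond
   [N k]. *)
pose n k := \max_(i < k.+1) N i.
have Nn k : (N k <= n k)%N by exact: (@leq_bigmax _ (fun i : 'I_k.+1 => N i) ord_max).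
have nn k p : (k <= p)%N -> (n k <= n p)%N.
  move=> kp; apply/bigmax_leqP => i _.
  have ip : (i < p.+1)%N by rewrite (leq_trans (ltn_ord i)).
  exact: (@leq_bigmax _ (fun i : 'I_p.+1 => N i) (Ordinal ip)).
have us k : sq (u_ (n k)) by exact: L2_sq.
have [k p kp|g [gs hg]] := L2_fast_limit us.
  rewrite -hnorm_cl; last exact: sqB.
  rewrite L2classB// !L2class_fun; apply: hN => //.
  by rewrite (leq_trans (Nn k)) ?nn.
exists (cl g); apply/hcvgP => e e0.
have [k hk] : exists k : nat, (2^-1 : R) ^+ (3 * k) < (e / 2) ^+ 2.
  have : ((2^-1 : R) ^+ 3) ^+ n @[n --> \oo] --> (0 : R).
    apply: cvg_expr; rewrite ger0_norm ?exprn_ge0 ?invr_ge0//.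
    by rewrite exprn_ilt1 ?invr_ge0 ?invf_lt1 ?ltr1n.
  move=> /cvgrPdist_lt /(_ _ (exprn_gt0 2 (divr_gt0 e0 (@ltr0n R 2))))[k _ hk].
  by exists k; have := hk k (leqnn k); rewrite sub0r normrN exprM; apply: le_lt_trans; exact: ler_norm.
exists (n k) => p np; apply: (le_lt_trans (hnorm_dist ipP _ (u_ (n k)) _)).
have small w : nrm w ^+ 2 <= (2^-1 : R) ^+ (3 * k) -> nrm w < e / 2.
  move=> h; rewrite -ltr_sqr ?nnegrE ?hnorm_ge0 ?divr_ge0 ?(ltW e0)//.
  exact: le_lt_trans h hk.
rewrite (splitr e); apply: ltrD; apply: small; first by apply: hN => //; exact: leq_trans (Nn k) np.
rewrite (hnormBC ipP) -[X in _ - X]L2class_fun -L2classB// hnorm_cl.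
  exact: hg.
exact: sqB.
Qed.

End L2Complete.

(** * Density of the trigonometric systems *)

Section Bernstein.
Variable R : realType.
Implicit Types (u : R) (f g : nat -> R).

(* The expectation of f under the binomial law with parameters n and u. *)
Fixpoint bernstein (n : nat) (u : R) (f : nat -> R) : R :=
  if n is n'.+1 then u * bernstein n' u (fun k => f k.+1) + (1 - u) * bernstein n' u f
  else f 0%N.

Lemma bernstein_le n u f g : 0 <= u <= 1 -> (forall k, (k <= n)%N -> f k <= g k) ->
  bernstein n u f <= bernstein n u g.
Proof.
move=> /andP[u0 u1]; elim: n f g => [|n IH] f g fg /=; first exact: fg.
apply: lerD; first by rewrite ler_wpM2l// IH// => k kn; exact: fg.
by rewrite ler_wpM2l ?subr_ge0// IH// => k kn; apply: fg; exact: leqW.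
Qed.

Lemma bernstein_affine n u f (a b : R) :
  bernstein n u (fun k => a * f k + b) = a * bernstein n u f + b.
Proof.
elim: n f => [//|n IH] f /=.
by rewrite (IH (fun k => f k.+1)) IH; ring.
Qed.

(** Variance plus squared bias. The centre c is left free because the recursion replaces it by c -
    1. *)
Lemma bernstein_sqr n u (c : R) :
  bernstein n u (fun k => (k%:R - c) ^+ 2) = n%:R * u * (1 - u) + (n%:R * u - c) ^+ 2.
Proof.
elim: n c => [|n IH] c /=; first by ring.
have -> : bernstein n u (fun k => (k.+1%:R - c) ^+ 2) =
    bernstein n u (fun k => (k%:R - (c - 1)) ^+ 2).
  by congr bernstein; apply/funext => k; rewrite -natr1; ring.
by rewrite !IH -natr1; ring.
Qed.

(* Korovkin-style error bound: K and d encode the modulus of continuity. *)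
Lemma bernstein_dist n u f (l e K : R) : 0 <= u <= 1 -> 0 <= K ->
  (forall k, (k <= n.+1)%N -> `|f k - l| <= e + K * (k%:R / n.+1%:R - u) ^+ 2) ->
  `|bernstein n.+1 u f - l| <= e + K / n.+1%:R.
Proof.
move=> u01 K0 h; set m := n.+1 in h *.
have m0 : 0 < m%:R :> R by rewrite ltr0n.
pose q k : R := (k%:R - m%:R * u) ^+ 2.
have hq k : (k <= m)%N -> `|f k - l| <= e + K / m%:R ^+ 2 * q k.
  move=> km; apply: (le_trans (h _ km)); rewrite lerD2l -mulrA ler_wpM2l//.
  rewrite le_eqVlt; apply/orP; left; apply/eqP; rewrite /q.
  by field; rewrite gt_eqF.
have B : bernstein m u q <= m%:R.
  rewrite /q bernstein_sqr subrr expr0n addr0 -[leRHS]mulr1 -mulrA ler_wpM2l//.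
  by move: u01 => /andP[? ?]; nra.
have KB : K / m%:R ^+ 2 * bernstein m u q <= K / m%:R.
  apply: (@le_trans _ _ (K / m%:R ^+ 2 * m%:R)).
    by rewrite ler_wpM2l// divr_ge0// exprn_ge0// ltW.
  by rewrite expr2 invfM !mulrA divfK ?gt_eqF.
have up : bernstein m u f <= K / m%:R ^+ 2 * bernstein m u q + (e + l).
  rewrite -bernstein_affine; apply: bernstein_le => // k /hq.
  by rewrite ler_norml => /andP[_]; lra.
have lo : - (K / m%:R ^+ 2) * bernstein m u q + (l - e) <= bernstein m u f.
  rewrite -bernstein_affine; apply: bernstein_le => // k /hq.
  by rewrite ler_norml => /andP[]; lra.
rewrite ler_norml; apply/andP; split; lra.
Qed.

End Bernstein.

(** * Uniform continuity on a segment *)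

Section UniformContinuity.
Variable R : realType.

Lemma uniformly_continuous_segment (G : R -> R) (a b e : R) : continuous G -> 0 < e ->
  exists2 d, 0 < d & forall x y, a <= x <= b -> `|x - y| < d -> `|G x - G y| < e.
Proof.
move=> cG e0; have cK := @segment_compact R a b.
have : \forall d \near (0 : R)^'+, `[a, b]%classic `<=`
    (fun x => forall y, `|x - y| < d -> `|G x - G y| < e).
  move/compact_near_coveringP : cK; apply => x _.
  have e2 : 0 < e / 2 by rewrite divr_gt0.
  have /cvgrPdist_lt /(_ _ e2) := cG x.
  move=> /nbhs_ballP[d /= d0 hd]; have d2 : 0 < d / 2 by rewrite divr_gt0.
  exists (ball x (d / 2), [set t | t < d / 2]) => /=.
    split; first exact: nbhsx_ballx.
    exact: nbhs_right_lt.
  move=> [z t] /= [xz td] y zy.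
  have h1 : `|G x - G z| < e / 2.
    by apply: hd; apply: le_ball xz; lra.
  have h2 : `|G x - G y| < e / 2.
    apply: hd; rewrite /ball /= -[x - y](subrKA z) (splitr d).
    apply: (le_lt_trans (ler_normD _ _)); apply: ltrD => //.
    exact: lt_trans zy td.
  rewrite -[G z - G y](subrKA (G x)) (splitr e).
  by apply: (le_lt_trans (ler_normD _ _)); apply: ltrD; rewrite // distrC.
move=> h; near (0 : R)^'+ => d; exists d.
  by near: d; exact: nbhs_right_gt.
have hd : `[a, b]%classic `<=` (fun x => forall y, `|x - y| < d -> `|G x - G y| < e).
  by near: d.
by move=> x y xab xy; apply: hd => //=; rewrite in_itv.
Unshelve. all: by end_near. Qed.

End UniformContinuity.

(** * Cosine sums and uniform approximation *)

Section TrigonometricSpan.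
Variables (R : realType) (L : R).
Hypothesis L0 : 0 < L.
Implicit Types (f g : R -> R) (x : R).

Definition cosn (n : nat) x : R := cos (n%:R * pi / L * x).
Definition sinn (n : nat) x : R := sin (n%:R * pi / L * x).

Definition fspan (F : nat -> R -> R) f := exists N (a : nat -> R),
  forall x, f x = \sum_(0 <= n < N) a n * F n x.
Local Notation cspan := (fspan cosn).

Lemma span_lin F (k : R) f g : fspan F f -> fspan F g -> fspan F (fun x => k * f x + g x).
Proof.
move=> [N [a fa]] [M [b gb]].
have ext K P (c : nat -> R) x : (K <= P)%N -> \sum_(0 <= n < K) c n * F n x =
    \sum_(0 <= n < P) (if (n < K)%N then c n else 0) * F n x.
  move=> KP; rewrite [RHS](@big_cat_nat _ _ _ K)//= [X in _ + X]big_nat.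
  rewrite [X in _ + X]big1 ?addr0 => [|i /andP[Ki _]]; last first.
    by rewrite ltnNge Ki mul0r.
  by rewrite [LHS]big_nat [RHS]big_nat; apply: eq_bigr => i /andP[_ ->].
exists (maxn N M), (fun n => k * (if (n < N)%N then a n else 0) +
                             (if (n < M)%N then b n else 0)) => x.
rewrite fa gb (ext N (maxn N M)) ?leq_maxl// (ext M (maxn N M)) ?leq_maxr//.
rewrite mulr_sumr -big_split; apply: eq_bigr => n _ /=; ring.
Qed.

Lemma span_base F n : fspan F (F n).
Proof.
exists n.+1, (fun k => (k == n)%:R) => x; rewrite big_nat_recr//= eqxx mul1r.
by rewrite big_nat big1 ?add0r// => k /andP[_ kn]; rewrite ltn_eqF// mul0r.
Qed.

Lemma span0 F : fspan F (fun=> 0).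
Proof. by exists 0%N, (fun=> 0) => x; rewrite big_geq. Qed.

(** Stability of a span under multiplication by T need only be checked on the generators. *)
Lemma span_map F G (T : R -> R) : (forall n, fspan G (fun x => F n x * T x)) ->
  forall f, fspan F f -> fspan G (fun x => f x * T x).
Proof.
move=> h f [N [a fa]].
have -> : f = fun x => \sum_(0 <= n < N) a n * F n x by exact/funext.
elim: N {fa} => [|N IH].
  by under [X in fspan _ X]eq_fun do rewrite big_geq// mul0r; exact: span0.
under [X in fspan _ X]eq_fun do rewrite big_nat_recr//= addrC mulrDl -mulrA.
exact: span_lin (h N) IH.
Qed.

Lemma cosn0 x : cosn 0 x = 1.
Proof. by rewrite /cosn !mul0r cos0. Qed.

Lemma cosn_mul n x : cosn n.+1 x * cosn 1 x = (cosn n.+2 x + cosn n x) / 2.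
Proof.
rewrite /cosn.
have -> : n.+2%:R * pi / L * x = n.+1%:R * pi / L * x + 1 * pi / L * x.
  by rewrite -(natr1 n.+1); ring.
have -> : n%:R * pi / L * x = n.+1%:R * pi / L * x - 1 * pi / L * x.
  by rewrite -(natr1 n); ring.
by rewrite cosD cosB; field.
Qed.

Lemma cosn_sin n x : cosn n.+1 x * sinn 1 x = (sinn n.+2 x - sinn n x) / 2.
Proof.
rewrite /cosn /sinn.
have -> : n.+2%:R * pi / L * x = n.+1%:R * pi / L * x + 1 * pi / L * x.
  by rewrite -(natr1 n.+1); ring.
have -> : n%:R * pi / L * x = n.+1%:R * pi / L * x - 1 * pi / L * x.
  by rewrite -(natr1 n); ring.
by rewrite sinD sinB; field.
Qed.

Lemma cspan_mul_cos f : cspan f -> cspan (fun x => f x * cosn 1 x).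
Proof.
apply: span_map => -[|n].
  by under [X in fspan _ X]eq_fun do rewrite cosn0 mul1r; exact: span_base.
rewrite (_ : (fun x => _) = fun x => 2^-1 * cosn n.+2 x + (2^-1 * cosn n x + 0)).
  by do 2! (apply: span_lin; first exact: span_base); exact: span0.
by apply/funext => x; rewrite cosn_mul; ring.
Qed.

Lemma cspan_mul_sin f : cspan f -> fspan (fun n => sinn n.+1) (fun x => f x * sinn 1 x).
Proof.
apply: span_map => -[|n].
  by under [X in fspan _ X]eq_fun do rewrite cosn0 mul1r; exact: span_base (fun n => sinn n.+1) 0%N.
have s2 : fspan (fun n => sinn n.+1) (sinn n.+2) := span_base (fun n => sinn n.+1) n.+1.
have s0 : fspan (fun n => sinn n.+1) (sinn n).
  case: n {s2} => [|n]; last exact: (span_base (fun n => sinn n.+1) n).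
  by rewrite (_ : sinn 0 = fun=> 0); [exact: span0|apply/funext => x; rewrite /sinn !mul0r sin0].
rewrite (_ : (fun x => _) = fun x => 2^-1 * sinn n.+2 x + (- 2^-1 * sinn n x + 0)).
  by do 2! (apply: span_lin => //); exact: span0.
by apply/funext => x; rewrite cosn_sin; ring.
Qed.

(** The Bernstein recursion only multiplies by u and 1 - u, which are affine in the first cosine,
    and the cosine span is stable under such products. *)
Lemma cspan_bernstein n (f : nat -> R) :
  cspan (fun x => bernstein n ((1 - cosn 1 x) / 2) f).
Proof.
elim: n f => [|n IH] f /=.
  rewrite (_ : (fun=> _) = fun x => f 0%N * cosn 0 x + 0).
    by apply: span_lin; [exact: span_base|exact: span0].
  by apply/funext => x; rewrite cosn0 mulr1 addr0.
rewrite (_ : (fun x => _) = fun x => 2^-1 * (bernstein n ((1 - cosn 1 x) / 2) (fun k => f k.+1)) +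
   ((- 2^-1) * (bernstein n ((1 - cosn 1 x) / 2) (fun k => f k.+1) * cosn 1 x) +
   (2^-1 * bernstein n ((1 - cosn 1 x) / 2) f +
   (2^-1 * (bernstein n ((1 - cosn 1 x) / 2) f * cosn 1 x) + 0)))).
  apply: span_lin; first exact: IH.
  apply: span_lin; first by apply: cspan_mul_cos; exact: IH.
  apply: span_lin; first exact: IH.
  apply: span_lin; first by apply: cspan_mul_cos; exact: IH.
  exact: span0.
by apply/funext => x; field.
Qed.

(** On [0, pi] a step of length b lowers the cosine least when it starts at 0. With a = 2p and b =
    2q the difference of the two sides is 4 cos (p + q) sin p sin q, a product of non-negative
    factors. *)
Lemma cos_gap (a b : R) : 0 <= a -> 0 <= b -> a + b <= pi ->
  1 - cos b <= cos a - cos (a + b).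
Proof.
move=> a0 b0 abpi.
have -> : a = a / 2 + a / 2 by lra. have -> : b = b / 2 + b / 2 by lra.
set p := a / 2; set q := b / 2.
have p0 : 0 <= p by rewrite divr_ge0. have q0 : 0 <= q by rewrite divr_ge0.
have pq : p + q <= pi / 2 by rewrite /p /q; lra.
have pi0 := pi_gt0 R.
have sp : 0 <= sin p by apply: sin_ge0_pi; apply/andP; split; lra.
have sq : 0 <= sin q by apply: sin_ge0_pi; apply/andP; split; lra.
have cpq : 0 <= cos (p + q) by apply: cos_ge0_pihalf; apply/andP; split; lra.
have := cos2Dsin2 p; have := cos2Dsin2 q.
rewrite -subr_ge0.
suff -> : cos (p + p) - cos (p + p + (q + q)) - (1 - cos (q + q)) =
    4 * (cos (p + q) * (sin p * sin q)) by move=> _ _; rewrite !mulr_ge0.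
have -> : p + p + (q + q) = (p + q) + (p + q) by ring.
rewrite (cosD (p + q)) (sinD p q) (cosD p q) (cosD p p) (cosD q q).
move: (cos2Dsin2 p) (cos2Dsin2 q).
move: (cos p) (sin p) (cos q) (sin q) => c s d t h1 h2.
have -> : c * c = 1 - s ^+ 2 by rewrite -h1; ring.
have -> : d * d = 1 - t ^+ 2 by rewrite -h2; ring.
have E1 : c ^+ 2 = 1 - s ^+ 2 by rewrite -h1; ring.
have E2 : d ^+ 2 = 1 - t ^+ 2 by rewrite -h2; ring.
have -> : (c * d - s * t) * (c * d - s * t) - (s * d + c * t) * (s * d + c * t) =
  c ^+ 2 * d ^+ 2 + s ^+ 2 * t ^+ 2 - s ^+ 2 * d ^+ 2 - c ^+ 2 * t ^+ 2
  - 4 * (c * d * s * t) by ring.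
by rewrite E1 E2; ring.
Qed.

Lemma angle_itv x : 0 <= x <= L -> 0 <= pi / L * x <= pi.
Proof.
move=> /andP[x0 xL]; have p0 := pi_gt0 R.
rewrite mulr_ge0 ?divr_ge0 ?(ltW p0) ?(ltW L0)//= mulrAC ler_pdivrMr//.
by rewrite ler_wpM2l// ltW.
Qed.

(** Quantitative injectivity of cos (pi x / L) on [0, L]: it converts closeness in x into the
    quadratic error term of [bernstein_dist], which is measured in the cosine variable. *)
Lemma cosn1_gap d : 0 < d -> exists2 k, 0 < k & forall x y,
  0 <= x <= L -> 0 <= y <= L -> d <= `|x - y| -> k <= `|cosn 1 x - cosn 1 y|.
Proof.
move=> d0; have p0 := pi_gt0 R.
(* Capped at pi, where the cosine is still decreasing, since d is arbitrary. *)
pose t := Num.min pi (pi / L * d).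
have t0 : 0 < t by rewrite lt_min p0 mulr_gt0 ?divr_gt0.
have tpi : t <= pi by rewrite ge_min lexx.
exists (1 - cos t).
  by rewrite subr_gt0 -cos0 ltr_cos// !in_itv/= ?lexx ?(ltW p0)// tpi ltW.
move=> x y; wlog xy : x y / x <= y => [hw|].
  have [xy|yx] := leP x y; first exact: hw.
  by move=> hx hy hd; rewrite distrC; apply: hw; [exact: ltW| | |rewrite distrC].
move=> hx hy hd.
have [/andP[X0 X1] /andP[Y0 Y1]] := (angle_itv hx, angle_itv hy).
have g := @cos_gap (pi / L * x) (pi / L * (y - x)).
rewrite /cosn mul1r; apply: le_trans (ler_norm _).
have pyx : 0 <= pi / L * (y - x) by rewrite mulr_ge0 ?subr_ge0// divr_ge0// ltW.
have := g X0 pyx; rewrite -mulrDr subrKC => /(_ Y1); apply: le_trans.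
have yxt : t <= pi / L * (y - x).
  rewrite ge_min; apply/orP; right; rewrite ler_pM2l ?divr_gt0//.
  by apply: le_trans hd _; rewrite distrC ger0_norm// subr_ge0.
rewrite lerD2l lerN2; move: yxt; rewrite le_eqVlt => /predU1P[->//|yxt].
rewrite ltW// ltr_cos// !in_itv/=.
  by rewrite tpi ltW.
by rewrite pyx mulrBr; lra.
Qed.

(* Bernstein polynomials in (1 - cos (pi x / L)) / 2, which maps [0, L] onto [0, 1]. *)
Lemma weierstrass_cos (G : R -> R) (e : R) : continuous G -> 0 < e ->
  exists2 f, cspan f & forall x, 0 <= x <= L -> `|f x - G x| <= e.
Proof.
move=> cG e0; have e2 : 0 < e / 2 by rewrite divr_gt0.
have [d d0 hd] := uniformly_continuous_segment 0 L cG e2.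
have [k k0 hk] := cosn1_gap d0.
have [M0 hM0] : exists M0, forall x, 0 <= x <= L -> `|G x| <= M0.
  have cn : {within `[0, L], continuous (fun x => `|G x|)}.
    apply: continuous_subspaceT => x; apply: continuous_comp; first exact: cG.
    exact: norm_continuous.
  by have [c _ hc] := EVT_max (ltW L0) cn; exists (`|G c|) => x hx; apply: hc; rewrite in_itv.
pose M := Num.max 0 M0.
have hM x : 0 <= x <= L -> `|G x| <= M by move=> /hM0 h; rewrite le_max h orbT.
have M0' : 0 <= M by rewrite le_max lexx.
(* Points at distance at least d have u-values at least k / 2 apart, so K times the squared gap
   exceeds the trivial bound 2 M. *)
pose K := 2 * M / (k / 2) ^+ 2.
have K0 : 0 <= K by apply: mulr_ge0; [exact: mulr_ge0|rewrite invr_ge0 sqr_ge0].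
pose u x := (1 - cosn 1 x) / 2.
have u01 x : 0 <= u x <= 1.
  by rewrite /u; have := cos_le1 (1%:R * pi / L * x); have := cos_geN1 (1%:R * pi / L * x); rewrite -/(cosn 1 x) => ? ?; apply/andP; split; lra.
have [n hn] : exists n : nat, K / n.+1%:R <= e / 2.
  exists (Num.truncn (K / (e / 2))); rewrite ler_pdivrMr// mulrC -ler_pdivrMr//.
  by rewrite ltW// truncnS_gt.
(* The point of [0, L] where u takes the value i / (n + 1). *)
pose node i : R := L / pi * acos (1 - 2 * (i%:R / n.+1%:R)).
have p0 := pi_gt0 R.
have ratio i : (i <= n.+1)%N -> 0 <= (i%:R / n.+1%:R : R) <= 1.
  by move=> i_n; rewrite divr_ge0//= ler_pdivrMr// mul1r ler_nat.
have nodeL i : (i <= n.+1)%N -> 0 <= node i <= L.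
  move=> /ratio /andP[r0 r1]; set r := _ / _ in r0 r1 *.
  have r2 : -1 <= 1 - 2 * r <= 1 by apply/andP; split; lra.
  rewrite /node mulr_ge0 ?divr_ge0 ?acos_ge0 ?(ltW L0) ?(ltW p0)//=.
  rewrite mulrAC ler_pdivrMr// ler_wpM2l ?(ltW L0)//.
  exact: acos_lepi.
have unode i : (i <= n.+1)%N -> u (node i) = i%:R / n.+1%:R.
  move=> /ratio /andP[r0 r1]; set r := _ / _ in r0 r1 *.
  rewrite /u /cosn /node mul1r mulrA (_ : pi / L * (L / pi) = 1); last first.
    by rewrite mulrA divfK ?divff ?gt_eqF.
  have -> : cos (1 * acos (1 - 2 * r)) = 1 - 2 * r; last by lra.
  rewrite mul1r acosK// in_itv/=.
  by apply/andP; split; lra.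
exists (fun x => bernstein n.+1 (u x) (fun i => G (node i))).
  exact: cspan_bernstein.
move=> x xL; apply: (@le_trans _ _ (e / 2 + K / n.+1%:R)).
  2: by rewrite [leRHS](splitr e) lerD2l.
apply: bernstein_dist => // i i_n; rewrite -unode//.
have [near_|far] := ltP `|node i - x| d.
  apply: (@le_trans _ _ (e / 2)); first by rewrite ltW// hd// nodeL.
  by rewrite lerDl mulr_ge0// sqr_ge0.
apply: (@le_trans _ _ (2 * M)).
  apply: (le_trans (ler_normB _ _)); rewrite mulr_natl mulr2n lerD// hM// nodeL//.
apply: (@le_trans _ _ (K * (k / 2) ^+ 2)).
  by rewrite /K divfK// expf_neq0// gt_eqF// divr_gt0.
rewrite -[leLHS]add0r lerD ?(ltW e2)// ler_wpM2l//.
rewrite -[leRHS]real_normK ?num_real// ler_sqr ?nnegrE ?divr_ge0 ?(ltW k0)//.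
have := hk _ _ (nodeL _ i_n) xL far.
have -> : u (node i) - u x = 2^-1 * - (cosn 1 (node i) - cosn 1 x).
  by rewrite /u; ring.
by rewrite normrM normrN gtr0_norm ?invr_gt0// mulrC ler_pM2l ?invr_gt0.
Qed.

End TrigonometricSpan.

(** * Density of cosines and sines in L^2 *)

Section L2Density.
Variables (R : realType) (L : R).
Hypothesis L0 : 0 < L.
Local Notation mu := (@lebesgue_measure R).
Local Notation I := (`]0, L[%classic : set R).
Local Notation sq := (@square_integrable R L).
Local Notation cl := (@L2class R L).
Local Notation ipL := (@ipL2 R L).
Local Notation nrm := (hnorm ipL).
Local Notation clr F := (cl (fun x => (F x)%:C)).
Let mI : measurable I := @measurable_I0L R L.
Let ipP := @ipL2_inner R L.
Implicit Types (F G : R -> R) (u v : L2 L).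

Lemma measure_I : mu I = L%:E.
Proof.
by rewrite lebesgue_measure_itv /= lte_fin L0 oppr0 adde0.
Qed.

Lemma sq_continuous G : continuous G -> sq (fun x => (G x)%:C).
Proof.
move=> cG; have mG : cmeasurable I (fun x => (G x)%:C).
  by apply: cmeasurable_real; apply: measurable_funTS; exact: continuous_measurable_fun.
have cn : {within `[0, L], continuous (fun x => `|G x|)}.
  apply: continuous_subspaceT => x; apply: continuous_comp; first exact: cG.
  exact: norm_continuous.
have [c _ hc] := EVT_max (ltW L0) cn; apply: (@sq_bounded _ _ _ (`|G c| ^+ 2)) => // x Ix.
rewrite sqmod_real -real_normK ?num_real// ler_sqr ?nnegrE//; apply: hc.
exact: subset_itv_oo_cc.
Qed.

(* L^1-approximation by continuous functions, clipped to the bound of F. *)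
Lemma continuous_dense_bounded F (N e : R) : measurable_fun I F -> 0 < N ->
  (forall x, I x -> `|F x| <= N) -> 0 < e ->
  exists2 G : R -> R, continuous G & nrm (clr F - clr G) <= e.
Proof.
move=> mF N0 FN e0.
have Fs : sq (fun x => (F x)%:C).
  apply: (@sq_bounded _ _ _ (N ^+ 2)); first exact: cmeasurable_real.
  move=> x /FN; rewrite sqmod_real -[X in _ -> X <= _]real_normK ?num_real//.
  by rewrite ler_sqr ?nnegrE// ltW.
have iN : mu.-integrable I (fun=> N%:E).
  apply: (@integrableS _ _ _ mu `[0, L]) => //; first exact: subset_itv_oo_cc.
  apply: (@continuous_compact_integrable R (fun=> N)); first exact: segment_compact.
  by apply: continuous_subspaceT => x; exact: cvg_cst.
have iF : mu.-integrable I (EFin \o F).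
  refine (@le_integrable _ _ _ mu I mI _ _ _ _ iN); first exact/measurable_EFinP.
  by move=> x Ix; rewrite lee_fin (ger0_norm (ltW N0)) FN.
have fin : (mu I < +oo)%E by rewrite measure_I ltry.
have [g [cg ig hg]] := approximation_continuous_integrable mI fin iF.
(* After clipping, |F - G| is at most 2 N and at most |F - g|, so |F - G|^2 <= 2 N |F - g|: the L^1
   error must be e^2 / (2 N). *)
have e1 : 0 < e ^+ 2 / (2 * N) by rewrite divr_gt0 ?exprn_gt0 ?mulr_gt0.
have [n hn] : exists n, (\int[mu]_(z in I) `|(F z - g n z)%:E| <= (e ^+ 2 / (2 * N))%:E)%E.
  have /fine_cvgP[_] := hg; move/cvgrPdist_le => /(_ _ e1)[n _ h].
  exists n; have := h n (leqnn n); rewrite /= sub0r normrN.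
  rewrite ger0_norm; last by rewrite fine_ge0// integral_ge0.
  rewrite -lee_fin fineK//.
  have iFg : mu.-integrable I (EFin \o (fun z => F z - g n z)).
    exact: (@integrableB _ _ _ mu I mI _ _ iF (ig n)).
  by rewrite ge0_fin_numE ?integral_ge0//; have /integrableP[_] := iFg.
pose G x := Num.max (- N) (Num.min N (g n x)).
have cG : continuous G.
  have cc (k : R) : continuous (fun _ : R => k) by move=> x; exact: cvg_cst.
  by move=> x; apply: (continuous_max (cc _ x)); exact: (continuous_min (cc _ x) (cg n x)).
exists G => //; apply: le_of_sqr; first exact: ltW.
have Gs := sq_continuous cG; have FGs := sqB Fs Gs.
rewrite -L2classB// hnorm_cl//.
have [_ _ i1] := FGs.
have iFg : mu.-integrable I (fun z => (F z - g n z)%:E).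
  exact: (@integrableB _ _ _ mu I mI _ _ iF (ig n)).
have iaFg : mu.-integrable I (fun z => `|F z - g n z|%:E).
  refine (@le_integrable _ _ _ mu I mI _ _ _ _ iFg).
    apply/measurable_EFinP; apply: measurableT_comp => //.
    by apply/measurable_EFinP; exact: (measurable_int mu iFg).
  by move=> x _; rewrite lee_fin normr_id.
rewrite -lee_fin -(RintegralE mI i1).
apply: (@le_trans _ _ (\int[mu]_(x in I) ((2 * N) * `|F x - g n x|)%:E)%E).
  apply: ge0_le_integral => //.
  - by move=> x _; rewrite lee_fin sqmod_ge0.
  - by apply/measurable_EFinP; apply: measurable_sqmod => //; exact: sq_meas.
  - exact: (measurable_int mu (rintegrableZ _ mI iaFg)).
  - move=> x Ix; rewrite lee_fin -rmorphB sqmod_real /G.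
    have := FN _ Ix; rewrite ler_norml => /andP[f1 f2].
    move: (F x) (g n x) f1 f2 => a b a1 a2.
    rewrite -real_normK ?num_real// expr2.
    have h : `|a - Num.max (- N) (Num.min N b)| <= `|a - b|.
      have [b1|b1] := leP N b.
        rewrite max_r; last by lra.
        by rewrite !ler0_norm; lra.
      have [b2|b2] := leP (- N) b => //.
      by rewrite !ger0_norm; lra.
    have h2 : `|a - Num.max (- N) (Num.min N b)| <= 2 * N.
      rewrite ler_norml; apply/andP; split.
        by have : Num.max (- N) (Num.min N b) <= N; [rewrite ge_max ge_min lexx orTb; lra|lra].
      by have : - N <= Num.max (- N) (Num.min N b); [rewrite le_max lexx|lra].
    by apply: ler_pM.
rewrite (_ : (fun x => _) = (fun x => (2 * N)%:E * `|(F x - g n x)%:E|))%E//.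
rewrite (@integralZl _ _ _ mu I mI _ iaFg).
apply: (@le_trans _ _ ((2 * N)%:E * (e ^+ 2 / (2 * N))%:E)%E).
  by rewrite lee_pmul2l// lte_fin mulr_gt0.
by rewrite lee_fin mulrC divfK// gt_eqF// mulr_gt0.
Qed.

(** Take b = F / s on the set where |F| <= n s and 0 elsewhere; these sets exhaust I because s is
    positive there, and dominated convergence applies with majorant F^2. The bound n + 1 instead of
    n keeps N positive. *)
Lemma truncation_dense F (s : R -> R) (e : R) : sq (fun x => (F x)%:C) ->
  continuous s -> (forall x, I x -> 0 < s x) -> 0 < e ->
  exists (N : R) (b : R -> R), [/\ 0 < N, measurable_fun I b,
    forall x, I x -> `|b x| <= N & nrm (clr F - clr (fun x => s x * b x)) <= e].
Proof.
move=> Fs cs s0 e0; have [mF _ iF2] := Fs.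
have ms : measurable_fun I s.
  by apply: measurable_funTS; exact: continuous_measurable_fun.
pose E (n : nat) := I `&` [set x | `|F x| <= n%:R * s x].
have mE n : measurable (E n).
  have h1 : measurable_fun I (fun x => `|F x|%:E).
    by apply/measurable_EFinP; exact: measurableT_comp.
  have h2 : measurable_fun I (fun x => (n%:R * s x)%:E).
    by apply/measurable_EFinP; exact: measurable_funM.
  by have := measurable_lee mI h1 h2.
pose b n x := \1_(E n) x * (F x / s x).
have mb n : measurable_fun I (b n).
  apply: measurable_funM; first exact: measurable_indic.
  apply: measurable_funM => //.
  apply: open_continuous_measurable_fun; first exact: interval_open.
  move=> x /set_mem /s0 sx; apply: cvgV; last exact: cs.
  exact: lt0r_neq0.
have bn n x : I x -> `|b n x| <= n.+1%:R.
  move=> Ix; rewrite /b indicE; have [xE|xE] := boolP (x \in E n); last first.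
    by rewrite mul0r normr0.
  rewrite mul1r normrM normfV (gtr0_norm (s0 _ Ix)) ler_pdivrMr ?s0//.
  move: xE => /set_mem[_ /= h]; apply: (le_trans h).
  by rewrite ler_wpM2r ?(ltW (s0 _ Ix))// ler_nat.
have sb n x : I x -> F x - s x * b n x = F x * (1 - \1_(E n) x).
  move=> Ix; rewrite /b; have := s0 _ Ix => sx; field; exact: lt0r_neq0.
have sbs n : sq (fun x => (s x * b n x)%:C).
  have := @sq_mulb _ L (fun x => (\1_(E n) x)%:C) _ 1 _ _ Fs.
  move=> h; have {h} : sq (fun x => (\1_(E n) x)%:C * (F x)%:C).
    apply: h; first by apply: cmeasurable_real; exact: measurable_indic.
    by move=> x _; rewrite sqmod_real indicE; case: (_ \in _); rewrite ?expr1n ?expr0n.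
  apply: sq_ae.
    by apply: cmeasurable_real; exact: measurable_funM.
  apply: (filterE (aeF R)) => x Ix; rewrite -rmorphM /=; congr (_%:C).
  by rewrite /b; have := s0 _ Ix => sx; field; exact: lt0r_neq0.
have md n : measurable_fun I (fun x : R => F x - s x * b n x).
  by apply: measurable_funB => //; exact: measurable_funM.
have key : (\int[mu]_(x in I) ((F x - s x * b n x) ^+ 2)%:E)%E @[n --> \oo] --> 0%E.
  have [] := @dominated_convergence _ _ _ mu I mI
     (fun n x => ((F x - s x * b n x) ^+ 2)%:E) (fun=> 0%E) (fun x => (F x ^+ 2)%:E).
  - by move=> n; apply/measurable_EFinP; apply: measurable_funX; exact: md.
  - exact: measurable_cst.
  - apply: aeW => x Ix; apply: cvg_EFin; first by near=> n.
    apply: cvg_near_cst; near=> n; rewrite /= sb// indicE mem_set ?subrr ?mulr0 ?expr0n//.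
    split => //=; rewrite -ler_pdivrMr ?s0//.
    by near: n; exact: nbhs_infty_ger.
  - by move: iF2; congr integrable; apply/funext => x; rewrite sqmod_real.
  - apply: aeW => x n Ix; rewrite lee_fin ger0_norm ?sqr_ge0// sb// exprMn.
    rewrite ler_piMr ?sqr_ge0// indicE; case: (_ \in _); rewrite ?subrr ?subr0 ?expr1n ?expr0n//.
  by rewrite integral0.
have /fine_cvgP[_] := key; move/cvgrPdist_le => /(_ _ (exprn_gt0 2 e0))[n _ h].
exists n.+1%:R, (b n); split => //; first exact: bn.
apply: le_of_sqr; first exact: ltW.
rewrite -L2classB// hnorm_cl; last exact: sqB.
have := h n (leqnn n); rewrite /= sub0r normrN; apply: le_trans.
apply: le_trans (ler_norm _); rewrite le_eqVlt; apply/orP; left; apply/eqP.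
by congr fine; apply: eq_integral => x _; rewrite -rmorphB sqmod_real.
Unshelve. all: by end_near. Qed.

Lemma cspan_continuous f : fspan (cosn L) f -> continuous f.
Proof.
move=> [N [a fa]]; have -> : f = fun x => \sum_(0 <= n < N) a n * cosn L n x by exact/funext.
elim: N {fa} => [|N IH] x.
  by under eq_fun do rewrite big_geq//; exact: cvg_cst.
under eq_fun do rewrite big_nat_recr//=.
apply: cvgD; first exact: IH.
apply: cvgM; first exact: cvg_cst.
apply: continuous_comp; last exact: continuous_cos.
by apply: cvgM; [exact: cvg_cst|exact: cvg_id].
Qed.

(* With s = sin (pi x / L) the products s * f lie in the span of the sines. *)
Lemma weighted_cos_dense F (s : R -> R) (e : R) : sq (fun x => (F x)%:C) ->
  continuous s -> (forall x, I x -> 0 < s x <= 1) -> 0 < e ->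
  exists2 f, fspan (cosn L) f &
    forall g, (forall x, g x = s x * f x) -> nrm (clr F - clr g) < e.
Proof.
move=> Fs cs s01 e0; have e4 : 0 < e / 4 by rewrite divr_gt0.
have s0 x : I x -> 0 < s x by move=> /s01/andP[].
have ms : cmeasurable I (fun x => (s x)%:C).
  by apply: cmeasurable_real; apply: measurable_funTS; exact: continuous_measurable_fun.
have sle x : I x -> sqmod (s x)%:C <= 1.
  by move=> Ix; rewrite sqmod_real expr_le1//; have /andP[/ltW] := s01 _ Ix.
have [N [b [N0 mb bN h1]]] := truncation_dense Fs cs s0 e4.
have [G cG h2] := continuous_dense_bounded mb N0 bN e4.
(* A uniform error of this size on (0, L) is an L^2 error of e / 4. *)
have e5 : 0 < e / 4 / Num.sqrt L by rewrite divr_gt0// sqrtr_gt0.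
have [f fsp h3] := weierstrass_cos L0 cG e5.
exists f => // g gE; have -> : g = fun x => s x * f x by exact/funext.
have {g gE} cf := cspan_continuous fsp.
have bs : sq (fun x => (b x)%:C).
  apply: (@sq_bounded _ _ _ (N ^+ 2)); first exact: cmeasurable_real.
  move=> x /bN; rewrite sqmod_real -[X in _ -> X <= _]real_normK ?num_real//.
  by rewrite ler_sqr ?nnegrE// ltW.
have Gs := sq_continuous cG; have fs := sq_continuous cf.
have h4 : nrm (clr G - clr f) <= e / 4.
  apply: le_of_sqr; first exact: ltW.
  rewrite -L2classB// hnorm_cl; last exact: sqB.
  have [_ _ i1] := sqB Gs fs.
  rewrite -lee_fin -(RintegralE mI i1).
  apply: (@le_trans _ _ (\int[mu]_(x in I) ((e / 4 / Num.sqrt L) ^+ 2)%:E)%E).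
    apply: ge0_le_integral => //.
    - by move=> x _; rewrite lee_fin sqmod_ge0.
    - by apply/measurable_EFinP; apply: measurable_sqmod => //; apply: sq_meas; exact: sqB.
    - move=> x Ix; rewrite lee_fin -rmorphB sqmod_real -[leLHS]real_normK ?num_real//.
      rewrite ler_sqr ?nnegrE ?(ltW e5)// distrC; apply: h3.
      by have := subset_itv_oo_cc Ix; rewrite /= in_itv.
  rewrite integral_cst// [X in (_ * X)%E](_ : _ = L%:E); last exact: measure_I.
  rewrite -EFinM lee_fin expr_div_n sqr_sqrtr ?(ltW L0)//.
  by rewrite divfK// gt_eqF.
have smul g : sq (fun x => (g x)%:C) -> sq (fun x => (s x * g x)%:C).
  move=> gs; rewrite (_ : (fun x => _) = fun x => (s x)%:C * (g x)%:C).
    exact: sq_mulb ms sle gs.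
  by apply/funext => x; rewrite rmorphM.
have sdist g g' : sq (fun x => (g x)%:C) -> sq (fun x => (g' x)%:C) ->
    nrm (clr (fun x => s x * g x) - clr (fun x => s x * g' x)) <= nrm (clr g - clr g').
  move=> gs gs'; rewrite -(L2classB (smul _ gs) (smul _ gs')) -(L2classB gs gs').
  rewrite (_ : (fun x => (s x * g x)%:C - _) = fun x => (s x)%:C * ((g x)%:C - (g' x)%:C)).
    apply: le_of_sqr; first exact: hnorm_ge0.
    by rewrite -[leRHS]mul1r; exact: hnorm_mulb ms sle (sqB gs gs').
  by apply/funext => x; rewrite !rmorphM /=; ring.
apply: (le_lt_trans (hnorm_dist ipP _ (clr (fun x => s x * b x)) _)).
have : nrm (clr (fun x => s x * b x) - clr (fun x => s x * f x)) <= e / 4 + e / 4.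
  apply: (le_trans (hnorm_dist ipP _ (clr (fun x => s x * G x)) _)).
  by apply: lerD; [apply: le_trans h2; exact: sdist|apply: le_trans h4; exact: sdist].
move: h1; set p := nrm (clr F - _); set q := nrm (_ - clr (fun x => s x * f x)).
by move: p q => p q; lra.
Qed.

Definition cosC n : L2 L := clr (cosn L n).
Definition sinC n : L2 L := clr (sinn L n).

Lemma cosn_continuous n : continuous (cosn L n).
Proof.
move=> x; apply: continuous_comp; last exact: continuous_cos.
by apply: cvgM; [exact: cvg_cst|exact: cvg_id].
Qed.

Lemma sinn_continuous n : continuous (sinn L n).
Proof.
move=> x; apply: continuous_comp; last exact: continuous_sin.
by apply: cvgM; [exact: cvg_cst|exact: cvg_id].
Qed.

Lemma clr_sum (B : nat -> R -> R) N (a : nat -> R) : (forall n, continuous (B n)) ->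
  clr (fun x => \sum_(0 <= n < N) a n * B n x) =
  \sum_(0 <= n < N) (a n)%:C *: clr (B n).
Proof.
move=> cB; elim: N => [|N IH].
  by rewrite big_geq//; under eq_fun do rewrite big_geq//; exact: L2class0.
rewrite big_nat_recr//= -IH -L2classZ; last exact: sq_continuous.
rewrite -L2classD; first by congr L2class; apply/funext => x; rewrite big_nat_recr//= rmorphD rmorphM.
  apply: sq_continuous => x.
  elim: {IH} N => [|N IH]; first by under eq_fun do rewrite big_geq//; exact: cvg_cst.
  under eq_fun do rewrite big_nat_recr//=.
  by apply: cvgD => //; apply: cvgM; [exact: cvg_cst|exact: cB].
by apply: sqZ; exact: sq_continuous.
Qed.

Lemma complex_dense (B : nat -> R -> R) : (forall n, continuous (B n)) ->
  (forall F (e : R), sq (fun x => (F x)%:C) -> 0 < e ->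
     exists2 f, fspan B f & nrm (clr F - clr f) < e) ->
  forall u (e : R), 0 < e -> exists N (a : nat -> R[i]),
    nrm (u - \sum_(0 <= n < N) a n *: clr (B n)) < e.
Proof.
move=> cB dB u e e0; have e2 : 0 < e / 2 by rewrite divr_gt0.
have us := L2_sq u; have [mr mi iu] := us.
have part (P : R[i] -> R) : (forall z : R[i], P z ^+ 2 <= sqmod z) ->
    measurable_fun I (fun x => P (u x)) -> sq (fun x => (P (u x))%:C).
  move=> hP mP; split; [exact: mP|exact: measurable_cst|].
  refine (@le_integrable _ _ _ mu I mI _ _ _ _ iu).
    apply/measurable_EFinP; under [X in measurable_fun _ X]eq_fun do rewrite sqmod_real.
    exact: measurable_funX.
  move=> x _; rewrite lee_fin !ger0_norm ?sqmod_ge0// sqmod_real; exact: hP.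
have rs := part _ (@sqr_Re_le R) mr; have is_ := part _ (@sqr_Im_le R) mi.
have [f [N [a fa]] hf] := dB _ _ rs e2; have [g [M [b gb]] hg] := dB _ _ is_ e2.
have uE : u = clr (fun x => Re (u x)) + 'i *: clr (fun x => Im (u x)).
  rewrite -L2classZ// -L2classD//; last exact: sqZ.
  rewrite -[LHS]L2class_fun; congr L2class; apply/funext => x.
  by rewrite [LHS]complexE.
have fE : clr f = \sum_(0 <= n < N) (a n)%:C *: clr (B n).
  by rewrite -clr_sum//; congr L2class; apply/funext => x; rewrite fa.
have gE : clr g = \sum_(0 <= n < M) (b n)%:C *: clr (B n).
  by rewrite -clr_sum//; congr L2class; apply/funext => x; rewrite gb.
have ext K P (c : nat -> R[i]) : (K <= P)%N -> \sum_(0 <= n < K) c n *: clr (B n) =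
    \sum_(0 <= n < P) (if (n < K)%N then c n else 0) *: clr (B n).
  move=> KP; rewrite [RHS](@big_cat_nat _ _ _ K)//= [X in _ + X]big_nat.
  rewrite [X in _ + X]big1 ?addr0 => [|i /andP[Ki _]]; last first.
    by rewrite ltnNge Ki scale0r.
  by rewrite [LHS]big_nat [RHS]big_nat; apply: eq_bigr => i /andP[_ ->].
exists (maxn N M), (fun n => (if (n < N)%N then (a n)%:C else 0) +
                            'i * (if (n < M)%N then (b n)%:C else 0)).
under eq_bigr do rewrite scalerDl -scalerA.
rewrite big_split /= -scaler_sumr -!ext ?leq_maxl ?leq_maxr//.
rewrite -fE -gE {1}uE opprD addrACA -scalerBr.
apply: (le_lt_trans (hnormD_le ipP _ _)); rewrite (splitr e); apply: ltrD; first exact: hf.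
apply: le_lt_trans hg; rewrite le_eqVlt; apply/orP; left; apply/eqP.
by rewrite (hnormZ ipP) /sqmod /= expr0n expr1n add0r sqrtr1 mul1r.
Qed.

Lemma cos_dense u (e : R) : 0 < e -> exists N (a : nat -> R[i]),
  nrm (u - \sum_(0 <= n < N) a n *: cosC n) < e.
Proof.
apply: complex_dense; first exact: cosn_continuous.
move=> F d Fs d0; have [| |f fsp h] := @weighted_cos_dense F (fun=> 1) d Fs _ _ d0.
- by move=> x; exact: cvg_cst.
- by move=> x _; rewrite ltr01 lexx.
by exists f => //; apply: h => x; rewrite mul1r.
Qed.

(** Sine sums vanish at 0 and L and cannot approximate uniformly. Factoring out the weight sin (pi x
    / L) leaves a function to be approximated by a cosine sum, and weight times cosine sum is a sine
    sum. *)
Lemma sin_dense u (e : R) : 0 < e -> exists N (a : nat -> R[i]),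
  nrm (u - \sum_(0 <= n < N) a n *: sinC n.+1) < e.
Proof.
apply: (@complex_dense (fun n => sinn L n.+1)); first by move=> n; exact: sinn_continuous.
move=> F d Fs d0; have [| |f fsp h] := @weighted_cos_dense F (sinn L 1) d Fs _ _ d0.
- exact: sinn_continuous.
- move=> x; rewrite /= in_itv/= => /andP[x0 xL]; have p0 := pi_gt0 R.
  rewrite sin_le1 andbT; apply: sin_gt0_pi; rewrite mul1r mulr_gt0 ?divr_gt0//=.
  by rewrite mulrAC ltr_pdivrMr// ltr_pM2l.
exists (fun x => f x * sinn L 1 x); first exact: cspan_mul_sin.
by apply: h => x; rewrite mulrC.
Qed.

End L2Density.

(** * Absolutely continuous functions and weak derivatives *)

Section ComplexDerivative.
Variable R : realType.
Implicit Types (F G f g : R -> R[i]) (x : R).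

Definition cderive F f := forall x, is_derive x 1 (fun t => Re (F t)) (Re (f x)) /\
  is_derive x 1 (fun t => Im (F t)) (Im (f x)).

Definition ccontinuous f := continuous (fun t => Re (f t)) /\ continuous (fun t => Im (f t)).

Lemma is_derive_continuous (f : R -> R) (df : R -> R) :
  (forall x, is_derive x 1 f (df x)) -> continuous f.
Proof.
move=> h x; apply: differentiable_continuous; apply/derivable1_diffP.
by have [] := h x.
Qed.

Lemma cderive_continuous F f : cderive F f -> ccontinuous F.
Proof.
move=> h; split.
  by apply: (@is_derive_continuous _ (fun x => Re (f x))) => x; have [] := h x.
by apply: (@is_derive_continuous _ (fun x => Im (f x))) => x; have [] := h x.
Qed.

Lemma ccontinuousM F G : ccontinuous F -> ccontinuous G ->
  ccontinuous (fun x => F x * G x).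
Proof.
move=> [F1 F2] [G1 G2]; split => t; rewrite /continuous_at ?(cReM, cImM).
  by under eq_fun do rewrite cReM; apply: cvgB; apply: cvgM;
    [exact: F1|exact: G1|exact: F2|exact: G2].
by under eq_fun do rewrite cImM; apply: cvgD; apply: cvgM;
  [exact: F1|exact: G2|exact: F2|exact: G1].
Qed.

Lemma ccontinuousD F G : ccontinuous F -> ccontinuous G ->
  ccontinuous (fun x => F x + G x).
Proof.
move=> [F1 F2] [G1 G2]; split => t; rewrite /continuous_at ?(cReD, cImD).
  by under eq_fun do rewrite cReD; apply: cvgD; [exact: F1|exact: G1].
by under eq_fun do rewrite cImD; apply: cvgD; [exact: F2|exact: G2].
Qed.

Lemma cderive_cst (k : R[i]) : cderive (fun=> k) (fun=> 0).
Proof. by move=> x; split; exact: is_derive_cst. Qed.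

Lemma cderiveD F f G g : cderive F f -> cderive G g ->
  cderive (fun x => F x + G x) (fun x => f x + g x).
Proof.
move=> hF hG x; have [F1 F2] := hF x; have [G1 G2] := hG x; split.
  by under eq_fun do rewrite cReD; rewrite cReD; exact: is_derive_funD.
by under eq_fun do rewrite cImD; rewrite cImD; exact: is_derive_funD.
Qed.

Lemma cderiveM F f G g : cderive F f -> cderive G g ->
  cderive (fun x => F x * G x) (fun x => f x * G x + F x * g x).
Proof.
move=> hF hG x; have [F1 F2] := hF x; have [G1 G2] := hG x; split.
  under eq_fun do rewrite cReM.
  have := is_derive_funD (is_derive_funM F1 G1) (is_derive_funN (is_derive_funM F2 G2)).
  by congr is_derive; rewrite !ReImE; ring.
under eq_fun do rewrite cImM.
have := is_derive_funD (is_derive_funM F1 G2) (is_derive_funM F2 G1).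
by congr is_derive; rewrite !ReImE; ring.
Qed.

Lemma cderiveZ a F f : cderive F f -> cderive (fun x => a * F x) (fun x => a * f x).
Proof.
move=> hF; have := cderiveM (cderive_cst a) hF.
by congr cderive; apply/funext => x; rewrite mul0r add0r.
Qed.

Lemma cderive_real (F f : R -> R) : (forall x, is_derive x 1 F (f x)) ->
  cderive (fun x => (F x)%:C) (fun x => (f x)%:C).
Proof. by move=> h x; split; [exact: h|exact: is_derive_cst]. Qed.

Lemma cRe_Cexp (z : R[i]) : Re (Cexp z) = expR (Re z) * cos (Im z).
Proof. by rewrite /Cexp cReM cRe_real cIm_real mul0r subr0. Qed.

Lemma cIm_Cexp (z : R[i]) : Im (Cexp z) = expR (Re z) * sin (Im z).
Proof. by rewrite /Cexp cImM cRe_real cIm_real mul0r addr0. Qed.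

Lemma cderive_Cexp (l : R[i]) :
  cderive (fun x => Cexp (l * x%:C)) (fun x => l * Cexp (l * x%:C)).
Proof.
have lr x : Re (l * x%:C) = x * Re l by rewrite !ReImE; ring.
have li x : Im (l * x%:C) = x * Im l by rewrite !ReImE; ring.
move=> x; split.
  under eq_fun do rewrite cRe_Cexp lr li; rewrite cReM cRe_Cexp cIm_Cexp lr li.
  have := is_derive_funM (is_derive_scale (is_derive_expR (x * Re l)))
    (is_derive_scale (is_derive_cos (x * Im l))).
  by congr is_derive; ring.
under eq_fun do rewrite cIm_Cexp lr li; rewrite cImM cRe_Cexp cIm_Cexp lr li.
have := is_derive_funM (is_derive_scale (is_derive_expR (x * Re l)))
  (is_derive_scale (is_derive_sin (x * Im l))).
by congr is_derive; ring.
Qed.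

Lemma ftc_real (F f : R -> R) x : (forall x, is_derive x 1 F (f x)) -> continuous f ->
  0 <= x -> \int[lebesgue_measure]_(t in `]0, x[) f t = F x - F 0.
Proof.
move=> dF cf; rewrite le_eqVlt => /predU1P[<-|x0].
  by rewrite set_itvoo0 Rintegral_set0 subrr.
have cF := is_derive_continuous dF.
have ic : lebesgue_measure.-integrable `[0, x] (EFin \o f).
  apply: continuous_compact_integrable; first exact: segment_compact.
  exact: continuous_subspaceT.
rewrite Rintegral_itv_bndo_bndc; last first.
  by apply: integrableS ic => //; apply: subset_itv; rewrite bnd_simp.
rewrite Rintegral_itv_obnd_cbnd; last first.
  by apply: integrableS ic => //; apply: subset_itv; rewrite bnd_simp.
rewrite /Rintegral (@continuous_FTC2 _ f F)//.
- exact: continuous_subspaceT.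
- split; first by move=> y _; have [] := dF y.
    by apply: cvg_at_right_filter; exact: cF.
  by apply: cvg_at_left_filter; exact: cF.
- by move=> y _; rewrite derive1E; have [_ ->] := dF y.
Qed.

Lemma ftc F f x : cderive F f -> ccontinuous f -> 0 <= x ->
  Cint `]0, x[ f = F x - F 0.
Proof.
move=> dF [c1 c2] x0; apply: complexP.
  rewrite cRe_Cint cReB.
  exact: (@ftc_real (fun t => Re (F t)) (fun t => Re (f t)) x (fun y => (dF y).1)).
rewrite cIm_Cint cImB.
exact: (@ftc_real (fun t => Im (F t)) (fun t => Im (f t)) x (fun y => (dF y).2)).
Qed.

End ComplexDerivative.

Opaque hnorm L2class ipL2 Cint.

(** * Primitives of L^2 functions and their product rule *)

Section Primitive.
Variables (R : realType) (L : R).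
Hypothesis L0 : 0 < L.
Local Notation mu := (@lebesgue_measure R).
Local Notation I := (`]0, L[%classic : set R).
Local Notation sq := (@square_integrable R L).
Local Notation cl := (@L2class R L).
Local Notation ipL := (@ipL2 R L).
Local Notation nrm := (hnorm ipL).
Let ipP := @ipL2_inner R L.
Implicit Types (f g u v : R -> R[i]) (x y : R).

Definition prim u x := Cint `]0, x[ u.

Lemma sq_cst (k : R[i]) : sq (fun=> k).
Proof.
apply: (@sq_bounded _ _ _ (sqmod k)) => [|x _]; last exact: lexx.
by split; exact: measurable_cst.
Qed.

Lemma sq_cintegrable u : sq u -> cintegrable I u.
Proof.
by move=> us; have := sq_mul us (sq_cst 1); under [X in cintegrable _ X]eq_fun do rewrite mulr1.
Qed.

(** Cauchy-Schwarz against the indicator of P. *)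
Lemma Cint_bound (P : set R) u : measurable P -> P `<=` I -> sq u ->
  sqmod (Cint P u) <= fine (mu P) * nrm (cl u) ^+ 2.
Proof.
move=> mP PI us; pose chi t : R[i] := (\1_P t)%:C.
have chis : sq chi.
  apply: (@sq_bounded _ _ _ 1).
    by apply: cmeasurable_real; exact: measurable_indic.
  by move=> x _; rewrite sqmod_real indicE; case: (_ \in _); rewrite ?expr1n ?expr0n.
have -> : Cint P u = ipL (cl u) (cl chi).
  rewrite ipL2_cl//.
  have E (g : R -> R) : \int[mu]_(x in P) g x = \int[mu]_(x in I) (g x * \1_P x).
    rewrite -[in LHS](setIidr PI) Rintegral_mkcondr.
    apply: eq_Rintegral => x _; rewrite /patch indicE.
    by case: (x \in P); rewrite ?mulr1 ?mulr0.
  apply: complexP; rewrite ?cRe_Cint ?cIm_Cint E; apply: eq_Rintegral => x _.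
    by rewrite !ReImE; ring.
  by rewrite !ReImE; ring.
apply: (le_trans (cauchy_schwarz ipP _ _)); rewrite mulrC ler_wpM2r ?sqr_ge0//.
rewrite hnorm_cl// le_eqVlt; apply/orP; left; apply/eqP.
have E t : (\1_P t : R) ^+ 2 = \1_P t.
  by rewrite indicE; case: (_ \in _); rewrite ?expr1n ?expr0n.
under eq_Rintegral do rewrite sqmod_real E.
by rewrite /Rintegral integral_indic// setIidl.
Qed.

Lemma prim_sub x : x <= L -> `]0, x[%classic `<=` I.
Proof. by move=> xL; apply: subset_itv; rewrite bnd_simp. Qed.

Lemma mprim x : measurable (`]0, x[%classic : set R).
Proof. exact: measurable_itv. Qed.

Lemma prim_cintegrable u x : sq u -> x <= L -> cintegrable `]0, x[ u.
Proof.
by move=> us xL; apply: cintegrableS (sq_cintegrable us) => //; exact: prim_sub.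
Qed.

Lemma prim_lin a u v x : sq u -> sq v -> x <= L ->
  prim (fun t => a * u t + v t) x = a * prim u x + prim v x.
Proof. by move=> us vs xL; apply: Cint_linear => //; exact: prim_cintegrable. Qed.

Lemma prim0 u : prim u 0 = 0.
Proof.
rewrite /prim set_itvoo0; apply: complexP; rewrite ?cRe_Cint ?cIm_Cint; exact: Rintegral_set0.
Qed.

Lemma primD u v x : sq u -> sq v -> x <= L ->
  prim (fun t => u t + v t) x = prim u x + prim v x.
Proof. by move=> us vs xL; apply: CintD => //; exact: prim_cintegrable. Qed.

Lemma primZ a u x : sq u -> x <= L -> prim (fun t => a * u t) x = a * prim u x.
Proof. by move=> us xL; apply: CintZ => //; exact: prim_cintegrable. Qed.

Lemma prim_ae u v x : sq u -> sq v -> x <= L ->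
  {ae mu, forall t, I t -> u t = v t} -> prim u x = prim v x.
Proof.
move=> us vs xL uv; apply: Cint_ae => //.
- exact: cintegrable_meas (prim_cintegrable us xL).
- exact: cintegrable_meas (prim_cintegrable vs xL).
- apply: filterS uv; first exact: aeF.
  by move=> t h It; apply: h; exact: prim_sub It.
Qed.

Lemma prim_dist u x y : sq u -> 0 <= y -> y <= x -> x <= L ->
  sqmod (prim u x - prim u y) <= (x - y) * nrm (cl u) ^+ 2.
Proof.
move=> us y0; rewrite le_eqVlt => /predU1P[->|yx] xL.
  by rewrite !subrr sqmod0 mul0r.
(* The case y = 0 is apart because 0 does not belong to I, so [[y, x[] is contained in I only for y
   > 0. *)
have [->|y1] := eqVneq y 0.
  rewrite prim0 !subr0; apply: le_trans (Cint_bound (mprim x) (prim_sub xL) us) _.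
  rewrite lebesgue_measure_itv /= lte_fin; case: ifP => [_|] /=; first by rewrite subr0.
  by move=> h; move: yx; rewrite ltNge; move: h; rewrite ltNge => /negbFE h; rewrite (le_trans h y0).
have U : `]0, x[%classic = `]0, y[ `|` `[y, x[ :> set R.
  by rewrite -itv_bndbnd_setU// bnd_simp ?(ltW yx)// lt0r y1.
have sub : `[y, x[%classic `<=` I.
  move=> t /=; rewrite !in_itv /= => /andP[yt tx].
  by rewrite (lt_le_trans _ yt) ?(lt_le_trans tx)// lt0r y1.
rewrite /prim U Cint_setU//.
- rewrite addrAC subrr add0r; apply: (le_trans (Cint_bound _ sub us)) => //.
  by rewrite lebesgue_measure_itv /= lte_fin yx.
- apply/seteqP; split => // t [] /=; rewrite !in_itv /= => /andP[_ ty] /andP[yt _].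
  by move: ty; rewrite ltNge yt.
- by rewrite -U; exact: prim_cintegrable.
Qed.

Lemma prim_bound u x : sq u -> 0 <= x <= L -> sqmod (prim u x) <= L * nrm (cl u) ^+ 2.
Proof.
move=> us /andP[x0 xL]; have := prim_dist us (lexx 0) x0 xL.
rewrite prim0 !subr0 => h; apply: (le_trans h).
by rewrite ler_wpM2r ?sqr_ge0.
Qed.

(** Projection onto [0, L]. Composition with it extends a function on [0, L] by constants, so
    continuity can be stated on the whole line. *)
Definition clamp x : R := Num.max 0 (Num.min L x).

Lemma clamp_id x : 0 <= x <= L -> clamp x = x.
Proof. by move=> /andP[x0 xL]; rewrite /clamp min_r// max_r. Qed.

Lemma clamp_itv x : 0 <= clamp x <= L.
Proof. by rewrite /clamp le_max lexx ge_max (ltW L0) ge_min lexx. Qed.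

Lemma clamp_dist x y : `|clamp x - clamp y| <= `|x - y|.
Proof.
wlog xy : x y / x <= y => [h|].
  have [xy|yx] := leP x y; first exact: h.
  by rewrite distrC [leRHS]distrC h// ltW.
rewrite [leRHS]distrC [leLHS]distrC [leRHS]ger0_norm ?subr_ge0//.
rewrite /clamp; case: (leP L x) => ?; case: (leP L y) => ?; case: (leP 0 L) => ?;
  case: (leP 0 x) => ?; case: (leP 0 y) => ?;
  by rewrite ler_norml; apply/andP; split; lra.
Qed.

Lemma prim_clamp_dist u x y : sq u ->
  sqmod (prim u (clamp x) - prim u (clamp y)) <= `|x - y| * nrm (cl u) ^+ 2.
Proof.
move=> us; apply: (@le_trans _ _ (`|clamp x - clamp y| * nrm (cl u) ^+ 2)); last first.
  by rewrite ler_wpM2r ?sqr_ge0// clamp_dist.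
have [/andP[x0 xL] /andP[y0 yL]] := (clamp_itv x, clamp_itv y).
have [yx|xy] := leP (clamp y) (clamp x).
  by rewrite ger0_norm ?subr_ge0// prim_dist.
by rewrite sqmodB distrC ger0_norm ?subr_ge0 ?(ltW xy)// prim_dist// ltW.
Qed.

Lemma sqmod_continuous (h : R -> R[i]) (C : R) :
  (forall x y, sqmod (h x - h y) <= `|x - y| * C) -> ccontinuous h.
Proof.
move=> hC; have C0 : 0 <= C.
  by have := hC 1 0; rewrite subr0 normr1 mul1r; apply: le_trans; exact: sqmod_ge0.
suff key (P : R[i] -> R) : (forall z w : R[i], P (z - w) = P z - P w) ->
    (forall z : R[i], P z ^+ 2 <= sqmod z) -> continuous (fun t => P (h t)).
  by split; apply: key; [exact: cReB|exact: sqr_Re_le|exact: cImB|exact: sqr_Im_le].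
move=> PB Ple x; apply/cvgrPdist_lt => e e0.
have d0 : 0 < e ^+ 2 / (C + 1) by rewrite divr_gt0 ?exprn_gt0// ltr_wpDl.
near=> y.
have xy : `|x - y| < e ^+ 2 / (C + 1) by near: y; exact: (nbhsx_ballx x _ d0).
rewrite -PB -ltr_sqr ?nnegrE ?(ltW e0)// real_normK ?num_real//.
apply: (le_lt_trans (Ple _)); apply: (le_lt_trans (hC _ _)).
apply: (@le_lt_trans _ _ (`|x - y| * (C + 1))); first by rewrite ler_wpM2l// lerDl.
by rewrite -ltr_pdivlMr ?ltr_wpDl.
Unshelve. all: by end_near. Qed.

Lemma prim_clamp_continuous u : sq u -> ccontinuous (fun x => prim u (clamp x)).
Proof. by move=> us; apply: sqmod_continuous => x y; exact: prim_clamp_dist. Qed.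

Lemma ccontinuous_meas h : ccontinuous h -> cmeasurable I h.
Proof.
by move=> [h1 h2]; split; apply: measurable_funTS; exact: continuous_measurable_fun.
Qed.

Lemma prim_meas u : sq u -> cmeasurable I (prim u).
Proof.
move=> us; have [h1 h2] := ccontinuous_meas (prim_clamp_continuous us).
have E x : x \in I -> prim u (clamp x) = prim u x.
  move=> /set_mem Ix; rewrite clamp_id//.
  by have := subset_itv_oo_cc Ix; rewrite /= in_itv.
by split; [apply: eq_measurable_fun h1|apply: eq_measurable_fun h2] => x /E ->.
Qed.

Lemma prim_bound_I u x : sq u -> I x -> sqmod (prim u x) <= L * nrm (cl u) ^+ 2.
Proof.
by move=> us Ix; apply: prim_bound => //; have := subset_itv_oo_cc Ix; rewrite /= in_itv.
Qed.

Lemma sq_prim u : sq u -> sq (prim u).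
Proof.
move=> us; apply: sq_bounded (prim_meas us) _ => x Ix; exact: prim_bound_I.
Qed.

Lemma ccontinuous_bounded h : ccontinuous h -> exists C, forall x, I x -> sqmod (h x) <= C.
Proof.
move=> [h1 h2].
have key (P : R -> R) : continuous P -> exists C, forall x, I x -> P x ^+ 2 <= C.
  move=> cP; have c2 : {within `[0, L], continuous (fun x => P x ^+ 2)}.
    apply: continuous_subspaceT => x; rewrite /continuous_at expr2.
    by under eq_fun do rewrite expr2; apply: cvgM; exact: cP.
  have [c _ hc] := EVT_max (ltW L0) c2; exists (P c ^+ 2) => x Ix.
  by apply: hc; exact: subset_itv_oo_cc.
have [[C hC] [D hD]] := (key _ h1, key _ h2).
by exists (C + D) => x Ix; apply: lerD; [exact: hC|exact: hD].
Qed.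

Lemma sq_ccontinuous h : ccontinuous h -> sq h.
Proof.
move=> ch; have [C hC] := ccontinuous_bounded ch.
exact: sq_bounded (ccontinuous_meas ch) hC.
Qed.

Lemma hnorm_prim u : sq u -> nrm (cl (prim u)) ^+ 2 <= L ^+ 2 * nrm (cl u) ^+ 2.
Proof.
move=> us; have := hnorm_mulb (prim_meas us) (fun x => @prim_bound_I u x us) (sq_cst 1).
rewrite (_ : (fun x => prim u x * 1) = prim u); last first.
  by apply/funext => x; rewrite mulr1.
move=> h; apply: (le_trans h).
rewrite [X in _ * X]hnorm_cl; last exact: sq_cst.
under eq_Rintegral do rewrite sqmod1.
rewrite Rintegral_cst// mul1r [X in fine X](_ : _ = L%:E); last exact: measure_I.
by rewrite /= expr2 mulrAC.
Qed.

(** By density of the cosines. Any identity that is linear and bounded in an L^2 argument thus needs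
    checking on cosines only. *)
Lemma functional_vanish (l : L2 L -> R[i]) (C : R) :
  (forall (a : R[i]) (u v : L2 L), l (a *: u + v) = a * l u + l v) ->
  (forall u : L2 L, sqmod (l u) <= C * nrm u ^+ 2) ->
  (forall n, l (cosC L n) = 0) -> forall u : L2 L, l u = 0.
Proof.
move=> lin bd l0 u; have lz : l 0 = 0.
  by have := lin (-1) 0 0; rewrite scaler0 addr0 mulN1r addNr.
have lsum N (a : nat -> R[i]) : l (\sum_(0 <= n < N) a n *: cosC L n) = 0.
  elim: N => [|N IH]; first by rewrite big_geq.
  by rewrite big_nat_recr//= addrC lin IH l0 mulr0 addr0.
have C0 : 0 <= Num.max C 0 by rewrite le_max lexx orbT.
apply/eqP; rewrite -sqmod_eq0 eq_le sqmod_ge0 andbT.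
apply/ler_addgt0Pl => e e0; rewrite addr0.
have d0 : 0 < e / (Num.max C 0 + 1) by rewrite divr_gt0// ltr_wpDl.
have s0 : 0 < Num.sqrt (e / (Num.max C 0 + 1)) by rewrite sqrtr_gt0.
have [N [a ha]] := cos_dense L0 u s0.
have -> : l u = l (u - \sum_(0 <= n < N) a n *: cosC L n).
  rewrite addrC -scaleN1r lin lsum mulr0 add0r//.
apply: (le_trans (bd _)).
have : nrm (u - \sum_(0 <= n < N) a n *: cosC L n) ^+ 2 <= e / (Num.max C 0 + 1).
  rewrite -[leRHS](sqr_sqrtr (ltW d0)) ler_sqr ?nnegrE ?sqrtr_ge0 ?hnorm_ge0//.
  exact: ltW.
set q := nrm _ ^+ 2 => hq; have q0 : 0 <= q by exact: sqr_ge0.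
apply: (@le_trans _ _ ((Num.max C 0 + 1) * q)).
  by rewrite ler_wpM2r//; apply: ler_wpDr => //; rewrite le_max lexx.
by rewrite mulrC -ler_pdivlMr// ltr_wpDl.
Qed.

Lemma prim_eq u v x : (forall t, 0 < t < x -> u t = v t) -> prim u x = prim v x.
Proof. by move=> uv; apply: CintE => t /set_mem; rewrite /= in_itv => /uv. Qed.

Lemma prim_conj u x : sq u -> x <= L -> prim (fun t => conjc (u t)) x = conjc (prim u x).
Proof. by move=> us xL; apply: Cint_conj => //; exact: prim_cintegrable. Qed.

Lemma prim_L u : prim u L = Cint I u. Proof. by []. Qed.

Opaque prim.

(** Failure at x of the product rule for the primitives of u and v. It is linear and bounded in each
    argument, which brings [functional_vanish] into play. *)
Definition defect x u v :=
  prim (fun t => u t * prim v t + prim u t * v t) x - prim u x * prim v x.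

Lemma sq_mul_prim u v : sq u -> sq v -> sq (fun t => u t * prim v t).
Proof.
move=> us vs; have := sq_mulb (prim_meas vs) (fun x => @prim_bound_I v x vs) us.
by congr square_integrable; apply/funext => t; rewrite mulrC.
Qed.

Lemma defectC x u v : defect x u v = defect x v u.
Proof.
rewrite /defect [prim v x * _]mulrC; congr (_ - _); apply: prim_eq => t _.
by rewrite addrC mulrC [prim v t * _]mulrC.
Qed.

Lemma defect_lin x a u v w : sq u -> sq v -> sq w -> x <= L ->
  defect x (fun t => a * u t + v t) w = a * defect x u w + defect x v w.
Proof.
move=> us vs ws xL; rewrite /defect prim_lin//.
have s1 := sqD (sq_mul_prim us ws) (sq_mul_prim ws us).
have s2 := sqD (sq_mul_prim vs ws) (sq_mul_prim ws vs).
rewrite (@prim_ae _ (fun t => a * (u t * prim w t + w t * prim u t) +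
   (v t * prim w t + w t * prim v t)))//.
- rewrite prim_lin//.
  rewrite (_ : (fun t => u t * prim w t + prim u t * w t) =
     fun t => u t * prim w t + w t * prim u t); last by apply/funext => t; ring.
  rewrite (_ : (fun t => v t * prim w t + prim v t * w t) =
     fun t => v t * prim w t + w t * prim v t); last by apply/funext => t; ring.
  by rewrite mulrDl mulrBr -mulrA opprD addrACA.
- apply: sqD; first by apply: sq_mul_prim => //; exact: sq_lin.
  have := sq_mul_prim ws (sq_lin a us vs).
  by congr square_integrable; apply/funext => t; rewrite mulrC.
- exact: sq_lin.
- apply: (filterE (aeF R)) => t It; rewrite prim_lin//; first by ring.
  by move: It; rewrite /= in_itv /= => /andP[_ /ltW].
Qed.

Lemma defect_ae x u u' v : sq u -> sq u' -> sq v -> x <= L ->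
  {ae mu, forall t, I t -> u t = u' t} -> defect x u v = defect x u' v.
Proof.
move=> us us' vs xL uu; rewrite /defect (prim_ae us us' xL uu); congr (_ - _).
have s w : sq w -> sq (fun t => w t * prim v t + prim w t * v t).
  move=> ws; apply: sqD; first exact: sq_mul_prim.
  have := sq_mul_prim vs ws.
  by congr square_integrable; apply/funext => t; rewrite mulrC.
apply: prim_ae; try exact: s; rewrite //.
have uu' := uu; apply: filterS uu; first exact: aeF.
move=> t h It; rewrite (h It); congr (_ + _ * _); apply: prim_ae => //.
by move: It; rewrite /= in_itv /= => /andP[_ /ltW].
Qed.

(** Each of the three products is at most q = L^2 |u|^2 |v|^2 in squared modulus, and two uses of |z
    + w|^2 <= 2 (|z|^2 + |w|^2) give 2 (2 (q + q) + q) = 10 q. *)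
Lemma defect_bound x u v : sq u -> sq v -> 0 <= x <= L ->
  sqmod (defect x u v) <= (10 * L ^+ 2 * nrm (cl v) ^+ 2) * nrm (cl u) ^+ 2.
Proof.
move=> us vs xL; have /andP[x0 x1] := xL.
have h1 : sqmod (prim u x * prim v x) <= L ^+ 2 * nrm (cl v) ^+ 2 * nrm (cl u) ^+ 2.
  rewrite sqmodM; apply: (@le_trans _ _ ((L * nrm (cl u) ^+ 2) * (L * nrm (cl v) ^+ 2))).
    by apply: ler_pM; rewrite ?sqmod_ge0// prim_bound.
  by rewrite le_eqVlt; apply/orP; left; apply/eqP; ring.
have h2 (f g : R -> R[i]) : sq f -> sq g -> sqmod (prim (fun t => f t * prim g t) x) <=
    L ^+ 2 * nrm (cl g) ^+ 2 * nrm (cl f) ^+ 2.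
  move=> fs gs; apply: (le_trans (prim_bound (sq_mul_prim fs gs) xL)).
  rewrite [leRHS](_ : _ = L * (L * nrm (cl g) ^+ 2 * nrm (cl f) ^+ 2)); last by ring.
  rewrite ler_wpM2l ?(ltW L0)//.
  apply: le_trans (hnorm_mulb (prim_meas gs) (fun x => @prim_bound_I g x gs) fs).
  rewrite (_ : (fun t => f t * prim g t) = fun t => prim g t * f t)//.
  by apply/funext => t; rewrite mulrC.
rewrite /defect (_ : (fun t => _) = fun t => u t * prim v t + v t * prim u t); last first.
  by apply/funext => t; rewrite [v t * _]mulrC.
rewrite primD; [|exact: sq_mul_prim|exact: sq_mul_prim|exact: x1].
have h3 := h2 _ _ us vs; have h4 := h2 _ _ vs us.
apply: (le_trans (sqmodD_le _ _)); rewrite sqmodN.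
apply: (@le_trans _ _ (2 * (2 * (L ^+ 2 * nrm (cl v) ^+ 2 * nrm (cl u) ^+ 2 +
    L ^+ 2 * nrm (cl u) ^+ 2 * nrm (cl v) ^+ 2) + L ^+ 2 * nrm (cl v) ^+ 2 * nrm (cl u) ^+ 2))).
  rewrite ler_wpM2l//; apply: lerD => //.
  by apply: (le_trans (sqmodD_le _ _)); rewrite ler_wpM2l//; exact: lerD.
rewrite [L ^+ 2 * nrm (cl u) ^+ 2 * _]mulrAC.
rewrite (_ : 10 * L ^+ 2 * nrm (cl v) ^+ 2 * nrm (cl u) ^+ 2 =
  10 * (L ^+ 2 * nrm (cl v) ^+ 2 * nrm (cl u) ^+ 2)); last by rewrite !mulrA.
by set q := L ^+ 2 * nrm (cl v) ^+ 2 * nrm (cl u) ^+ 2; clear; lra.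
Qed.

Lemma defect_smooth x U V u v : cderive U u -> cderive V v -> ccontinuous u ->
  ccontinuous v -> 0 <= x <= L -> defect x u v = 0.
Proof.
move=> dU dV cu cv /andP[x0 xL].
have pE (W w : R -> R[i]) (t : R) : cderive W w -> ccontinuous w -> 0 <= t -> prim w t = W t - W 0.
  by move=> dW cw t0; rewrite -(ftc dW cw t0).
have d0 (W w : R -> R[i]) : cderive W w -> cderive (fun t => W t - W 0) w.
  move=> dW; have := cderiveD dW (cderive_cst (- W 0)).
  by congr cderive; apply/funext => t; rewrite addr0.
have dM := cderiveM (d0 _ _ dU) (d0 _ _ dV).
have [cU cV] := (cderive_continuous (d0 _ _ dU), cderive_continuous (d0 _ _ dV)).
have := pE _ _ x dM (ccontinuousD (ccontinuousM cu cV) (ccontinuousM cU cv)) x0.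
rewrite subrr mul0r subr0 /defect (pE U _ x dU cu x0) (pE V _ x dV cv x0) => <-.
apply/eqP; rewrite subr_eq0; apply/eqP; apply: prim_eq => t /andP[/ltW t0 _].
by rewrite (pE U _ t dU cu t0) (pE V _ t dV cv t0).
Qed.

Lemma cosn_primitive n : exists U, cderive U (fun x => (cosn L n x)%:C).
Proof.
have [n0|n0] := eqVneq (n%:R * pi / L) (0 : R).
  exists (fun x => x%:C); apply: cderive_real => x.
  by rewrite /cosn n0 mul0r cos0; exact: is_derive_id.
exists (fun x => ((n%:R * pi / L)^-1 * sin (n%:R * pi / L * x))%:C).
apply: cderive_real => x; rewrite /cosn; move: n0; set w := _ / L => n0.
have := is_derive_scale (is_derive_sin (x * w)).
move=> /(is_derive_funM (is_derive_cst w^-1 x 1)).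
rewrite mul0r add0r mulKf// mulrC; under eq_fun do rewrite mulrC.
by under [X in is_derive _ _ X _ -> _]eq_fun do rewrite [_ * w]mulrC mulrC.
Qed.

Lemma cosn_ccontinuous n : ccontinuous (fun x => (cosn L n x)%:C).
Proof.
by split => [|x]; [exact: cosn_continuous|exact: cvg_cst].
Qed.

Lemma cosn_derive n : exists d, cderive (fun x => (cosn L n x)%:C) d /\ ccontinuous d.
Proof.
pose w : R := n%:R * pi / L.
exists (fun x => (- w * sin (w * x))%:C); split.
  apply: cderive_real => x; have := is_derive_scale (is_derive_cos (x * w)).
  under [X in is_derive _ _ X]eq_fun do rewrite mulrC.
  by congr is_derive; rewrite -/w mulrC [x * w]mulrC; ring.
split=> x; last exact: cvg_cst.
by apply: cvgM; [exact: cvg_cst|exact: (@sinn_continuous R L n)].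
Qed.

(** Density is used in one argument at a time, with the symmetry [defectC] in between; for two
    cosines the rule is the classical one. *)
Lemma product_rule u v x : sq u -> sq v -> 0 <= x <= L -> defect x u v = 0.
Proof.
move=> us vs x0L; have /andP[x0 xL] := x0L.
have cs n : sq (fun x => (cosn L n x)%:C) by exact: sq_ccontinuous (cosn_ccontinuous n).
have vanish w : sq w -> (forall n, defect x (fun x => (cosn L n x)%:C) w = 0) ->
    forall u0, sq u0 -> defect x u0 w = 0.
  move=> ws h u0 us0.
  pose l (z : L2 L) := defect x z w.
  have -> : defect x u0 w = l (cl u0).
    apply: defect_ae => //; first exact: L2_sq.
    by apply: filterS (L2classE us0); [exact: aeF|move=> t ht It; rewrite ht].
  apply: (@functional_vanish l (10 * L ^+ 2 * nrm (cl w) ^+ 2)) => [a z z'|z|n].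
  - rewrite -defect_lin//; [|exact: L2_sq..].
    apply: defect_ae => //; [exact: L2_sq|by apply: sq_lin; exact: L2_sq|exact: L2_linE].
  - by rewrite -[in leRHS](L2class_fun z); apply: defect_bound => //; exact: L2_sq.
  - rewrite /l -(h n); apply: defect_ae => //; [exact: L2_sq|exact: L2classE].
apply: (vanish v) => // n; rewrite defectC; apply: (vanish _ (cs n)) => // k.
have [[U dU] [V dV]] := (cosn_primitive k, cosn_primitive n).
exact: (defect_smooth dU dV (cosn_ccontinuous k) (cosn_ccontinuous n)).
Qed.

(** F is the representative of an H^1 function on the closed interval and f its derivative. Working
    with such pairs makes boundary values plain values of F, while f matters only up to null
    sets. *)
Definition ac F f := sq f /\ forall x, 0 <= x <= L -> F x = F 0 + prim f x.

Lemma I_itv x : I x -> 0 <= x <= L.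
Proof. by move=> /subset_itv_oo_cc; rewrite /= in_itv. Qed.

Lemma ac_continuous F f : ac F f -> ccontinuous (fun x => F (clamp x)).
Proof.
move=> [fs hF]; apply: (@sqmod_continuous _ (nrm (cl f) ^+ 2)) => x y.
rewrite (hF (clamp x)) ?clamp_itv// (hF (clamp y)) ?clamp_itv//.
by rewrite opprD addrACA subrr add0r; exact: prim_clamp_dist.
Qed.

Lemma ac_meas F f : ac F f -> cmeasurable I F.
Proof.
move=> /ac_continuous/ccontinuous_meas[h1 h2].
split; [apply: eq_measurable_fun h1|apply: eq_measurable_fun h2] => x /set_mem/I_itv Ix;
  by rewrite clamp_id.
Qed.

Lemma ac_bounded F f : ac F f -> exists C, forall x, I x -> sqmod (F x) <= C.
Proof.
move=> /ac_continuous/ccontinuous_bounded[C hC]; exists C => x Ix.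
by have := hC _ Ix; rewrite clamp_id//; exact: I_itv.
Qed.

Lemma ac_sq F f : ac F f -> sq F.
Proof.
by move=> h; have [C hC] := ac_bounded h; exact: sq_bounded (ac_meas h) hC.
Qed.

Lemma ac_lin a F f G g : ac F f -> ac G g ->
  ac (fun x => a * F x + G x) (fun x => a * f x + g x).
Proof.
move=> [fs hF] [gs hG]; split=> [|x x0L]; first exact: sq_lin.
have /andP[_ xL] := x0L.
by rewrite prim_lin// hF// hG// mulrDr addrACA.
Qed.

Lemma ac_cst k : ac (fun=> k) (fun=> 0).
Proof.
split=> [|x _]; first exact: sq0.
by rewrite (_ : prim _ x = 0) ?addr0//; exact: Cint0.
Qed.

Lemma acZ a F f : ac F f -> ac (fun x => a * F x) (fun x => a * f x).
Proof.
by move=> /(@ac_lin a)/(_ (ac_cst 0)); congr ac; apply/funext => x; rewrite addr0.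
Qed.

Lemma acD F f G g : ac F f -> ac G g -> ac (fun x => F x + G x) (fun x => f x + g x).
Proof.
by move=> hF /(ac_lin 1 hF); congr ac; apply/funext => x; rewrite mul1r.
Qed.

Lemma ac_mul_sq F f g : ac F f -> sq g -> sq (fun x => F x * g x).
Proof. by move=> hF gs; have [C hC] := ac_bounded hF; exact: sq_mulb (ac_meas hF) hC gs. Qed.

Lemma acM F f G g : ac F f -> ac G g ->
  ac (fun x => F x * G x) (fun x => f x * G x + F x * g x).
Proof.
move=> hF hG; have [[fs eF] [gs eG]] := (hF, hG).
have s1 : sq (fun x => f x * G x + F x * g x).
  apply: sqD; last exact: ac_mul_sq hF gs.
  by have := ac_mul_sq hG fs; congr square_integrable; apply/funext => x; rewrite mulrC.
split => // x x0L; have /andP[_ xL] := x0L.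
have s2 := sqD (sq_mul_prim fs gs) (sq_mul_prim gs fs).
have s3 := sq_lin (F 0) gs s2.
rewrite eF// eG//; have /eqP := product_rule fs gs x0L; rewrite subr_eq0 => /eqP pr.
rewrite (_ : prim (fun t => f t * G t + F t * g t) x = prim (fun t => G 0 * f t +
  (F 0 * g t + (f t * prim g t + g t * prim f t))) x); last first.
  apply: prim_eq => t /andP[t0 tx].
  have tL : 0 <= t <= L by rewrite (ltW t0) (le_trans (ltW tx)).
  rewrite (eF t tL) (eG t tL).
  by move: (F 0) (G 0) (prim f t) (prim g t) (f t) (g t) => ? ? ? ? ? ?; ring.
rewrite !prim_lin//.
rewrite (_ : (fun t => f t * prim g t + g t * prim f t) =
  fun t => f t * prim g t + prim f t * g t); last first.
  by apply/funext => t; rewrite [g t * _]mulrC.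
by rewrite pr; move: (F 0) (G 0) (prim f x) (prim g x) => ? ? ? ?; ring.
Qed.

Lemma ac_conj F f : ac F f -> ac (fun x => conjc (F x)) (fun x => conjc (f x)).
Proof.
move=> [fs hF]; split=> [|x x0L]; first exact: sq_conj.
by rewrite hF// rmorphD /= prim_conj//; case/andP: x0L.
Qed.

Lemma ac_cderive F f : cderive F f -> ccontinuous f -> ac F f.
Proof.
move=> dF cf; split=> [|x /andP[x0 xL]]; first exact: sq_ccontinuous.
by rewrite (_ : prim f x = F x - F 0); [rewrite addrC subrK|exact: ftc].
Qed.

Lemma ac_prim k f : sq f -> ac (fun x => k + prim f x) f.
Proof. by move=> fs; split => // x _; rewrite prim0 addr0. Qed.

Lemma ac_by_parts F f G g : ac F f -> ac G g ->
  Cint I (fun x => f x * G x) + Cint I (fun x => F x * g x) = F L * G L - F 0 * G 0.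
Proof.
move=> hF hG; have [_ /(_ L)] := acM hF hG; rewrite lexx (ltW L0) => /(_ isT) ->.
rewrite addrAC subrr add0r prim_L CintD//.
- by apply: sq_mul; [case: hF|exact: ac_sq hG].
- by apply: sq_mul; [exact: ac_sq hF|case: hG].
Qed.

Lemma test_function_ac p : test_function L p ->
  [/\ ac (fun x => (p x)%:C) (fun x => (p^`()%classic x)%:C), p 0 = 0 & p L = 0].
Proof.
move=> [dp cp [a [b [a0 bL ab0]]]]; split.
- apply: ac_cderive; last by split => // x; exact: cvg_cst.
  by apply: cderive_real => x; rewrite derive1E; split.
- by apply: ab0; rewrite in_itv /= leNgt a0.
- by apply: ab0; rewrite in_itv /= negb_and -!ltNge bL orbT.
Qed.

Lemma ac_weak F f : ac F f -> weak_deriv (cl F) (cl f).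
Proof.
move=> hF p /test_function_ac[hp p0 pL].
have [fs Fs] := (hF.1, ac_sq hF); have [p's ps] := (hp.1, ac_sq hp).
have E u w : sq u -> sq w -> Cint I (fun x => cl u x * w x) = Cint I (fun x => u x * w x).
  move=> us ws; apply: Cint_ae => //.
  - exact: cintegrable_meas (sq_mul (L2_sq _) ws).
  - exact: cintegrable_meas (sq_mul us ws).
  - by apply: filterS (L2classE us); [exact: aeF|move=> x h Ix; rewrite h].
rewrite !E//; apply/eqP; rewrite -addr_eq0 addrC (ac_by_parts hF hp).
by rewrite p0 pL !mulr0 subrr.
Qed.

End Primitive.

Opaque prim.

(** * Weak derivatives and traces *)

Section WeakDerivatives.
Variables (R : realType) (L : R).
Hypothesis L0 : 0 < L.
Local Notation mu := (@lebesgue_measure R).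
Local Notation I := (`]0, L[%classic : set R).
Local Notation sq := (@square_integrable R L).
Local Notation cl := (@L2class R L).
Local Notation ipL := (@ipL2 R L).
Local Notation nrm := (hnorm ipL).
Local Notation ac := (@ac R L).
Let ipP := @ipL2_inner R L.
Implicit Types (f g u v : R -> R[i]) (x y : R).

(** The primitive from minus infinity vanishes left of a; mean zero makes it vanish again right of
    b. *)
Lemma compact_support_primitive (g : R -> R) (a b : R) : 0 < a -> b < L -> continuous g ->
  (forall x, x \notin `[a, b] -> g x = 0) -> \int[mu]_(x in I) g x = 0 ->
  exists2 p, test_function L p & p^`()%classic = g.
Proof.
move=> a0 bL cg g0 gI.
have abI x : x \in `[a, b] -> I x.
  rewrite /= !in_itv /= => /andP[ax xb].
  by rewrite (lt_le_trans a0 ax) (le_lt_trans xb bL).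
have patchE (D : set R) : (forall x, x \in `[a, b] -> D x) -> g \_ D = g.
  move=> hD; apply/funext => x; rewrite /patch.
  case: ifPn => // /negP xD; rewrite g0//; apply/negP => /hD Dx.
  by apply: xD; exact: mem_set.
have gint : mu.-integrable setT (EFin \o g).
  have : mu.-integrable `[a, b] (EFin \o g).
    apply: continuous_compact_integrable; first exact: segment_compact.
    exact: continuous_subspaceT.
  move=> h; have := (@integrable_mkcond _ _ _ mu `[a, b]%classic (EFin \o g) (measurable_itv _)).1 h.
  by rewrite restrict_EFin patchE.
pose p x := \int[mu]_(t in `]-oo, x]) g t.
have dp x : derivable p x 1 /\ p^`()%classic x = g x.
  apply: (@continuous_FTC1 _ g -oo%O x (x + 1)) => //.
  - by rewrite ltrDl.
  - exact: integrableS gint.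
  - by rewrite ltNyr.
  - exact: cg.
have p'g : p^`()%classic = g by apply/funext => x; exact: (dp x).2.
exists p => //; split; [by move=> x; exact: (dp x).1|by rewrite p'g|].
exists a, b; split => // x; rewrite in_itv /= negb_and -!ltNge => /orP[xa|bx].
  rewrite /p (_ : \int[mu]_(t in _) _ = \int[mu]_(t in `]-oo, x]) 0).
    by rewrite /Rintegral integral0.
  apply: eq_Rintegral => t /set_mem; rewrite /= in_itv /= => tx.
  by apply: g0; rewrite in_itv /= negb_and -ltNge (le_lt_trans tx xa).
rewrite /p -gI Rintegral_mkcond [RHS]Rintegral_mkcond patchE; last first.
  by move=> t /=; rewrite !in_itv /= => /andP[_ /le_trans]; apply; exact: ltW.
by rewrite patchE.
Qed.

(** Continuous with compact support in (0, L) for e > 0. At each interior point it becomes positive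
    once e is small. *)
Definition bump (e : R) x : R := Num.max (x * (L - x) - e) 0.

Lemma bump_continuous e : continuous (bump e).
Proof.
have cb : continuous (fun x => x * (L - x) - e).
  move=> x; apply: cvgB; last exact: cvg_cst.
  by apply: cvgM; [exact: cvg_id|apply: cvgB; [exact: cvg_cst|exact: cvg_id]].
move=> x; rewrite /continuous_at /bump maxr_absE.
under eq_fun do rewrite maxr_absE.
apply: cvgM; last exact: cvg_cst; apply: cvgD; first by apply: cvgD; [exact: cb|exact: cvg_cst].
by apply: cvg_norm; apply: cvgB; [exact: cb|exact: cvg_cst].
Qed.

Lemma bump_ge e x : x * (L - x) - e <= bump e x.
Proof. by rewrite le_max lexx. Qed.

Lemma bump_gt0 e x : e < x * (L - x) -> 0 < bump e x.
Proof. by move=> h; apply: lt_le_trans (bump_ge e x); rewrite subr_gt0. Qed.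

(** For 0 < x < d / L one has x (L - x) <= x L < d <= e, and symmetrically near L. Keeping d apart
    from e lets two bumps share one support interval. *)
Lemma bump_support (e d : R) x : 0 < d -> d <= e -> x \notin `[d / L, L - d / L] -> bump e x = 0.
Proof.
move=> d0 de; have e0 := lt_le_trans d0 de.
rewrite in_itv /= negb_and -!ltNge => h.
apply: max_r; rewrite subr_le0; apply: le_trans de.
case/orP: h => h.
  have [x0|x0] := leP x 0.
    apply: le_trans (ltW d0); rewrite mulr_le0_ge0// subr_ge0.
    exact: le_trans x0 (ltW L0).
  have : x * L < d by rewrite -ltr_pdivlMr.
  by nra.
have [xL|xL] := leP L x.
  apply: le_trans (ltW d0); rewrite mulr_ge0_le0 ?subr_le0//.
  exact: le_trans (ltW L0) xL.
have : (L - x) * L < d by rewrite -ltr_pdivlMr//; lra.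
by nra.
Qed.

(** The bump dominates x (L - x) - L^2 / 8, whose integral is L^3 / 6 - L^3 / 8 = L^3 / 24. *)
Lemma bump_integral_gt0 : 0 < \int[mu]_(x in I) bump (L ^+ 2 / 8) x.
Proof.
have dF x : is_derive x 1 (fun t => t * (t * (L / 2 - t / 3) - L ^+ 2 / 8))
    (x * (L - x) - L ^+ 2 / 8).
  have id0 := is_derive_id x 1.
  have d1 := is_derive_funD (is_derive_cst (L / 2) x 1)
    (is_derive_funN (is_derive_mulr x (3^-1 : R))).
  have d2 := is_derive_funD (is_derive_funM id0 d1) (is_derive_cst (- (L ^+ 2 / 8)) x 1).
  have := is_derive_funM id0 d2.
  rewrite (_ : (fun t => _) = fun t => t * (t * (L / 2 - t / 3) - L ^+ 2 / 8))//.
by congr is_derive; rewrite /=; lra.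
have cf : continuous (fun x : R => x * (L - x) - L ^+ 2 / 8).
  move=> x; apply: cvgB; last exact: cvg_cst.
  by apply: cvgM; [exact: cvg_id|apply: cvgB; [exact: cvg_cst|exact: cvg_id]].
have ic (h : R -> R) : continuous h -> mu.-integrable I (EFin \o h).
  move=> ch; apply: (@integrableS _ _ _ mu `[0, L]) => //; first exact: subset_itv_oo_cc.
  apply: continuous_compact_integrable; first exact: segment_compact.
  exact: continuous_subspaceT.
apply: (@lt_le_trans _ _ (\int[mu]_(x in I) (x * (L - x) - L ^+ 2 / 8))).
  rewrite (ftc_real dF cf (ltW L0)) mul0r subr0.
  rewrite (_ : L * _ = L ^+ 3 / 24); last by lra.
  by rewrite divr_gt0// exprn_gt0.
apply: le_Rintegral => //; [exact: ic|by apply: ic; exact: bump_continuous|].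
by move=> x _; exact: bump_ge.
Qed.

Lemma cos_total (z : R -> R[i]) : sq z ->
  (forall n, Cint I (fun x => z x * (cosn L n x)%:C) = 0) -> cl z = 0.
Proof.
move=> zs h; apply/eqP; rewrite -(hnorm_eq0 ipP) -sqrf_eq0 (hnorm_sq ipP).
have -> : ipL (cl z) (cl z) = 0; last by [].
pose l (u : L2 L) := ipL u (cl z); suff : forall u : L2 L, l u = 0 by apply.
apply: (functional_vanish L0 (C := nrm (cl z) ^+ 2)) => [a u v|u|n].
- exact: ip_lin.
- by rewrite mulrC; exact: cauchy_schwarz.
- rewrite /l (ipC ipP) ipL2_cl//; last exact: sq_continuous (@cosn_continuous R L n).
  rewrite (_ : (fun x => z x * _) = fun x => z x * (cosn L n x)%:C) ?h ?conjc0//.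
  by apply/funext => x; rewrite conjc_real.
Qed.

(* Test functions are the primitives of bump_e * cos_n minus a multiple of a fixed bump; hence
   (w - k) * bump_e is orthogonal to every cosine. *)
Lemma weak_deriv0_const (w : L2 L) : weak_deriv w 0 -> exists k, w = cl (fun=> k).
Proof.
move=> hw; pose E (g : R -> R) := Cint I (fun x => w x * (g x)%:C).
have ws := L2_sq w.
have cs (g : R -> R) : continuous g -> sq (fun x => (g x)%:C) := @sq_continuous _ _ L0 g.
have Elin k (g h : R -> R) : continuous g -> continuous h ->
    E (fun x => k * g x + h x) = k%:C * E g + E h.
  move=> cg ch; rewrite /E -Cint_linear//; [|exact: sq_mul ws (cs _ _)..].
  by apply: CintE => x _; rewrite rmorphD rmorphM /=; ring.
have Ez (g : R -> R) (a b : R) : 0 < a -> b < L -> continuous g ->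
    (forall x, x \notin `[a, b] -> g x = 0) -> \int[mu]_(x in I) g x = 0 -> E g = 0.
  move=> a0 bL cg g0 gI; have [p tp p'] := compact_support_primitive a0 bL cg g0 gI.
  have := hw p tp; rewrite p' -/(E g) => ->.
  have [/ac_sq ps _ _] := test_function_ac L0 tp.
  rewrite (@Cint_ae _ _ _ (fun=> 0)) ?Cint0 ?oppr0//.
  - exact: cintegrable_meas (sq_mul (L2_sq _) (ps L0)).
  - rewrite -(L2class0 L); apply: filterS (L2classE (sq0 L)); first exact: aeF.
    by move=> x h Ix; rewrite h// mul0r.
pose e0 := L ^+ 2 / 8; have e00 : 0 < e0 by rewrite divr_gt0// exprn_gt0.
pose J := \int[mu]_(x in I) bump e0 x; have J0 : 0 < J := bump_integral_gt0.
(* The mean of w weighted by the fixed bump, the only possible value of the constant. *)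
pose k := E (bump e0) / J%:C.
have key e n : 0 < e -> Cint I (fun x => ((w x - k) * (bump e x)%:C) * (cosn L n x)%:C) = 0.
  move=> e0'; have cb : continuous (fun x => bump e x * cosn L n x).
    by move=> x; apply: cvgM; [exact: bump_continuous|exact: cosn_continuous].
  pose mm := \int[mu]_(x in I) (bump e x * cosn L n x).
  have ic (h : R -> R) : continuous h -> mu.-integrable I (EFin \o h).
    by move=> ch; have [] := sq_cintegrable (cs _ ch).
  have cB := @bump_continuous e0.
  (* The coefficient mm / J makes the integral zero, and the smaller of the two parameters gives a
     common support interval. *)
  have Eg : E (fun x => - (mm / J) * bump e0 x + bump e x * cosn L n x) = 0.
    have d0 : 0 < Num.min e e0 by rewrite lt_min e0' e00.
    apply: (Ez _ (Num.min e e0 / L) (L - Num.min e e0 / L)).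
    - by rewrite divr_gt0.
    - by rewrite ltrBlDr ltrDl divr_gt0.
    - move=> x; apply: cvgD; last exact: cb.
      by apply: cvgM; [exact: cvg_cst|exact: cB].
    - move=> x hx; rewrite (bump_support d0 _ hx) ?ge_min ?lexx ?orbT//.
      by rewrite (bump_support d0 _ hx) ?ge_min ?lexx ?orbT// mulr0 mul0r addr0.
    - rewrite RintegralD//; last exact: ic.
        rewrite RintegralZl//; last exact: ic.
        by rewrite -/J -/mm mulNr divfK ?gt_eqF// addNr.
      exact: rintegrableZ (ic _ cB).
  move: Eg; rewrite Elin// => /eqP; rewrite addr_eq0 => /eqP Eg.
  have mk : (mm / J)%:C * E (bump e0) = mm%:C * k.
    by rewrite /k rmorphM /= -mulrA fmorphV [_ * E _]mulrC.
  rewrite (_ : Cint I _ = E (fun x => bump e x * cosn L n x) - k * mm%:C).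
    rewrite -[E _]opprK -Eg rmorphN /= mulNr opprK mk mulrC subrr//.
  have -> : k * mm%:C = Cint I (fun x => k * (bump e x * cosn L n x)%:C).
    rewrite CintZ//; last exact: sq_cintegrable (cs _ cb).
    congr (_ * _); apply: complexP; rewrite ?cRe_Cint ?cIm_Cint ?cRe_real//.
    by rewrite /= /Rintegral integral0.
  rewrite -[- Cint _ _]mulN1r -CintZ//; last first.
    by apply: cintegrableZ => //; exact: sq_cintegrable (cs _ cb).
  rewrite /E -CintD//.
  - by apply: CintE => x _; rewrite rmorphM /=; ring.
  - exact: sq_mul ws (cs _ cb).
  - by do 2!apply: cintegrableZ => //; exact: sq_cintegrable (cs _ cb).
exists k; apply: L2_ext.
have zs e : sq (fun x => (w x - k) * (bump e x)%:C).
  have cb : ccontinuous (fun x => (bump e x)%:C).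
    by split=> [|x]; [exact: bump_continuous|exact: cvg_cst].
  have [C hC] := ccontinuous_bounded L0 cb.
  have := sq_mulb (sq_meas (cs _ (@bump_continuous e))) hC (sqB ws (@sq_cst R L k)).
  by congr square_integrable; apply/funext => x; rewrite mulrC.
have z0 n : {ae mu, forall x, I x -> (w x - k) * (bump n.+1%:R^-1 x)%:C = 0}.
  have := cos_total (zs n.+1%:R^-1) (fun k => key _ k _).
  rewrite invr_gt0 ltr0n => /(_ isT) h.
  have h1 := L2classE (zs n.+1%:R^-1); have h2 := L2classE (sq0 L).
  rewrite h in h1; rewrite L2class0 in h2.
  by apply: filterS2 h1 h2; [exact: aeF|move=> x h1 h2 Ix; rewrite -h1// h2].
(* One null set serves all parameters 1 / (n + 1); at each remaining x some bump is positive, and w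
   x = k follows. *)
have z1 : {ae mu, forall x, forall n, I x -> (w x - k) * (bump n.+1%:R^-1 x)%:C = 0}.
  exact: ae_foralln z0.
apply: filterS2 z1 (L2classE (@sq_cst R L k)); first exact: aeF.
move=> x hx hk Ix; rewrite hk//.
have b0 : 0 < x * (L - x).
  by move: Ix; rewrite /= in_itv /= => /andP[x0 xL]; rewrite mulr_gt0 ?subr_gt0.
have [N hN] : exists N, N.+1%:R^-1 < x * (L - x).
  exists (Num.truncn (x * (L - x))^-1).
  rewrite -ltf_pV2 ?posrE ?invr_gt0 ?ltr0n// invrK.
  exact: truncnS_gt.
have /eqP := hx N Ix; rewrite mulf_eq0 subr_eq0 => /orP[/eqP//|].
by rewrite -sqmod_eq0 sqmod_real expf_eq0 /= gt_eqF// bump_gt0.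
Qed.

(** u minus the primitive of v has zero weak derivative, hence is a constant. *)
Lemma weak_deriv_ac (u v : L2 L) : weak_deriv u v -> exists2 F, ac F v & u = cl F.
Proof.
move=> uv; have vs := L2_sq v.
have hP := ac_weak L0 (ac_prim 0 vs); rewrite L2class_fun in hP.
have := weak_deriv_lin (-1) hP uv; rewrite !scaleN1r addNr => /weak_deriv0_const[k hk].
exists (fun x => k + prim v x); first exact: ac_prim.
have ps : sq (fun x => 0 + prim v x) by exact: ac_sq (ac_prim 0 vs).
have := L2classD (@sq_cst R L k) ps; rewrite -hk.
rewrite addrAC addNr add0r => <-; congr L2class.
by apply/funext => x; rewrite add0r.
Qed.

(** A null set contains no interval of positive length, in particular not the part of (0, L) near
    a. *)
Lemma ae_near_point (P : set R) a (e : R) : {ae mu, forall x, I x -> P x} ->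
  0 <= a <= L -> 0 < e -> exists x, [/\ I x, `|x - a| < e & P x].
Proof.
move=> [N [mN N0 hN]] /andP[a0 aL] e0; apply: contrapT => hno.
pose l : R := Num.max 0 (a - e); pose r : R := Num.min L (a + e).
have lr : l < r.
  rewrite /l /r lt_min !gt_max; apply/andP; split; apply/andP; split => //.
    - by rewrite ltrBlDr (le_lt_trans aL)// ltrDl.
    - by rewrite (le_lt_trans a0)// ltrDl.
    - by rewrite ltrBlDr -addrA ltrDl addr_gt0.
have sub : `]l, r[%classic `<=` N.
  move=> x; rewrite /= in_itv /= gt_max lt_min => /andP[/andP[x0 xa] /andP[xL xe]].
  apply: hN => /= h; apply: hno; exists x.
  have Ix : I x by rewrite /= in_itv /= x0.
  by split => //; [rewrite ltr_norml; apply/andP; split; lra|exact: h].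
have : (mu `]l, r[ <= mu N)%E by apply: le_measure; rewrite ?inE.
rewrite N0 lebesgue_measure_itv /= lte_fin lr -EFinB lee_fin leNgt subr_gt0 lr.
by [].
Qed.

(** In the order of R[i] a positive e is real, so the comparison is one of real squares. *)
Lemma normc_lt (z e : R[i]) : 0 < e -> (`|z| < e) = (sqmod z < Re e ^+ 2).
Proof.
case: e => er ei; rewrite ltcE /= => /andP[/eqP ei0 er0].
rewrite normc_def ltcE /= ei0 eqxx /= -[X in _ < X](ger0_norm (ltW er0)) -sqrtr_sqr.
by rewrite ltr_sqrt ?exprn_gt0.
Qed.

Lemma ccontinuous_cvg (h : R -> R[i]) : ccontinuous h -> continuous (h : R -> R[i]^o).
Proof.
move=> [h1 h2] x; apply/cvgrPdist_lt => e e0.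
have er : 0 < Re e by move: e0; case: e => a b; rewrite ltcE => /andP[].
have er2 : 0 < Re e / 2 by rewrite divr_gt0.
have /cvgrPdist_lt/(_ _ er2) c1 := h1 x; have /cvgrPdist_lt/(_ _ er2) c2 := h2 x.
near=> y; rewrite normc_lt// /sqmod cReB cImB.
have : `|Re (h x) - Re (h y)| < Re e / 2 by near: y.
have : `|Im (h x) - Im (h y)| < Re e / 2 by near: y.
rewrite !ltr_norml; move: (Re (h x) - _) (Im (h x) - _) (Re e) er2 => a b d d0.
by move=> /andP[? ?] /andP[? ?]; nra.
Unshelve. all: by end_near. Qed.

(** Two continuous representatives agree almost everywhere, hence at points arbitrarily close to
    a. *)
Lemma trace_uniq (u : L2 L) a (y z : R[i]) : 0 <= a <= L ->
  is_trace u a y -> is_trace u a z -> y = z.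
Proof.
move=> a0L [f [cf uf fy]] [g [cg ug gz]]; apply: contrapT => /eqP yz.
have Aa : `[0, L]%classic a by rewrite /= in_itv.
have e0 : 0 < `|y - z| / 2 by rewrite divr_gt0// normr_gt0 subr_eq0.
have near_a (h : R -> R[i]^o) : {within `[0, L], continuous h} ->
    exists2 d : R, 0 < d & forall x, I x -> `|x - a| < d -> `|h a - h x| < `|y - z| / 2.
  move=> ch; have := (subspace_continuousP _ h).1 ch a Aa => /cvgrPdist_lt/(_ _ e0)/nbhs_ballP[d /= d0 hd]; exists d => // x Ix xa.
  apply: hd; first by rewrite /ball /= distrC.
  exact: subset_itv_oo_cc.
have [[d d0 hd] [d' d'0 hd']] := (near_a f cf, near_a g cg).
have fg : {ae mu, forall x, I x -> f x = g x}.
  by apply: filterS2 uf ug; [exact: aeF|move=> x h1 h2 Ix; rewrite -h1// h2].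
have dd0 : 0 < Num.min d d' by rewrite lt_min d0 d'0.
have [x [Ix]] := ae_near_point fg a0L dd0.
rewrite lt_min => /andP[xd xd'] fgx.
have := ltrD (hd x Ix xd) (hd' x Ix xd'); rewrite -fgx fy gz -mulrDl -mulr2n.
rewrite -[X in _ < X / _]mulr_natr mulfK ?pnatr_eq0// => h.
have : `|y - z| <= `|y - f x| + `|z - f x| by rewrite [`|z - _|]distrC ler_distD.
by move=> /le_lt_trans/(_ h); rewrite ltxx.
Qed.

Lemma trace_ac F f a : ac F f -> 0 <= a <= L -> is_trace (cl F) a (F a).
Proof.
move=> hF a0L; exists (fun x => F (clamp L x)); split; last by rewrite clamp_id.
  by apply: continuous_subspaceT; apply: ccontinuous_cvg; exact: ac_continuous hF.
apply: filterS (L2classE (ac_sq L0 hF)); first exact: aeF.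
by move=> x h Ix; rewrite h// clamp_id//; exact: I_itv.
Qed.

Lemma trace_acE F f a (y : R[i]) : ac F f -> 0 <= a <= L -> is_trace (cl F) a y -> y = F a.
Proof. by move=> hF a0L /(trace_uniq a0L); apply; exact: trace_ac hF a0L. Qed.

(** F vanishes at every point by uniqueness of traces. Integration by parts against cosines then
    shows that f is orthogonal to all of them. *)
Lemma ac_eq0 F f : ac F f -> cl F = 0 -> (forall x, 0 <= x <= L -> F x = 0) /\ cl f = 0.
Proof.
move=> hF F0.
have FE x : 0 <= x <= L -> F x = 0.
  move=> x0L; have := trace_ac hF x0L; rewrite F0 -(L2class0 L).
  by move=> /(trace_acE (ac_cst L 0) x0L).
split => //; apply: cos_total; first by case: hF.
move=> n; have [d [dd cd]] := @cosn_derive R L n.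
have hd : ac (fun x => (cosn L n x)%:C) d := ac_cderive L0 dd cd.
have := ac_by_parts L0 hF hd; rewrite !FE ?lexx ?(ltW L0)// !mul0r subrr.
rewrite [X in _ + X](_ : _ = 0) ?addr0//.
rewrite (_ : Cint _ _ = Cint I (fun=> 0)); last first.
  by apply: CintE => x /set_mem/I_itv Ix; rewrite FE// mul0r.
by rewrite Cint0.
Qed.

Lemma ac_cl_eq F f G g : ac F f -> ac G g -> cl F = cl G ->
  (forall x, 0 <= x <= L -> F x = G x) /\ cl f = cl g.
Proof.
move=> hF hG FG; have h := ac_lin (-1) hF hG.
have [|h1 h2] := ac_eq0 h.
  by rewrite L2_linE_cl; [rewrite FG scaleN1r addNr|exact: ac_sq hF|exact: ac_sq hG].
split=> [x x0L|]; first by have := h1 x x0L; rewrite mulN1r addrC => /eqP;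
  rewrite subr_eq0 => /eqP.
move: h2; rewrite L2_linE_cl; [|by case: hF|by case: hG].
by rewrite scaleN1r addrC => /eqP; rewrite subr_eq0 => /eqP.
Qed.

Lemma weak_deriv_uniq (u v w : L2 L) : weak_deriv u v -> weak_deriv u w -> v = w.
Proof.
move=> /weak_deriv_ac[F hF uF] /weak_deriv_ac[G hG uG].
have [|_] := ac_cl_eq hF hG; first by rewrite -uF -uG.
by rewrite !L2class_fun.
Qed.

Lemma wderivE (u v : L2 L) : weak_deriv u v -> wderiv u = v.
Proof.
move=> uv; apply: xget_unique; first exact: uv.
by move=> w uw; exact: weak_deriv_uniq uw uv.
Qed.

Lemma wderiv_ac F f : ac F f -> wderiv (cl F) = cl f.
Proof. by move=> /(ac_weak L0)/wderivE. Qed.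

Lemma H1_ac F f : ac F f -> H1 (cl F).
Proof. by move=> /(ac_weak L0) h; exists (cl f). Qed.

Lemma H1_weak (u : L2 L) : H1 u -> weak_deriv u (wderiv u).
Proof. by move=> [v uv]; rewrite (wderivE uv). Qed.

Lemma H1P (u : L2 L) : H1 u -> exists2 F, ac F (wderiv u) & u = cl F.
Proof. by move=> /H1_weak/weak_deriv_ac. Qed.

Lemma wderiv_lin a (u v : L2 L) : H1 u -> H1 v ->
  H1 (a *: u + v) /\ wderiv (a *: u + v) = a *: wderiv u + wderiv v.
Proof.
move=> /H1_weak hu /H1_weak hv; have h := weak_deriv_lin a hu hv.
by split; [exists (a *: wderiv u + wderiv v)|exact: wderivE].
Qed.

End WeakDerivatives.

Lemma hcvg_ext (R : realType) (H : lmodType R[i]) (ip : H -> H -> R[i])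
    (u_ v_ : nat -> H) u : u_ =1 v_ -> hcvg ip u_ u -> hcvg ip v_ u.
Proof. by move=> /funext ->. Qed.

(** * The state space and the operator *)

Section StateSpace.
Variables (R : realType) (L : R).
Hypothesis L0 : 0 < L.
Local Notation cl := (@L2class R L).
Local Notation ipL := (@ipL2 R L).
Local Notation nrm := (hnorm ipL).
Local Notation ac := (@ac R L).
Local Notation state := (state L).
Local Notation ip := (@ip0 R L).
Let ipP := @ipL2_inner R L.
Implicit Types (u v w : L2 L) (z : state).

Definition wd (g : H10 L) : L2 L := wderiv (H10_val g).

Lemma H10P (g : H10 L) : H1 (H10_val g) /\ is_trace (H10_val g) 0 0.
Proof. by case: g => u /= /asboolP. Qed.

Lemma wd_lin a (g h : H10 L) : wd (a *: g + h) = a *: wd g + wd h.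
Proof. by apply: (wderiv_lin L0 a _ _).2; [case: (H10P g)|case: (H10P h)]. Qed.

Lemma toH10_val u : H1 u -> is_trace u 0 0 -> H10_val (toH10 u) = u.
Proof. by move=> h1 h2; apply: insubdK; apply/asboolP. Qed.

Lemma x0L : 0 <= (0 : R) <= L. Proof. by rewrite lexx ltW. Qed.
Lemma xLL : 0 <= L <= L. Proof. by rewrite lexx ltW. Qed.

Lemma toH10_ac F f : ac F f -> F 0 = 0 -> H10_val (toH10 (cl F)) = cl F.
Proof.
move=> hF F0; apply: toH10_val; first exact: (H1_ac L0 hF).
by rewrite -F0; exact: trace_ac hF x0L.
Qed.

(** Inverse of [wd]: the primitive that vanishes at 0. The inner product of H^1_(0) is that of the
    derivatives, so both maps are isometries. *)
Definition mk10 u : H10 L := toH10 (cl (prim u)).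

Lemma ac_prim0 u : ac (prim u) u.
Proof.
have := @ac_prim R L 0 u (L2_sq u).
by congr ac; apply/funext => x; rewrite add0r.
Qed.

Lemma mk10_val u : H10_val (mk10 u) = cl (prim u).
Proof. by apply: (toH10_ac (ac_prim0 u)); exact: prim0. Qed.

Lemma wd_mk10 u : wd (mk10 u) = u.
Proof. by rewrite /wd mk10_val (wderiv_ac L0 (ac_prim0 u)) L2class_fun. Qed.

Lemma H10E (g : H10 L) : H10_val g = cl (prim (wd g)).
Proof.
have [/(H1P L0)[F hF gF] tg] := H10P g.
have F0 : F 0 = 0 by apply/esym/(trace_acE L0 hF x0L); rewrite -gF.
rewrite {1}gF; apply: L2class_eq; first exact: ac_sq hF.
by move=> x /I_itv Ix; case: hF => _ ->//; rewrite F0 add0r.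
Qed.

Lemma H10_inj (g h : H10 L) : wd g = wd h -> g = h.
Proof. by move=> gh; apply: val_inj; rewrite /= [LHS]H10E [RHS]H10E gh. Qed.

Lemma toH10_mk10 F f : ac F f -> F 0 = 0 -> toH10 (cl F) = mk10 (cl f).
Proof.
move=> hF F0; apply: H10_inj; rewrite wd_mk10 /wd (toH10_ac hF F0).
exact: wderiv_ac.
Qed.

Opaque wd mk10.

Lemma mk10K (g : H10 L) : mk10 (wd g) = g.
Proof. by apply: H10_inj; exact: wd_mk10. Qed.

Lemma mk10_lin a u v : mk10 (a *: u + v) = a *: mk10 u + mk10 v.
Proof.
apply: H10_inj; apply: etrans (wd_mk10 _) _; apply: esym.
by apply: etrans (wd_lin _ _ _) _; rewrite (wd_mk10 u) (wd_mk10 v).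
Qed.

(** The second argument is the derivative of the second component, so [mk3] carries the product
    inner product of three copies of L^2 to that of the state space. *)
Definition mk3 u v w : state := (u, mk10 v, w).

Lemma mk3_lin a u v w u' v' w' :
  mk3 (a *: u + u') (a *: v + v') (a *: w + w') = a *: mk3 u v w + mk3 u' v' w'.
Proof. by rewrite /mk3 mk10_lin. Qed.

Lemma mk3K z : mk3 z.1.1 (wd z.1.2) z.2 = z.
Proof. by case: z => [[u g] w]; rewrite /mk3 mk10K. Qed.

Lemma ip_mk3 u v w u' v' w' :
  ip (mk3 u v w) (mk3 u' v' w') = ipL u u' + ipL v v' + ipL w w'.
Proof. by rewrite -[in RHS](wd_mk10 v) -[in RHS](wd_mk10 v'). Qed.

Lemma ip0_inner : inner_product ip.
Proof.
have ex z : exists u v w, z = mk3 u v w.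
  by exists z.1.1, (wd z.1.2), z.2; rewrite mk3K.
split.
- move=> a z z' y; have [u [v [w ->]]] := ex z; have [u' [v' [w' ->]]] := ex z'.
  have [u1 [v1 [w1 ->]]] := ex y; rewrite -mk3_lin !ip_mk3 !(ip_lin ipP).
  move: (ipL u u1) (ipL v v1) (ipL w w1) (ipL u' u1) (ipL v' v1) (ipL w' w1).
  by move=> *; ring.
- move=> z y; have [u [v [w ->]]] := ex z; have [u' [v' [w' ->]]] := ex y.
  by rewrite !ip_mk3 !rmorphD /= -!(ipC ipP).
- move=> z; have [u [v [w ->]]] := ex z => h.
  rewrite ip_mk3 !(ip_self ipP) -!rmorphD /= ltcR lt_def !addr_ge0 ?sqr_ge0// andbT.
  apply: contra h; rewrite paddr_eq0 ?addr_ge0 ?sqr_ge0// paddr_eq0 ?sqr_ge0//.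
  rewrite !sqrf_eq0 !(hnorm_eq0 ipP) => /andP[/andP[/eqP-> /eqP->] /eqP->].
  have := mk3_lin (-1) 0 0 0 0 0 0; rewrite !scaleN1r !addNr.
  by move=> ->.
Qed.

Let ip0P := ip0_inner.

Lemma hnorm_mk3 u v w :
  hnorm ip (mk3 u v w) ^+ 2 = nrm u ^+ 2 + nrm v ^+ 2 + nrm w ^+ 2.
Proof. by rewrite (hnorm_sq ip0P) ip_mk3 !cReD -!(hnorm_sq ipP). Qed.

Lemma mk3B u v w u' v' w' :
  mk3 u v w - mk3 u' v' w' = mk3 (u - u') (v - v') (w - w').
Proof.
have := mk3_lin (-1) u' v' w' u v w.
by rewrite !scaleN1r ![- _ + _]addrC => ->.
Qed.

Lemma hcvg_mk3 (u_ v_ w_ : nat -> L2 L) u v w : hcvg ipL u_ u -> hcvg ipL v_ v ->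
  hcvg ipL w_ w -> hcvg ip (fun n => mk3 (u_ n) (v_ n) (w_ n)) (mk3 u v w).
Proof.
move=> hu hv hw; apply/hcvgP => e e0.
have e3 : 0 < e / 3 by rewrite divr_gt0.
have [N1 h1] := (hcvgP _ _ _).1 hu _ e3; have [N2 h2] := (hcvgP _ _ _).1 hv _ e3.
have [N3 h3] := (hcvgP _ _ _).1 hw _ e3.
exists (maxn N1 (maxn N2 N3)) => n; rewrite !geq_max => /and3P[/h1 a /h2 b /h3 c].
rewrite -ltr_sqr ?nnegrE ?hnorm_ge0 ?(ltW e0)//.
rewrite mk3B hnorm_mk3; move: a b c (hnorm_ge0 ipL (u_ n - u)) (hnorm_ge0 ipL (v_ n - v))
  (hnorm_ge0 ipL (w_ n - w)).
by move: (nrm _) (nrm _) (nrm _) => a b c ? ? ? ? ? ?; nra.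
Qed.

Lemma comp_le z : [/\ nrm z.1.1 <= hnorm ip z, nrm (wd z.1.2) <= hnorm ip z &
  nrm z.2 <= hnorm ip z].
Proof.
have := hnorm_mk3 z.1.1 (wd z.1.2) z.2; rewrite mk3K => h.
by split; apply: le_of_sqr; rewrite ?hnorm_ge0// h;
  move: (nrm _) (nrm _) (nrm _) => a b c; nra.
Qed.

Lemma wdB (g h : H10 L) : wd (g - h) = wd g - wd h.
Proof. by have := wd_lin (-1) h g; rewrite !scaleN1r ![- _ + _]addrC. Qed.

Lemma comp_dist z z' : [/\ nrm (z.1.1 - z'.1.1) <= hnorm ip (z - z'),
  nrm (wd z.1.2 - wd z'.1.2) <= hnorm ip (z - z') &
  nrm (z.2 - z'.2) <= hnorm ip (z - z')].
Proof. by rewrite -wdB; exact: comp_le (z - z'). Qed.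

Lemma hcvg_comp (z_ : nat -> state) z : hcvg ip z_ z ->
  [/\ hcvg ipL (fun n => (z_ n).1.1) z.1.1,
      hcvg ipL (fun n => wd (z_ n).1.2) (wd z.1.2) &
      hcvg ipL (fun n => (z_ n).2) z.2].
Proof.
move=> /hcvgP h; split; apply/hcvgP => e /h[N hN]; exists N => n /hN;
  by apply: le_lt_trans; have [] := comp_dist (z_ n) z.
Qed.

Lemma hcvg_mk3_comp (u_ v_ w_ : nat -> L2 L) z :
  hcvg ip (fun n => mk3 (u_ n) (v_ n) (w_ n)) z ->
  [/\ hcvg ipL u_ z.1.1, hcvg ipL v_ (wd z.1.2) & hcvg ipL w_ z.2].
Proof.
move=> /hcvg_comp[h1 h2 h3]; split; [exact: h1| |exact: h3].
by apply: hcvg_ext h2 => n; exact: wd_mk10.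
Qed.

Lemma state_hilbert : hilbert_space ip.
Proof.
split=> // z_ hz.
have hc (P : state -> L2 L) : (forall z z', nrm (P z - P z') <= hnorm ip (z - z')) ->
    exists u, hcvg ipL (fun n => P (z_ n)) u.
  move=> hP; apply: L2_complete => e /hz[N hN]; exists N => n p Nn Np.
  by apply: le_lt_trans (hP _ _) _; exact: hN.
have [|u hu] := hc (fun z => z.1.1); first by move=> z z'; have [] := comp_dist z z'.
have [|v hv] := hc (fun z => wd z.1.2); first by move=> z z'; have [] := comp_dist z z'.
have [|w hw] := hc (fun z => z.2); first by move=> z z'; have [] := comp_dist z z'.
exists (mk3 u v w).
suff -> : z_ = (fun n => mk3 (z_ n).1.1 (wd (z_ n).1.2) (z_ n).2) by exact: hcvg_mk3 hu hv hw.
by apply/funext => n; rewrite mk3K.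
Qed.

End StateSpace.

(** * Multiplication by a bounded function *)

Section Multiplication.
Variables (R : realType) (L : R) (beta : R -> R).
Hypothesis L0 : 0 < L.
Hypothesis bL : Linfty L beta.
Local Notation mu := (@lebesgue_measure R).
Local Notation I := (`]0, L[%classic : set R).
Local Notation sq := (@square_integrable R L).
Local Notation cl := (@L2class R L).
Local Notation nrm := (hnorm (@ipL2 R L)).

(** Clipping beta at its essential bound changes it on a null set only and yields a function bounded
    at every point. *)
Lemma mul_Linfty : exists2 K, 0 <= K & forall f, sq f ->
  sq (fun x => (beta x)%:C * f x) /\
  nrm (cl (fun x => (beta x)%:C * f x)) ^+ 2 <= K * nrm (cl f) ^+ 2.
Proof.
have [mb [M hM]] := bL.
pose b x := Num.max (- `|M|) (Num.min `|M| (beta x)).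
have mb' : measurable_fun I b.
  apply: (@measurable_maxr _ _ _ _ (fun=> - `|M|) (fun x => Num.min `|M| (beta x))).
    exact: measurable_cst.
  apply: (@measurable_minr _ _ _ _ (fun=> `|M|) beta) => //; exact: measurable_cst.
have bM x : `|b x| <= `|M|.
  rewrite ler_norml /b le_max lexx /= ge_max.
  by rewrite ge_min lexx andbT (@le_trans _ _ 0)// oppr_le0.
have bE : {ae mu, forall x, I x -> beta x = b x}.
  apply: filterS hM; first exact: aeF.
  move=> x h Ix; have := le_trans (h Ix) (ler_norm M).
  rewrite ler_norml => /andP[h1 h2]; rewrite /b min_r ?max_r//.
exists (`|M| ^+ 2); first exact: sqr_ge0.
move=> f fs; have hb x : I x -> sqmod (b x)%:C <= `|M| ^+ 2.
  by move=> _; rewrite sqmod_real -real_normK ?num_real// lerXn2r ?nnegrE.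
have bs : sq (fun x => (b x)%:C * f x) := sq_mulb (cmeasurable_real mb') hb fs.
have E : {ae mu, forall x, I x -> (beta x)%:C * f x = (b x)%:C * f x}.
  by apply: filterS bE; [exact: aeF|move=> x h Ix; rewrite h].
have s1 : sq (fun x => (beta x)%:C * f x).
  apply: sq_ae E bs; apply: cmeasurableM; first exact: cmeasurable_real.
  exact: sq_meas.
split => //; rewrite (L2class_ae s1 bs E).
exact: hnorm_mulb (cmeasurable_real mb') hb fs.
Qed.

Lemma sq_beta f : sq f -> sq (fun x => (beta x)%:C * f x).
Proof. by have [K _ h] := mul_Linfty => /h[]. Qed.

End Multiplication.

(** * Bounded linear maps *)

Section BoundedLinear.
Variables (R : realType) (H K : lmodType R[i]).
Variables (ip : H -> H -> R[i]) (ip' : K -> K -> R[i]).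
Hypotheses (ipP : inner_product ip) (ipP' : inner_product ip').

Definition blin (T : H -> K) := (forall a u v, T (a *: u + v) = a *: T u + T v) /\
  exists2 C, 0 <= C & forall u, hnorm ip' (T u) ^+ 2 <= C * hnorm ip u ^+ 2.

Lemma blin_sub T u v : blin T -> T (u - v) = T u - T v.
Proof. by move=> [lin _]; rewrite -scaleN1r addrC lin scaleN1r addrC. Qed.

Lemma blin0 T : blin T -> T 0 = 0.
Proof. by move=> bT; rewrite -(subrr 0) (blin_sub _ _ bT) subrr. Qed.

Lemma blinZ T a u : blin T -> T (a *: u) = a *: T u.
Proof. by move=> bT; have [lin _] := bT; rewrite -[a *: u]addr0 lin (blin0 bT) addr0. Qed.

Lemma blin_sum T (J : Type) (s : seq J) (a : J -> R[i]) (x : J -> H) : blin T ->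
  T (\sum_(j <- s) a j *: x j) = \sum_(j <- s) a j *: T (x j).
Proof.
move=> bT; elim: s => [|j s IH]; first by rewrite !big_nil (blin0 bT).
by rewrite !big_cons; have [-> _] := bT; rewrite IH.
Qed.

Lemma blin_cvg T (u_ : nat -> H) u : blin T -> hcvg ip u_ u ->
  hcvg ip' (fun n => T (u_ n)) (T u).
Proof.
move=> bT; have [_ [C _ hC]] := bT.
by apply: hcvg_bounded hC => x y; exact: blin_sub.
Qed.

Lemma blin_lin a T S : blin T -> blin S -> blin (fun u => a *: T u + S u).
Proof.
move=> [lT [C C0 hC]] [lS [D D0 hD]]; split=> [b u v|].
  rewrite lT lS !scalerDr !scalerA mulrC.
  by rewrite -!addrA; congr (_ + _); rewrite addrCA.
exists (2 * (sqmod a * C + D)).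
  by rewrite mulr_ge0// addr_ge0// mulr_ge0// sqmod_ge0.
move=> u; apply: (le_trans (hnormD_sq_le ipP' _ _)).
rewrite (hnorm_sqZ ipP').
rewrite [leRHS](_ : _ = 2 * (sqmod a * (C * hnorm ip u ^+ 2) + D * hnorm ip u ^+ 2)); last by ring.
by rewrite ler_wpM2l// lerD// ler_wpM2l ?sqmod_ge0.
Qed.

Lemma blinD T S : blin T -> blin S -> blin (fun u => T u + S u).
Proof.
by move=> bT /(blin_lin 1 bT); congr blin; apply/funext => u; rewrite scale1r.
Qed.

Lemma blin_functional (l : H -> R[i]) (C : R) (e : K) : 0 <= C ->
  (forall a u v, l (a *: u + v) = a * l u + l v) ->
  (forall u, sqmod (l u) <= C * hnorm ip u ^+ 2) -> blin (fun u => l u *: e).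
Proof.
move=> C0 ll lC; split=> [a u v|]; first by rewrite ll scalerDl scalerA.
exists (C * hnorm ip' e ^+ 2); first by rewrite mulr_ge0 ?sqr_ge0.
move=> u; rewrite (hnorm_sqZ ipP') mulrAC ler_wpM2r ?sqr_ge0//.
Qed.

End BoundedLinear.

Lemma blin_comp (R : realType) (H K M : lmodType R[i]) (ip : H -> H -> R[i])
    (ip' : K -> K -> R[i]) (ip'' : M -> M -> R[i]) (S : K -> M) (T : H -> K) :
  blin ip' ip'' S -> blin ip ip' T -> blin ip ip'' (fun u => S (T u)).
Proof.
move=> [lS [D D0 hD]] [lT [C C0 hC]]; split=> [a u v|]; first by rewrite lT lS.
exists (D * C) => [|u]; first exact: mulr_ge0.
by apply: (le_trans (hD _)); rewrite -mulrA ler_wpM2l.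
Qed.

(** * The domain of the operator, and closedness *)

Section Domain.
Variables (R : realType) (L c : R) (beta : R -> R) (alpha : R).
Hypothesis L0 : 0 < L.
Hypothesis bL : Linfty L beta.
Local Notation mu := (@lebesgue_measure R).
Local Notation I := (`]0, L[%classic : set R).
Local Notation sq := (@square_integrable R L).
Local Notation cl := (@L2class R L).
Local Notation ipL := (@ipL2 R L).
Local Notation ac := (@ac R L).
Local Notation state := (state L).
Local Notation ip := (@ip0 R L).
Local Notation domA := (@domA R L alpha).
Local Notation appA := (@appA R L c beta).
Let ipP := @ipL2_inner R L.
Let ip0P := @ip0_inner R L L0.
Let x0L : 0 <= (0 : R) <= L. Proof. by rewrite lexx ltW. Qed.
Let xLL : 0 <= L <= L. Proof. by rewrite lexx ltW. Qed.
Implicit Types (u v w k r q : L2 L) (z : state).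

Lemma cl_beta_ae f g : sq f -> sq g -> {ae mu, forall x, I x -> f x = g x} ->
  cl (fun x => (beta x)%:C * f x) = cl (fun x => (beta x)%:C * g x).
Proof.
move=> fs gs fg; apply: L2class_ae; [exact: sq_beta bL _ fs|exact: sq_beta bL _ gs|].
by apply: filterS fg; [exact: aeF|move=> x h Ix; rewrite h].
Qed.

Lemma domA_ac F F1 F2 G G1 G2 P Q : ac F F1 -> ac F1 F2 -> ac G G1 -> ac G1 G2 ->
  ac P Q -> F 0 = 0 -> F L = 0 -> G 0 = 0 -> P 0 = 0 -> G1 L + alpha%:C * P L = 0 ->
  domA (mk3 (cl F) (cl G1) (cl P)) /\
  appA (mk3 (cl F) (cl G1) (cl P)) =
    mk3 (cl F2 + c%:C *: cl F + cl (fun x => (beta x)%:C * G x)) (cl Q) (cl G2).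
Proof.
move=> hF hF1 hG hG1 hP F0 FL G0 P0 bc.
have gE : H10_val (mk10 (cl G1)) = cl G.
  by rewrite -(toH10_mk10 L0 hG G0) (toH10_ac L0 hG G0).
have [wF wF1] := (wderiv_ac L0 hF, wderiv_ac L0 hF1).
have [wG wG1] := (wderiv_ac L0 hG, wderiv_ac L0 hG1).
split.
  rewrite /Defs.domA /mk3 /= gE; split; split.
  - by split; [exact: (H1_ac L0 hF)|rewrite wF; exact: (H1_ac L0 hF1)].
  - by split; [exact: (H1_ac L0 hG)|rewrite wG; exact: (H1_ac L0 hG1)].
  - exact: (H1_ac L0 hP).
  - by rewrite -F0; exact: trace_ac hF x0L.
  - by rewrite -FL; exact: trace_ac hF xLL.
  - by rewrite -G0; exact: trace_ac hG x0L.
  - by rewrite -P0; exact: trace_ac hP x0L.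
  - exists (G1 L), (P L); split => //; last exact: trace_ac hP xLL.
    by rewrite wG; exact: trace_ac hG1 xLL.
rewrite /Defs.appA /mk3 /= gE wF wF1 wG wG1 (toH10_mk10 L0 hP P0).
congr (_ + _, _, _); apply: cl_beta_ae; [exact: L2_sq|exact: ac_sq hG|].
by apply: L2classE; exact: ac_sq hG.
Qed.

Definition Pop u : L2 L := cl (prim u).
Definition one : L2 L := cl (fun=> 1).
Definition idL : L2 L := cl (fun x => x%:C).
Definition Bop v := cl (fun x => (beta x)%:C * prim v x).

Lemma ac_id : ac (fun x => x%:C) (fun=> 1).
Proof.
apply: (ac_cderive L0); last by split => x; exact: cvg_cst.
by apply: (@cderive_real R id (fun=> 1)) => x; exact: is_derive_id.
Qed.

Lemma prim_one (x : R) : 0 <= x <= L -> prim (fun=> 1) x = x%:C :> R[i].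
Proof. by move=> x0; have [_ /(_ x x0)] := ac_id; rewrite add0r. Qed.

Lemma prim_L2_lin a u v (x : R) : x <= L ->
  prim (a *: u + v : L2 L) x = a * prim u x + prim v x.
Proof.
move=> xL; rewrite -(@prim_lin R L)//; [|exact: L2_sq..].
by apply: (prim_ae (L2_sq _) (sq_lin _ (L2_sq _) (L2_sq _)) xL); exact: L2_linE.
Qed.

Lemma prim_cl (x : R) (f : R -> R[i]) : sq f -> x <= L -> prim (cl f) x = prim f x.
Proof. by move=> fs xL; apply: (prim_ae (L2_sq _) fs xL); exact: L2classE. Qed.

Lemma sq_primL u : sq (prim u). Proof. by apply: (sq_prim L0); exact: L2_sq. Qed.

Lemma blin_Pop : blin ipL ipL Pop.
Proof.
split=> [a u v|].
  rewrite -L2_linE_cl; [|exact: sq_primL..]; apply: L2class_eq; first exact: sq_primL.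
  by move=> x /I_itv/andP[_ xL]; rewrite prim_L2_lin.
exists (L ^+ 2); first exact: sqr_ge0.
by move=> u; have := hnorm_prim L0 (L2_sq u); rewrite L2class_fun.
Qed.

Lemma blin_primL (e : L2 L) : blin ipL ipL (fun u => prim u L *: e).
Proof.
apply: (@blin_functional _ _ _ _ _ ipP (fun u => prim u L) L).
- exact: ltW.
- by move=> a u v; exact: prim_L2_lin.
- by move=> u; have := prim_bound (L2_sq u) xLL; rewrite L2class_fun.
Qed.

Lemma blin_Bop : blin ipL ipL Bop.
Proof.
have [K K0 hK] := mul_Linfty bL.
have b1 : blin ipL ipL (fun u => cl (fun x => (beta x)%:C * u x)).
  split=> [a u v|]; last first.
    by exists K => // u; have [_] := hK _ (L2_sq u); rewrite L2class_fun.
  have [su sv] := ((hK _ (L2_sq u)).1, (hK _ (L2_sq v)).1).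
  rewrite -L2_linE_cl//; apply: L2class_ae; first exact: (hK _ (L2_sq _)).1.
    exact: sq_lin.
  apply: filterS (L2_linE a u v); first exact: aeF.
  by move=> x h Ix; rewrite h// mulrDr mulrCA.
have := blin_comp b1 blin_Pop; congr blin; apply/funext => u.
by apply: cl_beta_ae; [exact: L2_sq|exact: sq_primL|apply: L2classE; exact: sq_primL].
Qed.

(* [Xf k], [Xg1 r + Xg2 q] and [Pop q] are the three components of the element of the
   domain with f'' = k, g'' = r and h' = q; the boundary conditions fix the constants of
   integration. *)
Definition Xf k := Pop (Pop k) + (- L^-1)%:C *: (prim (Pop k) L *: idL).
Definition Xg1 r := Pop r + (-1) *: (prim r L *: one).
Definition Xg2 q := (- alpha)%:C *: (prim q L *: one).
Definition domain_elt k r q := mk3 (Xf k) (Xg1 r + Xg2 q) (Pop q).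

Lemma blin_Xf : blin ipL ipL Xf.
Proof.
have h := blin_comp (blin_primL idL) blin_Pop.
have := blin_lin ipP (- L^-1)%:C h (blin_comp blin_Pop blin_Pop).
by congr blin; apply/funext => u; rewrite addrC.
Qed.

Lemma blin_Xg1 : blin ipL ipL Xg1.
Proof.
have := blin_lin ipP (-1) (blin_primL one) blin_Pop.
by congr blin; apply/funext => u; rewrite addrC.
Qed.

Lemma blin_Xg2 : blin ipL ipL Xg2.
Proof.
have b0 : blin ipL ipL (fun=> 0).
  split=> [a u v|]; first by rewrite scaler0 addr0.
  by exists 0 => // u; rewrite (hnorm0 ipP) expr0n mul0r.
have := blin_lin ipP (- alpha)%:C (blin_primL one) b0.
by congr blin; apply/funext => u; rewrite addr0.
Qed.

Lemma domain_elt_fun k r q : exists F F1 G1 P,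
  [/\ ac F F1, ac F1 k, ac G1 r & ac P q] /\
  [/\ F 0 = 0, F L = 0, P 0 = 0 & G1 L + alpha%:C * P L = 0] /\
  [/\ Xf k = cl F, Xg1 r + Xg2 q = cl G1 & Pop q = cl P].
Proof.
have acP f : sq f -> ac (prim f) f.
  move=> fs; have := @ac_prim R L 0 f fs.
  by congr ac; apply/funext => x; rewrite add0r.
have acPP := acP _ (sq_primL k).
have hD a f : sq f -> ac (fun x => a + prim f x) f.
  move=> fs; have := acD (ac_cst L a) (acP _ fs).
  by congr ac; apply/funext => x; rewrite add0r.
pose a := (- L^-1)%:C * prim (prim k) L; pose b := prim r L + alpha%:C * prim q L.
have hF := acD (acZ a ac_id) acPP.
exists (fun x => a * x%:C + prim (prim k) x), (fun x => a * 1 + prim k x),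
  (fun x => - b + prim r x), (prim q); split; [|split]; split.
- exact: hF.
- exact: hD (L2_sq k).
- exact: hD (L2_sq r).
- exact: acP (L2_sq q).
- by rewrite prim0 mulr0 addr0.
- by rewrite /a rmorphN /= fmorphV mulNr mulNr mulrAC mulVf ?mul1r ?addNr// fmorph_eq0 gt_eqF.
- exact: prim0.
- by rewrite /b opprD addrAC addrNK addNr.
- rewrite L2_linE_cl; [|exact: ac_sq ac_id|exact: ac_sq acPP].
  rewrite /Xf addrC scalerA /a (prim_cl (sq_primL k) (lexx L)).
  congr (_ + _); apply: L2class_eq; first exact: sq_primL.
  by move=> x /I_itv/andP[_ xL]; rewrite (prim_cl (sq_primL k) xL).
- rewrite L2classD; [|exact: sq_cst|exact: sq_primL].
  rewrite (_ : (fun=> - b) = fun=> (- b) * 1); last by apply/funext => x; rewrite mulr1.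
  rewrite L2classZ; last exact: sq_cst.
  rewrite /Xg1 /Xg2 -addrA addrC; congr (_ + _).
  by rewrite !scalerA -scalerDl mulN1r rmorphN /= mulNr opprD.
- by [].
Qed.

Lemma domain_eltP k r q : domA (domain_elt k r q) /\
  appA (domain_elt k r q) =
    mk3 (k + c%:C *: Xf k + Bop (Xg1 r + Xg2 q)) q r.
Proof.
have [F [F1 [G1 [P [[hF hF1 hG1 hP] [[F0 FL P0 bc] [E1 E2 E3]]]]]]] := domain_elt_fun k r q.
have hG : ac (prim G1) G1.
  have := ac_prim 0 (ac_sq L0 hG1).
  by congr ac; apply/funext => x; rewrite add0r.
have [h1 h2] := domA_ac hF hF1 hG hG1 hP F0 FL (prim0 _) P0 bc.
rewrite /domain_elt E1 E2 E3; split; first exact: h1.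
rewrite h2 !L2class_fun; congr mk3.
congr (_ + _); apply: L2class_eq => [|x /I_itv/andP[_ xL]].
  by apply: (sq_beta bL); exact: ac_sq hG.
by rewrite (prim_cl (ac_sq L0 hG1) xL).
Qed.

(** Together with [domain_eltP] this identifies the domain with the image of three L^2 parameters
    under bounded maps, so that limits in the domain are limits of parameters. *)
Lemma domA_elt z : domA z -> exists k r q, z = domain_elt k r q.
Proof.
case: z => [[f g] h] [[[Hf Hf1] [Hg Hg1] Hh] [f0 fL g0 h0 [y [y' [ty ty' bc]]]]].
rewrite /= in Hf Hf1 Hg Hg1 Hh f0 fL g0 h0 ty ty'.
have [F hF fE] := H1P L0 Hf; have [F1 hF1 f1E] := H1P L0 Hf1.
have [G1 hG1 g1E] := H1P L0 Hg1; have [P hP hE] := H1P L0 Hh.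
set k := wderiv (wderiv f) in hF1; set r := wderiv (wderiv _) in hG1.
set q := wderiv h in hP; exists k, r, q.
have F0 : F 0 = 0 by apply/esym/(trace_acE L0 hF x0L); rewrite -fE.
have FL : F L = 0 by apply/esym/(trace_acE L0 hF xLL); rewrite -fE.
have P0 : P 0 = 0 by apply/esym/(trace_acE L0 hP x0L); rewrite -hE.
have PL : y' = P L by apply: (trace_acE L0 hP xLL); rewrite -hE.
have G1L : y = G1 L by apply: (trace_acE L0 hG1 xLL); rewrite -g1E.
have PE x : 0 <= x <= L -> P x = prim q x by move=> xx; rewrite (hP.2 x xx) P0 add0r.
have FE x : 0 <= x <= L -> F x = F1 0 * x%:C + prim (Pop k) x.
  move=> xx; have /andP[_ xL] := xx; rewrite (hF.2 x xx) F0 add0r.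
  rewrite -(prim_one xx) (prim_cl (sq_primL k) xL).
  rewrite -(@prim_lin R L)//; [|exact: sq_cst|exact: sq_primL].
  rewrite f1E (prim_cl (ac_sq L0 hF1) xL).
  apply: prim_eq => t /andP[t0 tx]; rewrite (hF1.2 t) ?mulr1//.
  by rewrite (ltW t0) (le_trans (ltW tx)).
have F10 : F1 0 = (- L^-1)%:C * prim (Pop k) L.
  have /eqP := FE L xLL; rewrite FL eq_sym addr_eq0 => /eqP h1.
  rewrite rmorphN /= mulNr -mulrN fmorphV -[- prim _ _]h1 mulrC mulfK//.
  by rewrite fmorph_eq0 gt_eqF.
have E1 : f = Xf k.
  rewrite fE /Xf scalerA -F10 addrC -L2_linE_cl; [|exact: ac_sq ac_id|exact: sq_primL].
  by apply: L2class_eq => [|x /I_itv/FE]; first exact: ac_sq hF.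
have E2 : wd g = Xg1 r + Xg2 q.
  have -> : wd g = cl G1 by exact: g1E.
  pose b := prim r L + alpha%:C * prim q L.
  have G1E x : 0 <= x <= L -> G1 x = - b * 1 + prim r x.
    move=> xx; have [_ h1] := hG1; rewrite h1// mulr1; congr (_ + _).
    have := h1 L xLL; rewrite -G1L => h2.
    move: bc; rewrite h2 PL (PE L xLL) -addrA => /eqP; rewrite addr_eq0 => /eqP ->.
    by [].
  rewrite (@L2class_eq _ _ _ (fun x => - b * 1 + prim r x)); last first.
  - by move=> x /I_itv/G1E.
  - exact: ac_sq hG1.
  rewrite L2_linE_cl; [|exact: sq_cst|exact: sq_primL].
  rewrite /Xg1 /Xg2 addrC -addrA; congr (_ + _).
  by rewrite !scalerA -scalerDl mulN1r rmorphN /= mulNr opprD.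
have E3 : h = Pop q.
  by rewrite hE; apply: L2class_eq => [|x /I_itv/PE]; first exact: ac_sq hP.
by rewrite /domain_elt -E1 -E2 -E3 /mk3 mk10K.
Qed.

(* The second and third components of A z are h' and g'', and f'' is the first one minus
   bounded functions of z: all three parameters of the domain element converge. *)
Lemma opA_closed : closed_operator ip (opA L c beta alpha).
Proof.
have [lXf _] := blin_Xf; have [lX1 _] := blin_Xg1; have [lX2 _] := blin_Xg2.
have [lP _] := blin_Pop; have [lB _] := blin_Bop.
have Dlin a k r q k' r' q' : domain_elt (a *: k + k') (a *: r + r') (a *: q + q') =
    a *: domain_elt k r q + domain_elt k' r' q'.
  have EX : Xg1 (a *: r + r') + Xg2 (a *: q + q') =
      a *: (Xg1 r + Xg2 q) + (Xg1 r' + Xg2 q').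
    by rewrite (lX1 a r r') (lX2 a q q') (scalerDr a (Xg1 r) (Xg2 q)) addrACA.
  apply: etrans _ (mk3_lin L0 _ _ _ _ _ _ _).
  exact: (congr2 (fun f g => f g) (congr2 (@mk3 R L) (lXf a k k') EX) (lP a q q')).
split; first split.
- have := (domain_eltP 0 0 0).1; have := Dlin (-1) 0 0 0 0 0 0.
  by rewrite !scaleN1r !addNr => ->.
- move=> a z z' /= /domA_elt[k [r [q ->]]] /domA_elt[k' [r' [q' ->]]].
  rewrite -Dlin; split; first exact: (domain_eltP _ _ _).1.
  have [_ e1] := domain_eltP k r q; have [_ e2] := domain_eltP k' r' q'.
  have [_ e3] := domain_eltP (a *: k + k') (a *: r + r') (a *: q + q').
  apply: etrans e3 _; rewrite /= e1 e2; apply: etrans _ (mk3_lin L0 _ _ _ _ _ _ _).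
  apply: (congr1 (fun u => @mk3 R L u _ _)).
  have -> : Xg1 (a *: r + r') + Xg2 (a *: q + q') =
      a *: (Xg1 r + Xg2 q) + (Xg1 r' + Xg2 q').
    by rewrite (lX1 a r r') (lX2 a q q') (scalerDr a (Xg1 r) (Xg2 q)) addrACA.
  rewrite (lB a (Xg1 r + Xg2 q)) (lXf a k k').
  move: (Xf k) (Xf k') (Bop (Xg1 r + Xg2 q)) (Bop (Xg1 r' + Xg2 q')) => x x' b b'.
  rewrite !scalerDr !scalerA [c%:C * a]mulrC.
  by rewrite (addrACA (a *: k)) (addrACA _ _ (a *: b)).
move=> z_ z y dz hz hy.
have /choice[k_ hk] : forall n, exists k, exists r q, z_ n = domain_elt k r q.
  by move=> n; exact: domA_elt (dz n).
have /choice[r_ hr] := hk.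
have /choice[q_ hq] := hr.
have Aq n : app (opA L c beta alpha) (z_ n) =
    mk3 (k_ n + c%:C *: Xf (k_ n) + Bop (Xg1 (r_ n) + Xg2 (q_ n))) (q_ n) (r_ n).
  by rewrite hq; exact: (domain_eltP _ _ _).2.
have [y1 cq cr] := hcvg_mk3_comp L0 (hcvg_ext Aq hy).
have [z1 _ _] := hcvg_mk3_comp L0 (hcvg_ext hq hz).
pose g := Xg1 y.2 + Xg2 (wd y.1.2).
have cg : hcvg ipL (fun n => Xg1 (r_ n) + Xg2 (q_ n)) g.
  exact: (hcvgD ipP (blin_cvg blin_Xg1 cr) (blin_cvg blin_Xg2 cq)).
pose k := -1 *: Bop g + (- c%:C *: z.1.1 + y.1.1).
have ck : hcvg ipL k_ k.
  have h := hcvg_lin ipP (- c%:C) z1 y1.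
  apply: hcvg_ext (hcvg_lin ipP (-1) (blin_cvg blin_Bop cg) h) => n.
  move: (Xf (k_ n)) (Bop (Xg1 (r_ n) + Xg2 (q_ n))) => x w; move: (k_ n) => v; rewrite scaleN1r scaleNr.
  move: (c%:C *: _) => u.
  by rewrite addrA -opprD addrC -(addrA v) [u + w]addrC addrK.
have cz : hcvg ip z_ (domain_elt k y.2 (wd y.1.2)).
  apply: hcvg_ext (hcvg_mk3 L0 (blin_cvg blin_Xf ck) cg (blin_cvg blin_Pop cq)) => n.
  by rewrite hq.
have zE := hcvg_uniq ip0P hz cz.
have [d1 d2] := domain_eltP k y.2 (wd y.1.2).
rewrite zE; split => //; rewrite [LHS]d2 -/g.
have -> : k + c%:C *: Xf k + Bop g = y.1.1.
  rewrite (_ : Xf k = z.1.1); last by rewrite zE.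
  rewrite /k; move: (Bop g) z.1.1 y.1.1 => v x u; rewrite scaleN1r scaleNr.
  by move: (c%:C *: x) => w; rewrite [- w + u]addrC addrA addrNK addrAC addNr add0r.
exact: mk3K.
Qed.

End Domain.

Opaque wderiv wd mk10.

(** * Eigenvectors *)

Section Hyperbolic.
Variable R : realType.
Implicit Types (z w l : R[i]) (x y : R).

Definition Ccosh z : R[i] := (Cexp z + Cexp (- z)) / 2%:R.

Lemma CexpN z : Cexp z * Cexp (- z) = 1.
Proof. by rewrite -CexpD subrr Cexp0. Qed.

Lemma Csinh0 : Csinh (0 : R[i]) = 0.
Proof. by rewrite /Csinh oppr0 subrr mul0r. Qed.

Lemma CsinhB z w : Csinh (z - w) = Csinh z * Ccosh w - Ccosh z * Csinh w.
Proof.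
rewrite /Csinh /Ccosh opprB !CexpD.
by move: (Cexp z) (Cexp (- z)) (Cexp w) (Cexp (- w)) => a b p q; field.
Qed.

Lemma Ccosh_sinh z : Ccosh z * Ccosh z - Csinh z * Csinh z = 1.
Proof.
rewrite -[RHS](CexpN z) /Csinh /Ccosh.
by move: (Cexp z) (Cexp (- z)) => a b; field.
Qed.

Lemma cderive_CexpN l :
  cderive (fun x => Cexp (- (l * x%:C))) (fun x => - l * Cexp (- (l * x%:C))).
Proof.
have := cderive_Cexp (- l).
by congr cderive; apply/funext => x; rewrite -mulNr.
Qed.

Lemma cderive_Csinh l :
  cderive (fun x => Csinh (l * x%:C)) (fun x => l * Ccosh (l * x%:C)).
Proof.
have := cderiveZ (2%:R^-1) (cderiveD (cderive_Cexp l) (cderiveZ (-1) (cderive_CexpN l))).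
congr cderive; apply/funext => x; rewrite /Csinh /Ccosh.
  by rewrite mulN1r mulrC.
by move: (Cexp _) (Cexp _) => a b; field.
Qed.

Lemma cderive_Ccosh l :
  cderive (fun x => Ccosh (l * x%:C)) (fun x => l * Csinh (l * x%:C)).
Proof.
have := cderiveZ (2%:R^-1) (cderiveD (cderive_Cexp l) (cderive_CexpN l)).
congr cderive; apply/funext => x; rewrite /Csinh /Ccosh; first by rewrite mulrC.
by move: (Cexp _) (Cexp _) => a b; field.
Qed.

Lemma sin_int_pi (m : int) : sin (m%:~R * pi) = 0 :> R.
Proof.
have h (n : nat) : sin (n%:R * pi) = 0 :> R.
  elim: n => [|n IH]; first by rewrite mul0r sin0.
  by rewrite -natr1 mulrDl mul1r sinDpi IH oppr0.
by case: m => n; [exact: h|rewrite NegzE mulrNz mulNr sinN h oppr0].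
Qed.

Lemma sin_eq0 y : sin y = 0 -> exists n : nat, y ^+ 2 = n%:R ^+ 2 * pi ^+ 2.
Proof.
wlog y0 : y / 0 <= y => [h|] sy.
  have [/h|/ltW yn] := leP 0 y; first exact.
  by rewrite -sqrrN; apply: h; rewrite ?oppr_ge0// sinN sy oppr0.
have p0 : 0 < pi :> R := pi_gt0 R.
pose n := Num.truncn (y / pi); exists n.
have /andP[n1 n2] := Num.Theory.truncn_itv (divr_ge0 y0 (ltW p0)).
rewrite ler_pdivlMr// -/n in n1; rewrite ltr_pdivrMr// -/n in n2.
pose t := y - n%:R * pi.
have st : sin t = 0.
  by rewrite /t sinB sy (sin_int_pi n) mul0r mulr0 subrr.
suff -> : y = n%:R * pi by rewrite exprMn.
apply/eqP; rewrite -subr_eq0 -/t; apply: contraT => t0.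
suff : 0 < sin t by rewrite st ltxx.
apply: sin_gt0_pi; rewrite lt_def t0 subr_ge0 n1 /=.
by rewrite /t ltrBlDr; move: n2; rewrite -natr1 mulrDl mul1r addrC.
Qed.

Lemma cRe_Csinh z : Re (Csinh z) = (expR (Re z) - expR (- Re z)) / 2 * cos (Im z).
Proof.
rewrite /Csinh (_ : 2%:R^-1 = (2^-1 : R)%:C); last by rewrite rmorphV/= ?unitfE ?pnatr_eq0// rmorph_nat.
rewrite cReM cIm_real mulr0 subr0 cRe_real cReB !cRe_Cexp cReN cImN cosN.
by ring.
Qed.

Lemma cIm_Csinh z : Im (Csinh z) = (expR (Re z) + expR (- Re z)) / 2 * sin (Im z).
Proof.
rewrite /Csinh (_ : 2%:R^-1 = (2^-1 : R)%:C); last by rewrite rmorphV/= ?unitfE ?pnatr_eq0// rmorph_nat.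
rewrite cImM cIm_real mulr0 add0r cRe_real cImB !cIm_Cexp cReN cImN sinN.
by ring.
Qed.

(** The imaginary part cosh (Re z) sin (Im z) vanishes only with sin (Im z). Then cos (Im z) is
    non-zero, and the real part sinh (Re z) cos (Im z) forces Re z = 0. Squares hide the sign of Im
    z. *)
Lemma Csinh_eq0 z : Csinh z = 0 -> exists n : nat, z ^+ 2 = (- (n%:R ^+ 2 * pi ^+ 2))%:C.
Proof.
move=> sz; have := cIm_Csinh z; rewrite sz => /esym/eqP.
rewrite mulf_eq0 gt_eqF ?divr_gt0 ?addr_gt0 ?expR_gt0//= => /eqP s0.
have [n hn] := sin_eq0 s0; exists n.
have := cRe_Csinh z; rewrite sz => /esym/eqP.
have c0 : cos (Im z) != 0.
  by rewrite -normr_eq0 (sin0cos1 s0) oner_eq0.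
rewrite mulf_eq0 (negbTE c0) orbF mulf_eq0 invr_eq0 pnatr_eq0 orbF subr_eq0.
move=> /eqP/expR_inj r0; have rz : Re z = 0 by lra.
by apply: complexP; rewrite expr2 !ReImE rz -?hn; ring.
Qed.

End Hyperbolic.

(** * Energy identity and the explicit eigenvectors *)

Section Eigenvectors.
Variables (R : realType) (L c : R) (beta : R -> R) (alpha : R).
Hypothesis L0 : 0 < L.
Hypothesis bL : Linfty L beta.
Hypothesis alpha1 : 1 < alpha.
Local Notation mu := (@lebesgue_measure R).
Local Notation I := (`]0, L[%classic : set R).
Local Notation sq := (@square_integrable R L).
Local Notation cl := (@L2class R L).
Local Notation ipL := (@ipL2 R L).
Local Notation nrm := (hnorm ipL).
Local Notation ac := (@ac R L).
Local Notation state := (state L).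
Local Notation domA := (@domA R L alpha).
Local Notation appA := (@appA R L c beta).
Local Notation A := (opA L c beta alpha).
Local Notation sig := (sigma L alpha).
Local Notation lam2 := (lambda2 L alpha).
Let ipP := @ipL2_inner R L.
Let x0L : 0 <= (0 : R) <= L. Proof. by rewrite lexx ltW. Qed.
Let xLL : 0 <= L <= L. Proof. by rewrite lexx ltW. Qed.
Implicit Types (u v w : L2 L) (z : state).

(** Integration by parts. Its real part serves for injectivity of A - l, its imaginary part for the
    decay of the first components. *)
Lemma energy F F1 F2 : ac F F1 -> ac F1 F2 -> F 0 = 0 ->
  ipL (cl F2) (cl F) = F1 L * conjc (F L) - (nrm (cl F1) ^+ 2)%:C.
Proof.
move=> hF hF1 F0; have := ac_by_parts L0 hF1 (ac_conj hF).
rewrite F0 conjc0 mulr0 subr0 => <-; rewrite -(ip_self ipP).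
rewrite !ipL2_cl; [|exact: ac_sq hF1|exact: ac_sq hF1|by case: hF1|exact: ac_sq hF].
by rewrite addrK.
Qed.

Lemma mk3_inj u v w u' v' w' : mk3 u v w = mk3 u' v' w' -> [/\ u = u', v = v' & w = w'].
Proof.
move=> h; split; [exact: (congr1 (fun z : state => z.1.1) h)| |
  exact: (congr1 (fun z : state => z.2) h)].
have e := congr1 (fun z : state => wd z.1.2) h.
by rewrite -(wd_mk10 L0 v) -(wd_mk10 L0 v'); exact: e.
Qed.

Lemma mk30 : mk3 0 0 0 = 0 :> state.
Proof. by have := mk3_lin L0 (-1) 0 0 0 0 0 0; rewrite !scaleN1r !addNr. Qed.

Lemma mk3Z a u v w : mk3 (a *: u) (a *: v) (a *: w) = a *: mk3 u v w.
Proof.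
have := mk3_lin L0 a u v w 0 0 0; rewrite !addr0 mk30 => ->.
exact: addr0.
Qed.

(** Here h = l g and g'' = l h, and the boundary condition turns the energy identity into l^2 |g|^2
    + |g'|^2 + alpha l |g(L)|^2 = 0, so g = h = 0. What remains is f'' = (l - c) f, and the identity
    for f gives f = 0 since l > c. *)
Lemma resolvent_injective (l : R) z : 0 < l -> c < l -> domA z ->
  appA z = l%:C *: z -> z = 0.
Proof.
move=> l0 cl /(domA_elt L0)[k [r [q ->]]].
have [F [F1 [G1 [P [[hF hF1 hG1 hP] [[F0 FL P0 bc] [E1 E2 E3]]]]]]] :=
  domain_elt_fun alpha L0 k r q.
rewrite (domain_eltP c alpha L0 bL k r q).2 /domain_elt E1 E2 E3 -mk3Z.
move=> /mk3_inj[e1 e2 e3].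
have hG : ac (prim G1) G1.
  have := ac_prim 0 (ac_sq L0 hG1).
  by congr ac; apply/funext => x; rewrite add0r.
have [sG1 sG] := (ac_sq L0 hG1, ac_sq L0 hG).
have PE x : 0 <= x <= L -> P x = l%:C * prim G1 x.
  move=> xx; have /andP[_ xL] := xx; rewrite (hP.2 x xx) P0 add0r e2.
  by rewrite -(L2classZ l%:C sG1) (prim_cl (sqZ _ sG1) xL) (primZ _ sG1 xL).
have clP : L2class L P = l%:C *: L2class L (prim G1).
  rewrite -(L2classZ l%:C sG); apply: L2class_eq => [|x /I_itv/PE//].
  exact: ac_sq hP.
have eG := energy hG hG1 (prim0 G1).
rewrite L2class_fun e3 clP !(ipZl ipP) (ip_self ipP) in eG.
have G1L : G1 L = (- alpha * l)%:C * prim G1 L.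
  move/eqP: bc; rewrite addr_eq0 => /eqP ->; rewrite (PE _ xLL).
  by rewrite rmorphM rmorphN /= mulNr mulNr mulrA.
rewrite G1L -mulrA mulcJ in eG.
have := congr1 (fun z : R[i] => Re z) eG; rewrite !ReImE !mul0r ?mulr0 ?subr0.
set nG := nrm _ ^+ 2; set nG1 := nrm _ ^+ 2; set t := sqmod _ => {}eG.
have nG_ge0 : 0 <= nG by exact: sqr_ge0.
have nG1_ge0 : 0 <= nG1 by exact: sqr_ge0.
have alt : 0 <= alpha * l * t.
  by rewrite !mulr_ge0 ?sqmod_ge0 ?ltW// (lt_trans ltr01).
have l2G : 0 <= l * (l * nG) by apply: mulr_ge0 (ltW l0) (mulr_ge0 (ltW l0) nG_ge0).
have nG10 : nG1 = 0 by lra.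
have nG0 : nG = 0.
  have : l * (l * nG) = 0 by lra.
  by move/eqP; rewrite mulf_eq0 (gt_eqF l0) /= mulf_eq0 (gt_eqF l0) => /eqP.
have G10 : L2class L G1 = 0.
  by apply/eqP; rewrite -(hnorm_eq0 ipP) -sqrf_eq0; apply/eqP.
have G00 : L2class L (prim G1) = 0.
  by apply/eqP; rewrite -(hnorm_eq0 ipP) -sqrf_eq0; apply/eqP.
rewrite clP G10 G00 scaler0.
rewrite G10 (blin0 (blin_Bop L0 bL)) addr0 in e1.
have kE : k = (l - c)%:C *: L2class L F.
  by rewrite rmorphB scalerBl -e1 addrK.
have eF := energy hF hF1 F0.
rewrite L2class_fun kE (ipZl ipP) (ip_self ipP) FL conjc0 mulr0 sub0r in eF.
have := congr1 (fun z : R[i] => Re z) eF; rewrite !ReImE !mul0r !subr0 => {}eF.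
have F00 : L2class L F = 0.
  apply/eqP; rewrite -(hnorm_eq0 ipP) -sqrf_eq0.
  move: eF (sqr_ge0 (nrm (L2class L F1))) (sqr_ge0 (nrm (L2class L F))).
  set nF := nrm _ ^+ 2; set nF1 := nrm _ ^+ 2 => eF nF1_ge0 nF_ge0.
  have lc : 0 < l - c by rewrite subr_gt0.
  have : (l - c) * nF = 0.
    by apply/eqP; rewrite eq_le mulr_ge0 ?(ltW lc)// andbT eF oppr_le0.
  by move/eqP; rewrite mulf_eq0 (gt_eqF lc).
by rewrite F00; exact: mk30.
Qed.

Lemma sigma_lt0 : sig < 0.
Proof.
have a1 : 0 < alpha - 1 by rewrite subr_gt0.
have a2 : 0 < alpha + 1 by rewrite addr_gt0// (lt_trans ltr01).
rewrite /sigma pmulr_rlt0 ?invr_gt0 ?mulr_gt0// ln_lt0//.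
by rewrite divr_gt0// ltr_pdivrMr// mul1r; lra.
Qed.

Lemma expR_sigma : expR (2 * L * sig) = (alpha - 1) / (alpha + 1).
Proof.
have a1 : 0 < alpha - 1 by rewrite subr_gt0.
have a2 : 0 < alpha + 1 by rewrite addr_gt0// (lt_trans ltr01).
rewrite /sigma mulVKf ?mulf_neq0 ?gt_eqF// lnK// posrE divr_gt0//.
Qed.

Lemma Cexp_boundary m : Cexp (2 * (lam2 m * L%:C)) = ((alpha - 1) / (alpha + 1))%:C.
Proof.
have e1 : Re (2 * (lam2 m * L%:C)) = 2 * L * sig.
  rewrite mulr_natl mulr2n !ReImE mulr0 subr0.
  change (sig * L + sig * L = 2 * L * sig).
  by move: sig => t; ring.
have e2 : Im (2 * (lam2 m * L%:C)) = (m * 2)%:~R * pi.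
  rewrite mulr_natl mulr2n cImD cImM (cIm_real L) (cRe_real L) mulr0 add0r.
  change (m%:~R * pi / L * L + m%:~R * pi / L * L = (m * 2)%:~R * pi).
  by rewrite divfK ?gt_eqF// intrM; ring.
have c1 : cos ((m * 2)%:~R * pi) = 1 :> R.
  rewrite intrM mulrAC [X in cos X](_ : _ = (m%:~R * pi) *+ 2); last by rewrite mulr_natr.
  by rewrite cos_mulr2n cos2sin2 sin_int_pi expr0n /= subr0 mulr2n addrK.
apply: complexP; rewrite ?cRe_Cexp ?cIm_Cexp e1 e2.
  by rewrite c1 mulr1 expR_sigma.
by rewrite sin_int_pi mulr0.
Qed.

(** After multiplication by 2 e^z this is e^{2z} (alpha + 1) = alpha - 1, the equation that
    determines the lambda_{2,m}. *)
Lemma boundary_lam2 m :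
  Ccosh (lam2 m * L%:C) + alpha%:C * Csinh (lam2 m * L%:C) = 0.
Proof.
have := Cexp_boundary m; set z := lam2 m * L%:C.
rewrite mulr_natl mulr2n CexpD => h.
have n0 : Cexp z != 0.
  by apply/eqP => z0; have := CexpN z; rewrite z0 mul0r => /eqP; rewrite eq_sym oner_eq0.
have a2 : ((alpha + 1)%:C : R[i]) != 0.
  by rewrite fmorph_eq0 gt_eqF// addr_gt0// (lt_trans ltr01).
have hN : Cexp (- z) = (Cexp z)^-1.
  by apply: (mulfI n0); rewrite CexpN mulfV.
rewrite /Ccosh /Csinh hN.
have E : Cexp z * Cexp z * (alpha%:C + 1) = alpha%:C - 1.
  rewrite h rmorphM fmorphV /= rmorphB rmorphD /= divfK//.
  by rewrite -rmorphD.
apply: (mulfI n0); rewrite mulr0.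
transitivity ((Cexp z * Cexp z * (alpha%:C + 1) - (alpha%:C - 1)) / 2).
  by move: n0 => /= n0; field.
by rewrite E subrr mul0r.
Qed.

Lemma eigen_of_ac (l : R[i]) F F1 F2 G G1 G2 P Q : ac F F1 -> ac F1 F2 -> ac G G1 ->
  ac G1 G2 -> ac P Q -> F 0 = 0 -> F L = 0 -> G 0 = 0 -> P 0 = 0 ->
  G1 L + alpha%:C * P L = 0 -> mk3 (cl F) (cl G1) (cl P) != 0 ->
  {ae mu, forall x, I x -> F2 x + c%:C * F x + (beta x)%:C * G x = l * F x} ->
  (forall x, Q x = l * G1 x) -> (forall x, G2 x = l * P x) ->
  eigenvector A l (mk3 (cl F) (cl G1) (cl P)).
Proof.
move=> hF hF1 hG hG1 hP F0 FL G0 P0 bc n0 eF eQ eG.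
have [h1 h2] := domA_ac c L0 bL hF hF1 hG hG1 hP F0 FL G0 P0 bc.
split => //; apply: etrans h2 _; rewrite -mk3Z.
have [[sF sG1] sP] := (ac_sq L0 hF, ac_sq L0 hG1, ac_sq L0 hP).
have [sF2 sG] := (hF1.1, ac_sq L0 hG).
rewrite -(L2classZ l sF) -(L2classZ l sG1) -(L2classZ l sP).
rewrite (_ : Q = fun x => l * G1 x); last by apply/funext.
rewrite (_ : G2 = fun x => l * P x); last by apply/funext.
congr mk3; rewrite -(L2classZ c%:C sF) -L2classD//; last exact: sqZ.
have s1 := sqD sF2 (sqZ c%:C sF); have s2 := sq_beta bL sG.
by rewrite -L2classD//; apply: L2class_ae => //; [exact: sqD|exact: sqZ].
Qed.

Lemma ac_sinn n : ac (fun x => (sinn L n x)%:C)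
  (fun x => (n%:R * pi / L)%:C * (cosn L n x)%:C).
Proof.
set w := n%:R * pi / L.
have d : cderive (fun x => (sinn L n x)%:C) (fun x => (w * cosn L n x)%:C).
  apply: cderive_real => x; have := is_derive_scale (is_derive_sin (x * w)).
  under [X in is_derive _ _ X]eq_fun do rewrite mulrC.
  by congr is_derive; rewrite /cosn -/w [x * _]mulrC.
have cd : ccontinuous (fun x => (w * cosn L n x)%:C).
  split=> x; last exact: cvg_cst.
  by apply: cvgM; [exact: cvg_cst|exact: (@cosn_continuous R L n)].
have := ac_cderive L0 d cd.
by congr ac; apply/funext => x; rewrite rmorphM.
Qed.

Lemma ac_cosn n : ac (fun x => (cosn L n x)%:C)
  (fun x => (- (n%:R * pi / L))%:C * (sinn L n x)%:C).
Proof.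
set w := n%:R * pi / L.
have d : cderive (fun x => (cosn L n x)%:C) (fun x => (- w * sinn L n x)%:C).
  apply: cderive_real => x; have := is_derive_scale (is_derive_cos (x * w)).
  under [X in is_derive _ _ X]eq_fun do rewrite mulrC.
  by congr is_derive; rewrite /sinn -/w [x * _]mulrC; ring.
have cd : ccontinuous (fun x => (- w * sinn L n x)%:C).
  split=> x; last exact: cvg_cst.
  by apply: cvgM; [exact: cvg_cst|exact: (@sinn_continuous R L n)].
have := ac_cderive L0 d cd.
by congr ac; apply/funext => x; rewrite rmorphM.
Qed.

Lemma phi1E n : phi1 L n = mk3 ((Num.sqrt (2 / L))%:C *: sinC L n) 0 0.
Proof.
rewrite /phi1 /mkstate (_ : cl (fun=> 0) = 0); last exact: L2class0.
have := toH10_mk10 L0 (ac_cst L 0) erefl; rewrite L2class0 => ->.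
rewrite -L2classZ; last exact: ac_sq (ac_sinn n).
by congr (L2class _ _, _, _); apply/funext => x; rewrite rmorphM.
Qed.

(** Non-vanishing stays a hypothesis, here and in [phi2_eigen]; [riesz_neq0] supplies it from the
    lower Riesz bound. *)
Lemma phi1_eigen n : phi1 L n != 0 -> eigenvector A (lambda1 L c n) (phi1 L n).
Proof.
rewrite phi1E -L2classZ; last exact: ac_sq (ac_sinn n).
rewrite -(L2class0 L) => n0.
set s := (Num.sqrt _)%:C in n0 *; set w := (n%:R * pi / L : R).
have hF := acZ s (ac_sinn n); have hF1 := acZ s (acZ w%:C (ac_cosn n)).
have h0 := ac_cst L 0.
apply: (eigen_of_ac hF hF1 h0 h0 h0) => //.
- by rewrite /sinn mulr0 sin0 mulr0.
- by rewrite /sinn divfK ?gt_eqF// (sin_int_pi R n) mulr0.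
- by rewrite mulr0 addr0.
- apply: (filterE (aeF R)) => x _; rewrite mulr0 addr0 -/w.
  rewrite /lambda1 (_ : n%:R ^+ 2 * pi ^+ 2 / L ^+ 2 = w ^+ 2); last first.
    by rewrite /w expr_div_n exprMn.
  rewrite rmorphB rmorphXn rmorphN /= !mulrA.
  move: (sinn L n x)%:C (w%:C) (c%:C) => a b d; ring.
- by move=> x; rewrite mulr0.
- by move=> x; rewrite mulr0.
Qed.

Hypothesis c_neq : forall n : nat, c <> sig + n%:R ^+ 2 * pi ^+ 2 / L ^+ 2.

(** A zero would give (r L)^2 = - n^2 pi^2, whose real part (sigma - c) L^2 = - n^2 pi^2 is what the
    condition on c excludes. *)
Lemma Csinh_root_neq0 m (r : R[i]) : r ^+ 2 = lam2 m - c%:C -> Csinh (r * L%:C) != 0.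
Proof.
move=> hr; apply/eqP => /Csinh_eq0[n]; rewrite exprMn hr => h.
apply: (c_neq (n := n)).
have := congr1 (fun z : R[i] => Re z) h.
rewrite -rmorphXn cReM (cIm_real (L ^+ 2)) mulr0 subr0 (cRe_real (L ^+ 2)) cReB.
rewrite (cRe_real c) (cRe_real (- _)).
change ((sig - c) * L ^+ 2 = - (n%:R ^+ 2 * pi ^+ 2) -> c = sig + n%:R ^+ 2 * pi ^+ 2 / L ^+ 2).
move=> e; have L2 : L ^+ 2 != 0 by rewrite expf_neq0// gt_eqF.
by rewrite -[n%:R ^+ 2 * _]opprK -e mulNr mulfK// opprB addrC subrK.
Qed.

Lemma Anorm_gt0 m : 0 < Anorm L alpha m.
Proof.
have s0 := sigma_lt0; have ms : 0 < - sig by rewrite oppr_gt0.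
have p0 : 0 < pi :> R := pi_gt0 R.
rewrite /Anorm; apply: divr_gt0; last first.
  by rewrite mulr_gt0// sqrtr_gt0 mulr_gt0.
rewrite sqrtr_gt0; apply: mulr_gt0.
  by rewrite ltr_pwDl ?mulr_gt0 ?exprn_gt0// mulr_ge0 ?sqr_ge0.
rewrite divr_gt0// subr_gt0 ltr_expR.
have : 0 < 2 * - sig * L by rewrite !mulr_gt0.
by move=> h; rewrite (lt_trans _ h)// oppr_lt0.
Qed.

Lemma cderive_cc F f f' : cderive F f -> cderive f f' -> ac F f.
Proof. by move=> hF /cderive_continuous; exact: ac_cderive. Qed.

Lemma ac_Csinh (l : R[i]) : ac (fun x => Csinh (l * x%:C)) (fun x => l * Ccosh (l * x%:C)).
Proof. exact: cderive_cc (cderive_Csinh l) (cderiveZ l (cderive_Ccosh l)). Qed.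

Lemma ac_Ccosh (l : R[i]) : ac (fun x => Ccosh (l * x%:C)) (fun x => l * Csinh (l * x%:C)).
Proof. exact: cderive_cc (cderive_Ccosh l) (cderiveZ l (cderive_Csinh l)). Qed.

Transparent prim.
Lemma Cint_tail (u : R -> R[i]) x : sq u -> 0 < x < L ->
  Cint `]x, L[ u = prim u L - prim u x.
Proof.
move=> us /andP[x0 xL].
have U : I = `]0, x] `|` `]x, L[ by rewrite -itv_bndbnd_setU// bnd_simp ltW.
have iI := sq_cintegrable us.
have E : Cint `]0, x] u = Cint `]0, x[ u.
  have [i1 i2] := prim_cintegrable us (ltW xL).
  by apply: complexP; rewrite ?cRe_Cint ?cIm_Cint; rewrite Rintegral_itv_bndo_bndc.
rewrite /prim [X in _ = X - _](_ : _ = Cint (`]0, x] `|` `]x, L[) u); last by rewrite -U.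
rewrite Cint_setU//; first by rewrite E addrAC subrr add0r.
- apply/seteqP; split => // t [] /=; rewrite !in_itv /= => /andP[_ tx] /andP[xt _].
  by move: xt; rewrite ltNge tx.
- by rewrite -U.
Qed.
Opaque prim.

(* The addition formula for sinh (r (x - s)) writes phi^1 in terms of the primitives of
   cosh (r s) b(s) and sinh (r s) b(s). *)
Lemma phi2_fun m (r : R[i]) : r ^+ 2 = lam2 m - c%:C -> exists F F1 F2,
  [/\ ac F F1, ac F1 F2, F 0 = 0 & F L = 0] /\
  cl (phi2_1 L beta alpha m r) = cl F /\
  forall x, F2 x + c%:C * F x + (beta x)%:C * phi2_2 L alpha m x = lam2 m * F x.
Proof.
move=> hr; have shL := Csinh_root_neq0 hr.
have A0 : ((Anorm L alpha m)%:C : R[i]) != 0 by rewrite fmorph_eq0 gt_eqF// Anorm_gt0.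
have r0 : r != 0 by apply: contra shL => /eqP ->; rewrite mul0r Csinh0.
pose sh x := Csinh (r * x%:C); pose ch x := Ccosh (r * x%:C).
pose b s := (beta s)%:C * Csinh (lam2 m * s%:C).
have bs : sq b by apply: (sq_beta bL); exact: ac_sq (ac_Csinh _).
have bcs : sq (fun s => ch s * b s) := ac_mul_sq L0 (ac_Ccosh r) bs.
have bss : sq (fun s => sh s * b s) := ac_mul_sq L0 (ac_Csinh r) bs.
pose Pc := prim (fun s => ch s * b s); pose Ps := prim (fun s => sh s * b s).
(* The constant for which M vanishes at L. *)
pose K := Pc L - ch L / sh L * Ps L.
pose k0 := ((Anorm L alpha m)%:C * r)^-1.
have acP f : sq f -> ac (prim f) f.
  move=> fs; have := @ac_prim R L 0 f fs.
  by congr ac; apply/funext => x; rewrite add0r.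
have hPs : ac Ps (fun s => sh s * b s) := acP _ bss.
have hPc : ac (fun x => -1 * Pc x + K) (fun s => -1 * (ch s * b s) + 0).
  exact: ac_lin (acP _ bcs) (ac_cst L K).
have hsh : ac sh (fun x => r * ch x) := ac_Csinh r.
have hch : ac ch (fun x => r * sh x) := ac_Ccosh r.
(* M is phi^1 up to the factor [k0], and N is M' / r. From M' = r N and N' = r M - b one gets M'' =
   r^2 M - r b, and r^2 + c is the eigenvalue. *)
pose M x := sh x * (-1 * Pc x + K) + ch x * Ps x.
pose N x := ch x * (-1 * Pc x + K) + sh x * Ps x.
have hM : ac M (fun x => r * N x).
  have := acD (acM L0 hsh hPc) (acM L0 hch hPs); congr ac; apply/funext => x.
  by rewrite /N; move: (sh x) (ch x) (b x) (Pc x) (Ps x) => *; ring.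
have hN : ac N (fun x => r * M x - b x).
  have := acD (acM L0 hch hPc) (acM L0 hsh hPs); congr ac; apply/funext => x.
  have e : ch x * ch x - sh x * sh x = 1 := Ccosh_sinh _.
  rewrite /M; move: (sh x) (ch x) (b x) (Pc x) (Ps x) e => s t a p q e.
  transitivity (r * (s * (-1 * p + K) + t * q) - a * (t * t - s * s)); first by ring.
  by rewrite e mulr1.
exists (fun x => k0 * M x), (fun x => k0 * (r * N x)),
  (fun x => k0 * (r * (r * M x - b x))); split; [|split].
- split; [exact: acZ hM|exact: acZ (acZ _ hN)| |].
    by rewrite /M /sh /Ps prim0 mulr0 mulr0 Csinh0 mul0r addr0 mulr0.
  rewrite /M /K; have : sh L != 0 := shL.
  by move: (sh L) (ch L) (Pc L) (Ps L) => s t p q s0; rewrite (_ : _ + _ = 0) ?mulr0//; field.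
- apply/esym/L2class_eq; first exact: ac_sq (acZ _ hM).
  move=> x Ix; have x0L' : 0 < x < L by move: Ix; rewrite /= in_itv.
  have rB (y z : R) : r * (y - z)%:C = r * y%:C - r * z%:C by rewrite rmorphB mulrBr.
  rewrite /phi2_1 rB CsinhB -/(sh L) -/(ch L) -/(sh x) -/(ch x).
  have -> : Cint `]0, L[ (fun s => (beta s)%:C * Csinh (lam2 m * s%:C) * Csinh (r * s%:C))
      = Ps L.
    by rewrite /Ps prim_L; apply: CintE => s _; rewrite mulrC.
  have -> : Cint `]x, L[ (fun s => (beta s)%:C * Csinh (lam2 m * s%:C) *
      Csinh (r * (x - s)%:C)) = sh x * (Pc L - Pc x) - ch x * (Ps L - Ps x).
    rewrite (_ : Cint _ _ = Cint `]x, L[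
      (fun s => sh x * (ch s * b s) + (- ch x) * (sh s * b s))); last first.
      apply: CintE => s _; rewrite rB CsinhB -/(sh x) -/(ch x) -/(sh s) -/(ch s).
      rewrite -/(b s).
      by move: (sh x) (ch x) (b s) (sh s) (ch s) => *; ring.
    rewrite Cint_tail//; last exact: sq_lin (sqZ _ bss).
    have /andP[_ xL] := x0L'.
    rewrite !(prim_lin _ bcs (sqZ _ bss))//; last exact: ltW.
    rewrite !(primZ _ bss)//; last exact: ltW.
    rewrite -/(Pc L) -/(Pc x) -/(Ps L) -/(Ps x).
    by move: (sh x) (ch x) (Pc L) (Pc x) (Ps L) (Ps x) => *; ring.
  rewrite /M /K /k0; have : sh L != 0 := shL; move: r0 A0.
  move: (sh x) (ch x) (Pc L) (Pc x) (Ps L) (Ps x) (sh L) (ch L) (_%:C) => ? ? ? ? ? ? ? ? ? ? ? ?.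
  by field; do ?[apply/andP; split].
- move=> x; rewrite /phi2_2 (mulrCA (beta x)%:C) -/(b x).
  have -> : lam2 m = r ^+ 2 + c%:C by rewrite hr subrK.
  rewrite /k0; move: r0 A0; move: (M x) (b x) (_%:C) (c%:C) => M' b' a c' r0 a0.
  by field; apply/andP; split.
Qed.

(** Common factor of g' and h in phi_{2,m}, so that g' + h and g' - h are [kap m] times e^{lambda x}
    and e^{-lambda x}. *)
Definition kap m : R[i] := lam2 m / (Anorm L alpha m)%:C.
Definition coshC m : L2 L := cl (fun x => Ccosh (lam2 m * x%:C)).
Definition sinhC m : L2 L := cl (fun x => Csinh (lam2 m * x%:C)).

Lemma phi2E m (r : R[i]) : phi2 L beta alpha m r =
  mk3 (cl (phi2_1 L beta alpha m r)) (kap m *: coshC m) (kap m *: sinhC m).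
Proof.
have hG := acZ ((Anorm L alpha m)%:C)^-1 (ac_Csinh (lam2 m)).
rewrite /phi2 /mkstate; have -> : phi2_2 L alpha m =
  (fun x => ((Anorm L alpha m)%:C)^-1 * Csinh (lam2 m * x%:C)) by [].
rewrite (toH10_mk10 L0 hG) ?mulr0 ?Csinh0 ?mulr0//.
rewrite -(L2classZ _ (ac_sq L0 (ac_Csinh _))) -(L2classZ _ (ac_sq L0 (ac_Ccosh _))).
have -> : phi2_3 L alpha m = (fun x => kap m * Csinh (lam2 m * x%:C)) by [].
have -> : (fun x => ((Anorm L alpha m)%:C)^-1 * (lam2 m * Ccosh (lam2 m * x%:C))) =
    (fun x => kap m * Ccosh (lam2 m * x%:C)).
  by apply/funext => x; rewrite /kap mulrA [_^-1 * _]mulrC.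
by [].
Qed.

Lemma phi2_eigen m (r : R[i]) : r ^+ 2 = lam2 m - c%:C -> phi2 L beta alpha m r != 0 ->
  eigenvector A (lam2 m) (phi2 L beta alpha m r).
Proof.
move=> hr; have [F [F1 [F2 [[hF hF1 F0 FL] [FE eF]]]]] := phi2_fun hr.
rewrite phi2E FE -(L2classZ _ (ac_sq L0 (ac_Csinh _))) -(L2classZ _ (ac_sq L0 (ac_Ccosh _))).
have kE : kap m = ((Anorm L alpha m)%:C)^-1 * lam2 m by rewrite /kap mulrC.
have hG : ac (phi2_2 L alpha m) (fun x => kap m * Ccosh (lam2 m * x%:C)).
  have := acZ ((Anorm L alpha m)%:C)^-1 (ac_Csinh (lam2 m)).
  by congr ac; apply/funext => x; rewrite kE mulrA.
have hG1 := acZ (kap m) (ac_Ccosh (lam2 m)).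
have hP := acZ (kap m) (ac_Csinh (lam2 m)).
move=> n0; apply: (eigen_of_ac hF hF1 hG hG1 hP F0 FL) => //.
- by rewrite /phi2_2 mulr0 Csinh0 mulr0.
- by rewrite mulr0 Csinh0 mulr0.
- by rewrite (mulrCA alpha%:C) -mulrDr boundary_lam2 mulr0.
- by apply: (filterE (aeF R)) => x _; exact: eF.
- by move=> x; rewrite mulrCA.
- by move=> x; rewrite mulrCA.
Qed.

(** With g = beta phi^2, the imaginary part of the energy identity is Im lambda |f|^2 = Im <g, f>,
    because |f'|^2 and c |f|^2 are real. Cauchy-Schwarz concludes. *)
Lemma phi2_1_bound m (r : R[i]) : r ^+ 2 = lam2 m - c%:C ->
  (m%:~R * pi / L) ^+ 2 * nrm (cl (phi2_1 L beta alpha m r)) ^+ 2 <=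
  nrm (cl (fun x => (beta x)%:C * phi2_2 L alpha m x)) ^+ 2.
Proof.
move=> hr; have [F [F1 [F2 [[hF hF1 F0 FL] [FE eF]]]]] := phi2_fun hr.
have hG := acZ ((Anorm L alpha m)%:C)^-1 (ac_Csinh (lam2 m)).
have bs : sq (fun x => (beta x)%:C * phi2_2 L alpha m x).
  by apply: (sq_beta bL); exact: ac_sq hG.
have sF := ac_sq L0 hF.
rewrite FE; set g := cl (fun x => (beta x)%:C * _); set f := cl F.
have F2E : cl F2 = lam2 m *: f - c%:C *: f - g.
  rewrite /f /g -!L2classZ// -L2classB; [|exact: sqZ|exact: sqZ].
  rewrite -L2classB//; last by apply: sqB; exact: sqZ.
  apply: L2class_eq => [|x _]; first by case: hF1.
  by rewrite -eF; move: (F x) (F2 x) (c%:C) ((beta x)%:C * _) => *; ring.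
have := energy hF hF1 F0; rewrite FL conjc0 mulr0 sub0r F2E.
rewrite !(ipBl ipP) !(ipZl ipP) !(ip_self ipP) -/f => /(congr1 (fun z : R[i] => Im z)).
have imE (z w : R[i]) (t s : R) : Im (z * t%:C - s%:C * t%:C - w) = Im z * t - Im w.
  by rewrite !ReImE; ring.
rewrite imE cImN (cIm_real (nrm (cl F1) ^+ 2)) oppr0.
change (m%:~R * pi / L * nrm f ^+ 2 - Im (ipL g f) = 0 ->
  (m%:~R * pi / L) ^+ 2 * nrm f ^+ 2 <= nrm g ^+ 2).
move=> /eqP; rewrite subr_eq0 => /eqP e.
have h : (m%:~R * pi / L * nrm f ^+ 2) ^+ 2 <= nrm g ^+ 2 * nrm f ^+ 2.
  by rewrite e; apply: le_trans (sqr_Im_le _) _; exact: cauchy_schwarz.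
have [f0|f0] := eqVneq (nrm f) 0; first by rewrite f0 expr0n mulr0 sqr_ge0.
have f2 : 0 < nrm f ^+ 2 by rewrite exprn_gt0// lt_def f0 hnorm_ge0.
rewrite -(ler_pM2r f2); move: h; rewrite exprMn.
by rewrite [(nrm f ^+ 2) ^+ 2]expr2 mulrA.
Qed.

(** |lambda_{2,m}|^2 = (sigma^2 L^2 + m^2 pi^2) / L^2 cancels the only factor of A_m^2 that depends
    on m. *)
Lemma sqmod_kap m : sqmod (kap m) =
  2 * - sig / ((expR (2 * - sig * L) - expR (- (2 * - sig * L))) / 2).
Proof.
have A0 := Anorm_gt0 m; have s0 := sigma_lt0; have ms : 0 < - sig by rewrite oppr_gt0.
rewrite /kap sqmodM sqmodV sqmod_real /Anorm; set sh := (_ - _) / 2.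
have sh0 : 0 < sh.
  rewrite divr_gt0// subr_gt0 ltr_expR.
  have h : 0 < 2 * - sig * L by rewrite !mulr_gt0.
  by rewrite (lt_trans _ h)// oppr_lt0.
have q0 : 0 < (- sig) ^+ 2 * L ^+ 2 + m%:~R ^+ 2 * pi ^+ 2.
  by rewrite ltr_pwDl ?mulr_gt0 ?exprn_gt0// mulr_ge0 ?sqr_ge0.
rewrite expr_div_n exprMn !sqr_sqrtr; [|by rewrite ltW// mulr_gt0|by rewrite ltW// mulr_gt0].
have -> : sqmod (lam2 m) = ((- sig) ^+ 2 * L ^+ 2 + m%:~R ^+ 2 * pi ^+ 2) / L ^+ 2.
  change (sig ^+ 2 + (m%:~R * pi / L) ^+ 2 = ((- sig) ^+ 2 * L ^+ 2 + m%:~R ^+ 2 * pi ^+ 2) / L ^+ 2).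
  by move: (m%:~R) (pi : R) sig (lt0r_neq0 L0) => m' p s L1; field.
have n4 := lt0r_neq0 L0; have n2 := lt0r_neq0 sh0; have n1 := lt0r_neq0 q0.
have n3 := lt0r_neq0 ms; clearbody sh; move: n1 n3 {ms q0 A0 s0}.
move: (m%:~R : R) (pi : R) (- sig) => a p t n1 n3; field.
by rewrite n2 n3 n4 !exprMn.
Qed.

End Eigenvectors.

(** * Riesz bases *)

Section Sums.

(** Used with f the identity to separate heat from wave indices, and with a coding of the integers
    to separate signs. *)
Lemma split_sum (V : nmodType) (J A B : Type) (f : J -> A + B) (g : A + B -> J)
    (F : J -> V) (s : seq J) : cancel f g ->
  \sum_(j <- s) F j =
  \sum_(a <- pmap (fun j => if f j is inl a then Some a else None) s) F (g (inl a)) +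
  \sum_(b <- pmap (fun j => if f j is inr b then Some b else None) s) F (g (inr b)).
Proof.
move=> fK; elim: s => [|j s IH]; first by rewrite !big_nil addr0.
rewrite big_cons IH /=; case E: (f j) => [a|b] /=; rewrite big_cons -E fK.
  by rewrite addrA.
by rewrite addrCA.
Qed.

Lemma split_uniq (J A B : eqType) (f : J -> A + B) (g : A + B -> J) (s : seq J) :
  cancel f g -> uniq s ->
  uniq (pmap (fun j => if f j is inl a then Some a else None) s) /\
  uniq (pmap (fun j => if f j is inr b then Some b else None) s).
Proof.
move=> fK us; split.
  apply: (@pmap_uniq _ _ _ (fun a => g (inl a))) us => j.
  by case E: (f j) => [a|b] //=; rewrite -E fK.
apply: (@pmap_uniq _ _ _ (fun a => g (inr a))) us => j.
by case E: (f j) => [a|b] //=; rewrite -E fK.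
Qed.

Variable R : realType.

(** Decays like 1 / n^2 and telescopes as 1 / (n + 1) - 1 / (n + 2), so its sums over distinct
    indices are bounded explicitly. *)
Definition wt (n : nat) : R := (n.+1%:R * n.+2%:R)^-1.

Lemma wt_gt0 n : 0 < wt n.
Proof. by rewrite invr_gt0 mulr_gt0 ?ltr0n. Qed.

Lemma sum_wt_le1 (s : seq nat) : uniq s -> \sum_(i <- s) wt i <= 1.
Proof.
move=> us; pose N := (\max_(i <- s) i).+1.
have sN (i : nat) : i \in s -> (i < N)%N.
  by move=> si; rewrite ltnS; apply: (@leq_bigmax_seq _ _ xpredT id).
have -> : \sum_(i <- s) wt i = \sum_(i <- iota 0 N | i \in s) wt i.
  rewrite -[RHS]big_filter; apply: perm_big; apply: uniq_perm => //.
    exact: filter_uniq (iota_uniq _ _).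
  move=> i; rewrite mem_filter mem_iota add0n /=.
  by case E: (i \in s) => //=; rewrite (sN _ E).
apply: (@le_trans _ _ (\sum_(i <- iota 0 N) wt i)).
  rewrite big_mkcond; apply: ler_sum => i _; case: ifP => // _.
  exact: ltW (wt_gt0 i).
have -> : \sum_(i <- iota 0 N) wt i = 1 - N.+1%:R^-1.
  elim: N {sN} => [|N IH]; first by rewrite big_nil invr1 subrr.
  rewrite -addn1 iotaD big_cat /= IH add0n big_seq1 /wt addn1.
  have h1 : N.+1%:R != 0 :> R by rewrite pnatr_eq0.
  have h2 : N.+2%:R != 0 :> R by rewrite pnatr_eq0.
  rewrite -[N.+2]addn1 natrD in h2 *; move: (N.+1%:R : R) h1 h2 => x h1 h2.
  by field; rewrite h1 h2.
by rewrite lerBlDr lerDl invr_ge0.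
Qed.

Lemma sum_wt_int (s : seq int) : uniq s -> \sum_(m <- s) wt `|m|%N <= 2.
Proof.
pose f (m : int) : nat + nat := match m with Posz n => inl n | Negz n => inr n end.
pose g (x : nat + nat) : int := match x with inl n => Posz n | inr n => Negz n end.
have fK : cancel f g by case.
move=> us; rewrite (split_sum _ _ fK).
have [u1 u2] := split_uniq fK us.
apply: (@le_trans _ _ (1 + 1)); last by rewrite -[1 + 1]mulr2n.
apply: lerD; first exact: sum_wt_le1.
apply: le_trans (sum_wt_le1 u2); apply: ler_sum => n _.
(* [Negz n] is - (n + 1), of absolute value n + 1. *)
change (wt n.+1 <= wt n).
rewrite /wt lef_pV2 ?posrE ?mulr_gt0 ?ltr0n// ler_pM ?ler0n// ler_nat ltnW//.
Qed.

End Sums.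

(** * Closed linear spans *)

Section Adherence.
Variables (R : realType) (H : lmodType R[i]) (ip : H -> H -> R[i]).
Hypothesis ipP : inner_product ip.
Local Notation nrm := (hnorm ip).
Variables (J : eqType) (phi : J -> H).

Definition adherent z := forall e : R, 0 < e -> exists (s : seq J) (a : J -> R[i]),
  nrm (z - \sum_(j <- s) a j *: phi j) < e.

(** Brings combinations over different lists, possibly with repetitions, to one duplicate-free list,
    as is needed to add them. *)
Lemma sum_count (s t : seq J) (x : J -> H) : uniq t -> {subset s <= t} ->
  \sum_(j <- s) x j = \sum_(j <- t) (count_mem j s)%:R *: x j.
Proof.
move=> ut; elim: s => [|i s IH] st.
  by rewrite big_nil big1 // => j _; rewrite scale0r.
rewrite big_cons IH; last by move=> j js; apply: st; rewrite inE js orbT.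
rewrite (_ : \sum_(j <- t) (count_mem j (i :: s))%:R *: x j =
  \sum_(j <- t) (i == j)%:R *: x j + \sum_(j <- t) (count_mem j s)%:R *: x j).
  congr (_ + _); rewrite (bigD1_seq i)//=; last by apply: st; rewrite mem_head.
  by rewrite eqxx scale1r big1 ?addr0// => j; rewrite eq_sym => /negbTE ->; rewrite scale0r.
by rewrite -big_split /=; apply: eq_bigr => j _; rewrite natrD scalerDl.
Qed.

Lemma lincomb_lin k (s1 s2 : seq J) (a1 a2 : J -> R[i]) : exists (s : seq J) (a : J -> R[i]),
  \sum_(j <- s) a j *: phi j =
  k *: (\sum_(j <- s1) a1 j *: phi j) + \sum_(j <- s2) a2 j *: phi j.
Proof.
pose t := undup (s1 ++ s2); have ut : uniq t := undup_uniq _.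
exists t, (fun j => k * ((count_mem j s1)%:R * a1 j) + (count_mem j s2)%:R * a2 j).
rewrite (@sum_count s1 t)//; last by move=> j js; rewrite mem_undup mem_cat js.
rewrite (@sum_count s2 t)//; last by move=> j js; rewrite mem_undup mem_cat js orbT.
rewrite scaler_sumr -big_split /=; apply: eq_bigr => j _.
by rewrite scalerDl !scalerA !mulrA.
Qed.

Lemma adherent_lin k z w : adherent z -> adherent w -> adherent (k *: z + w).
Proof.
move=> hz hw e e0; pose K := Num.sqrt (sqmod k) + 1.
have K0 : 0 < K by rewrite ltr_wpDl ?sqrtr_ge0.
have [s1 [a1 h1]] := hz (e / 2 / K) (divr_gt0 (divr_gt0 e0 (ltr0n R 2)) K0).
have [s2 [a2 h2]] := hw (e / 2) (divr_gt0 e0 (ltr0n R 2)).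
have [s [a sa]] := lincomb_lin k s1 s2 a1 a2.
exists s, a; rewrite sa opprD addrACA -scalerBr.
apply: (le_lt_trans (hnormD_le ipP _ _)); rewrite [e]splitr ltrD//.
rewrite (hnormZ ipP); move: h1; rewrite ltr_pdivlMr//; apply: le_lt_trans.
by rewrite mulrC ler_wpM2l ?hnorm_ge0// lerDl.
Qed.

Lemma adherent_lim z : (forall e : R, 0 < e -> exists2 w, adherent w & nrm (z - w) < e) ->
  adherent z.
Proof.
move=> h e e0; have e2 : 0 < e / 2 by rewrite divr_gt0.
have [w hw zw] := h _ e2; have [s [a ws]] := hw _ e2.
exists s, a; apply: (le_lt_trans (hnorm_dist ipP _ w _)).
by rewrite [e]splitr ltrD.
Qed.

Lemma adherent_base j : adherent (phi j).
Proof.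
by move=> e e0; exists [:: j], (fun=> 1); rewrite big_seq1 scale1r subrr (hnorm0 ipP).
Qed.

Lemma adherent0 : adherent 0.
Proof. by move=> e e0; exists [::], (fun=> 1); rewrite big_nil subrr (hnorm0 ipP). Qed.

Lemma adherentZ k z : adherent z -> adherent (k *: z).
Proof. by move=> hz; rewrite -[k *: z]addr0; apply: adherent_lin => //; exact: adherent0. Qed.

Lemma adherentD z w : adherent z -> adherent w -> adherent (z + w).
Proof. by move=> hz hw; rewrite -[z]scale1r; exact: adherent_lin. Qed.

Lemma adherent_dense (K : lmodType R[i]) (ipK : K -> K -> R[i]) (T : K -> H) (e_ : nat -> K) :
  blin ipK ip T -> (forall n, adherent (T (e_ n))) ->
  (forall u (e : R), 0 < e -> exists N (a : nat -> R[i]),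
     hnorm ipK (u - \sum_(0 <= n < N) a n *: e_ n) < e) ->
  forall u, adherent (T u).
Proof.
move=> bT he dense u; apply: adherent_lim => e e0.
have [_ [C C0 hC]] := bT; have C1 : 0 < C + 1 by rewrite ltr_wpDl.
have [N [a ha]] := dense u _ (divr_gt0 e0 C1).
exists (T (\sum_(0 <= n < N) a n *: e_ n)).
  rewrite (blin_sum _ _ _ bT); elim: (index_iota 0 N) => [|n s IH].
    by rewrite big_nil; exact: adherent0.
  by rewrite big_cons; exact: adherent_lin.
rewrite -(blin_sub _ _ bT) -ltr_sqr ?nnegrE ?hnorm_ge0 ?(ltW e0)//.
apply: (le_lt_trans (hC _)); move: ha; rewrite ltr_pdivlMr//.
move: (hnorm_ge0 ipK (u - \sum_(0 <= n < N) a n *: e_ n)).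
set x := hnorm ipK _ => x0 xe.
apply: (@le_lt_trans _ _ ((x * (C + 1)) ^+ 2)); first by nra.
by rewrite ltr_sqr ?nnegrE ?mulr_ge0 ?(ltW C1) ?(ltW e0).
Qed.

(** Triangle inequality with Cauchy-Schwarz for the coefficients. In the induction the cross term
    satisfies 2 p q <= x B + A y because p^2 = x y and q^2 <= A B. *)
Lemma hnorm_sum_sq_le (s : seq J) (a : J -> R[i]) (v : J -> H) :
  nrm (\sum_(j <- s) a j *: v j) ^+ 2 <=
  (\sum_(j <- s) sqmod (a j)) * (\sum_(j <- s) nrm (v j) ^+ 2).
Proof.
elim: s => [|j s IH]; first by rewrite !big_nil (hnorm0 ipP) mul0r expr0n.
rewrite !big_cons; move: IH; set z := \sum_(j <- s) _; set A := \sum_(j <- s) _.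
set B := \sum_(j <- s) _ => IH.
have A0 : 0 <= A by apply: sumr_ge0 => i _; exact: sqmod_ge0.
have B0 : 0 <= B by apply: sumr_ge0 => i _; exact: sqr_ge0.
have h1 := hnormD_le ipP (a j *: v j) z; have h2 := hnorm_sqZ ipP (a j) (v j).
move: h1 h2 IH (sqmod_ge0 (a j)) (sqr_ge0 (nrm (v j))).
move: (hnorm_ge0 ip (a j *: v j)) (hnorm_ge0 ip z) (hnorm_ge0 ip (a j *: v j + z)).
move: (nrm (_ + _)) (nrm (a j *: _)) (nrm z) (sqmod _) (nrm (v j) ^+ 2).
move=> n p q x y p0 q0 n0 h1 h2 IH x0 y0.
have pq : 2 * (p * q) <= x * B + A * y.
  apply: le_of_sqr; first by rewrite addr_ge0// mulr_ge0.
  have -> : (2 * (p * q)) ^+ 2 = 4 * (x * y) * q ^+ 2 by rewrite -h2; ring.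
  apply: (@le_trans _ _ (4 * (x * y) * (A * B))); first by rewrite ler_wpM2l ?mulr_ge0.
  rewrite -subr_ge0 (_ : _ - _ = (x * B - A * y) ^+ 2); first exact: sqr_ge0.
  by ring.
apply: (@le_trans _ _ ((p + q) ^+ 2)); first by rewrite ler_sqr ?nnegrE ?addr_ge0.
rewrite (_ : (p + q) ^+ 2 = p ^+ 2 + q ^+ 2 + 2 * (p * q)); last by ring.
by rewrite h2 mulrDl !mulrDr; lra.
Qed.

End Adherence.

(** * Transport and reindexing of Riesz bases *)

Section RieszTransport.
Variables (R : realType) (H K : lmodType R[i]) (ip : H -> H -> R[i]) (ip' : K -> K -> R[i]).
Hypotheses (ipP : inner_product ip) (ipP' : inner_product ip').
Variables (J : eqType).

(** Density and the upper bound use boundedness of W, the lower bound that of its inverse V. The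
    constants are enlarged by 1 to be positive. *)
Lemma riesz_transport (D : set J) (y : J -> H) (W : H -> K) (V : K -> H) :
  blin ip ip' W -> blin ip' ip V -> cancel V W -> cancel W V ->
  riesz_basis ip D y -> riesz_basis ip' D (fun j => W (y j)).
Proof.
move=> bW bV VK WK [dense [m [M [m0 M0 bnd]]]].
have [_ [C C0 hC]] := bW; have [_ [C' C'0 hC']] := bV.
have C1 : 0 < C + 1 by rewrite ltr_wpDl.
have C'1 : 0 < C' + 1 by rewrite ltr_wpDl.
split=> [u e e0|].
  have [s [a [sD ha]]] := dense (V u) _ (divr_gt0 e0 C1); exists s, a; split=> //.
  rewrite -(blin_sum _ _ _ bW) -[u]VK -(blin_sub _ _ bW).
  rewrite -ltr_sqr ?nnegrE ?hnorm_ge0 ?(ltW e0)//.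
  apply: (le_lt_trans (hC _)); move: ha; rewrite ltr_pdivlMr//.
  move: (hnorm_ge0 ip (V u - \sum_(j <- s) a j *: y j)).
  set x := hnorm ip _ => x0 xe.
  apply: (@le_lt_trans _ _ ((x * (C + 1)) ^+ 2)); first by nra.
  by rewrite ltr_sqr ?nnegrE ?mulr_ge0 ?(ltW C1) ?(ltW e0).
exists (m / (C' + 1)), ((C + 1) * M); split; [exact: divr_gt0|exact: mulr_gt0|].
move=> s a us sD; have /andP[b1 b2] := bnd s a us sD.
rewrite -(blin_sum _ _ _ bW); move: b1 b2 (hC (\sum_(j <- s) a j *: y j))
  (hC' (W (\sum_(j <- s) a j *: y j))); rewrite WK.
set S := \sum_(j <- s) sqmod _; have S0 : 0 <= S.
  by apply: sumr_ge0 => i _; exact: sqmod_ge0.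
move: (sqr_ge0 (hnorm ip (\sum_(j <- s) a j *: y j))).
move: (sqr_ge0 (hnorm ip' (W (\sum_(j <- s) a j *: y j)))).
move: (hnorm _ _ ^+ 2) (hnorm _ _ ^+ 2) => p q p0 q0 b1 b2 h1 h2.
apply/andP; split.
  by rewrite mulrAC ler_pdivrMr//; nra.
by rewrite -mulrA; nra.
Qed.

(** The maps need be mutually inverse only on D and D', which allows the eigenvalues themselves as
    indices. *)
Lemma riesz_reindex (J' : eqType) (D : set J) (D' : set J') (f : J -> J') (g : J' -> J)
    (phi : J -> H) : (forall j, D j -> D' (f j)) -> (forall j, D' j -> D (g j)) ->
  (forall j, D j -> g (f j) = j) -> (forall j, D' j -> f (g j) = j) ->
  riesz_basis ip D phi -> riesz_basis ip D' (fun j => phi (g j)).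
Proof.
move=> hf hg gf fg [dense [m [M [m0 M0 bnd]]]]; split=> [u e e0|].
  have [s [a [sD h]]] := dense u e e0; exists (map f s), (fun j => a (g j)); split.
    by move=> j /mapP[i /sD Di ->]; exact: hf.
  rewrite big_map (_ : \sum_(i <- s) _ = \sum_(j <- s) a j *: phi j)//.
  by apply: eq_big_seq => j /sD Dj; rewrite gf.
exists m, M; split => // s a us sD.
have ug : uniq (map g s).
  rewrite map_inj_in_uniq// => i j /sD Di /sD Dj gij.
  by rewrite -(fg i Di) -(fg j Dj) gij.
have h : forall j, j \in map g s -> D j by move=> j /mapP[i /sD Di ->]; exact: hg.
have := bnd (map g s) (fun j => a (f j)) ug h; rewrite !big_map.
rewrite (_ : \sum_(i <- s) sqmod (a (f (g i))) = \sum_(j <- s) sqmod (a j)); last first.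
  by apply: eq_big_seq => j /sD Dj; rewrite fg.
rewrite (_ : \sum_(i <- s) a (f (g i)) *: _ = \sum_(j <- s) a j *: phi (g j))//.
by apply: eq_big_seq => j /sD Dj; rewrite fg.
Qed.

End RieszTransport.

(** * Decoupling the wave equation *)

Section ExponentialWeight.
Variables (R : realType) (L : R).
Hypothesis L0 : 0 < L.
Local Notation sq := (@square_integrable R L).
Local Notation cl := (@L2class R L).
Local Notation ipL := (@ipL2 R L).
Local Notation ac := (@ac R L).
Local Notation state := (state L).
Local Notation ip := (@ip0 R L).
Let ipP := @ipL2_inner R L.
Implicit Types (u v w : L2 L) (z : state).

Definition Msig (s : R) u := cl (fun x => Cexp (s%:C * x%:C) * u x).

Lemma ccontinuous_Cexp (l : R[i]) : ccontinuous (fun x => Cexp (l * x%:C)).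
Proof. exact: cderive_continuous (cderive_Cexp l). Qed.

Lemma sq_weight s (f : R -> R[i]) : sq f -> sq (fun x => Cexp (s%:C * x%:C) * f x).
Proof.
move=> fs; have cc := ccontinuous_Cexp s%:C; have [C hC] := ccontinuous_bounded L0 cc.
exact: sq_mulb (ccontinuous_meas L cc) hC fs.
Qed.

Lemma Msig_cl s (f : R -> R[i]) : sq f -> Msig s (cl f) = cl (fun x => Cexp (s%:C * x%:C) * f x).
Proof.
move=> fs; apply: L2class_ae; [exact: sq_weight (L2_sq _)|exact: sq_weight|].
by apply: filterS (L2classE fs); [exact: aeF|move=> x h Ix; rewrite h].
Qed.

Lemma blin_Msig s : blin ipL ipL (Msig s).
Proof.
have cc := ccontinuous_Cexp s%:C; have [C hC] := ccontinuous_bounded L0 cc.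
split=> [a u v|].
  rewrite -L2_linE_cl; [|exact: sq_weight (L2_sq _)..].
  apply: L2class_ae; [exact: sq_weight (L2_sq _)|by apply: sq_lin; exact: sq_weight (L2_sq _)|].
  apply: filterS (L2_linE a u v); first exact: aeF.
  by move=> x h Ix; rewrite h// mulrDr mulrCA.
exists (Num.max C 0); first by rewrite le_max lexx orbT.
move=> u; have := hnorm_mulb (ccontinuous_meas L cc) hC (L2_sq u).
rewrite L2class_fun => h; apply: (le_trans h); rewrite ler_wpM2r ?sqr_ge0//.
by rewrite le_max lexx.
Qed.

Lemma MsigK s : cancel (Msig (- s)) (Msig s).
Proof.
move=> u; rewrite Msig_cl; last exact: sq_weight (L2_sq _).
rewrite -[RHS]L2class_fun; congr L2class; apply/funext => x.
by rewrite mulrA -CexpD rmorphN /= mulNr subrr Cexp0 mul1r.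
Qed.

Lemma blin_mk3 (H : lmodType R[i]) (ipH : H -> H -> R[i]) (T1 T2 T3 : H -> L2 L) :
  blin ipH ipL T1 -> blin ipH ipL T2 -> blin ipH ipL T3 ->
  blin ipH ip (fun x : H => mk3 (T1 x) (T2 x) (T3 x)).
Proof.
move=> [l1 [C1 C10 h1]] [l2 [C2 C20 h2]] [l3 [C3 C30 h3]]; split=> [a u v|].
  by rewrite l1 l2 l3 mk3_lin.
exists (C1 + C2 + C3); first by rewrite !addr_ge0.
by move=> u; rewrite hnorm_mk3// !mulrDl !lerD.
Qed.

Lemma blin_fst : blin ip ipL (fun z => z.1.1).
Proof.
split=> //; exists 1 => // z; rewrite mul1r ler_sqr ?nnegrE ?hnorm_ge0//.
by have [] := comp_le L0 z.
Qed.

Lemma blin_wd : blin ip ipL (fun z => wd z.1.2).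
Proof.
split=> [a z w|]; first exact: (wd_lin L0 a z.1.2 w.1.2).
exists 1 => // z; rewrite mul1r ler_sqr ?nnegrE ?hnorm_ge0//.
by have [] := comp_le L0 z.
Qed.

Lemma blin_snd : blin ip ipL (fun z => z.2).
Proof.
split=> //; exists 1 => // z; rewrite mul1r ler_sqr ?nnegrE ?hnorm_ge0//.
by have [] := comp_le L0 z.
Qed.

(* In the variables g' + h and g' - h the wave equation decouples into two transport
   equations; multiplication by e^{+-s x} removes the damping. *)
Definition undamp s z := mk3 z.1.1 (Msig (- s) (wd z.1.2 + z.2)) (Msig s (wd z.1.2 - z.2)).

Definition damp s z := mk3 z.1.1
  (2^-1 *: (Msig s (wd z.1.2) + Msig (- s) z.2))
  (2^-1 *: (Msig s (wd z.1.2) - Msig (- s) z.2)).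

Lemma undamp_mk3 s u v w : undamp s (mk3 u v w) = mk3 u (Msig (- s) (v + w)) (Msig s (v - w)).
Proof. by rewrite -[in RHS](wd_mk10 L0 v). Qed.

Lemma damp_mk3 s u v w : damp s (mk3 u v w) =
  mk3 u (2^-1 *: (Msig s v + Msig (- s) w)) (2^-1 *: (Msig s v - Msig (- s) w)).
Proof. by rewrite -[in RHS](wd_mk10 L0 v). Qed.

Lemma blin_id : blin ipL ipL id.
Proof. by split=> //; exists 1 => // u; rewrite mul1r. Qed.

Lemma blin_zero : blin ip ipL (fun=> 0).
Proof.
split=> [a u v|]; first by rewrite scaler0 addr0.
by exists 0 => // u; rewrite (hnorm0 ipP) expr0n mul0r.
Qed.

Lemma blin_scale a (T : state -> L2 L) : blin ip ipL T -> blin ip ipL (fun z => a *: T z).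
Proof.
by move=> /(blin_lin ipP a)/(_ blin_zero); congr blin; apply/funext => z; rewrite addr0.
Qed.

Lemma blin_subL (T S : state -> L2 L) : blin ip ipL T -> blin ip ipL S ->
  blin ip ipL (fun z => T z - S z).
Proof.
by move=> hT /(blin_lin ipP (-1))/(_ hT); congr blin; apply/funext => z;
  rewrite scaleN1r addrC.
Qed.

Lemma blin_damp s : blin ip ip (damp s).
Proof.
have h1 := blin_comp (blin_Msig s) blin_wd.
have h2 := blin_comp (blin_Msig (- s)) blin_snd.
apply: blin_mk3; first exact: blin_fst.
  exact: blin_scale (blinD ipP h1 h2).
exact: blin_scale (blin_subL h1 h2).
Qed.

Lemma blin_undamp s : blin ip ip (undamp s).
Proof.
apply: blin_mk3; first exact: blin_fst.
  exact: blin_comp (blin_Msig (- s)) (blinD ipP blin_wd blin_snd).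
exact: blin_comp (blin_Msig s) (blin_subL blin_wd blin_snd).
Qed.

Lemma half_double (V : lmodType R[i]) (u : V) : (2^-1 : R[i]) *: (u + u) = u.
Proof.
by rewrite -[u in u + _]scale1r -[u in _ + u]scale1r -scalerDl scalerA mulVf ?scale1r// pnatr_eq0.
Qed.

Lemma half_add (V : lmodType R[i]) (a b : V) : (2^-1 : R[i]) *: (a + b + (a - b)) = a.
Proof. by rewrite addrACA subrr addr0 half_double. Qed.

Lemma half_sub (V : lmodType R[i]) (a b : V) : (2^-1 : R[i]) *: (a + b - (a - b)) = b.
Proof. by rewrite opprB addrC addrA addrNK half_double. Qed.

Lemma dampK s : cancel (undamp s) (damp s).
Proof.
move=> z; rewrite -(mk3K L0 z); move: z.1.1 (wd z.1.2) z.2 => u v w.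
rewrite undamp_mk3 damp_mk3 MsigK.
have := MsigK (- s) (v - w); rewrite opprK => ->.
by rewrite half_add half_sub.
Qed.

Lemma undampK s : cancel (damp s) (undamp s).
Proof.
move=> z; rewrite -(mk3K L0 z); move: z.1.1 (wd z.1.2) z.2 => u v w.
rewrite damp_mk3 undamp_mk3 -!scalerDr -scalerBr.
rewrite half_add half_sub MsigK; have := MsigK (- s) v; rewrite opprK => ->.
by [].
Qed.

End ExponentialWeight.

(** * The orthogonal system of undamped waves *)

Section Waves.
Variables (R : realType) (L : R).
Hypothesis L0 : 0 < L.
Local Notation sq := (@square_integrable R L).
Local Notation cl := (@L2class R L).
Local Notation ipL := (@ipL2 R L).
Local Notation nrm := (hnorm ipL).
Local Notation ac := (@ac R L).
Local Notation state := (state L).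
Local Notation ip := (@ip0 R L).
Let ipP := @ipL2_inner R L.
Let ip0P := @ip0_inner R L L0.
Implicit Types (u v w : L2 L) (z : state) (m n : int) (x : R).

Definition om m : R := m%:~R * pi / L.
Definition iw m : R[i] := Complex 0 (om m).
Definition Ep m : L2 L := cl (fun x => Cexp (iw m * x%:C)).
Definition En m : L2 L := cl (fun x => Cexp (- (iw m * x%:C))).
Definition wave m : state := mk3 0 (Ep m) (En m).

Lemma Re_iw m x : Re (iw m * x%:C) = 0.
Proof. by rewrite cReM (cIm_real x) mulr0 subr0 /= mul0r. Qed.

Lemma Im_iw m x : Im (iw m * x%:C) = om m * x.
Proof. by rewrite cImM (cIm_real x) (cRe_real x) mulr0 add0r. Qed.

Lemma iwB m n : iw (m - n) = iw m - iw n.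
Proof. by apply: complexP; rewrite ?cReB ?cImB /= ?subrr// /om intrB mulrBl mulrBl. Qed.

Lemma conj_Cexp (z : R[i]) : conjc (Cexp z) = Cexp (conjc z).
Proof.
by apply: complexP; rewrite ?cRe_conj ?cIm_conj ?cRe_Cexp ?cIm_Cexp cRe_conj cIm_conj
  ?cosN ?sinN ?mulrN.
Qed.

Lemma conj_iw m x : conjc (iw m * x%:C) = - (iw m * x%:C).
Proof. by apply: complexP; [rewrite cRe_conj cReN Re_iw oppr0|rewrite cIm_conj cImN]. Qed.

Lemma conj_iwN m x : conjc (- (iw m * x%:C)) = iw m * x%:C.
Proof. by apply: complexP; [rewrite cRe_conj cReN Re_iw oppr0|rewrite cIm_conj cImN opprK]. Qed.

Lemma sq_Cexp (l : R[i]) : sq (fun x => Cexp (l * x%:C)).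
Proof. exact: (sq_ccontinuous L0 (ccontinuous_Cexp l)). Qed.

Lemma sq_CexpN (l : R[i]) : sq (fun x => Cexp (- (l * x%:C))).
Proof.
have := sq_Cexp (- l).
by congr square_integrable; apply/funext => x; rewrite mulNr.
Qed.

(** A single exponential e^{ikx} with k = (m - n) pi / L need not have integral zero over (0, L).
    The two components of the waves together contribute e^{ikx} + e^{-ikx}, whose integral is 2 sin
    (k L) / k = 0. *)
Lemma wave_ortho m n : ip (wave m) (wave n) = if m == n then (2 * L)%:C else 0.
Proof.
rewrite /wave (ip_mk3 L0) (ip0l ipP) add0r /Ep /En.
rewrite (ipL2_cl (sq_Cexp _) (sq_Cexp _)) (ipL2_cl (sq_CexpN _) (sq_CexpN _)).
have e1 x : Cexp (iw m * x%:C) * conjc (Cexp (iw n * x%:C)) = Cexp (iw (m - n) * x%:C).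
  by rewrite conj_Cexp conj_iw -CexpD iwB mulrBl.
have e2 x : Cexp (- (iw m * x%:C)) * conjc (Cexp (- (iw n * x%:C))) =
    Cexp (- (iw (m - n) * x%:C)).
  by rewrite conj_Cexp conj_iwN -CexpD iwB mulrBl opprB addrC.
rewrite (_ : (fun x => Cexp (iw m * _) * _) = fun x => Cexp (iw (m - n) * x%:C)); last first.
  by apply/funext => x; exact: e1.
rewrite (_ : (fun x => Cexp (- _) * _) = fun x => Cexp (- (iw (m - n) * x%:C))); last first.
  by apply/funext => x; exact: e2.
rewrite -CintD//; [|exact: sq_cintegrable (sq_Cexp _)|exact: sq_cintegrable (sq_CexpN _)].
have [<-|mn] := eqVneq m n.
  have iw0 : iw (m - m) = 0 by rewrite iwB subrr.
  rewrite iw0 (_ : (fun x => _) = fun x => (2 : R)%:C * 1); last first.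
    apply/funext => x; rewrite mul0r oppr0 Cexp0 mulr1 -mulr2n.
    by rewrite rmorph_nat.
  rewrite CintZ//; last exact: sq_cintegrable (sq_cst L 1).
  rewrite rmorphM; congr (_ * _).
  by rewrite -prim_L (prim_one L0)// lexx ltW.
have k0 : iw (m - n) != 0.
  apply/eqP => /(congr1 (fun z : R[i] => Im z)) /= /eqP.
  rewrite /om !mulf_eq0 invr_eq0 (gt_eqF L0) (gt_eqF (pi_gt0 R)) !orbF.
  by rewrite intr_eq0 subr_eq0 (negbTE mn).
set k := iw _ in k0 *.
rewrite (_ : (fun x => _) = fun x => 2 / k * (k * Ccosh (k * x%:C))); last first.
  by apply/funext => x; rewrite /Ccosh; move: (Cexp _) (Cexp _) => a b; field.
have d := cderiveZ (2 / k) (cderive_Csinh k).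
have cc := ccontinuousM (cderive_continuous (cderive_cst (2 / k)))
  (cderive_continuous (cderiveZ k (cderive_Ccosh k))).
rewrite (ftc d cc (ltW L0)) mulr0 Csinh0 mulr0 subr0.
suff -> : Csinh (k * L%:C) = 0 by rewrite mulr0.
apply: complexP; rewrite ?cRe_Csinh ?cIm_Csinh Re_iw oppr0 ?subrr ?mul0r//.
by rewrite Im_iw /om divfK ?gt_eqF// sin_int_pi mulr0.
Qed.

Lemma iwN m : iw (- m) = - iw m.
Proof. by apply: complexP; rewrite ?cReN ?cImN /= ?oppr0// /om intrN !mulNr. Qed.

Lemma EpN m : Ep (- m) = En m.
Proof. by congr L2class; apply/funext => x; rewrite iwN mulNr. Qed.

Lemma EnN m : En (- m) = Ep m.
Proof. by congr L2class; apply/funext => x; rewrite iwN mulNr opprK. Qed.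

Lemma Ep_add (k : nat) : Ep k + En k = 2 *: cosC L k.
Proof.
rewrite -L2classD; [|exact: sq_Cexp|exact: sq_CexpN].
rewrite -L2classZ; last exact: (ac_sq L0 (ac_cosn L0 k)).
congr L2class; apply/funext => x; rewrite mulr_natl.
apply: complexP; rewrite ?cReD ?cImD ?cRe_Cexp ?cIm_Cexp ?cReN ?cImN Re_iw Im_iw.
  by rewrite oppr0 expR0 !mul1r cosN.
by rewrite oppr0 expR0 !mul1r sinN subrr /= addr0.
Qed.

Lemma Ep_sub (k : nat) : Ep k - En k = (Complex 0 2) *: sinC L k.
Proof.
rewrite -L2classB; [|exact: sq_Cexp|exact: sq_CexpN].
rewrite -L2classZ; last exact: (ac_sq L0 (ac_sinn L0 k)).
congr L2class; apply/funext => x.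
apply: complexP; rewrite ?cReB ?cImB ?cRe_Cexp ?cIm_Cexp ?cReN ?cImN Re_iw Im_iw.
  by rewrite oppr0 expR0 !mul1r cosN subrr /= mul0r mulr0 subr0.
by rewrite oppr0 expR0 !mul1r sinN opprK cImM /= mul0r add0r mulr_natl mulr2n.
Qed.

Lemma wave_sub (k : nat) : wave k - wave (- k%:Z) =
  mk3 0 (Complex 0 2 *: sinC L k) (- Complex 0 2 *: sinC L k).
Proof. by rewrite mk3B// subrr EpN EnN Ep_sub -[En _ - _]opprB Ep_sub scaleNr. Qed.

Lemma wave_add (k : nat) : wave k + wave (- k%:Z) = mk3 0 (2 *: cosC L k) (2 *: cosC L k).
Proof.
have := mk3_lin L0 1 0 (Ep k) (En k) 0 (Ep (- k%:Z)) (En (- k%:Z)).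
by rewrite !scale1r => <-; rewrite EpN EnN Ep_add [En _ + _]addrC Ep_add addr0.
Qed.

Lemma sin_ortho (i k : nat) :
  ipL (sinC L i.+1) (sinC L k.+1) = if i == k then (L / 2)%:C else 0.
Proof.
set t := ipL _ _.
(* The last two coordinates of the difference of opposite waves are 2i and -2i times a sine, whence
   the factor 2 |2i|^2 = 8. *)
have e : ip (wave i.+1 - wave (- i.+1%:Z)) (wave k.+1 - wave (- k.+1%:Z)) = 8%:R * t.
  rewrite !wave_sub (ip_mk3 L0) (ip0l ipP) add0r !(ipZl ipP) !(ipZr ipP) -/t.
  have h (a b : R[i]) : a * (conjc a * b) + - a * (conjc (- a) * b) = 2 * (sqmod a)%:C * b.
    have -> : conjc (- a) = - conjc a by case: a.
    by rewrite -mulcJ; ring.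
  rewrite h; have -> : sqmod (Complex 0 (2 : R)) = 4 by rewrite /sqmod /= expr0n add0r; ring.
  by rewrite rmorph_nat -natrM.
move: e; rewrite !(ipBl ip0P) !(ipBr ip0P) !wave_ortho.
have -> : (i.+1%:Z == k.+1 :> int) = (i == k) by rewrite eqz_nat eqSS.
have -> : (i.+1%:Z == - k.+1%:Z :> int) = false by [].
have -> : (- i.+1%:Z == k.+1 :> int) = false by [].
have -> : (- i.+1%:Z == - k.+1%:Z :> int) = (i == k) by rewrite eqr_opp eqz_nat eqSS.
have h8 : (8%:R : R[i]) != 0 by rewrite pnatr_eq0.
rewrite sub0r subr0 opprK => e; apply: (mulfI h8); rewrite -e.
case: ifP => _; last by rewrite addr0 mulr0.
rewrite -[8%:R](rmorph_nat (real_complex R)) -rmorphM -rmorphD; congr (_%:C).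
by field.
Qed.

(** * Triangular perturbation of the orthogonal basis *)

Section PerturbedBasis.
Variables (f1 : int -> L2 L) (k : int -> R[i]) (C kp : R).
Hypothesis kp0 : 0 < kp.
Hypothesis k_norm : forall m, sqmod (k m) = kp.
Hypothesis f1_bound : forall m, nrm (f1 m) ^+ 2 <= C * wt R `|m|%N.

Definition pert (j : nat + int) : state :=
  match j with
  | inl n => mk3 ((Num.sqrt (2 / L))%:C *: sinC L n.+1) 0 0
  | inr m => mk3 (f1 m) (k m *: Ep m) (k m *: En m)
  end.

Lemma pert_inr m : pert (inr m) = mk3 (f1 m) 0 0 + k m *: wave m.
Proof.
have := mk3_lin L0 (k m) 0 (Ep m) (En m) (f1 m) 0 0.
by rewrite scaler0 add0r !addr0 addrC.
Qed.

Lemma pert_inl (i : nat) :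
  pert (inl i) = (Num.sqrt (2 / L))%:C *: mk3 (sinC L i.+1) 0 0.
Proof. by apply: etrans _ (mk3Z L0 _ _ _ _); rewrite !scaler0. Qed.

Lemma blin_first : blin ipL ip (fun u => mk3 u 0 0).
Proof.
apply: (blin_mk3 L0); first exact: blin_id.
  by split=> [a u v|]; [rewrite scaler0 addr0|exists 0 => // u; rewrite (hnorm0 ipP) expr0n mul0r].
by split=> [a u v|]; [rewrite scaler0 addr0|exists 0 => // u; rewrite (hnorm0 ipP) expr0n mul0r].
Qed.

Lemma C_ge0 : 0 <= C.
Proof.
have := f1_bound 0; have w0 := wt_gt0 R 0.
move=> h; rewrite -(pmulr_lge0 _ w0); apply: le_trans h; exact: sqr_ge0.
Qed.

(** U collects the heat terms, V the first components of the wave terms. The other two components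
    are orthogonal to both and contribute exactly Z; the 2 in 2 C Y is the bound on the sum of the
    weights. *)
Lemma pert_norm (s : seq (nat + int)) (a : nat + int -> R[i]) : uniq s ->
  exists U V X Y Z, [/\ hnorm ip (\sum_(j <- s) a j *: pert j) ^+ 2 = nrm (U + V) ^+ 2 + Z,
    \sum_(j <- s) sqmod (a j) = X + Y, nrm U ^+ 2 = X, nrm V ^+ 2 <= 2 * C * Y &
    [/\ Z = kp * (2 * L) * Y & 0 <= Y]].
Proof.
move=> us; have idK : cancel (id : nat + int -> nat + int) id by [].
have [u1 u2] := split_uniq idK us.
rewrite (split_sum _ _ idK) [\sum_(j <- s) sqmod _](split_sum _ _ idK).
move: u1 u2; set s1 := pmap _ s; set s2 := pmap _ s => u1 u2 /=.
pose U := \sum_(n <- s1) a (inl n) *: ((Num.sqrt (2 / L))%:C *: sinC L n.+1).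
pose V := \sum_(m <- s2) a (inr m) *: f1 m.
pose w := \sum_(m <- s2) (a (inr m) * k m) *: wave m.
have -> : \sum_(n <- s1) a (inl n) *: mk3 ((Num.sqrt (2 / L))%:C *: sinC L n.+1) 0 0 =
    mk3 U 0 0 by rewrite /U (blin_sum _ _ _ blin_first).
have -> : \sum_(m <- s2) a (inr m) *: mk3 (f1 m) (k m *: Ep m) (k m *: En m) = mk3 V 0 0 + w.
  rewrite /V (blin_sum _ _ _ blin_first) /w -big_split /=; apply: eq_bigr => m _.
  by rewrite -scalerA -scalerDr -pert_inr.
pose X := \sum_(n <- s1) sqmod (a (inl n)); pose Y := \sum_(m <- s2) sqmod (a (inr m)).
exists U, V, X, Y, (hnorm ip w ^+ 2).
have Y0 : 0 <= Y by apply: sumr_ge0 => m _; exact: sqmod_ge0.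
split=> //.
- rewrite addrA; have -> : mk3 U 0 0 + mk3 V 0 0 = mk3 (U + V) 0 0.
    by have [lin _] := blin_first; have := lin 1 U V; rewrite !scale1r => ->.
  rewrite (hnormD_sq ip0P) (hnorm_mk3 L0) (hnorm0 ipP) expr0n /= !addr0.
  rewrite (_ : ip _ w = 0) ?mulr0 ?addr0//.
  rewrite /w (ip_sumr ip0P) big1 // => m _.
  by rewrite (ipZr ip0P) (ip_mk3 L0) (ip0r ipP) !(ip0l ipP) !addr0 mulr0.
- rewrite /U (pythagoras ipP _ u1) => [|i j _ _ ij].
    apply: eq_bigr => n _; rewrite (hnorm_sqZ ipP) (hnorm_sq ipP) sin_ortho eqxx.
    rewrite (cRe_real (L / 2)) sqmod_real sqr_sqrtr; last by rewrite divr_ge0// ltW.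
    have L1 : L != 0 by rewrite gt_eqF.
    by rewrite (_ : 2 / L * (L / 2) = 1) ?mulr1//; field.
  by rewrite (ipZl ipP) (ipZr ipP) sin_ortho (negbTE ij) !mulr0.
- apply: (le_trans (hnorm_sum_sq_le ipP _ _ _)); rewrite [leRHS]mulrC ler_wpM2l//.
  apply: (@le_trans _ _ (\sum_(m <- s2) C * wt R `|m|%N)).
    by apply: ler_sum => m _; exact: f1_bound.
  by rewrite -mulr_sumr mulrC ler_wpM2r ?C_ge0//; exact: sum_wt_int.
- split=> //; rewrite /w (pythagoras ip0P _ u2) => [|i j _ _ ij].
    rewrite /Y mulr_sumr; apply: eq_bigr => m _.
    rewrite sqmodM k_norm (hnorm_sq ip0P) wave_ortho eqxx (cRe_real (2 * L)).
    by rewrite -mulrA mulrC.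
  by rewrite wave_ortho (negbTE ij).
Qed.

Lemma pert_bounds : exists m M : R, [/\ 0 < m, 0 < M &
  forall (s : seq (nat + int)) (a : nat + int -> R[i]), uniq s ->
    m * (\sum_(j <- s) sqmod (a j)) <= hnorm ip (\sum_(j <- s) a j *: pert j) ^+ 2
      <= M * (\sum_(j <- s) sqmod (a j))].
Proof.
pose N := kp * (2 * L); have N0 : 0 < N by rewrite !mulr_gt0.
have C0 := C_ge0.
(* With T = |U + V|^2 one has X <= 2 T + 4 C Y, so X + Y <= 2 T + (4 C + 1) Y <= D (T + N Y). The
   upper constant comes from T <= 2 X + 4 C Y. *)
pose D := 2 + (4 * C + 1) / N.
have D0 : 0 < D by rewrite addr_gt0// divr_gt0// ltr_wpDl// mulr_ge0.
exists D^-1, (2 + 4 * C + N); split; first by rewrite invr_gt0.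
  by rewrite addr_gt0// ltr_wpDr// mulr_ge0.
move=> s a us; have [U [V [X [Y [Z [-> -> hU hV [-> Y0]]]]]]] := pert_norm a us.
have X0 : 0 <= X by rewrite -hU sqr_ge0.
have h1 : X <= 2 * (nrm (U + V) ^+ 2 + nrm V ^+ 2).
  have := hnormD_sq_le ipP (U + V) (- V); rewrite addrK (hnorm_opp ipP) hU.
  exact.
have h2 := hnormD_sq_le ipP U V; rewrite hU in h2.
have T0 := sqr_ge0 (nrm (U + V)).
move: h1 h2 hV T0; move: (nrm (U + V) ^+ 2) (nrm V ^+ 2) => T S h1 h2 hV T0.
apply/andP; split; last first.
  by rewrite -/N; nra.
rewrite mulrC ler_pdivrMr// -/N /D.
have -> : (T + N * Y) * (2 + (4 * C + 1) / N) =
    2 * T + T * ((4 * C + 1) / N) + 2 * (N * Y) + (4 * C + 1) * Y.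
  by field; rewrite gt_eqF.
have q0 : 0 <= T * ((4 * C + 1) / N).
  by rewrite mulr_ge0// divr_ge0 ?(ltW N0)// addr_ge0// mulr_ge0.
have q1 : 0 <= N * Y by rewrite mulr_ge0// ltW.
by nra.
Qed.

(** The heat vectors span the first coordinate by density of sines. Subtracting first components
    then yields the waves themselves; sums of opposite waves give all (0, u, u) by density of
    cosines, differences all (0, u, -u) by density of sines. *)
Lemma adherent_pert z : adherent ip pert z.
Proof.
have s0 : ((Num.sqrt (2 / L))%:C : R[i]) != 0.
  by rewrite fmorph_eq0 gt_eqF// sqrtr_gt0 divr_gt0.
have hz : blin ipL ipL (fun=> 0).
  by split=> [a u v|]; [rewrite scaler0 addr0|exists 0 => // u; rewrite (hnorm0 ipP) expr0n mul0r].
have hid : blin ipL ipL id := @blin_id _ _.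
have A1 u : adherent ip pert (mk3 u 0 0).
  move: u; apply: (@adherent_dense _ _ _ ip0P _ _ _ _ (fun u => mk3 u 0 0)
    (fun i : nat => sinC L i.+1)); last first.
  - by move=> u e e0; exact: sin_dense.
  - move=> n; have := adherentZ ip0P (Num.sqrt (2 / L))%:C^-1 (adherent_base ip0P pert (inl n)).
    rewrite pert_inl scalerA (mulVf s0) scale1r.
    exact.
  - exact: blin_first.
have A2 m : adherent ip pert (wave m).
  have k0 : k m != 0 by rewrite -sqmod_gt0 k_norm.
  have h := adherent_lin ip0P (-1) (A1 (f1 m)) (adherent_base ip0P pert (inr m)).
  have := adherentZ ip0P (k m)^-1 h.
  rewrite pert_inr scaleN1r addrA addNr add0r scalerA (mulVf k0) scale1r.
  exact.
have A3 u : adherent ip pert (mk3 0 u u).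
  move: u; apply: (@adherent_dense _ _ _ ip0P _ _ _ _ (fun u => mk3 0 u u) (cosC L)); last first.
  - by move=> u e e0; exact: cos_dense.
  - move=> n; have h := adherentD ip0P (A2 n) (A2 (- n%:Z)).
    have := adherentZ ip0P 2^-1 h; rewrite wave_add -(mk3Z L0) scaler0 scalerA.
    have n2 : (2 : R[i]) != 0 by rewrite pnatr_eq0.
    rewrite (mulVf n2) scale1r; exact.
  - exact: blin_mk3.
have A4 u : adherent ip pert (mk3 0 u (-1 *: u)).
  move: u; apply: (@adherent_dense _ _ _ ip0P _ _ _ _ (fun u => mk3 0 u (-1 *: u))
    (fun i : nat => sinC L i.+1)); last first.
  - by move=> u e e0; exact: sin_dense.
  - move=> n; have h := adherent_lin ip0P (-1) (A2 (- n.+1%:Z)) (A2 n.+1).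
    have := adherentZ ip0P (Complex 0 2)^-1 h; rewrite scaleN1r addrC wave_sub.
    have i0 : Complex 0 (2 : R) != 0.
      by rewrite -sqmod_gt0 /sqmod /= expr0n add0r exprn_gt0.
    rewrite -(mk3Z L0) scaler0 !scalerA mulrN (mulVf i0) scale1r.
    exact.
  - apply: (blin_mk3 L0) => //; have := blin_lin ipP (-1) hid hz.
    by congr blin; apply/funext => u; rewrite addr0.
rewrite -(mk3K L0 z); move: z.1.1 (wd z.1.2) z.2 => u v w.
have := adherentD ip0P (A1 u) (adherentD ip0P (A3 (2^-1 *: (v + w))) (A4 (2^-1 *: (v - w)))).
have mk3D a b c a' b' c' : mk3 a b c + mk3 a' b' c' = mk3 (a + a') (b + b') (c + c') :> state.
  by have := mk3_lin L0 1 a b c a' b' c'; rewrite !scale1r => <-.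
rewrite !mk3D !addr0 !add0r scaleN1r -scalerBr -scalerDr half_add half_sub.
exact.
Qed.

Lemma pert_riesz : riesz_basis ip setT pert.
Proof.
split=> [u e e0|].
  by have [s [a h]] := adherent_pert u e0; exists s, a; split.
have [m [M [m0 M0 h]]] := pert_bounds.
by exists m, M; split => // s a us _; exact: h.
Qed.

End PerturbedBasis.

End Waves.

(** * Spectrum and conclusion *)

Section Discreteness.
Variable R : realType.

(** Uniform separation makes S closed and each of its points relatively open, so connected subsets
    are points. The gap d lives in R[i] because the norm does. *)
Lemma uniformly_discrete_totally_disconnected (S : set (R[i]^o)) (d : R[i]) : 0 < d ->
  (forall s t, S s -> S t -> s != t -> d <= `|s - t|) -> totally_disconnected (closure S).
Proof.
move=> d0 sep.
have near_uniq p s t : S s -> S t -> `|p - s| < d / 2 -> `|p - t| < d / 2 -> s = t.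
  move=> Ss St ps pt; apply: contrapT => /eqP st; have := sep s t Ss St st.
  have h : `|s - t| < d.
    apply: (@le_lt_trans _ _ (`|s - p| + `|p - t|)); first exact: ler_distD.
    by rewrite distrC [d]splitr ltrD.
  by move=> /le_lt_trans/(_ h); rewrite ltxx.
have clS : closure S = S.
  apply/seteqP; split; last exact: subset_closure.
  move=> p cp; have d2 : 0 < d / 2 by rewrite divr_gt0.
  have [s [Ss ps]] := cp _ (nbhsx_ballx p _ d2).
  have [->//|sp] := eqVneq p s.
  have e0 : 0 < `|p - s| by rewrite normr_gt0 subr_eq0.
  (* This second point is nearer to p than s is, yet within d / 2 of p it must equal s. *)
  have [t [St pt]] := cp _ (filterI (nbhsx_ballx p _ d2) (nbhsx_ballx p _ e0)).
  have [pt1 pt2] := pt.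
  have st := near_uniq p s t Ss St ps pt1.
  by move: pt2; rewrite -st /ball /= ltxx.
rewrite clS => x Sx; apply/seteqP; split; last first.
  by move=> y ->; exact: connected_component_refl.
move=> y [C [Cx CS cC] Cy].
suff <- : C = [set x] by [].
apply/esym/cC; first by exists x.
  exists (ball x d); first exact: ball_open.
  apply/seteqP; split=> [z ->|z [Cz xz]]; first by split => //; exact: ballxx.
  apply: contrapT => zx; have := sep x z Sx (CS z Cz); move: xz; rewrite /ball /= => xz.
  have : x != z by apply/eqP => xz'; apply: zx; rewrite xz'.
  by move=> h /(_ h)/le_lt_trans/(_ xz); rewrite ltxx.
exists [set x]; last by apply/seteqP; split=> [z ->|z []//].
by apply: accessible_closed_set1; apply: hausdorff_accessible; exact: norm_hausdorff.
Qed.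

(** The lower Riesz bound for a sum with one term. *)
Lemma riesz_neq0 (H : lmodType R[i]) (ip : H -> H -> R[i]) (J : eqType) (D : set J)
    (phi : J -> H) j : inner_product ip -> riesz_basis ip D phi -> D j -> phi j != 0.
Proof.
move=> ipP [_ [m [M [m0 _ h]]]] Dj; apply/eqP => p0.
have := h [:: j] (fun=> 1) isT; rewrite !big_seq1 p0 scaler0 (hnorm0 ipP) sqmod1 mulr1.
rewrite expr0n /= leNgt m0 => /(_ _)/andP[]//.
by move=> i; rewrite inE => /eqP ->.
Qed.

(* nat + int is listed along the residues modulo 3. *)
Definition enc (j : nat + int) : nat :=
  match j with
  | inl n => n * 3
  | inr (Posz n) => n * 3 + 1
  | inr (Negz n) => n * 3 + 2
  end%N.

Definition dec (i : nat) : nat + int :=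
  match (i %% 3)%N with
  | 0%N => inl (i %/ 3)%N
  | 1%N => inr (Posz (i %/ 3))
  | _ => inr (Negz (i %/ 3))
  end.

Lemma encK : cancel enc dec.
Proof.
move=> [n|[n|n]]; rewrite /dec /=.
- by rewrite modnMl mulnK.
- by rewrite modnMDl divnMDl// addn0.
- by rewrite modnMDl divnMDl// addn0.
Qed.

Lemma decK : cancel dec enc.
Proof.
move=> i; rewrite /dec; have := ltn_pmod i (isT : (0 < 3)%N); have := divn_eq i 3.
by case: (i %% 3)%N => [|[|[|]]]//= E _; rewrite [RHS]E ?addn0.
Qed.

Lemma separated_from_zero (x : nat -> R) (N : nat) : (forall n, x n != 0) ->
  (forall n, (N <= n)%N -> 1 <= x n ^+ 2) ->
  exists2 d, 0 < d & forall n, d <= x n ^+ 2.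
Proof.
move=> x0 xN.
have [d d0 hd] : exists2 d, 0 < d & forall n, (n < N)%N -> d <= x n ^+ 2.
  elim: N {xN} => [|N [d d0 hd]]; first by exists 1.
  exists (Num.min d (x N ^+ 2)).
    by rewrite lt_min d0 exprn_even_gt0//= x0.
  move=> n; rewrite ltnS leq_eqVlt => /predU1P[->|/hd h]; rewrite ge_min ?lexx ?orbT//.
  by rewrite h.
exists (Num.min d 1); first by rewrite lt_min d0 ltr01.
move=> n; have [h|h] := ltnP n N; rewrite ge_min; first by rewrite hd.
by rewrite xN// orbT.
Qed.

End Discreteness.

(** * Separation of the eigenvalues *)

Section Spectrum.
Variables (R : realType) (L c alpha : R).
Hypothesis L0 : 0 < L.
Hypothesis alpha1 : 1 < alpha.
Local Notation sig := (sigma L alpha).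
Local Notation lam2 := (lambda2 L alpha).
Local Notation ev := (eigval L c alpha).
Hypothesis c_neq : forall n : nat, c <> sig + n%:R ^+ 2 * pi ^+ 2 / L ^+ 2.

Let p : R := pi / L.
Let p0 : 0 < p. Proof. by rewrite divr_gt0// pi_gt0. Qed.

Lemma lambda1E n : lambda1 L c n = (c - (n%:R * p) ^+ 2)%:C.
Proof. by rewrite /lambda1 /p mulrA expr_div_n exprMn. Qed.

Lemma sqr_int_ge1 (k : int) : k != 0 -> 1 <= (k%:~R : R) ^+ 2.
Proof.
move=> k0; rewrite -rmorphXn /= -[1]/(1%:~R) ler_int.
by rewrite -gtz0_ge1 exprn_even_gt0.
Qed.

(** Two heat eigenvalues differ by a non-zero integer times p^2. If a wave eigenvalue with m
    non-zero is compared with a heat one, or two wave ones are compared, the imaginary parts differ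
    by at least p. The heat eigenvalues against lambda_{2,0} need the condition on c. *)
Lemma eigval_separated : exists2 d : R, 0 < d &
  forall i j, i != j -> d <= sqmod (ev i - ev j).
Proof.
have p2 : 0 < p ^+ 2 by rewrite exprn_gt0.
pose x n := c - sig - (n%:R * p) ^+ 2.
have [d d0 hd] : exists2 d, 0 < d & forall n, d <= x n ^+ 2.
  (* From this index on, (n p)^2 >= n p^2 > |c - sigma| + 1, so x n < -1; the successor ensures n >=
     1. *)
  pose N := (Num.truncn ((`|c - sig| + 1) / p ^+ 2)).+1.
  apply: (@separated_from_zero _ x N) => n.
    apply/eqP => xn; apply: (c_neq (n := n)).
    rewrite -exprMn -expr_div_n -mulrA -/p.
    by move: xn; rewrite /x; lra.
  move=> Nn; have n1 : (`|c - sig| + 1) / p ^+ 2 < n%:R.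
    apply: lt_le_trans (truncnS_gt _) _; by rewrite ler_nat.
  have n0 : (1 : R) <= n%:R by rewrite ler1n (leq_trans _ Nn).
  move: n1; rewrite ltr_pdivrMr// => n1.
  have n2 : n%:R * p ^+ 2 <= (n%:R * p) ^+ 2.
    by rewrite (exprMn 2 n%:R p) ler_wpM2r ?(ltW p2)// [n%:R ^+ 2]expr2 ler_peMl// (le_trans ler01).
  have h3 := ler_norm (c - sig); rewrite /x; move: n1 n2 h3.
  move: (`|c - sig|) => a; move: (c - sig) (n%:R * p ^+ 2) ((n%:R * p) ^+ 2) => b s t.
  by move=> h1 h2 h3; nra.
exists (Num.min d (Num.min (p ^+ 2) ((p ^+ 2) ^+ 2))).
  by rewrite !lt_min d0 p2 exprn_gt0.
have hB (m : int) (z : R[i]) : m != 0 -> Im z = m%:~R * p -> p ^+ 2 <= sqmod z.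
  move=> m0 e; apply: le_trans (sqr_Im_le z); rewrite e (exprMn 2 m%:~R p).
  by rewrite ler_peMl ?(ltW p2)// sqr_int_ge1.
have h12 n m : Num.min d (Num.min (p ^+ 2) ((p ^+ 2) ^+ 2)) <= sqmod (ev (inl n) - ev (inr m)).
  have [->|m0] := eqVneq m 0.
    rewrite ge_min; apply/orP; left; apply: le_trans (hd n.+1) _.
    apply: le_trans (sqr_Re_le _).
    change (x n.+1 ^+ 2 <= Re (lambda1 L c n.+1 - lam2 0) ^+ 2).
    rewrite cReB lambda1E (_ : Re (lam2 0) = sig)//.
    by rewrite (cRe_real (c - (n.+1%:R * p) ^+ 2)) /x addrAC.
  rewrite ge_min ge_min; apply/orP; right; apply/orP; left.
  apply: (hB (- m)); first by rewrite oppr_eq0.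
  by rewrite cImB /= sub0r /p mulrA rmorphN /= !mulNr.
move=> [n|m] [k|l] ij.
- have nk : n != k by apply: contra ij => /eqP ->.
  rewrite !ge_min; apply/orP; right; apply/orP; right.
  rewrite /= !lambda1E -rmorphB sqmod_real.
  have -> : c - (n.+1%:R * p) ^+ 2 - (c - (k.+1%:R * p) ^+ 2) =
      ((k.+1%:Z ^+ 2 - n.+1%:Z ^+ 2)%:~R) * p ^+ 2.
    rewrite rmorphB !rmorphXn /= -!pmulrn (exprMn 2 n.+1%:R p) (exprMn 2 k.+1%:R p).
    by move: (n.+1%:R : R) (k.+1%:R : R) (p ^+ 2) => a b q; ring.
  have h : (k.+1%:Z ^+ 2 - n.+1%:Z ^+ 2 : int) != 0.
    by rewrite subr_eq0 eqrXn2// eqz_nat eqSS eq_sym.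
  rewrite (exprMn 2 _ (p ^+ 2)); have := sqr_int_ge1 h.
  by move: ((_)%:~R : R) (sqr_ge0 (p ^+ 2)) => q q0 q1; rewrite ler_peMl.
- exact: h12.
- by rewrite sqmodB; exact: h12.
- have ml : m - l != 0 by rewrite subr_eq0; apply: contra ij => /eqP ->.
  rewrite !ge_min; apply/orP; right; apply/orP; left.
  apply: (hB (m - l)) => //; rewrite cImB /= rmorphB /= /p.
  by rewrite mulrBl !mulrA.
Qed.

Lemma eigval_inj : injective ev.
Proof.
move=> i j e; apply: contrapT => /eqP ij; have [d d0 /(_ i j ij)] := eigval_separated.
by rewrite e subrr sqmod0 leNgt d0.
Qed.

Lemma Re_eigval j : Re (ev j) <= Num.max c 0.
Proof.
case: j => [n|m].
  by rewrite /eigval lambda1E cRe_real le_max gerBl sqr_ge0.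
by rewrite le_max; apply/orP; right; exact: ltW (sigma_lt0 L0 alpha1).
Qed.

Lemma spectrum_totally_disconnected (S : set (R[i]^o)) :
  (forall l, S l -> exists j, l = ev j) -> totally_disconnected (closure S).
Proof.
move=> hS; have [d d0 hd] := eigval_separated.
apply: (@uniformly_discrete_totally_disconnected _ _ (Num.sqrt d)%:C).
  by rewrite ltcR sqrtr_gt0.
move=> s t /hS[i ->] /hS[j ->] st.
rewrite normc_def lecR ler_wsqrtr//; apply: hd; apply: contra st => /eqP ->.
by [].
Qed.

End Spectrum.

(** (n + 1)(n + 2) <= 6 n^2 for n >= 1. The slack 2 N makes room for the value at index 0 in a
    common constant. *)
Lemma weight_arith (R : realFieldType) (n : nat) (N T X : R) : 0 <= N -> 0 <= T -> (0 < n)%N ->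
  n%:R ^+ 2 * T <= X -> T * (n.+1%:R * n.+2%:R) <= 2 * N + 6 * X.
Proof.
move=> N0 T0; rewrite -(ler1n R) -[n.+2%:R]natr1 -[n.+1%:R]natr1.
move: (n%:R : R) => t t1 h.
have : T * ((t + 1) * (t + 1 + 1)) <= 6 * (t ^+ 2 * T).
  by rewrite mulrC mulrA ler_wpM2r//; nra.
by move: (t ^+ 2 * T) h => Y h h2; lra.
Qed.

(** * The Riesz basis property and its consequences *)

Section RieszBasis.
Variables (R : realType) (L c : R) (beta : R -> R) (alpha : R) (r : int -> R[i]).
Hypothesis L0 : 0 < L.
Hypothesis bL : Linfty L beta.
Hypothesis alpha1 : 1 < alpha.
Local Notation cl := (@L2class R L).
Local Notation ipL := (@ipL2 R L).
Local Notation nrm := (hnorm ipL).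
Local Notation ac := (@ac R L).
Local Notation state := (state L).
Local Notation ip := (@ip0 R L).
Local Notation A := (opA L c beta alpha).
Local Notation sig := (sigma L alpha).
Local Notation lam2 := (lambda2 L alpha).
Local Notation ev := (eigval L c alpha).
Local Notation Phi := (Phi L beta alpha r).
Local Notation k := (kap L alpha).
Hypothesis c_neq : forall n : nat, c <> sig + n%:R ^+ 2 * pi ^+ 2 / L ^+ 2.
Hypothesis r_sqrt : forall m, r m ^+ 2 = lam2 m - c%:C.
Let ip0P := @ip0_inner R L L0.
Let f1 m : L2 L := cl (phi2_1 L beta alpha m (r m)).

Lemma lambda2E m : lam2 m = sig%:C + iw L m.
Proof. by apply: complexP; rewrite ?cReD ?cImD /= ?addr0 ?add0r. Qed.

Lemma Msig_Ep m : Msig sig (Ep L m) = cl (fun x => Cexp (lam2 m * x%:C)).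
Proof.
rewrite (Msig_cl L0 sig (sq_Cexp L0 (iw L m))); congr L2class; apply/funext => x.
by rewrite -CexpD -mulrDl -lambda2E.
Qed.

Lemma Msig_En m : Msig (- sig) (En L m) = cl (fun x => Cexp (- (lam2 m * x%:C))).
Proof.
rewrite (Msig_cl L0 (- sig) (sq_CexpN L0 (iw L m))); congr L2class; apply/funext => x.
rewrite -CexpD; congr Cexp; rewrite lambda2E mulrDl opprD; congr (_ - _).
by rewrite rmorphN mulNr.
Qed.

Lemma coshCE m : coshC L alpha m = 2^-1 *: (Msig sig (Ep L m) + Msig (- sig) (En L m)).
Proof.
have s1 := sq_Cexp L0 (lam2 m); have s2 := sq_CexpN L0 (lam2 m).
rewrite Msig_Ep Msig_En -(L2classD s1 s2) -L2classZ; last exact: sqD.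
by congr L2class; apply/funext => x; rewrite /Ccosh mulrC.
Qed.

Lemma sinhCE m : sinhC L alpha m = 2^-1 *: (Msig sig (Ep L m) - Msig (- sig) (En L m)).
Proof.
have s1 := sq_Cexp L0 (lam2 m); have s2 := sq_CexpN L0 (lam2 m).
rewrite Msig_Ep Msig_En -(L2classB s1 s2) -L2classZ; last exact: sqB.
by congr L2class; apply/funext => x; rewrite /Csinh mulrC.
Qed.

Lemma damp_wave m : mk3 0 (coshC L alpha m) (sinhC L alpha m) = damp sig (wave L m).
Proof. by rewrite coshCE sinhCE (damp_mk3 L0). Qed.

Lemma Phi_damp j : Phi j = damp sig (pert f1 k j).
Proof.
case: j => [n|m] /=.
  rewrite phi1E// (damp_mk3 L0) !(blin0 (blin_Msig L0 _)).
  by rewrite addr0 subr0 scaler0.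
rewrite phi2E// (damp_mk3 L0) !(blinZ _ _ (blin_Msig L0 _)) -scalerDr -scalerBr.
by rewrite coshCE sinhCE !scalerA mulrC.
Qed.

Lemma kap_norm : exists2 kp : R, 0 < kp & forall m, sqmod (k m) = kp.
Proof.
exists (sqmod (k 0)) => [|m]; last by rewrite !(sqmod_kap L0 alpha1).
rewrite sqmod_kap//; have := sigma_lt0 L0 alpha1 => s0.
rewrite !divr_gt0 ?mulr_gt0 ?oppr_gt0// subr_gt0 ltr_expR.
have h : 0 < 2 * - sig * L by rewrite !mulr_gt0// oppr_gt0.
by rewrite (lt_trans _ h)// oppr_lt0.
Qed.

(** phi^2 is the primitive of [kap m] times the cosh, a coordinate of the damped image of a wave
    whose norm does not depend on m. *)
Lemma forcing_bound : exists2 B, 0 <= B & forall m,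
  nrm (cl (fun x => (beta x)%:C * phi2_2 L alpha m x)) ^+ 2 <= B.
Proof.
have [kp kp0 hk] := kap_norm; have [K K0 hK] := mul_Linfty bL.
have [_ [D D0 hD]] := blin_damp L0 sig; have [_ [E E0 hE]] := blin_Pop L0.
exists (K * (E * (D * (kp * (2 * L))))); first by rewrite !mulr_ge0// ltW.
move=> m; have hG := acZ ((Anorm L alpha m)%:C)^-1 (ac_Csinh L0 (lam2 m)).
have [_ h] := hK _ (ac_sq L0 hG); apply: (le_trans h); rewrite ler_wpM2l//.
have -> : cl (fun x => ((Anorm L alpha m)%:C)^-1 * Csinh (lam2 m * x%:C)) =
    Pop (k m *: coshC L alpha m).
  have := toH10_mk10 L0 hG; rewrite mulr0 Csinh0 mulr0 => /(_ erefl)/(congr1 (@H10_val R L)).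
  rewrite (mk10_val L0) (toH10_ac L0 hG) ?mulr0 ?Csinh0 ?mulr0// => ->.
  rewrite /Pop -(L2classZ _ (ac_sq L0 (ac_Ccosh L0 _))); congr (cl (prim (cl _))).
  by apply/funext => x; rewrite /kap mulrA [_^-1 * _]mulrC.
apply: (le_trans (hE _)); rewrite ler_wpM2l//.
have w2 : hnorm ip (k m *: wave L m) ^+ 2 = kp * (2 * L).
  by rewrite (hnorm_sqZ ip0P) hk (hnorm_sq ip0P) (wave_ortho L0) eqxx (cRe_real (2 * L)).
have := hD (k m *: wave L m); rewrite w2 => h2; apply: le_trans h2.
rewrite (blinZ _ _ (blin_damp L0 sig)) -damp_wave -(mk3Z L0) (hnorm_mk3 L0).
by rewrite -addrA addrCA lerDl addr_ge0// sqr_ge0.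
Qed.

Lemma first_component_bound : exists C, forall m, nrm (f1 m) ^+ 2 <= C * wt R `|m|%N.
Proof.
have [B B0 hB] := forcing_bound.
pose q : R := (L / pi) ^+ 2; have p0 := pi_gt0 R.
exists (2 * nrm (f1 0) ^+ 2 + 6 * (B * q)) => m.
have N0 := sqr_ge0 (nrm (f1 0)); have q0 : 0 < q by rewrite exprn_gt0// divr_gt0.
rewrite /wt ler_pdivlMr ?mulr_gt0//.
(* The energy bound carries the factor m^2, so index 0 is covered by the first summand of the
   constant. *)
have [->|m0] := eqVneq m 0.
  rewrite absz0 (_ : (1%:R * 2%:R : R) = 2) ?mul1r// mulrC ler_wpDr//.
  by rewrite mulr_ge0// mulr_ge0// (ltW q0).
have h := le_trans (phi2_1_bound L0 bL alpha1 c_neq (r_sqrt m)) (hB m).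
have hq : (m%:~R * pi / L) ^+ 2 = `|m|%N%:R ^+ 2 / q.
  rewrite expr_div_n exprMn; have -> : (m%:~R : R) ^+ 2 = `|m|%N%:R ^+ 2.
    by rewrite natr_absz intr_norm real_normK// num_real.
  have -> : q = L ^+ 2 / pi ^+ 2 by exact: expr_div_n.
  by rewrite [in RHS]invf_div -mulrA.
move: h; rewrite hq -/(f1 m) mulrAC ler_pdivrMr// => h.
by apply: (@weight_arith _ `|m|%N _ _ _ N0 _ _ h); [exact: sqr_ge0|rewrite absz_gt0].
Qed.

Lemma Phi_riesz : riesz_basis ip setT Phi.
Proof.
have [kp kp0 hk] := kap_norm; have [C hC] := first_component_bound.
have h := riesz_transport (blin_damp L0 sig) (blin_undamp L0 sig)
  (dampK L0 sig) (undampK L0 sig) (pert_riesz L0 kp0 hk hC).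
by rewrite (_ : Phi = fun j => damp sig (pert f1 k j))//; apply/funext => j; exact: Phi_damp.
Qed.

Lemma Phi_eigenvector j : eigenvector A (ev j) (Phi j).
Proof.
have := riesz_neq0 ip0P Phi_riesz (j := j) I; case: j => [n|m] /= h.
  exact: phi1_eigen.
exact: phi2_eigen.
Qed.

(** The summand 1 puts it at distance at least 1 to the right of every eigenvalue, and strictly
    above both c and 0 as [resolvent_injective] asks. *)
Let l0 : R[i] := (Num.max c 0 + 1)%:C.

Lemma resolvent_far j : 1 <= sqmod (ev j - l0).
Proof.
apply: le_trans (sqr_Re_le _); rewrite cReB (cRe_real (Num.max c 0 + 1)).
by have := Re_eigval c L0 alpha1 j => h; nra.
Qed.

Lemma resolvent_ker z : dom A z -> app A z = l0 *: z -> z = 0.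
Proof.
apply: (resolvent_injective L0 bL alpha1); first by rewrite ltr_wpDl// le_max lexx orbT.
by rewrite ltr_pwDr// le_max lexx.
Qed.

Lemma spectral_theory : [/\ forall l, is_eigenvalue A l -> exists j, l = ev j,
  forall l, is_eigenvalue A l -> simple_eigenvalue A l & generates_C0_semigroup ip A].
Proof.
have hH := state_hilbert L0; have clA := opA_closed c alpha L0 bL.
have ei i : eigenvector A (ev (dec i)) (Phi (dec i)) := Phi_eigenvector (dec i).
(* The abstract theory is about bases indexed by [nat], hence the relabelling by [dec]. *)
have [dense [m [M [m0 M0 bnd]]]] : riesz_basis ip setT (fun i => Phi (dec i)).
  by apply: (riesz_reindex (f := enc) _ _ _ _ Phi_riesz) => // [j _|i _]; [exact: encK|exact: decK].
have bnd' s (a : nat -> R[i]) us := bnd s a us (fun j _ => I).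
have dense' u e (e0 : 0 < e) : exists (s : seq nat) (a : nat -> R[i]),
    hnorm ip (u - \sum_(j <- s) a j *: Phi (dec j)) < e.
  by have [s [a [_ h]]] := dense u e e0; exists s, a.
have eig i : dom A (Phi (dec i)) /\ app A (Phi (dec i)) = ev (dec i) *: Phi (dec i).
  by have [] := ei i.
have far i := resolvent_far (dec i).
have om0 : 0 <= Num.max c 0 by rewrite le_max lexx orbT.
have om_le i := Re_eigval c L0 alpha1 (dec i) : _ <= Num.max c 0.
split=> [l le|l le|].
- have [i ->] := is_eigenvalueP hH m0 M0 bnd' dense' clA eig far resolvent_ker le.
  by exists (dec i).
- apply: (simple_of_injective hH m0 M0 bnd' dense' clA eig far resolvent_ker) le.
    by apply: (inj_comp (eigval_inj L0 c_neq) (can_inj decK)).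
  by move=> i; have [] := ei i.
- eexists; split; first exact: (semigroup_C0 hH m0 M0 bnd' dense' om0 om_le).
  exact: (semigroup_generator hH m0 M0 bnd' dense' clA eig far resolvent_ker om0 om_le).
Qed.

Lemma opA_riesz_spectral : riesz_spectral ip A.
Proof.
have [evP simple _] := spectral_theory.
(* The index of an eigenvalue, unique by [eigval_inj]; on eigenvalues the default [inl 0] is never a
   fallback. *)
have hsel l : is_eigenvalue A l -> ev (xget (inl 0%N) [set j | ev j = l]) = l.
  move=> /evP[j ->]; exact: (@xgetPex _ (inl 0%N) [set j' | ev j' = ev j] (ex_intro _ j erefl)).
split.
- exact: state_hilbert.
- exact: opA_closed.
- exact: simple.
- exists (fun l => Phi (xget (inl 0%N) [set j | ev j = l])); split=> [l le|].
    by rewrite -{1}(hsel l le); exact: Phi_eigenvector.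
  apply: (riesz_reindex (f := ev) _ _ _ _ Phi_riesz) => // [j _|j _].
    by exists (Phi j); exact: Phi_eigenvector.
  apply: (eigval_inj L0 c_neq); apply: hsel.
  by exists (Phi j); exact: Phi_eigenvector.
- exact: (spectrum_totally_disconnected L0 c_neq).
Qed.

End RieszBasis.

Theorem lemma2 (R : realType) (L c : R) (beta : R -> R) (alpha : R)
    (r : int -> R[i])
    (L_gt0 : 0 < L)
    (beta_Linfty : Linfty L beta)
    (alpha_gt1 : 1 < alpha)
    (c_neq : forall n : nat,
       c <> (2 * L)^-1 * ln ((alpha - 1) / (alpha + 1))
            + n%:R ^+ 2 * pi ^+ 2 / L ^+ 2)
    (r_sqrt : forall m : int,
       r m ^+ 2 = lambda2 L alpha m - c%:C /\ 0 <= complex.Re (r m)) :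
  let A := opA L c beta alpha in
  let phi := Phi L beta alpha r in
  [/\ forall j, eigenvector A (eigval L c alpha j) (phi j),
      riesz_basis (@ip0 R L) setT phi,
      riesz_spectral (@ip0 R L) A &
      generates_C0_semigroup (@ip0 R L) A].
Proof.
have hr m := (r_sqrt m).1.
have [_ _ gen] := spectral_theory L_gt0 beta_Linfty alpha_gt1 c_neq hr.
split.
- exact: Phi_eigenvector.
- exact: (Phi_riesz L_gt0 beta_Linfty alpha_gt1 c_neq hr).
- exact: (opA_riesz_spectral L_gt0 beta_Linfty alpha_gt1 c_neq hr).
- exact: gen.
Qed.
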